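(* Let $\Omega$ be a hyperbolic domain in $\hat{\mathbb C}$ and let $K$ be an isolated nondegenerate connected component of $\hat{\mathbb C}\setminus\Omega$. Suppose that $p\in K\cap\partial\Omega$ is accessible. Then there exist a sequence $\{z_n\}$ in $\Omega$ tending to $p$ and an injective holomorphic function $f:\Omega\to\mathbb D$ such that the limit $$\lim_{n\to\infty}\left(\frac{\lambda_{\mathbb D}(f(z_n))\,|f'(z_n)|}{\lambda_\Omega(z_n)}-1\right)e^{4\,\mathrm d_\Omega(z_n,q)}$$ exists and is $<0$ for one (and hence for any) $q\in\Omega$.
   Context: $\hat{\mathbb C}=\mathbb C\cup\{\infty\}$ is the Riemann sphere and $\mathbb D$ is the open unit disk in $\mathbb C$. A hyperbolic domain $\Omega$ in $\hat{\mathbb C}$ is a non-empty, open, connected subset such that $\hat{\mathbb C}\setminus\Omega$ contains at least three distinct points. A connected component $K$ of $\hat{\mathbb C}\setminus\Omega$ is called nondegenerate if it does not reduce to a single point, and isolated if none of its points belongs to the closure of $\hat{\mathbb C}\setminus(\Omega\cup K)$. A point $p\in\partial\Omega\cap\mathbb C$ is called accessible if there is a continuous curve $\gamma:[0,1)\to\Omega$ with $\lim_{t\to1}\gamma(t)=p$. The hyperbolic metric of $\mathbb D$ is $\lambda_{\mathbb D}(z)\,|dz|=|dz|/(1-|z|^2)$ (curvature $-4$). The hyperbolic metric $\lambda_\Omega(z)\,|dz|$ of $\Omega$ is defined (in local coordinates) by $\lambda_\Omega(\pi(z))|\pi'(z)|=\lambda_{\mathbb D}(z)$ for a holomorphic universal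 covering $\pi:\mathbb D\to\Omega$. The hyperbolic distance is $\mathrm d_\Omega(z,w)=\inf_\gamma\int_\gamma\lambda_\Omega(\zeta)\,|d\zeta|$, the infimum being over all piecewise smooth curves $\gamma$ in $\Omega$ joining $z$ and $w$. *)

(* Defs.v *)
From HB Require Import structures.
From mathcomp Require Import all_boot all_order all_algebra.
From mathcomp Require Import all_classical all_reals all_analysis.
From mathcomp Require Import complex.

Set Implicit Arguments.
Unset Strict Implicit.
Unset Printing Implicit Defensive.

Import Order.TTheory GRing.Theory Num.Theory numFieldNormedType.Exports.

Local Open Scope classical_set_scope.
Local Open Scope ring_scope.

(* [R[i]^o] is the normed module of the field [R[i]] over itself, so that
   [derivable _ z 1] for maps between copies of [Cplx R] is complex
   differentiability.  The library norm [`|z|] is [R[i]]-valued; [normc] is its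
   real-valued version. *)
Notation Cplx R := (R[i]^o).
Notation normc := ComplexField.Normc.normc.

Definition sphere (R : realType) : topologicalType :=
  one_point_compactification (Cplx R).

Section RiemannSphere.
Context {R : realType}.
Implicit Types (z : Cplx R) (c w : sphere R) (Omega K : set (sphere R)).

Definition infty : sphere R := None.
Definition fin z : sphere R := Some z.

(* [sph_coord c] is a local coordinate around [c]: the identity of the plane if
   [c] is finite, [w |-> 1 / w] if [c] is infinity; [sph_chart c] is its inverse.
   [sph_coord c w] has a junk value at the one point [w] outside the chart
   domain (infinity if [c] is finite, 0 if [c] is infinity). *)
Definition sph_coord c w : Cplx R :=
  match c, w with
  | Some _, Some z => z
  | None, Some z => z^-1
  | _, None => 0
  end.

Definition sph_chart c (u : Cplx R) : sphere R :=
  if c is Some _ then fin u else if u == 0 then infty else fin u^-1.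

Definition unit_disk : set (Cplx R) := [set z | normc z < 1].

Definition hyperbolic_domain Omega :=
  [/\ Omega !=set0, open Omega, connected Omega &
      exists a b c, [/\ ~ Omega a, ~ Omega b, ~ Omega c &
                        [/\ a <> b, a <> c & b <> c]]].

Definition is_component (A K : set (sphere R)) :=
  exists2 x, A x & K = connected_component A x.

Definition nondegenerate_set K := forall x, K <> [set x].

Definition isolated_component Omega K :=
  K `&` closure (~` (Omega `|` K)) = set0.

Definition boundary Omega := closure Omega `\` interior Omega.

Definition accessible Omega (p : Cplx R) :=
  boundary Omega (fin p) /\
  exists gamma : R -> sphere R,
    [/\ {within `[0, 1[%classic, continuous gamma},
        (forall t, 0 <= t < 1 -> Omega (gamma t)) &
        gamma t @[t --> 1^'-] --> fin p].

Definition holomorphic_on Omega (f : sphere R -> Cplx R) :=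
  forall w, Omega w -> derivable (f \o sph_chart w) (sph_coord w w) 1.

Definition cderiv (f : sphere R -> Cplx R) w : Cplx R :=
  'D_1 (f \o sph_chart w) (sph_coord w w).

(* Continuity into the sphere is not redundant, because of the junk value of
   [sph_coord (g z)]. *)
Definition sphere_holomorphic_on (D : set (Cplx R)) (g : Cplx R -> sphere R) :=
  forall z, D z ->
    {for z, continuous g} /\ derivable (sph_coord (g z) \o g) z 1.

Definition sphere_cderiv (g : Cplx R -> sphere R) z : Cplx R :=
  'D_1 (sph_coord (g z) \o g) z.

Definition homeomorphism_on (S T : topologicalType) (A : set S) (B : set T)
    (f : S -> T) :=
  exists g : T -> S,
    [/\ set_fun A B f, set_fun B A g,
        (forall x, A x -> g (f x) = x), (forall y, B y -> f (g y) = y) &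
        {within A, continuous f} /\ {within B, continuous g}].

Definition covering_map (S T : topologicalType) (D : set S) (B : set T)
    (pi : S -> T) :=
  [/\ {within D, continuous pi}, pi @` D = B &
      forall y, B y -> exists U : set T,
        [/\ open U, U y, U `<=` B &
            exists sheets : set (set S),
              [/\ D `&` pi @^-1` U = \bigcup_(V in sheets) V,
                  trivIset sheets id &
                  forall V, sheets V -> open V /\ homeomorphism_on V U pi]]].

(* The disk is simply connected, so every covering by it is universal. *)
Definition holomorphic_universal_covering Omega (pi : Cplx R -> sphere R) :=
  sphere_holomorphic_on unit_disk pi /\ covering_map unit_disk Omega pi.

Definition disk_density z : R := (1 - normc z ^+ 2)^-1.

(* [lam w] is the coefficient of the metric at [w] in the coordinate
   [sph_coord w]. *)
Definition is_hyperbolic_density Omega (lam : sphere R -> R) :=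
  exists2 pi, holomorphic_universal_covering Omega pi &
    forall z, unit_disk z ->
      lam (pi z) * normc (sphere_cderiv pi z) = disk_density z.

(* A density chosen by the classical choice operator [get]; it is only
   determined on [Omega], and only used there. *)
Definition hyperbolic_density Omega : sphere R -> R :=
  get (is_hyperbolic_density Omega).

Definition re_part (g : R -> Cplx R) : R -> R := fun t => complex.Re (g t).
Definition im_part (g : R -> Cplx R) : R -> R := fun t => complex.Im (g t).

Definition C1_at (g : R -> Cplx R) (t : R) :=
  [/\ (\forall s \near t, derivable (re_part g) s 1 /\
                          derivable (im_part g) s 1),
      {for t, continuous (derive1 (re_part g))} &
      {for t, continuous (derive1 (im_part g))}].

Definition curve_deriv (gamma : R -> sphere R) (t : R) : Cplx R :=
  let g := sph_coord (gamma t) \o gamma in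
  (derive1 (re_part g) t +i* derive1 (im_part g) t)%C.

(* A smooth arc is parametrized by [0, 1] and is C^1 on a neighbourhood of that
   interval; values of [gamma] away from the interval are irrelevant, and a C^1
   curve on the closed interval always has such an extension. *)
Definition smooth_arc_in Omega (gamma : R -> sphere R) :=
  forall t, 0 <= t <= 1 ->
    [/\ Omega (gamma t), {for t, continuous gamma} &
        C1_at (sph_coord (gamma t) \o gamma) t].

(* A piecewise smooth curve is the list of its smooth pieces. *)
Fixpoint piecewise_smooth_curve Omega (z : sphere R) (s : seq (R -> sphere R)) w : Prop :=
  if s is gamma :: s' then
    [/\ smooth_arc_in Omega gamma, gamma 0 = z &
        piecewise_smooth_curve Omega (gamma 1) s' w]
  else z = w.

Definition arc_length Omega (gamma : R -> sphere R) : R :=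
  \int[lebesgue_measure]_(t in `[0, 1])
    (hyperbolic_density Omega (gamma t) * normc (curve_deriv gamma t)).

Definition hyperbolic_length Omega (s : seq (R -> sphere R)) : R :=
  \sum_(gamma <- s) arc_length Omega gamma.

Definition hyperbolic_distance Omega (z w : sphere R) : R :=
  inf [set hyperbolic_length Omega s
      | s in [set s | piecewise_smooth_curve Omega z s w]].

End RiemannSphere.

(* Main.v *)
Require Import Defs.
From HB Require Import structures.
From mathcomp Require Import all_boot all_order all_algebra.
From mathcomp Require Import all_classical all_reals all_analysis.
From mathcomp Require Import complex.
From mathcomp Require Import ring lra.

Import Order.TTheory GRing.Theory Num.Theory numFieldNormedType.Exports.

Local Open Scope classical_set_scope.
Local Open Scope ring_scope.

(** The component [K] contributes a boundary of [Omega] that looks, conformally,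
like a circle.  After the change of coordinate [w |-> 1 / (w - p)], which
moves [p] to infinity, [K] becomes a closed plane set all of whose pieces reach
infinity, so every component [U] of its complement admits holomorphic square
roots of zero-free functions ([component_square_roots]).  Koebe's argument then
gives a conformal map [psi] of the component [U] that contains [Omega] onto the
disk ([riemann_mapping]).  Since [K] is isolated, [psi] maps [Omega] onto a
subdomain [D'] of the disk that contains an annulus [r < |w| < 1]
([plane_riemann]).  Any sequence in [Omega] tending to [p] has images tending to
the circle; along a subsequence, and after a rotation, they tend to 1.

Let [y = i (1 - w) / (1 + w)] be the coordinate of the upper half-plane in which
1 becomes 0.  The admissible map is [f = Cayley^-1 (sqrt (1 + y))] composed with
[psi].  Its hyperbolic derivative with respect to the disk is exactly
[Re s / |s|] with [s = sqrt (1 + y)], so that it falls short of 1 by a quantity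
of the order of [(Im y)^2] ([root_mapP], [local_model]).  The density of [D'] is
squeezed between that of the disk and that of a half-disk [|y| < eps] contained
in [D'], and the ratio of these two is again [Re s / |s|], for another point
[s] close to 1, with the same order of defect ([half_disk_mapP]).  Hence
[1 - quotient] lies between two constant multiples of [(Im y)^2].

The distance to a fixed point is [- 1/2 ln (Im y)] up to a bounded error: from
below because [1/2 ln (1 - |psi|^2)] is a contraction for the hyperbolic metric
([curve_lower]), from above by the image in the half-disk of a radius of the
disk ([dist_upper]).  So the factor [exp (4 d)] compensates the defect up to bounded factors,
and the products stay in a compact interval of negative numbers
([defect_bounds]).  Convergence, for all base points at once, is a diagonal
argument: the differences [d (z_n, q) - d (z_n, q0)] are bounded and
equi-Lipschitz in [q], so convergence on a countable dense set is enough
([convergent_subsequence]).  The limit for [q] differs from that for [q0] by the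
factor [exp (4 lim (d (z_n, q) - d (z_n, q0)))], hence is negative as well.

Comparison of densities never uses a global lift to the universal covering.  If
[h] is a density on the disk that is locally the pull-back of the hyperbolic
density under some holomorphic map into the disk, then [h] is at most the
hyperbolic density ([ahlfors]): at a maximum of the ratio of [h] to the density
of a slightly smaller disk one is reduced to a statement about mean values on
small circles ([schwarz_local]).  This applies to maps into [Omega], through
local inverses of the covering, and to maps from [Omega], composed with the
covering.

The hyperbolic density is a chosen one, and is the zero function if there is no
covering of [Omega] by the disk.  In that case the quotient is 0, all distances
are 0, and the limit is -1. *)

Set Implicit Arguments.
Unset Strict Implicit.
Unset Printing Implicit Defensive.

(** * Complex numbers: norm and topology *)
Section Norm.
Context {R : realType}.
Notation C := (Cplx R).
Implicit Types z w a : C.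

Lemma normc_ge0 z : 0 <= normc z.
Proof. by case: z => a b; rewrite sqrtr_ge0. Qed.

Lemma normc_sq z : normc z ^+ 2 = complex.Re z ^+ 2 + complex.Im z ^+ 2.
Proof. by case: z => a b; rewrite sqr_sqrtr// addr_ge0// sqr_ge0. Qed.

Lemma normc_eq0 z : (normc z == 0) = (z == 0).
Proof.
apply/eqP/eqP => [/ComplexField.Normc.eq0_normc //|->].
exact: ComplexField.Normc.normc0.
Qed.

Lemma normc_gt0 z : (0 < normc z) = (z != 0).
Proof. by rewrite lt_neqAle normc_ge0 andbT eq_sym normc_eq0. Qed.

Lemma normcD z w : normc (z + w) <= normc z + normc w.
Proof. exact: le_normcD. Qed.

Lemma normcM z w : normc (z * w) = normc z * normc w.
Proof. exact: ComplexField.Normc.normcM. Qed.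

Lemma normcV z : normc z^-1 = (normc z)^-1.
Proof. exact: ComplexField.Normc.normcV. Qed.

Lemma normcf z w : normc (z / w) = normc z / normc w.
Proof. by rewrite normcM normcV. Qed.

Lemma normcX z n : normc (z ^+ n) = normc z ^+ n.
Proof.
elim: n => [|n IH]; first by rewrite !expr0 ComplexField.Normc.normc1.
by rewrite !exprS normcM IH.
Qed.

Lemma normcN z : normc (- z) = normc z.
Proof. exact: complex.normcN. Qed.

Lemma normcBC z w : normc (z - w) = normc (w - z).
Proof. by rewrite -normcN opprB. Qed.

Lemma normcB z w : normc (z - w) <= normc z + normc w.
Proof. by rewrite -(normcN w); exact: normcD. Qed.

Lemma normcB_ge z w : normc z - normc w <= normc (z - w).
Proof. by rewrite lerBlDr; have := normcD (z - w) w; rewrite subrK. Qed.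

Lemma normc0 : normc (0 : C) = 0.
Proof. exact: ComplexField.Normc.normc0. Qed.

Lemma normc1 : normc (1 : C) = 1.
Proof. exact: ComplexField.Normc.normc1. Qed.

Lemma normc_real (x : R) : normc (x%:C)%C = `|x|.
Proof. by rewrite /= expr0n /= addr0 sqrtr_sqr. Qed.

Lemma normc_i : normc ('i%C : C) = 1.
Proof. by rewrite /= expr0n expr1n /= add0r sqrtr1. Qed.

Lemma cReD z w : complex.Re (z + w) = complex.Re z + complex.Re w.
Proof. by case: z w => [? ?] [? ?]. Qed.
Lemma cImD z w : complex.Im (z + w) = complex.Im z + complex.Im w.
Proof. by case: z w => [? ?] [? ?]. Qed.
Lemma cReN z : complex.Re (- z) = - complex.Re z.
Proof. by case: z. Qed.
Lemma cImN z : complex.Im (- z) = - complex.Im z.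
Proof. by case: z. Qed.
Lemma cReM z w :
  complex.Re (z * w) = complex.Re z * complex.Re w - complex.Im z * complex.Im w.
Proof. by case: z w => [? ?] [? ?]. Qed.
Lemma cImM z w :
  complex.Im (z * w) = complex.Re z * complex.Im w + complex.Im z * complex.Re w.
Proof. by case: z w => [? ?] [? ?]. Qed.

Lemma Re_le z : `|complex.Re z| <= normc z.
Proof.
by rewrite -(ler_pXn2r (n := 2))// ?nnegrE ?normc_ge0 ?normr_ge0//
  real_normK ?num_real// normc_sq lerDl sqr_ge0.
Qed.

Lemma Im_le z : `|complex.Im z| <= normc z.
Proof.
by rewrite -(ler_pXn2r (n := 2))// ?nnegrE ?normc_ge0 ?normr_ge0//
  real_normK ?num_real// normc_sq lerDr sqr_ge0.
Qed.

Lemma normc_le_ReIm z : normc z <= `|complex.Re z| + `|complex.Im z|.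
Proof.
rewrite -(ler_pXn2r (n := 2))// ?nnegrE ?addr_ge0 ?normc_ge0 ?normr_ge0//.
rewrite normc_sq sqrrD !real_normK ?num_real//.
by rewrite -addrA lerD2l lerDr mulrn_wge0// mulr_ge0.
Qed.

Lemma mulJc z : z * z^*%C = ((normc z ^+ 2)%:C)%C.
Proof. by rewrite normc_sq; case: z => a b; simpc; congr (_ +i* _)%C => /=; ring. Qed.

Lemma normcJ z : normc (z^*%C) = normc z.
Proof. by case: z => a b /=; rewrite sqrrN. Qed.

Lemma cJV z : (z^-1)^*%C = (z^*%C)^-1 :> C.
Proof. exact: conjc_inv. Qed.
Lemma cJM z w : (z * w)^*%C = z^*%C * w^*%C :> C.
Proof. by case: z w => a b [c d]; rewrite /conjc; simpc; congr (_ +i* _)%C; ring. Qed.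
Lemma cJB z w : (z - w)^*%C = z^*%C - w^*%C :> C.
Proof. by case: z w => a b [c d]; rewrite /conjc; simpc; congr (_ +i* _)%C; ring. Qed.
Lemma cJ1 : (1 : C)^*%C = 1 :> C.
Proof. exact: conjc1. Qed.
Lemma cJK z : (z^*%C)^*%C = z :> C.
Proof. exact: conjcK. Qed.

Lemma nbhsCP z (A : set C) :
  nbhs z A <-> exists2 d : R, 0 < d & forall w, normc (w - z) < d -> A w.
Proof.
split.
- case/nbhs_ballP => e /= e0 h.
  move: e0; rewrite ltcE /= => /andP[/eqP ei er].
  exists (complex.Re e) => // w hw; apply: h; rewrite /ball /=.
  by rewrite distrC ltcE /= ei eqxx /=; move: hw; case: (w - z).
- case=> d d0 h; apply/nbhs_ballP; exists (d%:C)%C; first by rewrite /= ltcR.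
  move=> w; rewrite /ball /= distrC => hw; apply: h.
  by move: hw; rewrite ltcE /= => /andP[_]; case: (w - z).
Qed.

Lemma nbhsCE z (A : set C) :
  nbhs z A -> exists2 d : R, 0 < d & forall w, normc (w - z) < d -> A w.
Proof. by move/nbhsCP. Qed.

Lemma nbhsC_disk z (d : R) : 0 < d -> \forall w \near z, normc (w - z) < d.
Proof. by move=> d0; apply/nbhsCP; exists d. Qed.

Lemma openCP (A : set C) :
  open A <-> forall z, A z -> exists2 d : R, 0 < d & forall w, normc (w - z) < d -> A w.
Proof.
rewrite openE; split=> h z /h; first by move/nbhsCP.
by move=> ?; apply/nbhsCP.
Qed.

Lemma open_disk a (r : R) : open [set z | normc (z - a) < r].
Proof.
apply/openCP => z /= hz; exists (r - normc (z - a)); first by rewrite subr_gt0.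
move=> w hw /=; have := normcD (w - z) (z - a); rewrite addrA subrK => h.
by apply: le_lt_trans h _; rewrite -ltrBrDr.
Qed.

Lemma cvgCP (T : Type) (F : set_system T) {FF : Filter F} (f : T -> C) l :
  (f @ F --> l) <-> forall e : R, 0 < e -> \forall t \near F, normc (f t - l) < e.
Proof.
split=> [h e e0|h A /nbhsCP[e e0 hA]]; first exact: (h _ (nbhsC_disk l e0)).
by apply: filterS (h e e0) => t; exact: hA.
Qed.

Variant cts (f : C -> C) z : Prop := Cts of f @ z --> f z.

Lemma ccontP (f : C -> C) z : cts f z <->
  forall e : R, 0 < e -> exists2 d : R, 0 < d &
    forall w, normc (w - z) < d -> normc (f w - f z) < e.
Proof.
split=> [[/cvgCP h] e e0|h].
  exact/nbhsCP/h.
by constructor; apply/(cvgCP (F := nbhs z)) => e e0; exact/nbhsCP/h.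
Qed.

Lemma rcontP (f : C -> R) z : {for z, continuous f} <->
  forall e : R, 0 < e -> exists2 d : R, 0 < d &
    forall w, normc (w - z) < d -> `|f w - f z| < e.
Proof.
rewrite /prop_for /continuous_at; split.
  by move/cvgr_dist_lt => h e e0; apply/nbhsCP; apply: filterS (h e e0) => w; rewrite distrC.
move=> h; apply/(cvgrPdist_lt (FF := nbhs_filter z)) => e e0; case: (h e e0) => d d0 hd.
by apply/nbhsCP; exists d => // w /hd; rewrite distrC.
Qed.

Lemma continuous_normc : continuous (fun z : C => normc z).
Proof.
move=> z; apply/rcontP => e e0; exists e => // w hw.
apply: le_lt_trans hw; rewrite ler_norml; apply/andP; split.
  by rewrite lerNl opprB normcBC normcB_ge.
exact: normcB_ge.
Qed.

Lemma continuous_Re : continuous (@complex.Re R : C -> R).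
Proof.
move=> z; apply/rcontP => e e0; exists e => // w hw.
by apply: le_lt_trans hw; rewrite -cReN -cReD Re_le.
Qed.

Lemma continuous_Im : continuous (@complex.Im R : C -> R).
Proof.
move=> z; apply/rcontP => e e0; exists e => // w hw.
by apply: le_lt_trans hw; rewrite -cImN -cImD Im_le.
Qed.

Lemma cvg_complex (T : Type) (F : set_system T) {FF : Filter F} (f g : T -> R) (a b : R) :
  f @ F --> a -> g @ F --> b -> (fun t => (f t +i* g t)%C : C) @ F --> ((a +i* b)%C : C).
Proof.
move=> /cvgrPdist_lt hf /cvgrPdist_lt hg; apply/cvgCP => e e0.
have e2 : 0 < e / 2 by rewrite divr_gt0.
near=> t; apply: le_lt_trans (normc_le_ReIm _) _ => /=.
rewrite [e]splitr ltrD// distrC; [near: t; exact: hf|near: t; exact: hg].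
Unshelve. all: end_near. Qed.

Lemma cvgVc (T : Type) (F : set_system T) {FF : Filter F} (f : T -> C) l :
  l != 0 -> f @ F --> l -> (fun t => (f t)^-1) @ F --> l^-1.
Proof.
move=> l0 hf; apply/cvgCP => e e0.
have nl0 : 0 < normc l by rewrite normc_gt0.
have d0 : 0 < Num.min (normc l / 2) (e * normc l ^+ 2 / 2).
  by rewrite lt_min !divr_gt0// mulr_gt0// exprn_gt0.
have /cvgCP/(_ _ d0) := hf; apply: filterS => t; rewrite lt_min => /andP[h1 h2].
have h3 : normc l / 2 < normc (f t).
  have := normcB_ge l (l - f t); rewrite subKr normcBC => h.
  lra.
have ft0 : f t != 0 by rewrite -normc_gt0; lra.
have -> : (f t)^-1 - l^-1 = - ((f t - l) / (f t * l)) by field; rewrite ft0 l0.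
rewrite normcN normcf normcM ltr_pdivrMr; last by rewrite mulr_gt0// normc_gt0.
have : e * (normc l / 2 * normc l) < e * (normc (f t) * normc l).
  by rewrite ltr_pM2l// ltr_pM2r.
have -> : e * (normc l / 2 * normc l) = e * normc l ^+ 2 / 2 by field.
exact: lt_trans.
Qed.

End Norm.

Arguments ComplexField.Normc.normc : simpl never.

(** * Complex derivatives *)
Section Cder.
Context {R : realType}.
Notation C := (Cplx R).
Implicit Types (z w a l : C) (f g : C -> C).

(** Caratheodory's form of differentiability: the difference quotient extends to
a function continuous at the point. The rules of calculus then reduce to
identities between quotients. *)
Definition cder f z l := exists q : C -> C,
  [/\ cts q z, q z = l & \forall w \near z, f w - f z = q w * (w - z)].

Definition dc f z : C := xget 0 [set l | cder f z l].

Definition hol (U : set C) f := forall z, U z -> exists l, cder f z l.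

Lemma nearCW (P : C -> Prop) z : (forall w, P w) -> \forall w \near z, P w.
Proof. by move=> h; apply: (filterE (F := nbhs z)). Qed.

Lemma cont_id z : cts (fun w : C => w) z.
Proof. by constructor. Qed.

Lemma cont_cst a z : cts (fun _ : C => a) z.
Proof. by constructor; apply: cvg_cst; exact: nbhs_filter. Qed.

Lemma contD f g z : cts f z -> cts g z -> cts (fun w => f w + g w) z.
Proof. by move=> [hf] [hg]; constructor; exact: (cvgD hf hg). Qed.

Lemma contB f g z : cts f z -> cts g z -> cts (fun w => f w - g w) z.
Proof. by move=> [hf] [hg]; constructor; exact: (cvgB hf hg). Qed.

Lemma contM f g z : cts f z -> cts g z -> cts (fun w => f w * g w) z.
Proof. by move=> [hf] [hg]; constructor; exact: (cvgM hf hg). Qed.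

Lemma contV f z : cts f z -> f z != 0 -> cts (fun w => (f w)^-1) z.
Proof. by move=> [hf] h0; constructor; exact: (cvgVc h0 hf). Qed.

Lemma cont_comp f g z : cts f z -> cts g (f z) -> cts (fun w => g (f w)) z.
Proof. by move=> [hf] [hg]; constructor; exact: (cvg_comp _ _ hf hg). Qed.

Lemma cts_nbhs f z (A : set C) : cts f z -> nbhs (f z) A -> nbhs z (f @^-1` A).
Proof. by move=> [h] hA; exact: h. Qed.

Lemma cont_near f g z : (\forall w \near z, f w = g w) -> cts f z -> cts g z.
Proof.
move=> h hf; have e : f z = g z by apply: (nbhs_singleton h).
constructor; rewrite -e => A /(cts_nbhs hf) h2.
have h3 w : f w = g w -> (f @^-1` A) w -> (g @^-1` A) w by move=> /= ->.
exact: (filterS2 _ h3 h h2).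
Qed.

Lemma cont_neq0 f z : cts f z -> f z != 0 -> \forall w \near z, f w != 0.
Proof.
move=> /ccontP h h0; have n0 : 0 < normc (f z) by rewrite normc_gt0.
have [d d0 hd] := h _ n0; apply/nbhsCP; exists d => // w /hd h1.
apply/negP => /eqP e; move: h1; rewrite e sub0r normcN; lra.
Qed.

Lemma cder_cont f z l : cder f z l -> cts f z.
Proof.
move=> [q [qc ql hq]]; apply: (@cont_near (fun w => f z + q w * (w - z))).
  by apply: filterS hq => w <-; rewrite addrC subrK.
exact: (contD (cont_cst _ _) (contM qc (contB (@cont_id _) (cont_cst _ _)))).
Qed.

Lemma cderP f z l : cder f z l <->
  forall e : R, 0 < e -> \forall w \near z, normc (f w - f z - l * (w - z)) <= e * normc (w - z).
Proof.
split=> [[q [qc ql hq]] e e0|h].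
  have /ccontP/(_ _ e0)/nbhsCP hc := qc.
  near=> w; have -> : f w - f z = q w * (w - z) by near: w; exact: hq.
  rewrite -mulrBl normcM ler_wpM2r ?normc_ge0// ltW// -ql; near: w; exact: hc.
pose q w := if w == z then l else (f w - f z) / (w - z).
exists q; split; last first.
- near=> w; rewrite /q; case: eqVneq => [->|wz]; first by rewrite !subrr mulr0.
  by rewrite divfK// subr_eq0.
- by rewrite /q eqxx.
- apply/ccontP => e e0; have e2 : 0 < e / 2 by rewrite divr_gt0.
  apply/nbhsCP; apply: filterS (h _ e2) => w hw; rewrite {2}/q eqxx /q; case: eqVneq => [_|wz].
    by rewrite subrr normc0.
  have wz' : w - z != 0 by rewrite subr_eq0.
  have -> : (f w - f z) / (w - z) - l = (f w - f z - l * (w - z)) / (w - z) by field.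
  rewrite normcf ltr_pdivrMr ?normc_gt0//; apply: le_lt_trans hw _.
  by rewrite ltr_pM2r ?normc_gt0//; lra.
Unshelve. all: end_near. Qed.

Lemma cder_uniq f z l l' : cder f z l -> cder f z l' -> l = l'.
Proof.
move=> /cderP h /cderP h'; apply/eqP; rewrite -subr_eq0 -normc_eq0 eq_le normc_ge0 andbT.
apply/ler_addgt0Pr => e e0; rewrite add0r.
have e2 : 0 < e / 2 by rewrite divr_gt0.
have [d d0 hd] := nbhsCE (filterI (h _ e2) (h' _ e2)).
pose w : C := z + (d / 2)%:C%C.
have hw : normc (w - z) = d / 2.
  by rewrite /w addrC addKr normc_real ger0_norm// divr_ge0// ltW.
case: (hd w); first by rewrite hw; lra.
rewrite hw => h1 h2.
have := normcB (f w - f z - l' * (w - z)) (f w - f z - l * (w - z)).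
have -> : f w - f z - l' * (w - z) - (f w - f z - l * (w - z)) = (l - l') * (w - z) by ring.
rewrite normcM hw => h3.
have h4 : normc (l - l') * (d / 2) <= e * (d / 2) by lra.
by move: h4; rewrite ler_pM2r// divr_gt0.
Qed.

Lemma dcE f z l : cder f z l -> dc f z = l.
Proof. by move=> h; apply: (@cder_uniq f z) => //; exact: (@xgetI _ 0 [set l | cder f z l] l). Qed.

Lemma hol_dc U f z : hol U f -> U z -> cder f z (dc f z).
Proof. by move=> h /h[l hl]; rewrite (dcE hl). Qed.

Lemma hol_cont U f z : hol U f -> U z -> cts f z.
Proof. by move=> h /h[l]; exact: cder_cont. Qed.

Lemma cder_near f g z l : (\forall w \near z, f w = g w) -> cder f z l -> cder g z l.
Proof.
move=> h [q [qc ql hq]]; exists q; split=> //.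
have e : f z = g z := nbhs_singleton h.
by near=> w; rewrite -e -(near h w)//; near: w.
Unshelve. all: end_near. Qed.

Lemma cder_ext f g z l : f =1 g -> cder f z l -> cder g z l.
Proof. by move=> h; apply: cder_near; apply: nearCW => w; exact: h. Qed.

Lemma cder_cst a z : cder (fun _ => a) z 0.
Proof.
exists (fun _ => 0); split=> //; first exact: cont_cst.
by apply: nearCW => w; rewrite subrr mul0r.
Qed.

Lemma cder_id z : cder (fun w => w) z 1.
Proof.
exists (fun _ => 1); split=> //; first exact: cont_cst.
by apply: nearCW => w; rewrite mul1r.
Qed.

Lemma cderD f g z l m : cder f z l -> cder g z m -> cder (fun w => f w + g w) z (l + m).
Proof.
move=> [q [qc <- hq]] [r [rc <- hr]]; exists (fun w => q w + r w); split=> //.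
  exact: contD.
by near=> w; rewrite mulrDl opprD addrACA (near hq w)// (near hr w).
Unshelve. all: end_near. Qed.

Lemma cderM f g z l m : cder f z l -> cder g z m ->
  cder (fun w => f w * g w) z (l * g z + f z * m).
Proof.
move=> hf [r [rc <- hr]]; have fc := cder_cont hf; move: hf => [q [qc <- hq]].
exists (fun w => q w * g z + f w * r w); split=> //.
  exact: (contD (contM qc (cont_cst _ _)) (contM fc rc)).
near=> w; have e1 : f w - f z = q w * (w - z) by near: w.
have e2 : g w - g z = r w * (w - z) by near: w.
rewrite mulrDl.
have -> : q w * g z * (w - z) = (q w * (w - z)) * g z by ring.
rewrite -e1 -[f w * r w * _]mulrA -e2; ring.
Unshelve. all: end_near. Qed.

Lemma cder_lin f z l a b : cder f z l -> cder (fun w => a * f w + b) z (a * l).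
Proof.
move=> h; have := cderD (cderM (cder_cst a z) h) (cder_cst b z).
by rewrite mul0r add0r addr0.
Qed.

Lemma cderN f z l : cder f z l -> cder (fun w => - f w) z (- l).
Proof.
move=> h; have := cder_lin (-1) 0 h; rewrite mulN1r.
by apply: cder_ext => w; rewrite mulN1r addr0.
Qed.

Lemma cderB f g z l m : cder f z l -> cder g z m -> cder (fun w => f w - g w) z (l - m).
Proof. by move=> h k; exact: cderD h (cderN k). Qed.

Lemma cderV f z l : cder f z l -> f z != 0 -> cder (fun w => (f w)^-1) z (- l / f z ^+ 2).
Proof.
move=> hf f0; have fc := cder_cont hf; move: hf => [q [qc <- hq]].
exists (fun w => - q w / (f w * f z)); split=> //; last first.
- near=> w; have fw : f w != 0 by near: w; exact: cont_neq0.
  have -> : (f w)^-1 - (f z)^-1 = - (f w - f z) / (f w * f z) by field; rewrite f0 fw.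
  by rewrite (near hq w)//; ring.
- apply: contM; first by have := contB (cont_cst 0 z) qc; apply: cont_near; apply: nearCW => w; rewrite sub0r.
  apply: contV; first exact: (contM fc (cont_cst _ _)).
  by rewrite mulf_neq0.
Unshelve. all: end_near. Qed.

Lemma cder_div f g z l m : cder f z l -> cder g z m -> g z != 0 ->
  cder (fun w => f w / g w) z ((l * g z - f z * m) / g z ^+ 2).
Proof.
move=> hf hg g0; have := cderM hf (cderV hg g0).
by have -> : l / g z + f z * (- m / g z ^+ 2) = (l * g z - f z * m) / g z ^+ 2 by field.
Qed.

Lemma cder_comp f g z l m : cder f z l -> cder g (f z) m ->
  cder (fun w => g (f w)) z (m * l).
Proof.
move=> hf; have fc := cder_cont hf; move: hf => [q [qc <- hq]] [r [rc <- hr]].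
exists (fun w => r (f w) * q w); split=> //.
  exact: (contM (cont_comp fc rc) qc).
near=> w; rewrite -mulrA -(near hq w)//; near: w.
exact: (cts_nbhs fc hr).
Unshelve. all: end_near. Qed.

(** A continuous local inverse is differentiable wherever the derivative does
not vanish. *)
Lemma cder_inv f g a l : cder f (g a) l -> l != 0 -> cts g a ->
  (\forall w \near a, f (g w) = w) -> cder g a l^-1.
Proof.
move=> [q [qc <- hq]] l0 gc hfg.
have qgc : cts (fun w => q (g w)) a by exact: cont_comp.
exists (fun w => (q (g w))^-1); split=> //; first exact: contV.
have e : f (g a) = a := nbhs_singleton hfg.
have hq' := cts_nbhs gc hq.
near=> w; have : f (g w) - f (g a) = q (g w) * (g w - g a) by near: w.
have -> : f (g w) = w by near: w.
have qw0 : q (g w) != 0 by near: w; exact: (@cont_neq0 (fun w => q (g w))).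
by rewrite e => ->; rewrite mulrA mulVf// mul1r.
Unshelve. all: end_near. Qed.

(** A continuous square root of a differentiable function is differentiable
wherever it does not vanish. *)
Lemma cder_sqrt s g z l : cts s z -> (\forall w \near z, s w ^+ 2 = g w) ->
  s z != 0 -> cder g z l -> cder s z (l / (s z *+ 2)).
Proof.
move=> sc hs s0 [q [qc <- hq]].
have c2 : cts (fun w => s w + s z) z := contD sc (cont_cst _ _).
have s2 : s z + s z != 0 by rewrite -mulr2n mulrn_eq0.
exists (fun w => q w / (s w + s z)); split; [exact: (contM qc (contV c2 s2))|by []|].
have e : s z ^+ 2 = g z := nbhs_singleton hs.
near=> w; have sw0 : s w + s z != 0.
  by near: w; exact: (@cont_neq0 (fun w => s w + s z)).
rewrite mulrAC -(near hq w)// -(near hs w)// -e subr_sqr mulfK//.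
Unshelve. all: end_near. Qed.

Lemma hol_sub (U V : set C) f : V `<=` U -> hol U f -> hol V f.
Proof. by move=> h hf z /h; exact: hf. Qed.

End Cder.

(** * Integrals over intervals *)
Section Integral.
Context {R : realType}.
Notation C := (Cplx R).
Notation mu := (@lebesgue_measure R).
Implicit Types (a b t x y : R).

Variant rcts (f : R -> R) t : Prop := Rcts of f @ t --> f t.
Variant ccts (f : R -> C) t : Prop := Ccts of f @ t --> f t.

Lemma cctsP (f : R -> C) t : ccts f t <->
  forall e : R, 0 < e -> exists2 d : R, 0 < d & forall s, `|s - t| < d -> normc (f s - f t) < e.
Proof.
split=> [[/cvgCP h] e e0|h].
  have [d /= d0 hd] := h e e0; exists d => // s hs; apply: hd.
  by rewrite /ball_ /= distrC.
constructor; apply/(cvgCP (FF := nbhs_filter t)) => e e0.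
have [d d0 hd] := h e e0; exists d => //= s; rewrite /ball_ /= distrC => hs.
exact: hd.
Qed.

Lemma ccts_Re f t : ccts f t -> rcts (fun s => complex.Re (f s)) t.
Proof. by move=> [h]; constructor; exact: (cvg_comp _ _ h (@continuous_Re R _)). Qed.

Lemma ccts_Im f t : ccts f t -> rcts (fun s => complex.Im (f s)) t.
Proof. by move=> [h]; constructor; exact: (cvg_comp _ _ h (@continuous_Im R _)). Qed.

Lemma ccts_normc f t : ccts f t -> rcts (fun s => normc (f s)) t.
Proof. by move=> [h]; constructor; exact: (cvg_comp _ _ h (@continuous_normc R _)). Qed.

Lemma ccts_pair (f g : R -> R) t : rcts f t -> rcts g t -> ccts (fun s => (f s +i* g s)%C) t.
Proof. by move=> [hf] [hg]; constructor; exact: cvg_complex hf hg. Qed.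

Lemma ccts_comp (f : R -> C) (g : C -> C) t : ccts f t -> cts g (f t) -> ccts (fun s => g (f s)) t.
Proof. by move=> [hf] [hg]; constructor; exact: (cvg_comp _ _ hf hg). Qed.

Lemma ccts_rcomp (f : R -> R) (g : R -> C) t : rcts f t -> ccts g (f t) -> ccts (fun s => g (f s)) t.
Proof. by move=> [hf] [hg]; constructor; exact: (cvg_comp _ _ hf hg). Qed.

Lemma cctsD (f g : R -> C) t : ccts f t -> ccts g t -> ccts (fun s => f s + g s) t.
Proof. by move=> [hf] [hg]; constructor; exact: (cvgD hf hg). Qed.
Lemma cctsB (f g : R -> C) t : ccts f t -> ccts g t -> ccts (fun s => f s - g s) t.
Proof. by move=> [hf] [hg]; constructor; exact: (cvgB hf hg). Qed.
Lemma cctsM (f g : R -> C) t : ccts f t -> ccts g t -> ccts (fun s => f s * g s) t.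
Proof. by move=> [hf] [hg]; constructor; exact: (cvgM hf hg). Qed.
Lemma ccts_cst (c : C) t : ccts (fun _ => c) t.
Proof. by constructor; apply: cvg_cst; exact: nbhs_filter. Qed.

Lemma rctsD (f g : R -> R) t : rcts f t -> rcts g t -> rcts (fun s => f s + g s) t.
Proof. by move=> [hf] [hg]; constructor; exact: (cvgD hf hg). Qed.
Lemma rctsB (f g : R -> R) t : rcts f t -> rcts g t -> rcts (fun s => f s - g s) t.
Proof. by move=> [hf] [hg]; constructor; exact: (cvgB hf hg). Qed.
Lemma rctsM (f g : R -> R) t : rcts f t -> rcts g t -> rcts (fun s => f s * g s) t.
Proof. by move=> [hf] [hg]; constructor; exact: (cvgM hf hg). Qed.
Lemma rcts_cst (c : R) t : rcts (fun _ => c) t.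
Proof. by constructor; apply: cvg_cst; exact: nbhs_filter. Qed.
Lemma rcts_id t : rcts (fun s => s) t.
Proof. by constructor. Qed.

Definition rint a b (f : R -> R) : R := \int[mu]_(t in `[a, b]) f t.

Definition rcon a b (f : R -> R) := forall t, a <= t <= b -> rcts f t.
Definition ccon a b (f : R -> C) := forall t, a <= t <= b -> ccts f t.

Lemma rcon_integrable a b f : rcon a b f -> mu.-integrable `[a, b] (EFin \o f).
Proof.
move=> h; apply: continuous_compact_integrable; first exact: segment_compact.
apply: continuous_in_subspaceT => x; rewrite inE /= in_itv /= => /h[].
done.
Qed.

Lemma rintD a b f g : rcon a b f -> rcon a b g ->
  rint a b (fun t => f t + g t) = rint a b f + rint a b g.
Proof. by move=> /rcon_integrable hf /rcon_integrable hg; exact: RintegralD. Qed.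

Lemma rintB a b f g : rcon a b f -> rcon a b g ->
  rint a b (fun t => f t - g t) = rint a b f - rint a b g.
Proof. by move=> /rcon_integrable hf /rcon_integrable hg; exact: RintegralB. Qed.

Lemma rintZ a b (k : R) f : rcon a b f -> rint a b (fun t => k * f t) = k * rint a b f.
Proof. by move=> /rcon_integrable hf; exact: RintegralZl. Qed.

Lemma rint_cst a b (k : R) : a <= b -> rint a b (fun _ => k) = k * (b - a).
Proof.
move=> ab; rewrite /rint Rintegral_cst//; congr (_ * _).
apply: etrans (congr1 fine (lebesgue_measure_itv `[a, b])) _.
by rewrite /= lte_fin; case: ltgtP ab => //= ->; rewrite subrr.
Qed.

Lemma le_rint a b f g : rcon a b f -> rcon a b g ->
  (forall t, a <= t <= b -> f t <= g t) -> rint a b f <= rint a b g.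
Proof.
move=> /rcon_integrable hf /rcon_integrable hg h.
by apply: le_Rintegral => // t /=; rewrite in_itv /=; exact: h.
Qed.

Lemma eq_rint a b f g : (forall t, a <= t <= b -> f t = g t) -> rint a b f = rint a b g.
Proof.
by move=> h; apply: eq_Rintegral => t; rewrite inE /= in_itv /=; exact: h.
Qed.

Lemma rint_split a c b f : a <= c <= b -> rcon a b f ->
  rint a b f = rint a c f + rint c b f.
Proof.
move=> /andP[ac cb] hf; have hI := rcon_integrable hf.
have := @Rintegral_itvB R f (BLeft a) (BRight b) c hI.
rewrite !bnd_simp => /(_ ac cb) h.
rewrite -[LHS](subrK (rint a c f)) addrC; congr (_ + _).
rewrite /rint h; apply: Rintegral_itv_obnd_cbnd.
apply: (@integrableS _ _ _ mu `[a, b]) => //.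
by apply: subset_itvr; rewrite bnd_simp.
Qed.

Definition cint a b (f : R -> C) : C :=
  (rint a b (fun t => complex.Re (f t)) +i* rint a b (fun t => complex.Im (f t)))%C.

Lemma eq_cint a b f g : (forall t, a <= t <= b -> f t = g t) -> cint a b f = cint a b g.
Proof.
by move=> h; rewrite /cint; congr (_ +i* _)%C; apply: eq_rint => t /h ->.
Qed.

Lemma ccon_Re a b f : ccon a b f -> rcon a b (fun t => complex.Re (f t)).
Proof. by move=> h t /h; exact: ccts_Re. Qed.
Lemma ccon_Im a b f : ccon a b f -> rcon a b (fun t => complex.Im (f t)).
Proof. by move=> h t /h; exact: ccts_Im. Qed.

Lemma rconZ a b (k : R) f : rcon a b f -> rcon a b (fun t => k * f t).
Proof. by move=> h t /h hf; exact: (rctsM (rcts_cst k t) hf). Qed.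

Lemma cintD a b f g : ccon a b f -> ccon a b g ->
  cint a b (fun t => f t + g t) = cint a b f + cint a b g.
Proof.
move=> hf hg; rewrite /cint.
under eq_rint do rewrite cReD.
under [X in (_ +i* X)%C]eq_rint do rewrite cImD.
rewrite (rintD (ccon_Re hf) (ccon_Re hg)) (rintD (ccon_Im hf) (ccon_Im hg)).
by [].
Qed.

Lemma cintZ a b (k : C) f : ccon a b f -> cint a b (fun t => k * f t) = k * cint a b f.
Proof.
move=> hf; have hr := ccon_Re hf; have hi := ccon_Im hf; rewrite /cint.
under eq_rint do rewrite cReM.
under [X in (_ +i* X)%C]eq_rint do rewrite cImM.
rewrite rintB; [|exact: rconZ|exact: rconZ].
rewrite rintD; [|exact: rconZ|exact: rconZ].
by rewrite !rintZ//; case: k.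
Qed.

Lemma cconZ a b (k : C) f : ccon a b f -> ccon a b (fun t => k * f t).
Proof. by move=> h t /h hf; exact: (cctsM (ccts_cst k t) hf). Qed.

Lemma cintB a b f g : ccon a b f -> ccon a b g ->
  cint a b (fun t => f t - g t) = cint a b f - cint a b g.
Proof.
move=> hf hg; rewrite -[in RHS](mulN1r (cint a b g)) -(cintZ _ hg) -cintD//.
  by apply: eq_cint => t _; rewrite mulN1r.
exact: cconZ.
Qed.

Lemma cint_cst a b (k : C) : a <= b -> cint a b (fun _ => k) = k * ((b - a)%:C)%C.
Proof.
by move=> ab; rewrite /cint !rint_cst//; case: k => x y; simpc.
Qed.

Lemma cint_split a c b f : a <= c <= b -> ccon a b f ->
  cint a b f = cint a c f + cint c b f.
Proof.
move=> acb hf; rewrite /cint (rint_split acb (ccon_Re hf)) (rint_split acb (ccon_Im hf)).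
by [].
Qed.

Lemma cint_conj a b f : ccon a b f -> cint a b (fun t => (f t)^*%C) = (cint a b f)^*%C.
Proof.
move=> hf; rewrite /cint /=; congr (_ +i* _)%C; first by apply: eq_rint => t _; case: (f t).
rewrite -mulN1r -rintZ; last exact: ccon_Im.
by apply: eq_rint => t _; case: (f t) => /= ? ?; rewrite mulN1r.
Qed.

Lemma rcon_normc a b f : ccon a b f -> rcon a b (fun t => normc (f t)).
Proof. by move=> h t /h; exact: ccts_normc. Qed.

Lemma cint_norm a b f : a <= b -> ccon a b f ->
  normc (cint a b f) <= rint a b (fun t => normc (f t)).
Proof.
move=> ab hf; set I := cint a b f.
have [->|I0] := eqVneq I 0.
  rewrite normc0 -(mul0r (b - a)) -rint_cst//; apply: le_rint => //; first by move=> t _; exact: rcts_cst.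
    exact: rcon_normc.
  by move=> t _; exact: normc_ge0.
have nI : 0 < normc I by rewrite normc_gt0.
have e : normc I ^+ 2 = complex.Re (cint a b (fun t => I^*%C * f t)).
  by rewrite cintZ// -/I mulrC mulJc.
have : normc I ^+ 2 <= normc I * rint a b (fun t => normc (f t)).
  rewrite e -rintZ; last exact: rcon_normc.
  change (rint a b (fun t => complex.Re (I^*%C * f t)) <= rint a b (fun t => normc I * normc (f t))).
  apply: le_rint.
  - by apply: ccon_Re; exact: cconZ.
  - by apply: rconZ; exact: rcon_normc.
  - move=> t _; apply: le_trans (ler_norm _) _; apply: le_trans (Re_le _) _.
    by rewrite normcM normcJ.
by rewrite expr2 ler_pM2l.
Qed.

Lemma cint_bound a b f M : a <= b -> ccon a b f ->
  (forall t, a <= t <= b -> normc (f t) <= M) -> normc (cint a b f) <= M * (b - a).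
Proof.
move=> ab hf h; apply: le_trans (cint_norm ab hf) _; rewrite -rint_cst//.
by apply: le_rint => //; [exact: rcon_normc|move=> t _; exact: rcts_cst].
Qed.

End Integral.

(** * Goursat's theorem for rectangles *)
Section Goursat.
Context {R : realType}.
Notation C := (Cplx R).
Notation "x '+I' y" := ((x +i* y)%C : C) (at level 50).
Variable F : C -> C.

(** The contour integral of [F] along the boundary of a rectangle. *)
Definition gI (x0 x1 y0 y1 : R) : C :=
  cint x0 x1 (fun x => F (x +I y0) - F (x +I y1)) +
  'i%C * cint y0 y1 (fun y => F (x1 +I y) - F (x0 +I y)).

Definition inrect (x0 x1 y0 y1 : R) (z : C) :=
  x0 <= complex.Re z <= x1 /\ y0 <= complex.Im z <= y1.

Lemma ccts_hslice (y t : R) : cts F (t +I y) -> ccts (fun x => F (x +I y)) t.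
Proof.
move=> h; exact: (ccts_comp (f := fun x => x +I y) (ccts_pair (rcts_id t) (rcts_cst y t)) h).
Qed.

Lemma ccts_vslice (x t : R) : cts F (x +I t) -> ccts (fun y => F (x +I y)) t.
Proof.
move=> h; exact: (ccts_comp (f := fun y => x +I y) (ccts_pair (rcts_cst x t) (rcts_id t)) h).
Qed.

Lemma gI_splitx x0 c x1 y0 y1 : x0 <= c <= x1 -> y0 <= y1 ->
  (forall z, inrect x0 x1 y0 y1 z -> cts F z) ->
  gI x0 x1 y0 y1 = gI x0 c y0 y1 + gI c x1 y0 y1.
Proof.
move=> /andP[h1 h2] hy hc; rewrite /gI (@cint_split _ x0 c x1); last 2 first.
- by rewrite h1 h2.
- move=> t ht; apply: cctsB; apply: ccts_hslice; apply: hc; split=> //=.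
    by rewrite lexx hy.
  by rewrite lexx hy.
have -> : cint y0 y1 (fun y => F (x1 +I y) - F (x0 +I y)) =
    cint y0 y1 (fun y => F (c +I y) - F (x0 +I y)) + cint y0 y1 (fun y => F (x1 +I y) - F (c +I y)).
  rewrite -cintD; first by apply: eq_cint => t _; ring.
  - move=> t ht; apply: cctsB; apply: ccts_vslice; apply: hc; split=> //=.
      by rewrite h1 h2.
    by rewrite lexx (le_trans h1).
  - move=> t ht; apply: cctsB; apply: ccts_vslice; apply: hc; split=> //=.
      by rewrite lexx (le_trans h1).
    by rewrite h1 h2.
by rewrite mulrDr addrACA.
Qed.

Lemma gI_splity x0 x1 y0 c y1 : x0 <= x1 -> y0 <= c <= y1 ->
  (forall z, inrect x0 x1 y0 y1 z -> cts F z) ->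
  gI x0 x1 y0 y1 = gI x0 x1 y0 c + gI x0 x1 c y1.
Proof.
move=> hx /andP[h1 h2] hc; rewrite /gI (@cint_split _ y0 c y1); last 2 first.
- by rewrite h1 h2.
- move=> t ht; apply: cctsB; apply: ccts_vslice; apply: hc; split=> //=.
    by rewrite lexx hx.
  by rewrite lexx hx.
have -> : cint x0 x1 (fun x => F (x +I y0) - F (x +I y1)) =
    cint x0 x1 (fun x => F (x +I y0) - F (x +I c)) + cint x0 x1 (fun x => F (x +I c) - F (x +I y1)).
  rewrite -cintD; first by apply: eq_cint => t _; ring.
  - move=> t ht; apply: cctsB; apply: ccts_hslice; apply: hc; split=> //=.
      by rewrite lexx (le_trans h1).
    by rewrite h1 h2.
  - move=> t ht; apply: cctsB; apply: ccts_hslice; apply: hc; split=> //=.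
      by rewrite h1 h2.
    by rewrite lexx (le_trans h1).
by rewrite mulrDr addrACA.
Qed.

Lemma gI_split4 x0 xm x1 y0 ym y1 : x0 <= xm -> xm <= x1 -> y0 <= ym -> ym <= y1 ->
  (forall z, inrect x0 x1 y0 y1 z -> cts F z) ->
  gI x0 x1 y0 y1 = (gI x0 xm y0 ym + gI x0 xm ym y1) + (gI xm x1 y0 ym + gI xm x1 ym y1).
Proof.
move=> h1 h2 h3 h4 hc.
have hy : y0 <= y1 := le_trans h3 h4.
have hx : x0 <= xm <= x1 by rewrite h1 h2.
have hy' : y0 <= ym <= y1 by rewrite h3 h4.
rewrite (gI_splitx hx hy hc); congr (_ + _); apply: gI_splity => // z [/andP[r1 r2] r3].
  by apply: hc; split=> //; rewrite r1 (le_trans r2).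
by apply: hc; split=> //; rewrite r2 (le_trans h1).
Qed.

(** The affine part of [F] has a primitive, so it does not contribute to the
integral over the boundary. *)
Lemma gI_small x0 x1 y0 y1 (c l : C) (D : R) : x0 <= x1 -> y0 <= y1 ->
  (forall z, inrect x0 x1 y0 y1 z -> cts F z) ->
  (forall z, inrect x0 x1 y0 y1 z -> normc (F z - F c - l * (z - c)) <= D) ->
  normc (gI x0 x1 y0 y1) <= D *+ 2 * ((x1 - x0) + (y1 - y0)).
Proof.
move=> hx hy hc hD.
have cx (t y : R) : x0 <= t <= x1 -> y0 <= y <= y1 -> ccts (fun x => F (x +I y)) t.
  by move=> ht hyy; apply: ccts_hslice; exact: hc.
have cy (x t : R) : x0 <= x <= x1 -> y0 <= t <= y1 -> ccts (fun y => F (x +I y)) t.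
  by move=> ht hyy; apply: ccts_vslice; exact: hc.
have ex : x0 <= x0 <= x1 by rewrite lexx.
have ex' : x0 <= x1 <= x1 by rewrite lexx andbT.
have ey : y0 <= y0 <= y1 by rewrite lexx.
have ey' : y0 <= y1 <= y1 by rewrite lexx andbT.
pose k1 : C := - (l * (0 +I (y1 - y0))); pose k2 : C := l * ((x1 - x0) +I 0).
have c1 : ccon x0 x1 (fun x => F (x +I y0) - F (x +I y1)) by move=> t ht; apply: cctsB; exact: cx.
have c2 : ccon y0 y1 (fun y => F (x1 +I y) - F (x0 +I y)) by move=> t ht; apply: cctsB; exact: cy.
have k1c : ccon x0 x1 (fun _ => k1) by move=> t _; exact: ccts_cst.
have k2c : ccon y0 y1 (fun _ => k2) by move=> t _; exact: ccts_cst.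
have -> : gI x0 x1 y0 y1 = cint x0 x1 (fun x => F (x +I y0) - F (x +I y1) - k1) +
    'i%C * cint y0 y1 (fun y => F (x1 +I y) - F (x0 +I y) - k2).
  rewrite (cintB c1 k1c) (cintB c2 k2c) !cint_cst// /gI.
  have e : k1 * ((x1 - x0)%:C)%C + 'i%C * (k2 * ((y1 - y0)%:C)%C) = 0.
    rewrite /k1 /k2 mulNr.
    have -> : (0 +I (y1 - y0)) = 'i%C * ((y1 - y0)%:C)%C by simpc.
    have -> : ((x1 - x0) +I 0) = ((x1 - x0)%:C)%C by [].
    ring.
  by rewrite -[LHS]subr0 -e; ring.
apply: le_trans (normcD _ _) _; rewrite mulrDr normcM.
rewrite normc_i mul1r; apply: lerD.
  apply: cint_bound => //; first by move=> t ht; exact: (cctsB (c1 t ht) (k1c t ht)).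
  move=> t ht; have -> : F (t +I y0) - F (t +I y1) - k1 =
     (F (t +I y0) - F c - l * ((t +I y0) - c)) - (F (t +I y1) - F c - l * ((t +I y1) - c)).
    rewrite /k1; have -> : 0 +I (y1 - y0) = (t +I y1) - (t +I y0) by simpc.
    ring.
  by apply: le_trans (normcB _ _) _; rewrite mulr2n lerD// hD.
apply: cint_bound => //; first by move=> t ht; exact: (cctsB (c2 t ht) (k2c t ht)).
move=> t ht; have -> : F (x1 +I t) - F (x0 +I t) - k2 =
   (F (x1 +I t) - F c - l * ((x1 +I t) - c)) - (F (x0 +I t) - F c - l * ((x0 +I t) - c)).
  rewrite /k2; have -> : (x1 - x0) +I 0 = (x1 +I t) - (x0 +I t) by simpc.
  ring.
by apply: le_trans (normcB _ _) _; rewrite mulr2n lerD// hD.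
Qed.

Lemma dependent_sequence (T : Type) (P : nat -> T -> Prop) (r : nat -> T -> T -> Prop) v0 :
  P 0%N v0 -> (forall k v, P k v -> exists v', P k.+1 v' /\ r k v v') ->
  exists2 u : nat -> T, (forall k, P k (u k)) & forall k, r k (u k) (u k.+1).
Proof.
move=> P0 step.
pose s := fix s k : {v | P k v} :=
  match k with 0%N => exist _ _ P0
  | j.+1 => let: exist v pv := s j in let: exist v' h := cid (step j v pv) in exist _ v' h.1 end.
exists (fun k => sval (s k)) => k; first exact: svalP (s k).
by rewrite /=; case: (s k) => v pv /=; case: cid => v' [h1 h2].
Qed.

Lemma nested_limit (u : nat -> R) (a : R) : 0 <= a ->
  (forall k, u k <= u k.+1 /\ u k.+1 + a / 2 ^+ k.+1 <= u k + a / 2 ^+ k) ->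
  exists X, forall k, u k <= X <= u k + a / 2 ^+ k.
Proof.
move=> a0 h.
have mono i j : (i <= j)%N -> u i <= u j.
  move=> /subnK <-; elim: (j - i)%N => [|n IH]; first by rewrite add0n.
  by rewrite addSn; exact: le_trans IH (h _).1.
have mono' i j : (i <= j)%N -> u j + a / 2 ^+ j <= u i + a / 2 ^+ i.
  move=> /subnK <-; elim: (j - i)%N => [|n IH]; first by rewrite add0n.
  by rewrite addSn; exact: le_trans (h _).2 IH.
have nn k : 0 <= a / 2 ^+ k by rewrite divr_ge0// exprn_ge0.
have ub k : ubound (range u) (u k + a / 2 ^+ k).
  move=> _ [j _ <-]; have [jk|kj] := leqP j k.
    by apply: le_trans (mono _ _ jk) _; rewrite lerDl.
  by apply: le_trans (mono' _ _ (ltnW kj)); rewrite lerDl.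
exists (sup (range u)) => k; apply/andP; split.
  apply: ub_le_sup; last by exists k.
  by exists (u 0%N + a / 2 ^+ 0); exact: ub.
by apply: ge_sup; [exists (u 0%N); exists 0%N|exact: ub].
Qed.

(** Bisection: one of the four quarters carries at least a fourth of the
integral. At the common point of the nested quarters [F] is affine up to an
error small against the diameter, and [gI_small] makes the integral over the
k-th rectangle small against [4^-k]. *)
Lemma goursat x0 x1 y0 y1 : x0 <= x1 -> y0 <= y1 ->
  (forall z, inrect x0 x1 y0 y1 z -> exists l, cder F z l) -> gI x0 x1 y0 y1 = 0.
Proof.
move=> hx hy hF; have [//|I0] := eqVneq (gI x0 x1 y0 y1) 0; exfalso.
have hc z : inrect x0 x1 y0 y1 z -> cts F z by move=> /hF[l]; exact: cder_cont.
pose a := x1 - x0; pose b := y1 - y0; pose eta := normc (gI x0 x1 y0 y1).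
have eta0 : 0 < eta by rewrite normc_gt0.
have a0 : 0 <= a by rewrite subr_ge0.
have b0 : 0 <= b by rewrite subr_ge0.
pose wa k := a / 2 ^+ k; pose wb k := b / 2 ^+ k.
have wa0 k : 0 <= wa k by rewrite divr_ge0// exprn_ge0.
have wb0 k : 0 <= wb k by rewrite divr_ge0// exprn_ge0.
have waS k : wa k = wa k.+1 + wa k.+1 by rewrite /wa exprS; field; rewrite expf_neq0// pnatr_eq0.
have wbS k : wb k = wb k.+1 + wb k.+1 by rewrite /wb exprS; field; rewrite expf_neq0// pnatr_eq0.
pose P k (v : R * R) := [/\ x0 <= v.1, v.1 + wa k <= x1, y0 <= v.2, v.2 + wb k <= y1 &
  eta / 4 ^+ k <= normc (gI v.1 (v.1 + wa k) v.2 (v.2 + wb k))].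
pose rel k (v v' : R * R) := [/\ v.1 <= v'.1, v'.1 + wa k.+1 <= v.1 + wa k, v.2 <= v'.2
  & v'.2 + wb k.+1 <= v.2 + wb k].
have step k v : P k v -> exists v', P k.+1 v' /\ rel k v v'.
  case: v => x y [/= p1 p2 p3 p4 p5].
  have hc' z : inrect x (x + wa k) y (y + wb k) z -> cts F z.
    by case=> /andP[q1 q2] /andP[q3 q4]; apply: hc; split; apply/andP; split; lra.
  pose xm := x + wa k.+1; pose ym := y + wb k.+1.
  have ha := wa0 k.+1; have hb := wb0 k.+1; have ha' := waS k; have hb' := wbS k.
  have [q1 q2 q3 q4] : [/\ x <= xm, xm <= x + wa k, y <= ym & ym <= y + wb k].
    by rewrite /xm /ym lerDl ha lerDl hb ha' hb' !addrA !lerDl ha hb.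
  have e := gI_split4 q1 q2 q3 q4 hc'.
  have ex : x + wa k = xm + wa k.+1 by rewrite /xm -addrA -waS.
  have ey : y + wb k = ym + wb k.+1 by rewrite /ym -addrA -wbS.
  have fx : [/\ x0 <= x, x + wa k.+1 <= x1, x <= x & x + wa k.+1 <= x + wa k].
    by split=> //; exact: le_trans q2 p2.
  have fy : [/\ y0 <= y, y + wb k.+1 <= y1, y <= y & y + wb k.+1 <= y + wb k].
    by split=> //; exact: le_trans q4 p4.
  have fxm : [/\ x0 <= xm, xm + wa k.+1 <= x1, x <= xm & xm + wa k.+1 <= x + wa k].
    by rewrite -ex; split=> //; exact: le_trans p1 q1.
  have fym : [/\ y0 <= ym, ym + wb k.+1 <= y1, y <= ym & ym + wb k.+1 <= y + wb k].
    by rewrite -ey; split=> //; exact: le_trans p3 q3.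
  pose m := eta / 4 ^+ k.+1.
  have em : eta / 4 ^+ k = m + m + (m + m) by rewrite /m exprS; field; rewrite expf_neq0// pnatr_eq0.
  have tri : eta / 4 ^+ k <= (normc (gI x xm y ym) + normc (gI x xm ym (y + wb k))) +
     (normc (gI xm (x + wa k) y ym) + normc (gI xm (x + wa k) ym (y + wb k))).
    apply: le_trans p5 _; rewrite e; apply: le_trans (normcD _ _) _.
    by apply: lerD; exact: normcD.
  case: fx => fx1 fx2 fx3 fx4; case: fy => fy1 fy2 fy3 fy4.
  case: fxm => gx1 gx2 gx3 gx4; case: fym => gy1 gy2 gy3 gy4.
  have [g1|g1] := leP m (normc (gI x xm y ym)).
    by exists (x, y); split; split.
  have [g2|g2] := leP m (normc (gI x xm ym (y + wb k))).
    by exists (x, ym); split; split=> //=; rewrite -?ey.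
  have [g3|g3] := leP m (normc (gI xm (x + wa k) y ym)).
    by exists (xm, y); split; split=> //=; rewrite -?ex.
  have [g4|g4] := leP m (normc (gI xm (x + wa k) ym (y + wb k))).
    by exists (xm, ym); split; split=> //=; rewrite -?ex -?ey.
  suff: eta / 4 ^+ k < m + m + (m + m) by rewrite em ltxx.
  apply: le_lt_trans tri _; apply: ltrD; exact: ltrD.
have P0 : P 0%N (x0, y0).
  have ea : wa 0 = a by rewrite /wa expr0 divr1.
  have eb : wb 0 = b by rewrite /wb expr0 divr1.
  by split; rewrite /= ?ea ?eb /a /b ?expr0 ?divr1// ?(addrC x0) ?(addrC y0) ?subrK.
have [u Pu su] := dependent_sequence P0 step; clear step P0.
have [X hX] := @nested_limit (fun k => (u k).1) a a0 (fun k => let: And4 h1 h2 _ _ := su k in conj h1 h2).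
have [Y hY] := @nested_limit (fun k => (u k).2) b b0 (fun k => let: And4 _ _ h1 h2 := su k in conj h1 h2).
pose c := X +I Y.
have hcin : inrect x0 x1 y0 y1 c.
  have [q1 q2 q3 q4 _] := Pu 0%N; have := hX 0%N; have := hY 0%N; rewrite -/(wa 0) -/(wb 0).
  by move=> /andP[? ?] /andP[? ?]; split=> /=; lra.
have [l /cderP hl] := hF c hcin.
pose S := a + b + 1; have S0 : 0 < S by rewrite /S; lra.
pose e := eta / (S ^+ 2 * 4).
have e0 : 0 < e by rewrite divr_gt0// mulr_gt0// exprn_gt0.
have [d d0 hd] := nbhsCE (hl e e0).
have [k hk] : exists k : nat, S / 2 ^+ k < d.
  have [k] : exists k : nat, S / d < 2 ^+ k.
    exists (Num.truncn (S / d)).+1.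
    apply: lt_trans (truncnS_gt _) _; rewrite -natrX ltr_nat.
    exact: ltn_expl.
  by move=> hk; exists k; rewrite ltr_pdivrMr ?exprn_gt0// mulrC -ltr_pdivrMr.
have [p1 p2 p3 p4 p5] := Pu k.
set x := (u k).1 in p1 p2 p5; set y := (u k).2 in p3 p4 p5.
have dist z : inrect x (x + wa k) y (y + wb k) z -> normc (z - c) <= (a + b) / 2 ^+ k.
  case=> q1 q2; apply: le_trans (normc_le_ReIm _) _; rewrite cReD cReN cImD cImN /= mulrDl.
  have := hX k; have := hY k; rewrite -/x -/y -/(wa k) -/(wb k) => hyk hxk.
  by apply: lerD; rewrite ler_norml; apply/andP; split; lra.
have pk : 0 < 2 ^+ k :> R by rewrite exprn_gt0.
have abS : (a + b) / 2 ^+ k < S / 2 ^+ k by rewrite ltr_pM2r ?invr_gt0// /S; lra.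
have := @gI_small x (x + wa k) y (y + wb k) c l (e * ((a + b) / 2 ^+ k)).
have q1 : x <= x + wa k by rewrite lerDl.
have q2 : y <= y + wb k by rewrite lerDl.
move=> /(_ q1 q2).
have hcin' z : inrect x (x + wa k) y (y + wb k) z -> cts F z.
  by case=> /andP[? ?] /andP[? ?]; apply: hc; split; apply/andP; split; lra.
move=> /(_ hcin').
have hsm z : inrect x (x + wa k) y (y + wb k) z -> normc (F z - F c - l * (z - c)) <= e * ((a + b) / 2 ^+ k).
  move=> hz; have hz' := dist z hz; apply: le_trans (hd z _) _; last by rewrite ler_pM2l.
  by lra.
move=> /(_ hsm); rewrite !(addrC x) !(addrC y) !addrK => hfin.
have : eta / 4 ^+ k <= e * ((a + b) / 2 ^+ k) *+ 2 * (wa k + wb k).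
  by apply: le_trans p5 _; rewrite !(addrC x) !(addrC y).
have -> : e * ((a + b) / 2 ^+ k) *+ 2 * (wa k + wb k) = e * 2 * (a + b) ^+ 2 / 4 ^+ k.
  have -> : (4 : R) = 2 ^+ 2 by rewrite expr2; ring.
  rewrite -exprM mulnC exprM /wa /wb; field; rewrite expf_neq0// pnatr_eq0//.
rewrite ler_pM2r ?invr_gt0 ?exprn_gt0// => hfin2.
have : e * 2 * (a + b) ^+ 2 <= e * 2 * S ^+ 2.
  rewrite ler_pM2l; last by rewrite mulr_gt0.
  by rewrite ler_pXn2r// ?nnegrE /S; lra.
have -> : e * 2 * S ^+ 2 = eta / 2 by rewrite /e; field; rewrite gt_eqF.
lra.
Qed.

End Goursat.

(** * The complex exponential *)
Section IsDerive.
Context {K : numFieldType}.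

(** One expansion for both base fields: complex derivatives and derivatives of
real functions of a real variable are both read off from it. *)
Lemma is_deriveP (f : K^o -> K^o) (z d : K^o) : is_derive z 1 f d <->
  forall e : K, 0 < e -> \forall w \near z, `|f w - f z - d * (w - z)| <= e * `|w - z|.
Proof.
split=> [[hd hv] e e0|h].
  have hcv : (h^-1 *: ((f \o shift z) (h *: (1 : K^o)) - f z) @[h --> (0 : K)^']) --> d.
    by rewrite -hv; exact: hd.
  have /cvgrPdist_le/(_ e e0) := hcv => -[r /= r0 hr].
  exists r => //= w; rewrite /ball_ /= distrC => hw.
  have [->|wz] := eqVneq w z; first by rewrite !subrr mulr0 subrr !normr0 mulr0.
  have wz' : w - z != 0 by rewrite subr_eq0.
  have := hr (w - z); rewrite /ball_ /= sub0r normrN => /(_ hw wz').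
  have -> : ((w - z) *: (1 : K^o) + z) = w by rewrite /GRing.scale /= mulr1 subrK.
  rewrite /GRing.scale /= => hh.
  have -> : f w - f z - d * (w - z) = - ((d - (w - z)^-1 * (f w - f z)) * (w - z)) by field.
  by rewrite normrN normrM ler_wpM2r.
suff hc : (h^-1 *: ((f \o shift z) (h *: (1 : K^o)) - f z) @[h --> (0 : K)^']) --> d.
  by split; [apply/cvg_ex; exists d|exact: (cvg_lim _ hc)].
apply/cvgrPdist_le => e e0; have [r /= r0 hr] := h e e0.
exists r => //= x; rewrite /ball_ /= sub0r normrN => hx x0.
have -> : (x *: (1 : K^o) + z) = x + z by rewrite /GRing.scale /= mulr1.
have := hr (x + z); rewrite /ball_ /= opprD addrCA subrr addr0 normrN => /(_ hx).
rewrite addrK => hh; rewrite /GRing.scale /=.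
have -> : d - x^-1 * (f (x + z) - f z) = - ((f (x + z) - f z - d * x) / x) by field.
by rewrite normrN normrM normfV ler_pdivrMr ?normr_gt0.
Qed.

End IsDerive.

Section Exponential.
Context {R : realType}.
Notation C := (Cplx R).

Lemma cder_is_derive (f : C -> C) z l : cder f z l <-> is_derive (z : C) (1 : C) f l.
Proof.
have nE (x : C) : `|x| = ((normc x)%:C)%C by case: x.
rewrite is_deriveP; split=> [/cderP h e|h].
  case: e => er ei; rewrite ltcE /= => /andP[/eqP -> e0]; apply: filterS (h _ e0) => w hw.
  by rewrite !nE -[(_ +i* 0)%C]/((er%:C)%C) -rmorphM lecR.
apply/cderP => e e0; have := h (e%:C)%C; rewrite ltcR => /(_ e0).
by apply: filterS => w; rewrite !nE -rmorphM lecR.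
Qed.

Lemma rderE (f : R -> R) (t d : R) : is_derive t 1 f d ->
  forall e : R, 0 < e -> exists2 r : R, 0 < r &
    forall s, `|s - t| < r -> `|f s - f t - d * (s - t)| <= e * `|s - t|.
Proof.
move=> /(is_deriveP (K := R)) h e e0; have [r /= r0 hr] := h e e0; exists r => // s hs.
by apply: hr; rewrite /ball_ /= distrC.
Qed.

Definition cis (t : R) : C := (cos t +i* sin t)%C.
Definition cexp (z : C) : C := (expR (complex.Re z))%:C%C * cis (complex.Im z).

Lemma cisD s t : cis (s + t) = cis s * cis t.
Proof. by rewrite /cis cosD sinD; simpc; congr (_ +i* _)%C; ring. Qed.

Lemma cexpD z w : cexp (z + w) = cexp z * cexp w.
Proof. by rewrite /cexp cReD cImD expRD cisD rmorphM /=; ring. Qed.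

Lemma normc_cis t : normc (cis t) = 1.
Proof.
by apply/eqP; rewrite -sqrp_eq1 ?normc_ge0// normc_sq /= cos2Dsin2.
Qed.

Lemma cexp0 : cexp 0 = 1.
Proof. by rewrite /cexp /cis /= expR0 cos0 sin0 mulr1. Qed.

Lemma cder_cexp0 : cder cexp 0 1.
Proof.
apply/cderP => e e0; rewrite cexp0.
have [k [k0 k1 ke]] : exists k, [/\ 0 < k, k <= 1 & k * 8 <= e].
  exists (Num.min (e / 8) 1); split.
  - by rewrite lt_min ltr01 divr_gt0.
  - by rewrite ge_min lexx orbT.
  - by rewrite -ler_pdivlMr// ge_min lexx.
have [d1 d10 h1] := rderE (is_derive_expR (0 : R)) k0.
have [d2 d20 h2] := rderE (is_derive_cos (0 : R)) k0.
have [d3 d30 h3] := rderE (is_derive_sin (0 : R)) k0.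
apply/nbhsCP; exists (Num.min (Num.min d1 d2) (Num.min d3 k)).
  by rewrite !lt_min d10 d20 d30 k0.
move=> w; rewrite subr0 !lt_min -andbA => /and4P[w1 w2 w3 w4].
have hx := Re_le w; have hy := Im_le w.
case: w w1 w2 w3 w4 hx hy => x y /=; set n := normc _ => w1 w2 w3 w4 hx hy.
have n0 : 0 <= n by exact: normc_ge0.
have {}h1 : `|expR x - 1 - x| <= k * n.
  have := h1 x; rewrite subr0 expR0 mul1r => /(_ (le_lt_trans hx w1)) h.
  by apply: le_trans h _; rewrite ler_pM2l.
have {}h2 : `|cos y - 1| <= k * n.
  have := h2 y; rewrite subr0 cos0 sin0 oppr0 mul0r subr0 => /(_ (le_lt_trans hy w2)) h.
  by apply: le_trans h _; rewrite ler_pM2l.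
have {}h3 : `|sin y - y| <= k * n.
  have := h3 y; rewrite subr0 sin0 cos0 mul1r subr0 => /(_ (le_lt_trans hy w3)) h.
  by apply: le_trans h _; rewrite ler_pM2l.
apply: le_trans (normc_le_ReIm _) _.
have -> : cexp (x +i* y)%C = ((expR x * cos y) +i* (expR x * sin y))%C by rewrite /cexp /cis; simpc.
rewrite mul1r !cReD !cImD !cReN !cImN /= subr0.
have hc : `|cos y| <= 1 by rewrite ler_norml cos_geN1 cos_le1.
have hs : `|sin y| <= 1 by rewrite ler_norml sin_geN1 sin_le1.
have kn : 0 <= k * n by rewrite mulr_ge0// ltW.
have kn1 : k * n <= n by rewrite ler_piMl.
have -> : expR x * cos y - 1 - x = (expR x - 1 - x) * cos y + (1 + x) * (cos y - 1) by ring.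
have -> : expR x * sin y - y = (expR x - 1 - x) * sin y + x * sin y + (sin y - y) by ring.
have b1 : `|(expR x - 1 - x) * cos y| <= k * n.
  by rewrite normrM -[leRHS]mulr1 ler_pM.
have b2 : `|(1 + x) * (cos y - 1)| <= 2 * (k * n).
  rewrite normrM ler_pM//; apply: le_trans (ler_normD _ _) _; rewrite normr1.
  lra.
have b3 : `|(expR x - 1 - x) * sin y| <= k * n.
  by rewrite normrM -[leRHS]mulr1 ler_pM.
have b4 : `|x * sin y| <= 2 * (k * n).
  have sy : `|sin y| <= 2 * n.
    have := ler_normD (sin y - y) y; rewrite subrK; lra.
  have : `|x * sin y| <= n * (2 * n) by rewrite normrM ler_pM.
  have : n * (2 * n) <= k * (2 * n) by rewrite ler_wpM2r// ?mulr_ge0// ltW.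
  lra.
have c1 := ler_normD ((expR x - 1 - x) * cos y) ((1 + x) * (cos y - 1)).
have c2 := ler_normD ((expR x - 1 - x) * sin y + x * sin y) (sin y - y).
have c3 := ler_normD ((expR x - 1 - x) * sin y) (x * sin y).
have : k * 8 * n <= e * n by rewrite ler_wpM2r.
lra.
Qed.

Lemma cder_cexp z : cder cexp z (cexp z).
Proof.
have h0 : cder (fun w => w - z) z (1 - 0) := cderB (cder_id z) (cder_cst z z).
have h : cder cexp ((fun w => w - z) z) 1 by rewrite /= subrr; exact: cder_cexp0.
have := cder_lin (cexp z) 0 (cder_comp h0 h); rewrite subr0 !mulr1.
by apply: cder_ext => w; rewrite addr0 -cexpD addrC subrK.
Qed.

Lemma ccts_cis t : ccts cis t.
Proof.
apply: ccts_pair; constructor; [exact: continuous_cos|exact: continuous_sin].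
Qed.

Lemma cis_per t : cis (t + pi *+ 2) = cis t.
Proof. by rewrite /cis (cosD t) (sinD t) cos2pi sin2pi !mulr1 !mulr0 subr0 addr0. Qed.

End Exponential.

(** * Circle means *)
Section Compact.
Context {R : realType}.
Notation C := (Cplx R).

Lemma disk_compact (a : C) (r : R) : compact [set z : C | normc (z - a) <= r].
Proof.
pose f (v : R * R) : C := a + (v.1 +i* v.2)%C.
have fc : continuous f.
  move=> v; apply: cvgD; first exact: cvg_cst.
  by apply: cvg_complex; [exact: cvg_fst|exact: cvg_snd].
have hK : compact (f @` (`[- r, r] `*` `[- r, r])).
  apply: continuous_compact; first exact: continuous_subspaceT.
  by apply: compact_setX; exact: segment_compact.
apply: (subclosed_compact _ hK).
  rewrite -[X in closed X]setCK closedC; apply/openCP => z /= /negP; rewrite -ltNge => hz.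
  exists (normc (z - a) - r); first by rewrite subr_gt0.
  move=> w hw /= hwr; have := normcD (z - w) (w - a); rewrite addrA subrK normcBC; lra.
move=> z /= hz; exists (complex.Re (z - a), complex.Im (z - a)); last first.
  by rewrite /f /=; case: (z - a) (subrK a z) => x y <-; rewrite addrC.
split=> /=; rewrite in_itv /= -ler_norml; apply: le_trans hz; [exact: Re_le|exact: Im_le].
Qed.

Lemma circle_compact (a : C) (r : R) : compact [set z : C | normc (z - a) = r].
Proof.
apply: (subclosed_compact _ (@disk_compact a r)); last by move=> z /= ->.
rewrite -[X in closed X]setCK closedC; apply/openCP => z /= hz.
have hz' : 0 < `|normc (z - a) - r| by rewrite normr_gt0 subr_eq0; apply/eqP.
exists `|normc (z - a) - r| => // w hw /= hwr.
have : `|normc (z - a) - r| <= normc (w - z).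
  rewrite -hwr ler_norml; apply/andP; split.
    have := normcD (w - z) (z - a); rewrite addrA subrK; lra.
  have := normcD (z - w) (w - a); rewrite addrA subrK normcBC; lra.
lra.
Qed.

Lemma compact_ucts (K : set C) (f : C -> C) : compact K -> (forall z, K z -> cts f z) ->
  forall e : R, 0 < e -> exists2 d : R, 0 < d &
    forall z w, K z -> normc (w - z) < d -> normc (f w - f z) < e.
Proof.
move=> cK fK e e0; apply: contrapT => hn.
have /choice[u hu] : forall n : nat, exists zw : C * C,
    K zw.1 /\ normc (zw.2 - zw.1) < n.+1%:R^-1 /\ e <= normc (f zw.2 - f zw.1).
  move=> n; apply: contrapT => h; apply: hn; exists n.+1%:R^-1; first by rewrite invr_gt0.
  move=> z w Kz zw; rewrite ltNge; apply/negP => h'; apply: h; by exists (z, w).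
have [p [Kp hp]] : K `&` cluster ((fun n => (u n).1) @ \oo) !=set0.
  by apply: cK; exists 0%N => // n _; exact: (hu n).1.
have e2 : 0 < e / 2 by rewrite divr_gt0.
have /ccontP/(_ _ e2)[d d0 hd] := fK p Kp.
have d2 : 0 < d / 2 by rewrite divr_gt0.
have [N _ hN] : \forall n \near \oo, n.+1%:R^-1 < d / 2.
  by have := @near_infty_natSinv_lt R (PosNum d2).
have h1 : ((fun n => (u n).1) @ \oo) [set z | exists2 n, (N <= n)%N & z = (u n).1].
  by exists N => // n /= Nn; exists n.
have [z [[n Nn ->] /= hz]] := hp _ _ h1 (nbhsC_disk p d2).
have [_ [hw he]] := hu n; have hn' := hN n Nn.
have hzw : normc ((u n).2 - p) < d.
  have := normcD ((u n).2 - (u n).1) ((u n).1 - p); rewrite addrA subrK => h.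
  by apply: le_lt_trans h _; rewrite [d]splitr ltrD// (lt_trans hw).
have hz' : normc ((u n).1 - p) < d by apply: lt_trans hz _; lra.
have := normcB (f (u n).2 - f p) (f (u n).1 - f p).
have -> : f (u n).2 - f p - (f (u n).1 - f p) = f (u n).2 - f (u n).1 by ring.
have := hd _ hzw; have := hd _ hz'; lra.
Qed.

End Compact.

Section CircleMean.
Context {R : realType}.
Notation C := (Cplx R).
Implicit Types (f g : C -> C) (a z w : C) (r : R).

Definition circ a r (t : R) : C := a + r%:C%C * cis (pi *+ 2 * t).
Definition cm f a r : C := cint 0 1 (fun t => f (circ a r t)).

Lemma normc_circ a r t : normc (circ a r t - a) = `|r|.
Proof. by rewrite /circ addrC addKr normcM normc_real normc_cis mulr1. Qed.

Lemma ccts_circ a r t : ccts (circ a r) t.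
Proof.
apply: cctsD; first exact: ccts_cst.
apply: cctsM; first exact: ccts_cst.
apply: (ccts_rcomp (f := fun t => pi *+ 2 * t)); last exact: ccts_cis.
exact: (rctsM (rcts_cst _ _) (rcts_id _)).
Qed.

Lemma ccon_circ f a r : (forall z, normc (z - a) = `|r| -> cts f z) ->
  ccon 0 1 (fun t => f (circ a r t)).
Proof.
move=> h t _; apply: ccts_comp; first exact: ccts_circ.
by apply: h; exact: normc_circ.
Qed.

Lemma eq_cm f g a r : (forall z, normc (z - a) = `|r| -> f z = g z) -> cm f a r = cm g a r.
Proof. by move=> h; apply: eq_cint => t _; apply: h; exact: normc_circ. Qed.

Lemma cm0 f a : cm f a 0 = f a.
Proof.
rewrite /cm (_ : (fun t => _) = (fun _ => f a)); first by rewrite cint_cst// subr0 mulr1.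
by apply/funext => t; rewrite /circ mul0r addr0.
Qed.

(** In logarithmic polar coordinates the annulus is a rectangle whose horizontal
sides carry the same values, so Goursat's theorem compares the means on the two
remaining sides. *)
Lemma cm_annulus f a (r0 r1 : R) : 0 < r0 -> r0 <= r1 ->
  (forall z, r0 <= normc (z - a) <= r1 -> exists l, cder f z l) -> cm f a r0 = cm f a r1.
Proof.
move=> r00 r01 hf.
have r10 : 0 < r1 := lt_le_trans r00 r01.
have p2 : 0 < (pi *+ 2 : R) by rewrite mulrn_wgt0// pi_gt0.
have p20 : (pi *+ 2 : R) != 0 by rewrite gt_eqF.
pose F (z : C) := f (a + cexp ((pi *+ 2)%:C%C * z)).
pose x r : R := ln r / (pi *+ 2).
have hE u v : (a + cexp ((pi *+ 2)%:C%C * (u +i* v)%C)) = circ a (expR (pi *+ 2 * u)) v.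
  rewrite /circ /cexp; congr (_ + _ * cis _).
    by congr (expR _)%:C%C; simpc.
  by simpc.
have hx r : 0 < r -> expR (pi *+ 2 * x r) = r by move=> ?; rewrite /x mulrC divfK// lnK.
have x01 : x r0 <= x r1 by rewrite ler_pM2r ?invr_gt0// ler_ln.
have h01 : (0 : R) <= 1 by [].
have hF z : inrect (x r0) (x r1) 0 1 z -> exists l, cder F z l.
  case: z => u v [/= /andP[h1 h2] _].
  have [l hl] : exists l, cder f (a + cexp ((pi *+ 2)%:C%C * (u +i* v)%C)) l.
    apply: hf; rewrite hE normc_circ ger0_norm ?expR_ge0//.
    rewrite -{1}(hx _ r00) -(hx _ r10) !ler_expR !ler_pM2l//.
    by rewrite h1 h2.
  have d1 : cder (fun z : C => (pi *+ 2)%:C%C * z + 0) (u +i* v)%C ((pi *+ 2)%:C%C * 1) :=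
    cder_lin _ _ (cder_id _).
  have d2 := cder_comp d1 (cder_cexp _).
  have d3 := cder_lin 1 a d2.
  have e w : 1 * cexp ((pi *+ 2)%:C%C * w + 0) + a = a + cexp ((pi *+ 2)%:C%C * w).
    by rewrite mul1r addr0 addrC.
  have d4 := cder_ext e d3.
  by eexists; exact: (cder_comp d4 hl).
have := goursat x01 h01 hF; rewrite /gI.
have -> : cint (x r0) (x r1) (fun u => F (u +i* 0)%C - F (u +i* 1)%C) = 0.
  rewrite -(mul0r ((x r1 - x r0)%:C)%C) -cint_cst//; apply: eq_cint => t _.
  rewrite /F !hE /circ mulr0 mulr1.
  by have := cis_per (0 : R); rewrite add0r => ->; rewrite subrr.
rewrite add0r => /eqP; rewrite mulf_eq0 => /orP[/eqP/(congr1 (fun z => normc z))|].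
  by rewrite normc_i normc0 => /eqP; rewrite oner_eq0.
have hFc (r : R) t : r0 <= r <= r1 -> ccts (fun v => F (x r +i* v)%C) t.
  move=> /andP[h1 h2]; have rr : 0 < r := lt_le_trans r00 h1.
  have e v : F (x r +i* v)%C = f (circ a r v) by rewrite /F hE hx.
  have -> : (fun v => F (x r +i* v)%C) = (fun v => f (circ a r v)) by apply/funext.
  apply: ccts_comp; first exact: ccts_circ.
  have [|l hl] := hf (circ a r t); first by rewrite normc_circ ger0_norm ?h1 ?h2// ltW.
  exact: cder_cont hl.
rewrite cintB; last 2 first.
- by move=> t _; apply: hFc; rewrite r01 lexx.
- by move=> t _; apply: hFc; rewrite r01 lexx.
have -> : cint 0 1 (fun v => F (x r1 +i* v)%C) = cm f a r1.
  by apply: eq_cint => t _; rewrite /F hE hx.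
have -> : cint 0 1 (fun v => F (x r0 +i* v)%C) = cm f a r0.
  by apply: eq_cint => t _; rewrite /F hE hx.
by rewrite subr_eq0 => /eqP.
Qed.

Lemma cm_cont f a r : 0 <= r -> (forall z, normc (z - a) = r -> cts f z) ->
  forall e : R, 0 < e -> exists2 d : R, 0 < d & forall s, 0 <= s -> `|s - r| < d ->
    (forall z, normc (z - a) = s -> cts f z) -> normc (cm f a s - cm f a r) <= e.
Proof.
move=> r0 hf e e0.
have [d d0 hd] := compact_ucts (@circle_compact R a r) hf e0.
exists d => // s s0 sr hs; rewrite /cm -cintB; last 2 first.
- by apply: ccon_circ => z; rewrite ger0_norm//; exact: hs.
- by apply: ccon_circ => z; rewrite ger0_norm//; exact: hf.
rewrite -[e]mulr1 -{2}[1](subr0 1); apply: cint_bound => //.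
  move=> t _; apply: cctsB.
    by apply: (ccts_comp (ccts_circ _ _ _)); apply: hs; rewrite normc_circ ger0_norm.
  by apply: (ccts_comp (ccts_circ _ _ _)); apply: hf; rewrite normc_circ ger0_norm.
move=> t _; apply/ltW/hd; first by rewrite /= normc_circ ger0_norm.
rewrite /circ opprD addrACA subrr add0r -mulrBl normcM normc_cis mulr1.
by rewrite -rmorphB normc_real.
Qed.

(** Means over circles are constant in the radius on each side of the exceptional
circle by [cm_annulus], and continuous in the radius. The exceptional circle is
needed because difference quotients are only known to be continuous at one
point, which need not be the centre. *)
Lemma cm_center f a (rho s : R) : 0 <= s ->
  (forall z, normc (z - a) < rho -> cts f z) ->
  (forall z, normc (z - a) < rho -> 0 < normc (z - a) -> normc (z - a) != s ->
     exists l, cder f z l) ->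
  forall r, 0 <= r < rho -> cm f a r = f a.
Proof.
move=> s0 fc fd.
have same r r' : 0 < r -> r <= r' -> r' < rho -> (r' < s \/ s < r) -> cm f a r = cm f a r'.
  move=> h1 h2 h3 h4; apply: cm_annulus => // z /andP[g1 g2]; apply: fd.
  - exact: le_lt_trans g2 h3.
  - exact: lt_le_trans h1 g1.
  - by case: h4 => h4; [rewrite lt_eqF// (le_lt_trans g2)|rewrite gt_eqF// (lt_le_trans h4)].
have cc r : r < rho -> forall z, normc (z - a) = r -> cts f z by move=> h z hz; apply: fc; rewrite hz.
have limit r v : 0 <= r < rho ->
    (forall d : R, 0 < d -> exists q, [/\ 0 <= q, q < rho, `|q - r| < d & cm f a q = v]) -> cm f a r = v.
  move=> /andP[h1 h2] h; apply/eqP; rewrite -subr_eq0 -normc_eq0 eq_le normc_ge0 andbT.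
  apply/ler_addgt0Pr => e e0; rewrite add0r.
  have [d d0 hd] := cm_cont h1 (cc _ h2) e0.
  have [q [q0 qr qd <-]] := h _ d0; rewrite normcBC; apply: hd => //.
  exact: cc.
move=> r /andP[]; rewrite le_eqVlt => /orP[/eqP <- _|r0 rr]; first exact: cm0.
rewrite -cm0; have rho0 : 0 < rho := lt_trans r0 rr.
have near0 v r' : 0 < r' -> (forall q, 0 < q -> q < r' -> q < rho -> cm f a q = v) -> cm f a 0 = v.
  move=> r'0 h; apply: limit => [|d d0]; first by rewrite lexx.
  pose q := Num.min (d / 2) (Num.min (r' / 2) (rho / 2)).
  have q0 : 0 < q by rewrite !lt_min !divr_gt0.
  have q1 : q <= d / 2 by rewrite ge_min lexx.
  have q2 : q <= r' / 2 by rewrite !ge_min lexx orbT.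
  have q3 : q <= rho / 2 by rewrite !ge_min lexx !orbT.
  exists q; split; [exact: ltW|lra| |apply: h; lra].
  by rewrite subr0 ger0_norm; [lra|exact: ltW].
have below r' : 0 < r' -> r' < rho -> r' < s -> cm f a r' = cm f a 0.
  move=> h1 h2 h3; symmetry; apply: (near0 _ r') => // q q0 qr _.
  by apply: same => //; [exact: ltW|left].
have ats : s < rho -> cm f a s = cm f a 0.
  move=> h2; move: s0; rewrite le_eqVlt => /orP[/eqP <- //|h1].
  apply: limit => [|d d0]; first by rewrite h2 ltW.
  exists (Num.max (s / 2) (s - d / 2)); have m1 : s / 2 <= Num.max (s / 2) (s - d / 2) by rewrite le_max lexx.
  have m2 : s - d / 2 <= Num.max (s / 2) (s - d / 2) by rewrite le_max lexx orbT.
  have m3 : Num.max (s / 2) (s - d / 2) < s by rewrite gt_max; apply/andP; split; lra.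
  split; [lra|lra| |apply: below; lra].
  by rewrite ler0_norm; lra.
have [rs|sr|rs] := ltgtP r s; [exact: below| |by rewrite rs; apply: ats; rewrite -rs].
rewrite -(ats (lt_trans sr rr)); symmetry; apply: limit => [|d d0]; first by rewrite s0 (lt_trans sr).
exists (Num.min r (s + d / 2)); have m1 : Num.min r (s + d / 2) <= r by rewrite ge_min lexx.
have m2 : Num.min r (s + d / 2) <= s + d / 2 by rewrite ge_min lexx orbT.
have m3 : s < Num.min r (s + d / 2) by rewrite lt_min; apply/andP; split; lra.
split; [lra|lra| |apply: same => //; [lra|by right]].
by rewrite ger0_norm; lra.
Qed.

End CircleMean.

(** * Cauchy's formula *)
Section Cauchy.
Context {R : realType}.
Notation C := (Cplx R).
Implicit Types (f g u : C -> C) (a z w : C) (r rho : R).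

Definition disk a r : set C := [set z | normc (z - a) < r].

Definition dquot f w (l : C) z : C := if z == w then l else (f z - f w) / (z - w).

Lemma near_neq z w : z != w -> \forall x \near z, x != w.
Proof.
move=> zw; have d0 : 0 < normc (z - w) by rewrite normc_gt0 subr_eq0.
apply/nbhsCP; exists (normc (z - w)) => // x hx; apply/eqP => xw.
by move: hx; rewrite xw normcBC ltxx.
Qed.

Lemma dquot_near f w l z : z != w -> \forall x \near z, (f x - f w) / (x - w) = dquot f w l x.
Proof. by move=> /near_neq; apply: filterS => x; rewrite /dquot => /negbTE ->. Qed.

Lemma cder_dquot f w l z m : z != w -> cder f z m -> exists k, cder (dquot f w l) z k.
Proof.
move=> zw hf; have z0 : z - w != 0 by rewrite subr_eq0.
have h1 := cderB hf (cder_cst (f w) z); have h2 := cderB (cder_id z) (cder_cst w z).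
eexists; apply: (cder_near (dquot_near f l zw)); exact: (cder_div h1 h2 z0).
Qed.

Lemma cts_dquot f w l z : cder f w l -> cts f z -> cts (dquot f w l) z.
Proof.
move=> hf fz; have [->|zw] := eqVneq z w.
  case: hf => q [qc ql hq]; apply: cont_near qc.
  apply: filterS hq => x; rewrite /dquot; case: eqVneq => [->|xw ->]; first by rewrite ql.
  by rewrite mulfK// subr_eq0.
apply: (cont_near (dquot_near f l zw)); apply: contM.
  exact: (contB fz (cont_cst _ _)).
apply: contV; last by rewrite subr_eq0.
exact: (contB (cont_id _) (cont_cst _ _)).
Qed.

Lemma dquotE f w l z : z != w -> f z - f w = dquot f w l z * (z - w).
Proof. by move=> zw; rewrite /dquot (negbTE zw) divfK// subr_eq0. Qed.

Lemma circle_neq a w r z : normc (w - a) < r -> normc (z - a) = r -> z != w.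
Proof. by move=> h1 h2; apply/eqP => zw; move: h1; rewrite -zw h2 ltxx. Qed.

(** The conjugate of [(z - a) / (z - w)] on the circle is the restriction of a
function holomorphic across the disk, with value 1 at the centre. *)
Lemma cm_pole a w r : normc (w - a) < r -> cm (fun z => (z - a) / (z - w)) a r = 1.
Proof.
move=> wr; have s0 := normc_ge0 (w - a); have r0 : 0 < r := le_lt_trans s0 wr.
set s := normc (w - a) in wr s0.
have rn0 : r != 0 by rewrite gt_eqF.
have rC0 : ((r ^+ 2)%:C%C : C) != 0 by rewrite -normc_gt0 normc_real normr_gt0 expf_neq0.
pose c : C := (w - a)^*%C / (r ^+ 2)%:C%C.
have nc : normc c = s / r ^+ 2 by rewrite normcf normcJ normc_real ger0_norm ?exprn_ge0// ltW.
pose h z : C := (1 - c * (z - a))^-1.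
pose rho := 2 * r ^+ 2 / (r + s).
have rs : 0 < r + s by lra.
have hn z : normc (z - a) < rho -> 1 - c * (z - a) != 0.
  move=> hz; rewrite subr_eq0; apply/eqP => /(congr1 (fun z => normc z)).
  rewrite normc1 normcM nc => e.
  have : s / r ^+ 2 * normc (z - a) <= s / r ^+ 2 * rho.
    by rewrite ler_wpM2l ?divr_ge0 ?exprn_ge0// ltW.
  rewrite -e /rho; have -> : s / r ^+ 2 * (2 * r ^+ 2 / (r + s)) = 2 * s / (r + s).
    by field; rewrite rn0 gt_eqF.
  by rewrite ler_pdivlMr//; lra.
have hd z : normc (z - a) < rho -> exists l, cder h z l.
  move=> /hn hz; have d1 := cderB (cder_cst 1 z) (cderM (cder_cst c z) (cderB (cder_id z) (cder_cst a z))).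
  by eexists; exact: (cderV d1 hz).
have rrho : r < rho.
  have h1 : r * s < r * r by rewrite ltr_pM2l.
  rewrite /rho ltr_pdivlMr// expr2; lra.
have := @cm_center R h a rho 0 (lexx 0).
move=> /(_ (fun z hz => let: ex_intro l hl := hd z hz in cder_cont hl)) /(_ (fun z hz _ _ => hd z hz)).
move=> /(_ r); rewrite rrho ltW// => /(_ isT); rewrite {2}/h subrr mulr0 subr0 invr1 => hc.
have hcc : ccon 0 1 (fun t => h (circ a r t)).
  apply: ccon_circ => z; rewrite ger0_norm ?(ltW r0)// => hz.
  by have [|l] := hd z; [rewrite hz|exact: cder_cont].
have -> : cm (fun z => (z - a) / (z - w)) a r = (cm h a r)^*%C.
  rewrite -cint_conj//; apply: eq_cint => t _; rewrite /h.
  have hz : normc (circ a r t - a) = r by rewrite normc_circ ger0_norm// ltW.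
  set z := circ a r t in hz *.
  have za : z - a != 0 by rewrite -normc_gt0 hz.
  have zw : z - w != 0 by rewrite subr_eq0; exact: circle_neq wr hz.
  have hJ : (z - a)^*%C = (r ^+ 2)%:C%C / (z - a).
    by rewrite -hz -mulJc mulrC mulKf.
  rewrite cJV cJB cJ1 cJM /c cJM cJV cJK conjc_real hJ.
  have e (q : C) : q != 0 -> 1 - (w - a) / q * (q / (z - a)) = (z - w) / (z - a).
    by move=> q0; field; rewrite za q0.
  by rewrite e// invf_div.
by rewrite hc conjc1.
Qed.

(** The mean value property for the difference quotient of [f] at [w], which is
differentiable except at [w] and at [a]. *)
Lemma cauchy f a rho r w :
  (forall z, normc (z - a) < rho -> cts f z) ->
  (forall z, normc (z - a) < rho -> z != a -> exists l, cder f z l) ->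
  normc (w - a) < r -> r < rho ->
  cm (fun z => (z - a) * f z / (z - w)) a r = f w.
Proof.
move=> fc fd wr rr; have r0 : 0 < r := le_lt_trans (normc_ge0 _) wr.
have r0' := ltW r0.
have [->|wa] := eqVneq w a.
  rewrite -(@cm_center R f a rho 0 (lexx 0) fc _ r); last by rewrite r0'.
    apply: eq_cm => z; rewrite (ger0_norm r0') => hz.
    by rewrite mulrC mulrA mulVf ?mul1r// -normc_gt0 hz.
  by move=> z h1 h2 _; apply: fd => //; rewrite -subr_eq0 -normc_gt0.
have [l hl] := fd w (lt_trans wr rr) wa.
pose g z := (z - a) * dquot f w l z.
have gc z : normc (z - a) < rho -> cts g z.
  move=> hz; apply: contM; first exact: (contB (cont_id _) (cont_cst _ _)).
  by apply: cts_dquot hl _; exact: fc.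
have hg : cm g a r = 0.
  rewrite (@cm_center R g a rho (normc (w - a)) (normc_ge0 _) gc) ?r0'//.
    by rewrite /g subrr mul0r.
  move=> z h1 h2 h3; have za : z != a by rewrite -subr_eq0 -normc_gt0.
  have zw : z != w by apply/eqP => e; move: h3; rewrite e eqxx.
  have [m hm] := fd z h1 za; have [k hk] := cder_dquot l zw hm.
  by eexists; exact: (cderM (cderB (cder_id z) (cder_cst a z)) hk).
pose k z := (z - a) * f z / (z - w); pose p z := (z - a) / (z - w).
have pc z : normc (z - a) = `|r| -> cts p z.
  rewrite (ger0_norm r0') => hz; apply: contM; first exact: (contB (cont_id _) (cont_cst _ _)).
  apply: contV; first exact: (contB (cont_id _) (cont_cst _ _)).
  by rewrite subr_eq0; exact: circle_neq wr hz.
have kc z : normc (z - a) = `|r| -> cts k z.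
  move=> hz; have := contM (pc z hz) (fc z _).
  rewrite hz (ger0_norm r0') => /(_ rr); apply: cont_near; apply: nearCW => x.
  by rewrite /p /k mulrAC.
have e : cm g a r = cm k a r - f w * cm p a r.
  rewrite /cm -cintZ; last exact: ccon_circ.
  rewrite -cintB; [|exact: ccon_circ|by apply: cconZ; exact: ccon_circ].
  apply: eq_cint => t _; have hz : normc (circ a r t - a) = r by rewrite normc_circ ger0_norm.
  have zw := circle_neq wr hz; rewrite /g /k /p /dquot (negbTE zw).
  by field; rewrite subr_eq0.
by move: e; rewrite hg (cm_pole wr) mulr1 => /eqP; rewrite eq_sym subr_eq0 => /eqP.
Qed.

Lemma ccon_bounded (k : R -> C) : ccon 0 1 k -> exists2 M : R, 0 <= M & forall t, 0 <= t <= 1 -> normc (k t) <= M.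
Proof.
move=> hk; have hr := rcon_normc hk.
have hc : {within `[0, 1], continuous (fun t => normc (k t))}.
  by apply: continuous_in_subspaceT => x; rewrite inE /= in_itv /= => /hr[].
have [c _ hM] := EVT_max (ler01 : (0 : R) <= 1) hc.
exists (normc (k c)); first exact: normc_ge0.
by move=> t ht; apply: hM; rewrite in_itv.
Qed.

(** The condition on a family of integrands under which the integral depends
continuously on the parameter. *)
Definition ucts (G : C -> R -> C) w :=
  (exists2 M : R, 0 <= M & forall t, 0 <= t <= 1 -> normc (G w t) <= M) /\
  forall e : R, 0 < e -> \forall x \near w, forall t, 0 <= t <= 1 -> normc (G x t - G w t) <= e.

Lemma ucts_cst (k : R -> C) w : ccon 0 1 k -> ucts (fun _ => k) w.
Proof.
move=> /ccon_bounded hM; split=> // e e0; apply: nearCW => x t _.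
by rewrite subrr normc0 ltW.
Qed.

Lemma ucts_mul (G H : C -> R -> C) w : ucts G w -> ucts H w -> ucts (fun x t => G x t * H x t) w.
Proof.
move=> [[M M0 hM] hG] [[N N0 hN] hH]; split.
  by exists (M * N); [exact: mulr_ge0|move=> t ht; rewrite normcM ler_pM ?normc_ge0 ?hM ?hN].
move=> e e0; pose S := M + N + 1; have S0 : 0 < S by rewrite /S; lra.
have [k [k0 k1 kS]] : exists k : R, [/\ 0 < k, k <= 1 & k * S <= e].
  exists (Num.min (e / S) 1); split.
  - by rewrite lt_min ltr01 divr_gt0.
  - by rewrite ge_min lexx orbT.
  - by rewrite -ler_pdivlMr// ge_min lexx.
apply: (filterS2 _ _ (hG _ k0) (hH _ k0)) => x gx' hx' t ht.
have gx := gx' t ht; have hx := hx' t ht.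
have -> : G x t * H x t - G w t * H w t =
  (G x t - G w t) * (H x t - H w t) + (G x t - G w t) * H w t + G w t * (H x t - H w t) by ring.
apply: le_trans (normcD _ _) _; have := normcD ((G x t - G w t) * (H x t - H w t)) ((G x t - G w t) * H w t).
rewrite !normcM.
have b1 : normc (G x t - G w t) * normc (H x t - H w t) <= k * 1.
  by rewrite ler_pM ?normc_ge0// (le_trans hx).
have b2 : normc (G x t - G w t) * normc (H w t) <= k * N by rewrite ler_pM ?normc_ge0 ?hN.
have b3 : normc (G w t) * normc (H x t - H w t) <= M * k by rewrite ler_pM ?normc_ge0 ?hM.
move: kS; rewrite /S; lra.
Qed.

Lemma ucts_inv a r w : normc (w - a) < r -> ucts (fun x t => (circ a r t - x)^-1) w.
Proof.
move=> wr; have r0 := le_lt_trans (normc_ge0 _) wr.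
pose d := r - normc (w - a); have d0 : 0 < d by rewrite /d subr_gt0.
have hz x t : normc (x - w) < d / 2 -> d / 2 < normc (circ a r t - x).
  move=> hx; have := normc_circ a r t; rewrite (ger0_norm (ltW r0)) => e.
  have := normcB_ge (circ a r t - a) (x - a); rewrite e opprB addrA subrK.
  have := normcD (x - w) (w - a); rewrite addrA subrK.
  move: hx; rewrite /d; lra.
have d2 : 0 < d / 2 by rewrite divr_gt0.
have hw t : d / 2 < normc (circ a r t - w) by apply: hz; rewrite subrr normc0.
split.
  exists (d / 2)^-1; first by rewrite invr_ge0 ltW.
  by move=> t _; rewrite normcV lef_pV2 ?posrE ?ltW// (lt_trans d2).
move=> e e0; apply/nbhsCP; exists (Num.min (d / 2) (e * (d / 2) ^+ 2)).
  by rewrite lt_min d2 mulr_gt0// exprn_gt0.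
move=> x; rewrite lt_min => /andP[h1 h2] t _.
have n1 := hz x t h1; have n2 := hw t.
have z1 : circ a r t - x != 0 by rewrite -normc_gt0 (lt_trans d2).
have z2 : circ a r t - w != 0 by rewrite -normc_gt0 (lt_trans d2).
have -> : (circ a r t - x)^-1 - (circ a r t - w)^-1 = (x - w) / ((circ a r t - x) * (circ a r t - w)).
  by field; rewrite z1 z2.
rewrite normcf normcM ler_pdivrMr ?mulr_gt0 ?normc_gt0//.
apply: le_trans (ltW h2) _; rewrite ler_pM2l// expr2 ler_pM// ltW//.
Qed.

Lemma cts_cint (G : C -> R -> C) w : ucts G w -> (\forall x \near w, ccon 0 1 (G x)) ->
  cts (fun x => cint 0 1 (G x)) w.
Proof.
move=> [_ hG] hc; apply/ccontP => e e0; apply/nbhsCP.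
have e2 : 0 < e / 2 by rewrite divr_gt0.
have hw : ccon 0 1 (G w) := nbhs_singleton hc.
apply: (filterS2 _ _ hc (hG _ e2)) => x hx hxe; rewrite -cintB//.
have : normc (cint 0 1 (fun t => G x t - G w t)) <= e / 2 * (1 - 0).
  by apply: cint_bound => // t ht; exact: (cctsB (hx t ht) (hw t ht)).
rewrite subr0 mulr1 => h; lra.
Qed.

Section Transform.
Variables (k : R -> C) (a : C) (r : R).
Hypothesis hk : ccon 0 1 k.

Let v x t : C := (circ a r t - x)^-1.

Lemma circ_sub_neq0 x t : normc (x - a) < r -> circ a r t - x != 0.
Proof.
move=> xr; have r0 := le_lt_trans (normc_ge0 _) xr.
by rewrite subr_eq0; apply: (circle_neq xr); rewrite normc_circ ger0_norm// ltW.
Qed.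

Let vc x : normc (x - a) < r -> ccon 0 1 (v x).
Proof.
move=> xr t _; have h : cts (fun z => (z - x)^-1) (circ a r t).
  apply: contV; first exact: (contB (cont_id _) (cont_cst _ _)).
  exact: circ_sub_neq0.
exact: (ccts_comp (ccts_circ a r t) h).
Qed.

Let cconM (g h : R -> C) : ccon 0 1 g -> ccon 0 1 h -> ccon 0 1 (fun t => g t * h t).
Proof. by move=> hg hh t ht; exact: (cctsM (hg t ht) (hh t ht)). Qed.

Let near_disk w : normc (w - a) < r -> \forall x \near w, normc (x - a) < r.
Proof.
move=> h; have := @open_disk R a r; rewrite openE => /(_ w h).
exact.
Qed.

(** Differentiation of a Cauchy integral: the kernel satisfies
[v x t - v w t = v x t * v w t * (x - w)], so difference quotients are again
Cauchy integrals and only continuity in the parameter is used. *)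
Lemma cder_transform1 w : normc (w - a) < r ->
  cder (fun x => cint 0 1 (fun t => k t * v x t)) w (cint 0 1 (fun t => k t * v w t * v w t)).
Proof.
move=> wr; exists (fun x => cint 0 1 (fun t => k t * v w t * v x t)); split=> //.
  apply: cts_cint.
    apply: (@ucts_mul (fun _ t => k t * v w t)); last exact: ucts_inv.
    by apply: ucts_cst; apply: cconM => //; exact: vc.
  by apply: filterS (near_disk wr) => x xr; apply: cconM; [apply: cconM => //|]; exact: vc.
apply: filterS (near_disk wr) => x xr; have cx := vc xr; have cw := vc wr.
rewrite -cintB; [|by apply: cconM|by apply: cconM].
rewrite mulrC -cintZ; last by apply: cconM => //; exact: cconM.
apply: eq_cint => t _; rewrite /v; field.
by rewrite !circ_sub_neq0.
Qed.

Lemma cder_transform2 w : normc (w - a) < r ->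
  cder (fun x => cint 0 1 (fun t => k t * v x t * v x t)) w
    (cint 0 1 (fun t => k t * v w t * v w t * v w t) + cint 0 1 (fun t => k t * v w t * v w t * v w t)).
Proof.
move=> wr; have cw := vc wr.
exists (fun x => cint 0 1 (fun t => k t * v w t * v w t * v x t) +
                 cint 0 1 (fun t => k t * v w t * v x t * v x t)); split=> //.
  apply: contD; apply: cts_cint.
  - apply: (@ucts_mul (fun _ t => k t * v w t * v w t)); last exact: ucts_inv.
    by apply: ucts_cst; apply: cconM => //; exact: cconM.
  - by apply: filterS (near_disk wr) => x xr; apply: cconM; [apply: cconM => //; exact: cconM|exact: vc].
  - apply: (@ucts_mul (fun x t => k t * v w t * v x t)); last exact: ucts_inv.
    apply: (@ucts_mul (fun _ t => k t * v w t)); last exact: ucts_inv.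
    by apply: ucts_cst; exact: cconM.
  - apply: filterS (near_disk wr) => x xr; have cx := vc xr.
    by apply: cconM => //; apply: cconM => //; exact: cconM.
apply: filterS (near_disk wr) => x xr; have cx := vc xr.
have c1 : ccon 0 1 (fun t => k t * v w t) by exact: cconM.
have c2 : ccon 0 1 (fun t => k t * v x t) by exact: cconM.
rewrite -cintB; [|exact: cconM|exact: cconM].
rewrite -cintD; [|by apply: cconM => //; exact: cconM|by apply: cconM => //; exact: cconM].
rewrite mulrC -cintZ; last first.
  by move=> t ht; apply: cctsD; apply: (cconM _ cx ht); exact: cconM.
apply: eq_cint => t _; rewrite /v; field.
by rewrite !circ_sub_neq0.
Qed.

End Transform.

End Cauchy.

(** * Local theory of holomorphic functions *)
Section Consequences.
Context {R : realType}.
Notation C := (Cplx R).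
Implicit Types (f g h u : C -> C) (a z w : C) (r rho M : R) (U : set C).

Lemma cint01_bound (f : R -> C) M : ccon 0 1 f -> (forall t, 0 <= t <= 1 -> normc (f t) <= M) ->
  normc (cint 0 1 f) <= M.
Proof. by move=> hf hM; have := cint_bound ler01 hf hM; rewrite subr0 mulr1. Qed.

Lemma disk_near a r w : disk a r w -> \forall x \near w, disk a r x.
Proof. by move=> h; have := @open_disk R a r; rewrite openE => /(_ w h). Qed.

Lemma open_hol_disk U f z : open U -> U z -> hol U f -> exists2 rho : R, 0 < rho & disk z rho `<=` U /\ hol (disk z rho) f.
Proof.
move=> /openCP oU Uz hf; have [d d0 hd] := oU z Uz; exists d => //; split.
  by move=> w; exact: hd.
by apply: hol_sub hf => w; exact: hd.
Qed.

Lemma cauchy_rep f a rho r w :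
  (forall z, disk a rho z -> cts f z) ->
  (forall z, disk a rho z -> z != a -> exists l, cder f z l) ->
  normc (w - a) < r -> r < rho ->
  f w = cint 0 1 (fun t => (circ a r t - a) * f (circ a r t) * (circ a r t - w)^-1).
Proof. by move=> fc fd h1 h2; rewrite -(cauchy fc fd h1 h2). Qed.

Lemma ccon_kernel f a rho r : 0 <= r -> r < rho -> (forall z, disk a rho z -> cts f z) ->
  ccon 0 1 (fun t => (circ a r t - a) * f (circ a r t)).
Proof.
move=> r0 rr fc; apply: (@ccon_circ _ (fun z => (z - a) * f z)) => z; rewrite (ger0_norm r0) => hz.
apply: contM; first exact: (contB (cont_id _) (cont_cst _ _)).
by apply: fc; rewrite /disk /= hz.
Qed.

(** Cauchy's formula tolerates the exceptional point, and the Cauchy integral is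
differentiable there. *)
Lemma removable f a rho : 0 < rho ->
  (forall z, disk a rho z -> cts f z) ->
  (forall z, disk a rho z -> z != a -> exists l, cder f z l) ->
  hol (disk a rho) f.
Proof.
move=> rho0 fc fd z hz; have [->|] := eqVneq z a; last exact: fd.
pose r := rho / 2; have r0 : 0 < r by rewrite divr_gt0.
have rr : r < rho by rewrite /r; lra.
have hk := ccon_kernel (ltW r0) rr fc.
have ha : normc (a - a) < r by rewrite subrr normc0.
eexists; apply: cder_near (cder_transform1 hk ha).
by apply: filterS (disk_near ha) => w hw; rewrite [RHS](cauchy_rep fc fd hw rr).
Qed.

Lemma hol_fc U f : hol U f -> forall z, U z -> cts f z.
Proof. by move=> hf z /hf[l]; exact: cder_cont. Qed.

Lemma hol_fd U f a : hol U f -> forall z, U z -> z != a -> exists l, cder f z l.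
Proof. by move=> hf z /hf. Qed.

Lemma hol_dc_hol U f : open U -> hol U f -> hol U (dc f).
Proof.
move=> oU hf z Uz; have [rho rho0 [_ hr]] := open_hol_disk oU Uz hf.
pose r := rho / 2; have r0 : 0 < r by rewrite divr_gt0.
have rr : r < rho by rewrite /r; lra.
have fc := hol_fc hr; have fd := hol_fd (a := z) hr.
have hk := ccon_kernel (ltW r0) rr fc.
have ha : normc (z - z) < r by rewrite subrr normc0.
eexists; apply: cder_near (cder_transform2 hk ha).
apply: filterS (disk_near ha) => w hw; symmetry; apply: dcE.
apply: cder_near (cder_transform1 hk hw).
by apply: filterS (disk_near hw) => x hx; rewrite [RHS](cauchy_rep fc fd hx rr).
Qed.

Lemma cm_mean f a rho r : hol (disk a rho) f -> 0 <= r < rho -> cm f a r = f a.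
Proof.
move=> hf; apply: (@cm_center _ f a rho 0 (lexx 0)); first exact: hol_fc.
by move=> z hz _ _; exact: hf.
Qed.

Lemma cauchy_bound f a rho r w M : hol (disk a rho) f -> r < rho -> normc (w - a) < r ->
  (forall z, normc (z - a) = r -> normc (f z) <= M) -> normc (f w) <= M * (r / (r - normc (w - a))).
Proof.
move=> hf rr wr hM; have r0 := le_lt_trans (normc_ge0 _) wr.
have fc := hol_fc hf; have fd := hol_fd (a := a) hf.
rewrite (cauchy_rep fc fd wr rr); set K := M * _.
apply: cint01_bound.
  apply: (@ccon_circ _ (fun z => (z - a) * f z / (z - w))) => z; rewrite (ger0_norm (ltW r0)) => hz.
  apply: contM; last first.
    apply: contV; first exact: (contB (cont_id _) (cont_cst _ _)).
    by rewrite subr_eq0; exact: circle_neq wr hz.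
  apply: contM; first exact: (contB (cont_id _) (cont_cst _ _)).
  by apply: fc; rewrite /disk /= hz.
move=> t _; have hz : normc (circ a r t - a) = r by rewrite normc_circ ger0_norm// ltW.
set z := circ a r t in hz *.
have d0 : 0 < r - normc (w - a) by rewrite subr_gt0.
have hd : r - normc (w - a) <= normc (z - w).
  by have := normcB_ge (z - a) (w - a); rewrite hz opprB addrA subrK.
have M0 : 0 <= M := le_trans (normc_ge0 _) (hM z hz).
rewrite !normcM normcV hz -mulrA mulrCA /K ler_pM ?normc_ge0//; last 2 first.
- exact: hM.
- by rewrite ler_pM2l// lef_pV2 ?posrE// (lt_le_trans d0).
by rewrite mulr_ge0 ?invr_ge0 ?normc_ge0 ?ltW.
Qed.

Lemma max_center f a rho r M : hol (disk a rho) f -> 0 < r < rho ->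
  (forall z, normc (z - a) = r -> normc (f z) <= M) -> normc (f a) <= M.
Proof.
move=> hf /andP[r0 rr] hM; have := @cauchy_bound f a rho r a M hf rr.
by rewrite subrr normc0 subr0 divff ?gt_eqF// mulr1 => /(_ r0 hM).
Qed.

(** Uniform bounds give uniform Lipschitz bounds; this replaces equicontinuity in
the compactness argument for bounded families. *)
Lemma hol_lipschitz f a rho M : hol (disk a rho) f -> 0 < rho ->
  (forall z, disk a rho z -> normc (f z) <= M) ->
  forall w w', normc (w - a) < rho / 4 -> normc (w' - a) < rho / 4 ->
    normc (f w - f w') <= M * 8 / rho * normc (w - w').
Proof.
move=> hf rho0 hM w w' hw hw'; pose r := rho / 2.
have r0 : 0 < r by rewrite divr_gt0.
have rr : r < rho by rewrite /r; lra.
have wr : normc (w - a) < r by rewrite /r; lra.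
have wr' : normc (w' - a) < r by rewrite /r; lra.
have fc := hol_fc hf; have fd := hol_fd (a := a) hf.
have hk := ccon_kernel (ltW r0) rr fc.
have hv x : normc (x - a) < r -> ccon 0 1 (fun t => (circ a r t - a) * f (circ a r t) * (circ a r t - x)^-1).
  move=> xr; apply: (@ccon_circ _ (fun z => (z - a) * f z / (z - x))) => z; rewrite (ger0_norm (ltW r0)) => hz.
  apply: contM; last first.
    apply: contV; first exact: (contB (cont_id _) (cont_cst _ _)).
    by rewrite subr_eq0; exact: circle_neq xr hz.
  apply: contM; first exact: (contB (cont_id _) (cont_cst _ _)).
  by apply: fc; rewrite /disk /= hz.
rewrite (cauchy_rep fc fd wr rr) (cauchy_rep fc fd wr' rr) -cintB; [|exact: hv|exact: hv].
set K := M * 8 / rho * _.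
apply: cint01_bound.
  by move=> t ht; exact: (cctsB (hv w wr t ht) (hv w' wr' t ht)).
move=> t _; have hz : normc (circ a r t - a) = r by rewrite normc_circ ger0_norm// ltW.
set z := circ a r t in hz *.
have d1 : rho / 4 <= normc (z - w).
  by have := normcB_ge (z - a) (w - a); rewrite hz opprB addrA subrK /r; lra.
have d2 : rho / 4 <= normc (z - w').
  by have := normcB_ge (z - a) (w' - a); rewrite hz opprB addrA subrK /r; lra.
have r4 : 0 < rho / 4 by rewrite divr_gt0.
have z1 : z - w != 0 by rewrite -normc_gt0 (lt_le_trans r4).
have z2 : z - w' != 0 by rewrite -normc_gt0 (lt_le_trans r4).
have -> : (z - a) * f z * (z - w)^-1 - (z - a) * f z * (z - w')^-1 =
   (z - a) * f z / ((z - w) * (z - w')) * (w - w') by field; rewrite z1 z2.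
have M0 : 0 <= M by apply: le_trans (normc_ge0 _) (hM a _); rewrite /disk /= subrr normc0.
rewrite normcM /K ler_wpM2r ?normc_ge0// normcf !normcM hz.
have fz : normc (f z) <= M by apply: hM; rewrite /disk /= hz.
rewrite ler_pdivrMr ?mulr_gt0 ?(lt_le_trans r4)//.
have h1 : r * normc (f z) <= r * M by rewrite ler_pM2l.
have h2 : rho / 4 * (rho / 4) <= normc (z - w) * normc (z - w') by rewrite ler_pM// ltW.
apply: le_trans h1 _; apply: le_trans (ler_wpM2l _ h2); last first.
  by rewrite divr_ge0 ?mulr_ge0// ltW.
rewrite /r le_eqVlt; apply/orP; left; apply/eqP; field.
by rewrite gt_eqF.
Qed.

(** Dividing out a zero keeps holomorphy, which allows repeated division. *)
Lemma hol_dquot f a rho : hol (disk a rho) f -> 0 < rho -> hol (disk a rho) (dquot f a (dc f a)).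
Proof.
move=> hf rho0; have ha : disk a rho a by rewrite /disk /= subrr normc0.
have hda := hol_dc hf ha.
apply: removable => // z hz; first by apply: cts_dquot hda _; exact: hol_fc hz.
by move=> za; have [m hm] := hf z hz; exact: cder_dquot hm.
Qed.

(** If every repeated quotient vanishes at [a] then [f] is divisible by all powers
of [z - a], and Cauchy's bound forces [f] to vanish on a smaller disk. *)
Lemma isolated_zeros f a rho : hol (disk a rho) f -> 0 < rho ->
  (exists2 d : R, 0 < d & forall z, normc (z - a) < d -> f z = 0) \/
  (exists2 d : R, 0 < d & forall z, normc (z - a) < d -> z != a -> f z != 0).
Proof.
move=> hf rho0; pose u := fix u n := if n is m.+1 then dquot (u m) a (dc (u m) a) else f.
have hu n : hol (disk a rho) (u n) by elim: n => [//|n IH] /=; exact: hol_dquot.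
have fac n : (forall m, (m < n)%N -> u m a = 0) -> forall z, f z = (z - a) ^+ n * u n z.
  elim: n => [|n IH] h z; first by rewrite expr0 mul1r.
  rewrite IH; last by move=> m mn; apply: h; exact: ltnW.
  have [->|za] := eqVneq z a.
    by rewrite h// mulr0 subrr exprS mul0r mul0r.
  have := dquotE (u n) (dc (u n) a) za; rewrite h// subr0 => ->.
  by rewrite exprSr /= -mulrA; congr (_ * _); rewrite mulrC.
have [[n hn]|h] := pselect (exists n, u n a != 0).
  right; have ex : exists n, u n a != 0 by exists n.
  case: (ex_minnP ex) => m hm hmin.
  have ha : disk a rho a by rewrite /disk /= subrr normc0.
  have [d d0 hd] := nbhsCE (cont_neq0 (hol_fc (hu m) ha) hm).
  exists d => // z /hd hz za; rewrite (fac m) ?mulf_neq0 ?expf_neq0 ?subr_eq0//.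
  move=> k km; apply/eqP/negP => /negP /hmin; by rewrite leqNgt km.
left; have h0 n : u n a = 0 by apply/eqP/negP => /negP hn; apply: h; exists n.
have ha : disk a rho a by rewrite /disk /= subrr normc0.
pose r := rho / 2; have r0 : 0 < r by rewrite divr_gt0.
have rr : r < rho by rewrite /r; lra.
have cf : ccon 0 1 (fun t => f (circ a r t)).
  apply: ccon_circ => z; rewrite (ger0_norm (ltW r0)) => hz; apply: hol_fc hf _ _.
  by rewrite /disk /= hz.
have [M M0 hM] : exists2 M : R, 0 <= M & forall z, normc (z - a) = r -> normc (f z) <= M.
  have fcz z : normc (z - a) = r -> cts f z by move=> hz; apply: hol_fc hf _ _; rewrite /disk /= hz.
  have hcc : {within [set z | normc (z - a) = r], continuous (fun z => normc (f z))}.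
    apply: continuous_in_subspaceT => z; rewrite inE /= => /fcz[hz].
    exact: (cvg_comp _ _ hz (@continuous_normc R _)).
  have ne : [set z | normc (z - a) = r] !=set0.
    by exists (circ a r 0); rewrite /= normc_circ ger0_norm// ltW.
  have [c hc hmax] := compact_EVT_max ne (@circle_compact R a r) hcc.
  exists (normc (f c)); first exact: normc_ge0.
  by move=> z hz; apply: hmax; rewrite inE.
exists (r / 2); first by rewrite divr_gt0.
move=> z hz; apply/eqP; rewrite -normc_eq0 eq_le normc_ge0 andbT.
have zr : normc (z - a) < r by lra.
have bnd n : normc (f z) <= M * 2 * (1 / 2) ^+ n.
  have hun x : normc (x - a) = r -> normc (u n x) <= M / r ^+ n.
    move=> hx; rewrite ler_pdivlMr ?exprn_gt0//.
    by have := hM x hx; rewrite (fac n)// normcM normcX hx mulrC.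
  have := cauchy_bound (hu n) rr zr hun => hb.
  have rz0 : 0 < r - normc (z - a) by rewrite subr_gt0.
  have hb2 : normc (u n z) <= M / r ^+ n * 2.
    apply: le_trans hb _; rewrite ler_wpM2l ?divr_ge0 ?exprn_ge0 ?(ltW r0)//.
    by rewrite ler_pdivrMr//; lra.
  rewrite (fac n)// normcM normcX.
  have hp : normc (z - a) ^+ n <= (r / 2) ^+ n by rewrite lerXn2r ?nnegrE ?normc_ge0 ?divr_ge0 ?(ltW r0)// ltW.
  apply: le_trans (ler_pM _ _ hp hb2) _; rewrite ?exprn_ge0 ?normc_ge0//.
  rewrite exprMn le_eqVlt; apply/orP; left; apply/eqP; rewrite !exprVn div1r exprVn.
  by field; rewrite !expf_neq0// ?pnatr_eq0// gt_eqF.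
apply/ler_addgt0Pr => e e0; rewrite add0r.
have hcv : (fun n => M * 2 * (1 / 2) ^+ n) @ \oo --> M * 2 * (0 : R).
  apply: cvgM; first exact: cvg_cst.
  by apply: cvg_expr; rewrite ger0_norm; lra.
move: hcv; rewrite mulr0 => /cvgrPdist_lt/(_ e e0)[N _ hN].
have := hN N (leqnn N) => /=; rewrite sub0r normrN => hlt.
by apply: le_trans (bnd N) _; apply: le_trans (ler_norm _) _; exact: ltW.
Qed.

Lemma circle_min f a r : 0 < r -> (forall z, normc (z - a) = r -> cts f z) ->
  (forall z, normc (z - a) = r -> f z != 0) ->
  exists2 m : R, 0 < m & forall z, normc (z - a) = r -> m <= normc (f z).
Proof.
move=> r0 fcz fz.
have hcc : {within [set z | normc (z - a) = r], continuous (fun z => normc (f z))}.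
  apply: continuous_in_subspaceT => z; rewrite inE /= => /fcz[hz].
  exact: (cvg_comp _ _ hz (@continuous_normc R _)).
have ne : [set z | normc (z - a) = r] !=set0.
  by exists (circ a r 0); rewrite /= normc_circ ger0_norm// ltW.
have [c hc hmin] := compact_EVT_min ne (@circle_compact R a r) hcc.
exists (normc (f c)); first by rewrite normc_gt0; apply: fz; rewrite inE in hc.
by move=> z hz; apply: hmin; rewrite inE.
Qed.

(** A function without zeros which is uniformly close, on a small circle, to a
function with an isolated zero at the centre cannot be small at the centre:
apply the mean value property to its reciprocal. *)
Lemma hurwitz h a rho : hol (disk a rho) h -> 0 < rho ->
  (exists2 d : R, 0 < d & forall z, normc (z - a) < d -> z != a -> h z != 0) ->
  exists r m : R, [/\ 0 < r, r < rho, 0 < m &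
    forall g rho', r < rho' -> hol (disk a rho') g -> (forall z, disk a rho' z -> g z != 0) ->
      (forall z, normc (z - a) = r -> normc (g z - h z) <= m) -> m <= normc (g a)].
Proof.
move=> hh rho0 [d d0 hd]; pose r := Num.min (d / 2) (rho / 2).
have r0 : 0 < r by rewrite lt_min !divr_gt0.
have rd : r < d by apply: le_lt_trans (_ : d / 2 < d); rewrite ?ge_min ?lexx//; lra.
have rr : r < rho by apply: le_lt_trans (_ : rho / 2 < rho); rewrite ?ge_min ?lexx ?orbT//; lra.
have [|||m m0 hm] := @circle_min h a r.
- exact: r0.
- by move=> z hz; apply: hol_fc hh _ _; rewrite /disk /= hz.
- move=> z hz; apply: hd; first by rewrite hz.
  by rewrite -subr_eq0 -normc_gt0 hz.
exists r, (m / 2); split=> //; first by rewrite divr_gt0.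
move=> g rho' rr' hg gz hgh.
have hi : hol (disk a rho') (fun z => (g z)^-1).
  by move=> z hz; have [l hl] := hg z hz; eexists; exact: (cderV hl (gz z hz)).
have m2 : 0 < m / 2 by rewrite divr_gt0.
have := @max_center _ a rho' r (m / 2)^-1 hi; rewrite r0 rr' => /(_ isT).
have hb z : normc (z - a) = r -> normc (g z)^-1 <= (m / 2)^-1.
  move=> hz; have h1 : m / 2 <= normc (g z).
    have := hm z hz; have := hgh z hz; have := normcB_ge (h z) (h z - g z); rewrite subKr normcBC; lra.
  by rewrite normcV lef_pV2 ?posrE// (lt_le_trans m2).
move=> /(_ hb); have ga : g a != 0 by apply: gz; rewrite /disk /= subrr normc0 (lt_trans r0).
by rewrite normcV lef_pV2 ?posrE ?normc_gt0.
Qed.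

(** [hurwitz] for [f - f a]: omitting a value close to [f a] would make
[f - w] a zero-free function close to one with an isolated zero. *)
Lemma open_mapping f a rho : hol (disk a rho) f -> 0 < rho ->
  (exists2 d : R, 0 < d & forall z, normc (z - a) < d -> z != a -> f z != f a) ->
  exists2 m : R, 0 < m & forall w, normc (w - f a) < m -> exists2 z, disk a rho z & f z = w.
Proof.
move=> hf rho0 [d d0 hd].
have ha : disk a rho a by rewrite /disk /= subrr normc0.
have hh : hol (disk a rho) (fun z => f z - f a).
  by move=> z /hf[l hl]; eexists; exact: (cderB hl (cder_cst _ _)).
have [|r [m [r0 rr m0 hm]]] := hurwitz hh rho0.
  by exists d => // z h1 h2; rewrite subr_eq0; exact: hd.
exists m => // w hw; apply: contrapT => hn.
have hg : hol (disk a rho) (fun z => f z - w).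
  by move=> z /hf[l hl]; eexists; exact: (cderB hl (cder_cst _ _)).
have := hm _ rho rr hg; rewrite normcBC leNgt hw => H; suff : false by []; apply: H.
  by move=> z hz; rewrite subr_eq0; apply/eqP => e; apply: hn; exists z.
move=> z _; have -> : f z - w - (f z - f a) = f a - w by ring.
by rewrite normcBC ltW.
Qed.

(** The form in which connectedness enters: a property that is local together with
its negation propagates. *)
Lemma connected_ind U (P : C -> Prop) : connected U -> open U ->
  (forall z, U z -> P z -> \forall w \near z, P w) ->
  (forall z, U z -> ~ P z -> \forall w \near z, ~ P w) ->
  (exists2 z, U z & P z) -> forall z, U z -> P z.
Proof.
move=> cU oU h1 h2 [z0 Uz0 Pz0].
pose B := U `&` [set z | P z].
have oB : open B.
  rewrite openE => z [Uz Pz]; rewrite /interior; apply: filterI; last exact: h1.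
  by move: oU; rewrite openE => /(_ z Uz).
have oB' : open (U `&` [set z | ~ P z]).
  rewrite openE => z [Uz Pz]; rewrite /interior; apply: filterI; last exact: h2.
  by move: oU; rewrite openE => /(_ z Uz).
have e : B = U.
  apply: cU.
  - by exists z0.
  - by exists B => //; rewrite /B setIA setIid.
  - exists (~` (U `&` [set z | ~ P z])); first by rewrite closedC.
    apply/seteqP; split=> z; rewrite /B /setI /setC /=.
      by move=> [Uz Pz]; split=> // -[_].
    by move=> [Uz h]; split=> //; apply: contrapT => hp; apply: h.
by move=> z; rewrite -e => -[].
Qed.

Lemma identity_theorem U f : connected U -> open U -> hol U f ->
  (exists2 z, U z & \forall w \near z, f w = 0) -> forall z, U z -> \forall w \near z, f w = 0.
Proof.
move=> cU oU hf; apply: (connected_ind (P := fun z => \forall w \near z, f w = 0)) => //.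
  by move=> z Uz; exact: near_join.
move=> z Uz hz; have [rho rho0 [_ hr]] := open_hol_disk oU Uz hf.
have [[d d0 hd]|[d d0 hd]] := isolated_zeros hr rho0.
  by exfalso; apply: hz; apply/nbhsCP; exists d.
have H w : normc (w - z) < d -> ~ (\forall x \near w, f x = 0).
  move=> hw hw2; apply: hz; suff <- : w = z by exact: hw2.
  apply/eqP/negP => /negP wz; have := hd w hw wz; rewrite (nbhs_singleton hw2).
  by rewrite eqxx.
by apply/nbhsCP; exact: (ex_intro2 _ _ d d0 H).
Qed.

Lemma hol_isolated U f a : connected U -> open U -> hol U f -> U a ->
  (exists2 z, U z & f z != f a) ->
  exists2 d : R, 0 < d & forall z, normc (z - a) < d -> z != a -> f z != f a.
Proof.
move=> cU oU hf Ua [z0 Uz0 hz0].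
have hh : hol U (fun z => f z - f a).
  by move=> z /hf[l hl]; eexists; exact: (cderB hl (cder_cst _ _)).
have [rho rho0 [_ hr]] := open_hol_disk oU Ua hh.
have [[d d0 hd]|[d d0 hd]] := isolated_zeros hr rho0; last first.
  by exists d => // z h1 h2; rewrite -subr_eq0; exact: hd.
have hn : \forall w \near a, f w - f a = 0 by apply/nbhsCP; exists d.
have := nbhs_singleton (identity_theorem cU oU hh (ex_intro2 _ _ a Ua hn) Uz0).
by move=> /= /eqP; rewrite subr_eq0 (negbTE hz0).
Qed.

End Consequences.

(** * Derivatives along curves and injective holomorphic maps *)
Section Curves.
Context {R : realType}.
Notation C := (Cplx R).
Implicit Types (f g : C -> C) (a z w : C) (r rho M : R) (U : set C) (t s : R).

Definition rder (gam : R -> C) t (v : C) := forall e : R, 0 < e -> exists2 d : R, 0 < d &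
  forall s, `|s - t| < d -> normc (gam s - gam t - (s - t)%:C%C * v) <= e * `|s - t|.

Lemma rder_ccts gam t v : rder gam t v -> ccts gam t.
Proof.
move=> h; apply/cctsP => e e0; have [d d0 hd] := h 1 ltr01.
pose n := normc v + 1 + 1; have n0 : 0 < n by rewrite /n; have := normc_ge0 v; lra.
exists (Num.min d (e / n)); first by rewrite lt_min d0 divr_gt0.
move=> s; rewrite lt_min => /andP[/hd h1]; rewrite ltr_pdivlMr// => h2.
have := normcD (gam s - gam t - (s - t)%:C%C * v) ((s - t)%:C%C * v).
rewrite subrK normcM normc_real => h3; apply: le_lt_trans h3 _.
move: h1 h2; rewrite /n; have := normr_ge0 (s - t); lra.
Qed.

Lemma rder_cder f gam t v l : cder f (gam t) l -> rder gam t v -> rder (fun s => f (gam s)) t (l * v).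
Proof.
move=> /cderP hf hg e e0.
pose n := normc v + 1; have n0 : 0 < n by rewrite /n; have := normc_ge0 v; lra.
have nl : 0 < normc l + 1 by have := normc_ge0 l; lra.
have e1 : 0 < e / 2 / n by rewrite !divr_gt0.
have [d1 d10 h1] := nbhsCE (hf _ e1).
have /cctsP/(_ _ d10)[d2 d20 h2] := rder_ccts hg.
have e3 : 0 < Num.min 1 (e / 2 / (normc l + 1)) by rewrite lt_min ltr01 !divr_gt0.
have [d3 d30 h3] := hg _ e3.
exists (Num.min d2 d3); first by rewrite lt_min d20 d30.
move=> s; rewrite lt_min => /andP[s2 s3].
have := h1 _ (h2 s s2); have := h3 s s3; set D := gam s - gam t => k3 k1.
have k31 : normc (D - (s - t)%:C%C * v) <= `|s - t|.
  by apply: le_trans k3 _; rewrite ler_piMl// ge_min lexx.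
have k32 : normc (D - (s - t)%:C%C * v) <= e / 2 / (normc l + 1) * `|s - t|.
  by apply: le_trans k3 _; rewrite ler_wpM2r// ge_min lexx orbT.
have kD : normc D <= n * `|s - t|.
  have := normcD (D - (s - t)%:C%C * v) ((s - t)%:C%C * v); rewrite subrK normcM normc_real /n; lra.
have -> : f (gam s) - f (gam t) - (s - t)%:C%C * (l * v) =
  (f (gam s) - f (gam t) - l * D) + l * (D - (s - t)%:C%C * v) by ring.
apply: le_trans (normcD _ _) _; rewrite normcM.
have b1 : e / 2 / n * normc D <= e / 2 * `|s - t|.
  apply: le_trans (ler_wpM2l (ltW e1) kD) _; rewrite mulrA divfK//; exact: lt0r_neq0.
have b2 : normc l * normc (D - (s - t)%:C%C * v) <= e / 2 * `|s - t|.
  have := ler_wpM2l (normc_ge0 l) k32; move/le_trans; apply.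
  rewrite mulrA ler_wpM2r// mulrCA ler_piMr ?divr_ge0 ?(ltW e0)// ler_pdivrMr//; lra.
lra.
Qed.

Lemma rder_affine a v t : rder (fun s => a + s%:C%C * v) t v.
Proof.
move=> e e0; exists 1 => // s _.
have -> : a + s%:C%C * v - (a + t%:C%C * v) - (s - t)%:C%C * v = 0 by rewrite rmorphB; ring.
by rewrite normc0 mulr_ge0// ltW.
Qed.

Lemma rder_is_derive gam t v : rder gam t v <->
  is_derive t 1 (fun s => complex.Re (gam s)) (complex.Re v) /\
  is_derive t 1 (fun s => complex.Im (gam s)) (complex.Im v).
Proof.
have eR (x : C) y : complex.Re (x - y) = complex.Re x - complex.Re y by rewrite cReD cReN.
have eI (x : C) y : complex.Im (x - y) = complex.Im x - complex.Im y by rewrite cImD cImN.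
have sR (x : R) (y : C) : complex.Re (x%:C%C * y) = complex.Re y * x by rewrite cReM /= mul0r subr0 mulrC.
have sI (x : R) (y : C) : complex.Im (x%:C%C * y) = complex.Im y * x by rewrite cImM /= mul0r addr0 mulrC.
split=> [h|[h1 h2] e e0].
  split; apply/(is_deriveP (K := R)) => e e0; have [d d0 hd] := h e e0; exists d => //= s;
    rewrite /ball_ /= distrC => /hd; apply: le_trans.
    by rewrite -sR -!eR; exact: Re_le.
  by rewrite -sI -!eI; exact: Im_le.
have e2 : 0 < e / 2 by rewrite divr_gt0.
have [d1 d10 k1] := rderE h1 e2; have [d2 d20 k2] := rderE h2 e2.
exists (Num.min d1 d2); first by rewrite lt_min d10 d20.
move=> s; rewrite lt_min => /andP[s1 s2]; apply: le_trans (normc_le_ReIm _) _.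
by rewrite !eR !eI sR sI; have := k1 s s1; have := k2 s s2; lra.
Qed.

(** The mean value theorem for the component of the curve in the direction of its
chord. *)
Lemma mvt_ineq gam (v : R -> C) M : (forall t, 0 <= t <= 1 -> rder gam t (v t)) ->
  (forall t, 0 <= t <= 1 -> normc (v t) <= M) -> normc (gam 1 - gam 0) <= M.
Proof.
move=> hd hM; set D := gam 1 - gam 0.
have M0 : 0 <= M by apply: le_trans (normc_ge0 _) (hM 0 _); rewrite lexx ler01.
have [->|D0] := eqVneq D 0; first by rewrite normc0.
pose phi t := complex.Re (D^*%C * gam t).
have hphi t : 0 <= t <= 1 -> is_derive t 1 phi (complex.Re (D^*%C * v t)).
  move=> ht; have hc : cder (fun z : C => (D^*%C : C) * z + 0) (gam t) ((D^*%C : C) * 1) := cder_lin _ 0 (cder_id _).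
  have /rder_is_derive[+ _] := rder_cder hc (hd t ht).
  have -> : (fun s => complex.Re (D^*%C * gam s + 0)) = phi by apply/funext => s; rewrite addr0.
  by rewrite mulr1.
have [|||c hc] := @MVT_segment R phi (fun t => complex.Re (D^*%C * v t)) 0 1.
- exact: ler01.
- by move=> x; rewrite in_itv /= => /andP[x0 x1]; apply: hphi; rewrite !ltW.
- apply: derivable_within_continuous => x; rewrite in_itv /= => hx.
  by have [] := hphi x hx.
rewrite subr0 mulr1 /phi -cReN -cReD -mulrN -mulrDr -/D mulrC mulJc /= => e.
rewrite in_itv /= in hc.
have : normc D ^+ 2 <= normc D * M.
  rewrite e; apply: le_trans (ler_norm _) _; apply: le_trans (Re_le _) _.
  by rewrite normcM normcJ ler_wpM2l ?normc_ge0 ?hM.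
by rewrite expr2 ler_pM2l// normc_gt0.
Qed.

Lemma segment_disk a r z w t : disk a r z -> disk a r w -> 0 <= t <= 1 -> disk a r (z + t%:C%C * (w - z)).
Proof.
rewrite /disk /= => hz hw /andP[t0 t1].
have -> : z + t%:C%C * (w - z) - a = (1 - t)%:C%C * (z - a) + t%:C%C * (w - a).
  by rewrite rmorphB rmorph1; ring.
have := normcD ((1 - t)%:C%C * (z - a)) (t%:C%C * (w - a)).
rewrite !normcM !normc_real (ger0_norm t0) ger0_norm ?subr_ge0// => h.
apply: le_lt_trans h _; have [->|tn0] := eqVneq t 0; first by rewrite subr0 mul1r mul0r addr0.
have tp : 0 < t by rewrite lt_neqAle eq_sym tn0.
have k1 : (1 - t) * normc (z - a) <= (1 - t) * r by rewrite ler_wpM2l ?subr_ge0// ltW.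
have k2 : t * normc (w - a) < t * r by rewrite ltr_pM2l.
lra.
Qed.

Lemma deriv_approx f a rho z e m : hol (disk a rho) f -> disk a rho z -> disk a rho (z + e) ->
  (forall t, 0 <= t <= 1 -> normc (dc f (z + t%:C%C * e) - dc f z) <= m) ->
  normc (f (z + e) - f z - dc f z * e) <= m * normc e.
Proof.
move=> hf hz hze hm.
have hin t : 0 <= t <= 1 -> disk a rho (z + t%:C%C * e).
  by move=> ht; have := segment_disk hz hze ht; rewrite [z + e]addrC addrK.
pose gam t : C := f (z + t%:C%C * e) - (dc f z * (z + t%:C%C * e)).
have := @mvt_ineq gam (fun t => (dc f (z + t%:C%C * e) - dc f z) * e) (m * normc e).
rewrite /gam rmorph1 rmorph0 mul1r mul0r addr0 => H.
have -> : f (z + e) - f z - dc f z * e = f (z + e) - dc f z * (z + e) - (f z - dc f z * z) by ring.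
apply: H => t ht; last by rewrite normcM ler_wpM2r ?normc_ge0 ?hm.
have h1 := hol_dc hf (hin t ht).
have h2 : cder (fun w => dc f z * w + 0) (z + t%:C%C * e) (dc f z * 1) := cder_lin _ _ (cder_id _).
have h3 : cder (fun w => f w - dc f z * w) (z + t%:C%C * e) (dc f (z + t%:C%C * e) - dc f z).
  have := cderB h1 h2; rewrite mulr1; apply: cder_ext => w.
  by rewrite addr0.
exact: (rder_cder (gam := fun t => z + t%:C%C * e) h3 (rder_affine z e t)).
Qed.

Lemma const_of_deriv0 f a rho : hol (disk a rho) f -> (forall z, disk a rho z -> dc f z = 0) ->
  forall z, disk a rho z -> f z = f a.
Proof.
move=> hf h0 z hz; have ha : disk a rho a.
  by rewrite /disk /= subrr normc0; exact: le_lt_trans (normc_ge0 _) hz.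
have ez : a + (z - a) = z by rewrite addrC subrK.
have hz' : disk a rho (a + (z - a)) by rewrite ez.
have := deriv_approx (m := 0) hf ha hz'; rewrite ez (h0 a)// !mul0r subr0 => H.
apply/eqP; rewrite -subr_eq0 -normc_eq0 eq_le normc_ge0 andbT; apply: H => t ht.
by rewrite h0 ?sub0r ?normcN ?normc0//; exact: segment_disk.
Qed.

(** The difference quotients of an injective map have no zeros and converge
to the derivative, so Hurwitz's principle keeps the derivative from vanishing. *)
Lemma inj_deriv_neq0 U f a : open U -> hol U f ->
  (forall z w, U z -> U w -> f z = f w -> z = w) -> U a -> dc f a != 0.
Proof.
move=> oU hf inj Ua; have [rho rho0 [sU hr]] := open_hol_disk oU Ua hf.
have hd := hol_dc_hol (@open_disk R a rho) hr.
apply/negP => /eqP da0.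
have aa : disk a rho a by rewrite /disk /= subrr normc0.
have [[d d0 hd0]|hiso] := isolated_zeros hd rho0.
  have [k [k0 kd kr]] : exists k : R, [/\ 0 < k, k <= d & k <= rho].
    by exists (Num.min d rho); rewrite lt_min d0 rho0 !ge_min !lexx orbT.
  have hk : hol (disk a k) f by apply: hol_sub hr => z; rewrite /disk /= => /lt_le_trans; apply.
  have nk : normc (a + (k / 2)%:C%C - a) = k / 2 by rewrite addrC addKr normc_real ger0_norm ?divr_ge0 ?ltW.
  have k2 : disk a k (a + (k / 2)%:C%C) by rewrite /disk /= nk; lra.
  have e := const_of_deriv0 hk (fun z hz => hd0 z (lt_le_trans hz kd)) k2.
  have := inj _ _ (sU _ (lt_le_trans k2 kr)) Ua e => e2.
  by move: nk; rewrite e2 subrr normc0; lra.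
have [r [m [r0 rr m0 hm]]] := hurwitz hd rho0 hiso.
have dcc z : normc (z - a) = r -> cts (dc f) z.
  by move=> hz; apply: hol_fc hd _ _; rewrite /disk /= hz.
have [d1 d10 hd1] := compact_ucts (@circle_compact R a r) dcc m0.
have m2 : 0 < m / 2 by rewrite divr_gt0.
have /cderP/(_ _ m2)/nbhsCE[d2 d20 hd2] := hol_dc hf Ua.
have [e [e0 ed1 ed2 er]] : exists e : R, [/\ 0 < e, e < d1, e < d2 & e < rho - r].
  have := @lt_min _ R; pose e := Num.min d1 (Num.min d2 (rho - r)).
  have e0 : 0 < e by rewrite !lt_min d10 d20 subr_gt0.
  have h1 : e <= d1 by rewrite ge_min lexx.
  have h2 : e <= d2 by rewrite !ge_min lexx orbT.
  have h3 : e <= rho - r by rewrite !ge_min lexx !orbT.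
  by exists (e / 2); split; lra.
have eC0 : (e%:C%C : C) != 0 by rewrite -normc_gt0 normc_real normr_gt0 gt_eqF.
have ne : normc (e%:C%C : C) = e by rewrite normc_real ger0_norm// ltW.
have sh z : disk a (rho - e) z -> disk a rho (z + e%:C%C).
  rewrite /disk /= => hz; have := normcD (z - a) (e%:C%C : C); rewrite ne addrAC; lra.
have sub z : disk a (rho - e) z -> disk a rho z by rewrite /disk /=; lra.
pose g z := (f (z + e%:C%C) - f z) / e%:C%C.
have hg : hol (disk a (rho - e)) g.
  move=> z hz; have [l1 k1] := hr _ (sh z hz); have [l2 k2] := hr _ (sub z hz).
  have k3 : cder (fun w : C => w + e%:C%C) z (1 + 0) := cderD (cder_id z) (cder_cst _ z).
  by eexists; exact: (cder_div (cderB (cder_comp k3 k1) k2) (cder_cst _ z) eC0).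
have gn0 z : disk a (rho - e) z -> g z != 0.
  move=> hz; rewrite mulf_neq0 ?invr_eq0// subr_eq0; apply/negP => /eqP h.
  have := inj _ _ (sU _ (sh z hz)) (sU _ (sub z hz)) h => h2.
  have e3 : (e%:C%C : C) = (z + e%:C%C) - z by rewrite addrC addKr.
  by move/negP: eC0; apply; apply/eqP; apply: (etrans e3); rewrite h2 subrr.
have hcirc z : normc (z - a) = r -> normc (g z - dc f z) <= m.
  move=> hz; have hz' : disk a (rho - e) z by rewrite /disk /= hz; lra.
  have H := deriv_approx (m := m) hr (sub z hz') (sh z hz').
  have -> : g z - dc f z = (f (z + e%:C%C) - f z - dc f z * e%:C%C) / e%:C%C by rewrite /g; field.
  rewrite normcf ne ler_pdivrMr//; move: H; rewrite ne; apply => t /andP[t0 t1].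
  apply/ltW/hd1 => //; rewrite addrC addKr normcM normc_real ne ger0_norm//.
  by apply: le_lt_trans ed1; rewrite ler_piMl// ltW.
have rr' : r < rho - e by lra.
have := hm g _ rr' hg gn0 hcirc.
have he2 : normc (a + e%:C%C - a) < d2 by rewrite addrC addKr ne.
have := hd2 _ he2; rewrite da0 mul0r subr0 addrAC subrr add0r ne => h1 h2.
have : normc (g a) <= m / 2 by rewrite normcf ne ler_pdivrMr.
lra.
Qed.

(** The inverse is continuous by the open mapping theorem, and the derivative of [f]
does not vanish, by [inj_deriv_neq0]. *)
Lemma hol_inverse U f : open U -> hol U f ->
  (forall z w, U z -> U w -> f z = f w -> z = w) ->
  open (f @` U) /\ exists g : C -> C,
    [/\ hol (f @` U) g, (forall z, U z -> g (f z) = z) & (forall w, (f @` U) w -> U (g w) /\ f (g w) = w)].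
Proof.
move=> oU hf inj.
have om a (e : R) : U a -> 0 < e ->
    exists2 m : R, 0 < m & forall w, normc (w - f a) < m -> exists z, [/\ U z, normc (z - a) < e & f z = w].
  move=> Ua e0; have [rho rho0 [sU hr]] := open_hol_disk oU Ua hf.
  pose k := Num.min e rho; have k0 : 0 < k by rewrite lt_min e0 rho0.
  have hk : hol (disk a k) f by apply: hol_sub hr => z; rewrite /disk /= lt_min => /andP[].
  have [|m m0 hm] := open_mapping hk k0.
    exists rho => // z hz za; apply/negP => /eqP h; move/negP: za; apply.
    by rewrite (inj z a)//; exact: sU.
  exists m => // w /hm[z hz <-]; exists z; split=> //.
    by apply: sU; move: hz; rewrite /disk /= lt_min => /andP[].
  by move: hz; rewrite /disk /= lt_min => /andP[].
have oV : open (f @` U).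
  apply/openCP => _ [a Ua <-]; have [m m0 hm] := om a 1 Ua ltr01.
  by exists m => // w /hm[z [Uz _ <-]]; exists z.
split=> //.
pose g w := xget (0 : C) [set z | U z /\ f z = w].
have gP w : (f @` U) w -> U (g w) /\ f (g w) = w.
  by move=> [z Uz fz]; apply: (@xgetPex _ (0 : C) [set z | U z /\ f z = w]); exists z.
have gf z : U z -> g (f z) = z.
  by move=> Uz; have [|h1 h2] := gP (f z); [exists z|exact: inj].
exists g; split=> // w Vw; have [Ug fg] := gP w Vw.
have gc : cts g w.
  apply/ccontP => e e0; have [m m0 hm] := om (g w) e Ug e0.
  by exists m => // x; rewrite -{1}fg => /hm[z [Uz zg <-]]; rewrite gf.
exists (dc f (g w))^-1; apply: (@cder_inv _ f) => //.
- exact: hol_dc hf Ug.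
- exact: inj_deriv_neq0 oU hf inj Ug.
- by move: oV; rewrite openE => /(_ w Vw); apply: filterS => x /gP[].
Qed.

End Curves.

(** * Limits of bounded holomorphic functions along an ultrafilter *)
Section Ultra.
Context {R : realType}.
Notation C := (Cplx R).

(** Limits along a free ultrafilter exist for every bounded sequence, and for all
points of a domain at once. This avoids extracting subsequences. *)
Lemma free_ultrafilter : exists F : set_system nat, UltraFilter F /\ (forall N, F [set n | (N <= n)%N]).
Proof.
have [F [uF hF]] := ultraFilterLemma (eventually_filter : ProperFilter \oo).
by exists F; split=> // N; apply: hF; exists N.
Qed.

Lemma ultra_limit (F : set_system nat) (uF : UltraFilter F) (u : nat -> C) (M : R) :
  (forall n, normc (u n) <= M) -> exists2 l : C, normc l <= M & u @ F --> l.
Proof.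
move=> hM; have FF : ProperFilter F by exact: ultra_proper.
have [l [hl cl]] : [set z : C | normc (z - 0) <= M] `&` cluster (u @ F) !=set0.
  apply: (@disk_compact R 0 M (u @ F)).
  have -> : [set z : C | normc (z - 0) <= M] = [set z : C | normc z <= M].
    by apply/seteqP; split=> z /=; rewrite subr0.
  have h : F [set n | normc (u n) <= M].
    have -> : [set n | normc (u n) <= M] = setT by apply/seteqP; split=> n //= _; exact: hM.
    exact: filterT.
  exact: h.
exists l; first by move: hl; rewrite /= subr0.
move=> A hA; have [//|hc] := in_ultra_setVsetC (u @^-1` A) uF.
have [z [hz1 hz2]] := cl _ A (hc : (u @ F) (~` A)) hA.
by case: hz1.
Qed.

Lemma ultra_le (F : set_system nat) (FF : ProperFilter F) (u : nat -> C) (l : C) (M : R) :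
  u @ F --> l -> F [set n | normc (u n) <= M] -> normc l <= M.
Proof.
move=> /cvgCP h hM; apply/ler_addgt0Pr => e e0.
have [n [/= h1 h2]] := filter_ex (filterI (h e e0) hM).
have := normcD (u n) (l - u n); rewrite addrC subrK normcBC => h3.
by apply: le_trans h3 _; rewrite lerD// ltW.
Qed.

End Ultra.

Section NormalLimit.
Context {R : realType}.
Notation C := (Cplx R).
Variables (F : set_system nat) (uF : UltraFilter F) (U : set C) (fn : nat -> C -> C) (f : C -> C) (M : R).
Hypotheses (oU : open U) (hfn : forall n, hol U (fn n))
  (bfn : forall n z, U z -> normc (fn n z) <= M)
  (lim : forall z, U z -> (fun n => fn n z) @ F --> f z).

Let FF : ProperFilter F := ultra_proper.

Lemma limit_near z : U z -> forall e : R, 0 < e -> F [set n | normc (fn n z - f z) < e].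
Proof. by move=> Uz e e0; have /cvgCP/(_ e e0) := lim Uz. Qed.

Lemma limit_lipschitz a : U a -> exists rho : R, [/\ 0 < rho, disk a rho `<=` U &
  exists2 L : R, 0 <= L & (forall n w w', normc (w - a) < rho -> normc (w' - a) < rho ->
    normc (fn n w - fn n w') <= L * normc (w - w')) /\
    (forall w w', normc (w - a) < rho -> normc (w' - a) < rho ->
    normc (f w - f w') <= L * normc (w - w'))].
Proof.
move=> Ua; have /openCP/(_ a Ua)[d d0 sU] := oU.
have r4 : 0 < d / 4 by rewrite divr_gt0.
have sU' : disk a (d / 4) `<=` U by move=> z hz; apply: sU; rewrite /disk /= in hz; lra.
have M0 : 0 <= M := le_trans (normc_ge0 _) (bfn 0%N Ua).
have L0 : 0 <= M * 8 / d by rewrite divr_ge0 ?mulr_ge0// ltW.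
have HL n w w' : normc (w - a) < d / 4 -> normc (w' - a) < d / 4 ->
    normc (fn n w - fn n w') <= M * 8 / d * normc (w - w').
  move=> hw hw'; apply: (@hol_lipschitz R (fn n) a d M) => //.
    by apply: hol_sub (hfn n) => z; exact: sU.
  by move=> z hz; apply: bfn; exact: sU.
exists (d / 4); split=> //; exists (M * 8 / d) => //; split=> // w w' hw hw'.
apply/ler_addgt0Pr => e e0; have e2 : 0 < e / 2 by rewrite divr_gt0.
have [n [/= h1 h2]] := filter_ex (filterI (limit_near (sU' _ hw) e2) (limit_near (sU' _ hw') e2)).
have -> : f w - f w' = (fn n w - fn n w') + (fn n w' - f w') - (fn n w - f w) by ring.
have := normcB ((fn n w - fn n w') + (fn n w' - f w')) (fn n w - f w).
have := normcD (fn n w - fn n w') (fn n w' - f w').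
by have := HL n w w' hw hw'; lra.
Qed.

(** Pointwise limits of a locally equi-Lipschitz family are locally uniform:
otherwise the bad points would accumulate somewhere along the ultrafilter. *)
Lemma limit_uniform a : U a -> exists rho : R, [/\ 0 < rho, disk a rho `<=` U &
  forall e : R, 0 < e -> F [set n | forall z, normc (z - a) < rho -> normc (fn n z - f z) <= e]].
Proof.
move=> Ua; have [d [d0 sU [L L0 [HLn HL]]]] := limit_lipschitz Ua.
have d2 : d / 2 < d by lra.
exists (d / 2); split; first by rewrite divr_gt0.
  by move=> z hz; apply: sU; rewrite /disk /= in hz *; lra.
move=> e e0; have [//|hc] := in_ultra_setVsetC [set n | forall z, normc (z - a) < d / 2 -> normc (fn n z - f z) <= e] uF.
exfalso.
have /choice[u hu] : forall n, exists z, normc (z - a) < d / 2 /\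
   ((~` [set n | forall z, normc (z - a) < d / 2 -> normc (fn n z - f z) <= e]) n -> e < normc (fn n z - f z)).
  move=> n; have [hn|hn] := pselect ([set n | forall z, normc (z - a) < d / 2 -> normc (fn n z - f z) <= e] n).
    by exists a; rewrite subrr normc0 divr_gt0.
  have [z hz] : exists z, normc (z - a) < d / 2 /\ e < normc (fn n z - f z).
    apply: contrapT => h; apply: hn => z hz /=; rewrite leNgt; apply/negP => h2; apply: h.
    by exists z.
  by exists z; split; case: hz.
have [p hp hup] := @ultra_limit R F uF (fun n => u n - a) (d / 2) (fun n => ltW (hu n).1).
have pd : normc (p + a - a) < d by rewrite addrK; lra.
have e3 : 0 < e / (4 * (L + 1)) by rewrite divr_gt0// mulr_gt0//; lra.
have e4 : 0 < e / 4 by rewrite divr_gt0.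
have /cvgCP/(_ _ e3) h1 := hup.
have h2 := limit_near (sU _ pd) e4.
have [n [/= [k1 k2] k3]] := filter_ex (filterI (filterI h1 h2) hc).
have [un /(_ k3) hun] := hu n.
have und : normc (u n - a) < d by lra.
have du : normc (u n - (p + a)) < e / (4 * (L + 1)) by have -> : u n - (p + a) = u n - a - p by ring.
have Ldu : L * normc (u n - (p + a)) <= e / 4.
  have h5 : L * normc (u n - (p + a)) <= L * (e / (4 * (L + 1))) by rewrite ler_wpM2l// ltW.
  apply: le_trans h5 _; have -> : L * (e / (4 * (L + 1))) = e / 4 * (L / (L + 1)).
    by field; rewrite lt0r_neq0//; lra.
  by rewrite ler_piMr ?(ltW e4)// ler_pdivrMr; lra.
have := HLn n _ _ und pd; have := HL _ _ und pd.
have -> : f (u n) - f (p + a) = - (f (p + a) - f (u n)) by ring.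
rewrite normcN => j1 j2.
have := normcD (fn n (u n) - fn n (p + a)) (fn n (p + a) - f (p + a)).
have := normcD (fn n (u n) - fn n (p + a) + (fn n (p + a) - f (p + a))) (f (p + a) - f (u n)).
have -> : fn n (u n) - fn n (p + a) + (fn n (p + a) - f (p + a)) + (f (p + a) - f (u n)) = fn n (u n) - f (u n) by ring.
lra.
Qed.

(** The limit still satisfies Cauchy's formula, because convergence is uniform on
small circles. *)
Lemma limit_hol : hol U f.
Proof.
move=> a Ua; have [d [d0 sU [L L0 [_ HL]]]] := limit_lipschitz Ua.
have [d' [d'0 sU' hunif]] := limit_uniform Ua.
have fc z : normc (z - a) < d -> cts f z.
  move=> hz; apply/ccontP => e e0; have L1 : 0 < L + 1 by lra.
  exists (Num.min (d - normc (z - a)) (e / (L + 1))); first by rewrite lt_min subr_gt0 hz divr_gt0.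
  move=> w; rewrite lt_min ltr_pdivlMr// => /andP[h1 h2].
  have hw : normc (w - a) < d by have := normcD (w - z) (z - a); rewrite addrA subrK; lra.
  apply: le_lt_trans (HL w z hw hz) _; apply: le_lt_trans h2.
  by rewrite mulrC ler_wpM2l ?normc_ge0//; lra.
pose rho := Num.min d d'.
have rho0 : 0 < rho by rewrite lt_min d0 d'0.
have rd z : normc (z - a) < rho -> normc (z - a) < d by rewrite lt_min => /andP[].
have rd' z : normc (z - a) < rho -> normc (z - a) < d' by rewrite lt_min => /andP[].
pose r := rho / 2; have r0 : 0 < r by rewrite divr_gt0.
have rr : r < rho by rewrite /r; lra.
have hk : ccon 0 1 (fun t => (circ a r t - a) * f (circ a r t)).
  by apply: (ccon_kernel (ltW r0) rr) => z hz; apply: fc; exact: rd.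
have ha : normc (a - a) < r by rewrite subrr normc0.
eexists; apply: cder_near (cder_transform1 hk ha).
apply: filterS (disk_near ha) => w hw; rewrite /disk /= in hw; symmetry.
apply/eqP; rewrite -subr_eq0 -normc_eq0 eq_le normc_ge0 andbT; apply/ler_addgt0Pr => e e0; rewrite add0r.
pose q := r - normc (w - a); have q0 : 0 < q by rewrite subr_gt0.
have rq : 0 < r / q by rewrite divr_gt0.
have k0 : 0 < e / (1 + r / q) by rewrite divr_gt0//; lra.
have [n hn] := filter_ex (hunif _ k0).
have hfr : hol (disk a rho) (fn n) by apply: hol_sub (hfn n) => z hz; apply: sU; exact: rd.
have -> : f w - cint 0 1 (fun t => (circ a r t - a) * f (circ a r t) / (circ a r t - w)) =
   (f w - fn n w) + cint 0 1 (fun t => (circ a r t - a) * (fn n (circ a r t) - f (circ a r t)) / (circ a r t - w)).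
  rewrite {1}(cauchy_rep (hol_fc hfr) (hol_fd (a := a) hfr) hw rr).
  have hv : ccon 0 1 (fun t => (circ a r t - w)^-1).
    apply: (@ccon_circ _ (fun z => (z - w)^-1)) => z; rewrite (ger0_norm (ltW r0)) => hz.
    apply: contV; first exact: (contB (cont_id _) (cont_cst _ _)).
    by rewrite subr_eq0; exact: circle_neq hw hz.
  have hk' : ccon 0 1 (fun t => (circ a r t - a) * fn n (circ a r t)) := ccon_kernel (ltW r0) rr (hol_fc hfr).
  have -> : cint 0 1 (fun t => (circ a r t - a) * (fn n (circ a r t) - f (circ a r t)) / (circ a r t - w)) =
    cint 0 1 (fun t => (circ a r t - a) * fn n (circ a r t) * (circ a r t - w)^-1) -
    cint 0 1 (fun t => (circ a r t - a) * f (circ a r t) * (circ a r t - w)^-1).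
    rewrite -cintB; first by apply: eq_cint => t _; ring.
    - by move=> t ht; exact: (cctsM (hk' t ht) (hv t ht)).
    - by move=> t ht; exact: (cctsM (hk t ht) (hv t ht)).
  rewrite -(cauchy_rep (hol_fc hfr) (hol_fd (a := a) hfr) hw rr); ring.
apply: le_trans (normcD _ _) _.
have wr : normc (w - a) < rho := lt_trans hw rr.
have h1 : normc (f w - fn n w) <= e / (1 + r / q) by rewrite normcBC; apply: hn; exact: rd'.
have h2 : normc (cint 0 1 (fun t => (circ a r t - a) * (fn n (circ a r t) - f (circ a r t)) / (circ a r t - w))) <= e / (1 + r / q) * (r / q).
  apply: cint01_bound.
    have hcc z : normc (z - a) = `|r| -> cts (fun z => (z - a) * (fn n z - f z) / (z - w)) z.
      rewrite (ger0_norm (ltW r0)) => hz.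
      have hzr : normc (z - a) < rho by rewrite hz.
      apply: contM; last first.
        apply: contV; first exact: (contB (cont_id _) (cont_cst _ _)).
        by rewrite subr_eq0; exact: circle_neq hw hz.
      apply: contM; first exact: (contB (cont_id _) (cont_cst _ _)).
      exact: (contB (hol_fc hfr hzr) (fc z (rd z hzr))).
    exact: (ccon_circ hcc).
  move=> t _; have hz : normc (circ a r t - a) = r by rewrite normc_circ ger0_norm// ltW.
  set z := circ a r t in hz *.
  have hq : q <= normc (z - w).
    by have := normcB_ge (z - a) (w - a); rewrite hz opprB addrA subrK /q.
  have hnz : normc (fn n z - f z) <= e / (1 + r / q) by apply: hn; apply: rd'; rewrite hz.
  rewrite !normcM normcV hz mulrAC mulrC ler_pM ?normc_ge0//.
    by rewrite divr_ge0 ?normc_ge0// ltW.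
  by rewrite ler_pM2l// lef_pV2 ?posrE// (lt_le_trans q0).
apply: le_trans (lerD h1 h2) _; rewrite -[X in X + _]mulr1 -mulrDr divfK// lt0r_neq0//; lra.
Qed.

(** If the limit took a value twice, [hurwitz] applied near one of the two points
would contradict injectivity of the approximating functions. *)
Lemma limit_inj : connected U ->
  (forall n z w, U z -> U w -> fn n z = fn n w -> z = w) ->
  (exists z w, [/\ U z, U w & f z != f w]) -> forall z w, U z -> U w -> f z = f w -> z = w.
Proof.
move=> cU inj [z1 [z2 [U1 U2 z12]]] b c Ub Uc fbc.
have [//|bc] := eqVneq b c; exfalso.
have nc : exists2 z, U z & f z != f c.
  have [e|] := eqVneq (f z1) (f c); last by exists z1.
  by exists z2 => //; rewrite -e eq_sym.
have [d d0 hd] := hol_isolated cU oU limit_hol Uc nc.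
have [d' [d'0 sU' hunif]] := limit_uniform Uc.
have bc0 : 0 < normc (b - c) by rewrite normc_gt0 subr_eq0.
pose rho := Num.min d' (normc (b - c)).
have rho0 : 0 < rho by rewrite lt_min d'0.
have hh : hol (disk c rho) (fun z => f z - f b).
  move=> z hz; have [|l hl] := limit_hol (_ : U z).
    by apply: sU'; move: hz; rewrite /disk /= lt_min => /andP[].
  by eexists; exact: (cderB hl (cder_cst _ _)).
have [|r [m [r0 rr m0 hm]]] := hurwitz hh rho0.
  by exists d => // z h1 h2; rewrite subr_eq0 fbc; exact: hd.
have m2 : 0 < m / 2 by rewrite divr_gt0.
have m4 : 0 < m / 4 by rewrite divr_gt0.
have F1 := hunif _ m4.
have [n [/= hn1 hn2]] := filter_ex (filterI F1 (limit_near Ub m4)).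
have sU z : disk c rho z -> U z by move=> hz; apply: sU'; move: hz; rewrite /disk /= lt_min => /andP[].
have hg : hol (disk c rho) (fun z => fn n z - fn n b).
  move=> z hz; have [l hl] := hfn n (sU z hz).
  by eexists; exact: (cderB hl (cder_cst _ _)).
have := hm _ rho rr hg.
have gn0 z : disk c rho z -> fn n z - fn n b != 0.
  move=> hz; rewrite subr_eq0; apply/negP => /eqP /(inj n z b (sU z hz) Ub) e.
  by move: hz; rewrite e /disk /= lt_min ltxx andbF.
move=> /(_ gn0).
have hcirc z : normc (z - c) = r -> normc (fn n z - fn n b - (f z - f b)) <= m.
  move=> hz; have -> : fn n z - fn n b - (f z - f b) = (fn n z - f z) - (fn n b - f b) by ring.
  have h1 := hn1 z; rewrite hz in h1.
  have rd' : r < d' by apply: lt_le_trans rr _; rewrite ge_min lexx.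
  have := h1 rd'; have := normcB (fn n z - f z) (fn n b - f b); lra.
move=> /(_ hcirc).
have h3 := hn1 c; rewrite subrr normc0 in h3; have h3' := h3 d'0.
have -> : fn n c - fn n b = (fn n c - f c) - (fn n b - f b) by rewrite fbc; ring.
have := normcB (fn n c - f c) (fn n b - f b); lra.
Qed.

End NormalLimit.

(** * Moebius maps and the Riemann mapping theorem *)
Section Moebius.
Context {R : realType}.
Notation C := (Cplx R).
Implicit Types (b w z : C).

Definition udisk : set C := [set z | normc z < 1].

Lemma cJN z : (- z)^*%C = - z^*%C :> C.
Proof. by case: z => x y; rewrite /conjc; simpc. Qed.

Definition moeb b w : C := (w - b) / (1 - b^*%C * w).

Lemma moeb_den b w : udisk b -> udisk w -> 1 - (b^*%C : C) * w != 0.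
Proof.
rewrite /udisk /= => hb hw; rewrite subr_eq0; apply/negP => /eqP/(congr1 (fun z => normc z)).
rewrite normc1 normcM normcJ => e.
have : normc b * normc w < 1 * 1 by rewrite ltr_pM ?normc_ge0.
by rewrite -e mulr1 ltxx.
Qed.

Lemma moeb_id b w :
  normc (1 - (b^*%C : C) * w) ^+ 2 - normc (w - b) ^+ 2 = (1 - normc b ^+ 2) * (1 - normc w ^+ 2).
Proof.
rewrite !normc_sq; case: b w => b1 b2 [w1 w2]; simpc => /=; ring.
Qed.

Lemma moeb_norm b w : udisk b -> udisk w ->
  1 - normc (moeb b w) ^+ 2 = (1 - normc b ^+ 2) * (1 - normc w ^+ 2) / normc (1 - (b^*%C : C) * w) ^+ 2.
Proof.
move=> hb hw; rewrite -moeb_id normcf expr_div_n.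
have : normc (1 - (b^*%C : C) * w) != 0 by rewrite normc_eq0 moeb_den.
by move=> h; field.
Qed.

Lemma sq_lt1 z : udisk z -> 0 < 1 - normc z ^+ 2.
Proof. by rewrite /udisk /= subr_gt0 => h; rewrite expr_lt1// normc_ge0. Qed.

Lemma sq_lt1E z : 0 < 1 - normc z ^+ 2 -> udisk z.
Proof. by rewrite subr_gt0 expr_lt1 ?normc_ge0. Qed.

Lemma moeb_disk b w : udisk b -> udisk w -> udisk (moeb b w).
Proof.
move=> hb hw; apply: sq_lt1E; rewrite moeb_norm//.
apply: divr_gt0; first by apply: mulr_gt0; exact: sq_lt1.
by apply: exprn_gt0; rewrite normc_gt0 moeb_den.
Qed.

Lemma moebK b w : udisk b -> udisk w -> moeb (- b) (moeb b w) = w.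
Proof.
move=> hb hw; rewrite /moeb.
rewrite cJN; move: (b^*%C : C) (moeb_den hb hw) (moeb_den hb hb) => c h1 h2.
have -> : 1 - - c * ((w - b) / (1 - c * w)) = (1 - c * b) / (1 - c * w) by field.
have -> : (w - b) / (1 - c * w) - - b = w * (1 - c * b) / (1 - c * w) by field.
by field; rewrite h1 h2.
Qed.

Lemma moeb_inj b z w : udisk b -> udisk z -> udisk w -> moeb b z = moeb b w -> z = w.
Proof. by move=> hb hz hw e; rewrite -(moebK hb hz) e moebK. Qed.

Lemma cder_moeb b w : udisk b -> udisk w ->
  cder (moeb b) w ((1 - b^*%C * b) / (1 - (b^*%C : C) * w) ^+ 2).
Proof.
move=> hb hw; have h0 := moeb_den hb hw.
have d1 := cderB (cder_id w) (cder_cst b w).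
have d2 := cderB (cder_cst 1 w) (cderM (cder_cst (b^*%C : C) w) (cder_id w)).
have := cder_div d1 d2 h0.
have -> : ((1 - 0) * (1 - (b^*%C : C) * w) - (w - b) * (0 - (0 * w + (b^*%C : C) * 1))) = 1 - b^*%C * b by ring.
done.
Qed.

Lemma moeb0 b : moeb b b = 0.
Proof. by rewrite /moeb subrr mul0r. Qed.

Lemma moeb_eq0 b w : udisk b -> udisk w -> moeb b w = 0 -> w = b.
Proof. by move=> hb hw; rewrite -(moeb0 b) => /moeb_inj; apply. Qed.

End Moebius.

Section RiemannMapping.
Context {R : realType}.
Notation C := (Cplx R).
Variable U : set C.

Definition has_square_roots := forall g : C -> C, hol U g -> (forall z, U z -> g z != 0) ->
  exists2 s : C -> C, hol U s & forall z, U z -> s z ^+ 2 = g z.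

Definition inj_on (f : C -> C) := forall z w, U z -> U w -> f z = f w -> z = w.

Hypotheses (oU : open U) (cU : connected U) (sq : has_square_roots).
Variables (z0 z1 : C).
Hypotheses (Uz0 : U z0) (Uz1 : U z1) (z01 : z1 != z0).

Let fam (f : C -> C) := [/\ hol U f, inj_on f, (forall z, U z -> udisk (f z)) & f z0 = 0].

(** A square root [s] of [z - a] never takes both a value and its opposite, so
[- s z0] has a neighbourhood that [s] omits, and [1 / (s + s z0)] is bounded. *)
Lemma fam_nonempty a : ~ U a -> exists f, fam f.
Proof.
move=> Ua; have h1 : hol U (fun z => z - a).
  by move=> z _; eexists; exact: (cderB (cder_id z) (cder_cst a z)).
have h1n z : U z -> z - a != 0 by move=> Uz; rewrite subr_eq0; apply/eqP => e; apply: Ua; rewrite -e.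
have [s hs ss] := sq h1 h1n.
have sn0 z : U z -> s z != 0.
  by move=> Uz; have := h1n z Uz; rewrite -ss// expf_eq0.
have sinj z w : U z -> U w -> s z = s w -> z = w.
  by move=> Uz Uw e; apply: (addIr (- a)); rewrite -ss// -[w - a]ss// e.
have snn z w : U z -> U w -> s z != - s w.
  move=> Uz Uw; apply/eqP => e.
  have zw : z = w by apply: (addIr (- a)); rewrite -ss// -[w - a]ss// e sqrrN.
  move: e; rewrite zw => /eqP; rewrite -addr_eq0 -mulr2n mulrn_eq0 /=.
  by rewrite (negbTE (sn0 w Uw)).
have [oV _] := hol_inverse oU hs sinj.
have [|m m0 hm] := (openCP (s @` U)).1 oV (s z0); first by exists z0.
have big z : U z -> m <= normc (s z + s z0).
  move=> Uz; rewrite leNgt; apply/negP => h.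
  have [|w Uw e] := hm (- s z); first by rewrite -normcN opprB opprK addrC.
  by have := snn w z Uw Uz; rewrite e eqxx.
have nz z : U z -> s z + s z0 != 0 by move=> /big h; rewrite -normc_gt0 (lt_le_trans m0).
pose q z : C := (s z + s z0)^-1.
have qd z : U z -> exists l, cder q z l.
  by move=> Uz; have [l hl] := hs z Uz; eexists; exact: (cderV (cderD hl (cder_cst (s z0) z)) (nz z Uz)).
have qb z : U z -> normc (q z) <= m^-1.
  by move=> Uz; rewrite normcV lef_pV2 ?posrE ?normc_gt0 ?nz ?big.
pose k : C := (m / 3)%:C%C.
have m3 : 0 < m / 3 by rewrite divr_gt0.
have k0 : k != 0 by rewrite -normc_gt0 normc_real normr_gt0 gt_eqF.
exists (fun z => k * q z + (- (k * q z0))); split.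
- by move=> z /qd[l hl]; eexists; exact: cder_lin hl.
- move=> z w Uz Uw /addIr /(mulfI k0) /invr_inj /addIr; exact: sinj.
- move=> z Uz; rewrite /udisk /= -mulrBr normcM normc_real ger0_norm ?(ltW m3)//.
  have := normcB (q z) (q z0); have := qb z Uz; have := qb z0 Uz0 => h2 h3 h4.
  have h5 : normc (q z - q z0) <= m^-1 + m^-1 by lra.
  apply: le_lt_trans (ler_wpM2l (ltW m3) h5) _.
  have -> : m / 3 * (m^-1 + m^-1) = 2 / 3 by field; rewrite gt_eqF.
  lra.
- by rewrite subrr.
Qed.

(** A limit of a maximizing sequence is not constant, since its value at [z1] is
not 0, hence injective by [limit_inj]; it maps into the open disk because its
image is open. *)
Lemma extremal_exists a : ~ U a -> exists2 f, fam f & forall g, fam g -> normc (g z1) <= normc (f z1).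
Proof.
move=> Ua; have [f0 ff0] := fam_nonempty Ua.
pose S := [set x : R | exists2 f, fam f & x = normc (f z1)].
have S0 : S (normc (f0 z1)) by exists f0.
have ubS : ubound S 1.
  by move=> _ [f [_ _ fb _] ->]; have := fb z1 Uz1; rewrite /udisk /= => /ltW.
have hs : has_sup S by split; [exists (normc (f0 z1))|exists 1].
pose sg := sup S.
have sg0 : 0 < sg.
  apply: (@lt_le_trans _ _ (normc (f0 z1))); last by apply: ub_le_sup => //; exists 1.
  rewrite normc_gt0; apply/negP => /eqP e; case: ff0 => _ inj _ fz0.
  by move/negP: z01; apply; apply/eqP; apply: inj => //; rewrite e fz0.
have /choice[fn hfn] : forall n : nat, exists f, fam f /\ sg - n.+1%:R^-1 < normc (f z1).
  move=> n; have n0 : (0 : R) < n.+1%:R^-1 by rewrite invr_gt0.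
  have [x [f hf ->] hx] := sup_adherent n0 hs.
  by exists f.
have [F [uF hF]] := free_ultrafilter.
have FF : ProperFilter F by exact: ultra_proper.
have /choice[f hf] : forall z, exists l : C, U z -> (fun n => fn n z) @ F --> l.
  move=> z; have [Uz|nUz] := pselect (U z); last by exists 0.
  have [|l _ hl] := @ultra_limit R F uF (fun n => fn n z) 1; last by exists l.
  by move=> n; have [[_ _ fb _] _] := hfn n; have := fb z Uz; rewrite /udisk /= => /ltW.
have h1 n : hol U (fn n) by have [[]] := hfn n.
have h2 n z : U z -> normc (fn n z) <= 1.
  by move=> Uz; have [[_ _ fb _] _] := hfn n; have := fb z Uz; rewrite /udisk /= => /ltW.
have h3 z : U z -> (fun n => fn n z) @ F --> f z by exact: hf.
have fhol := limit_hol uF oU h1 h2 h3.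
have fz0 : f z0 = 0.
  apply/eqP; rewrite -normc_eq0 eq_le normc_ge0 andbT; apply/ler_addgt0Pr => e e0; rewrite add0r.
  have [n hn] := filter_ex (limit_near uF h3 Uz0 e0); move: hn => /=.
  by have [[_ _ _ ->] _] := hfn n; rewrite sub0r normcN => /ltW.
have fz1 : sg <= normc (f z1).
  apply/ler_addgt0Pr => e e0; have e2 : 0 < e / 2 by rewrite divr_gt0.
  have [N _ hN] : \forall n \near \oo, n.+1%:R^-1 < e / 2.
    by have := @near_infty_natSinv_lt R (PosNum e2).
  have [n [/= k1 k2]] := filter_ex (filterI (limit_near uF h3 Uz1 e2) (hF N)).
  have [_ k3] := hfn n; have k4 := hN n k2; rewrite /= in k4.
  have := normcB_ge (fn n z1) (f z1) => k5.
  move: (n.+1%:R^-1 : R) k3 k4 => x k3 k4; lra.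
have nc : exists z w, [/\ U z, U w & f z != f w].
  exists z1, z0; split=> //; rewrite fz0 -normc_gt0; exact: lt_le_trans sg0 fz1.
have finj : inj_on f.
  apply: (limit_inj uF oU h1 h2 h3 cU) => // n z w Uz Uw.
  by have [[_ inj _ _] _] := hfn n; exact: inj.
have fle z : U z -> normc (f z) <= 1.
  move=> Uz; apply: (ultra_le FF (h3 z Uz)).
  have -> : [set n | normc (fn n z) <= 1] = setT by apply/seteqP; split=> n //= _; exact: h2.
  exact: filterT.
have [oV _] := hol_inverse oU fhol finj.
have flt z : U z -> udisk (f z).
  move=> Uz; rewrite /udisk /= lt_neqAle fle// andbT; apply/negP => /eqP e.
  have [|m m0 hm] := (openCP (f @` U)).1 oV (f z); first by exists z.
  have m2 : 0 < m / 2 by rewrite divr_gt0.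
  have [|w Uw ew] := hm (f z + (m / 2)%:C%C * f z).
    by rewrite addrC addKr normcM e mulr1 normc_real ger0_norm ?(ltW m2)//; lra.
  have := fle w Uw; rewrite ew -{1}[f z]mul1r -mulrDl normcM e mulr1.
  have -> : (1 + (m / 2)%:C%C : C) = ((1 + m / 2)%:C)%C by rewrite rmorphD rmorph1.
  by rewrite normc_real ger0_norm; lra.
exists f; first by split.
move=> g hg; apply: le_trans fz1; apply: ub_le_sup; first by exists 1.
by exists g.
Qed.

(** Let [f] omit [alpha]. A Moebius map moves [alpha] to 0, the square root of the
result exists, and a second Moebius map restores the normalization. Then [f] is
the new map followed by a two-to-one self-map of the disk that fixes 0, which
strictly decreases modulus. *)
Lemma koebe_step f alpha : fam f -> udisk alpha -> (forall z, U z -> f z != alpha) ->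
  exists2 g, fam g & normc (f z1) < normc (g z1).
Proof.
move=> [hf finj fb fz0] ha hn.
have ma z : U z -> udisk (moeb alpha (f z)) by move=> /fb; exact: moeb_disk.
have h1 : hol U (fun z => moeb alpha (f z)).
  move=> z Uz; have [l hl] := hf z Uz.
  by eexists; exact: (cder_comp hl (cder_moeb ha (fb z Uz))).
have h1n z : U z -> moeb alpha (f z) != 0.
  move=> Uz; apply/negP => /eqP /(moeb_eq0 ha (fb z Uz)) e.
  by have := hn z Uz; rewrite e eqxx.
have [s hs ss] := sq h1 h1n.
have sb z : U z -> udisk (s z).
  move=> Uz; have := ma z Uz; rewrite /udisk /= -ss// normcX => h.
  by rewrite -(@expr_lt1 _ 2)// normc_ge0.
have sinj z w : U z -> U w -> s z = s w -> z = w.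
  move=> Uz Uw e; apply: finj => //; apply: (moeb_inj ha (fb z Uz) (fb w Uw)).
  by rewrite -!ss// e.
pose b := s z0; have hb : udisk b by exact: sb.
pose g z := moeb b (s z).
have gfam : fam g.
  split.
  - move=> z Uz; have [l hl] := hs z Uz.
    by eexists; exact: (cder_comp hl (cder_moeb hb (sb z Uz))).
  - by move=> z w Uz Uw /(moeb_inj hb (sb z Uz) (sb w Uw)); exact: sinj.
  - by move=> z Uz; apply: moeb_disk => //; exact: sb.
  - exact: moeb0.
exists g => //.
have hnb : udisk (- b) by rewrite /udisk /= normcN.
have hb2 : b ^+ 2 = - alpha by rewrite /b ss// /moeb fz0 mulr0 subr0 sub0r divr1.
have fE : f z1 = g z1 * moeb (- b) (s z1).
  have U1 := sb z1 Uz1; have f1 := fb z1 Uz1.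
  have := moebK ha f1; rewrite -ss// => <-.
  have eA : alpha^*%C = - (b^*%C) ^+ 2 :> C.
    by rewrite -[alpha]opprK -hb2 cJN expr2 cJM -expr2.
  have n1 := moeb_den hb U1; have n2 := moeb_den hnb U1.
  rewrite /g /moeb !cJN in n2 *; rewrite eA -hb2.
  move: (b^*%C : C) n1 n2 => c n1 n2.
  have e1 : 1 - - - c ^+ 2 * s z1 ^+ 2 = (1 - c * s z1) * (1 - - c * s z1) by ring.
  by rewrite e1; field; rewrite n1 n2.
have g1 : 0 < normc (g z1).
  rewrite normc_gt0; apply/negP => /eqP e; case: gfam => _ ginj _ gz0.
  by move/negP: z01; apply; apply/eqP; apply: ginj => //; rewrite e gz0.
rewrite fE normcM -[ltRHS]mulr1 ltr_pM2l//.
exact: (moeb_disk hnb (sb z1 Uz1)).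
Qed.

Theorem riemann_mapping a : ~ U a ->
  exists f, [/\ hol U f, inj_on f & f @` U = udisk].
Proof.
move=> Ua; have [f ff hmax] := extremal_exists Ua.
have [hf finj fb fz0] := ff.
exists f; split=> //; apply/seteqP; split=> [_ [z Uz <-]|w hw]; first exact: fb.
apply: contrapT => hn.
have [|g gf] := koebe_step ff hw; last by rewrite ltNge hmax.
by move=> z Uz; apply/negP => /eqP e; apply: hn; exists z.
Qed.

End RiemannMapping.

(** * Sign labellings of a square grid *)
Section Grid.
Local Open Scope nat_scope.
Implicit Types (i j : nat) (Q : nat * nat).

(** The total sign change around the square with lower left corner [Q], for labels
[sx], [sy] of the horizontal and vertical edges. *)
Definition curl (sx sy : nat -> nat -> bool) Q : bool :=
  sx Q.1 Q.2 (+) sy Q.1.+1 Q.2 (+) sx Q.1 Q.2.+1 (+) sy Q.1 Q.2.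

Definition in_box (m : nat) Q := (Q.1 < m) && (Q.2 < m).

Definition on_rim (m : nat) Q := [|| Q.1 == 0, Q.2 == 0, Q.1.+1 == m | Q.2.+1 == m].

Definition adjacent Q Q' :=
  [|| (Q'.1 == Q.1.+1) && (Q'.2 == Q.2), (Q.1 == Q'.1.+1) && (Q'.2 == Q.2),
      (Q'.2 == Q.2.+1) && (Q'.1 == Q.1) | (Q.2 == Q'.2.+1) && (Q'.1 == Q.1)].

Variables (m : nat) (bad : nat * nat -> Prop).

Definition same_good (sx sy sx' sy' : nat -> nat -> bool) :=
  forall Q, in_box m Q -> ~ bad Q ->
    [/\ sx' Q.1 Q.2 = sx Q.1 Q.2, sx' Q.1 Q.2.+1 = sx Q.1 Q.2.+1,
        sy' Q.1 Q.2 = sy Q.1 Q.2 & sy' Q.1.+1 Q.2 = sy Q.1.+1 Q.2].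

(** Curl sitting on a togglable square can be removed, at the cost of labels on
edges that no good square uses. *)
Definition togglable Q := forall sx sy, exists sx' sy', same_good sx sy sx' sy' /\
  forall P, in_box m P -> curl sx' sy' P = curl sx sy P (+) (P == Q).

Let flip (s : nat -> nat -> bool) i j := fun k l => s k l (+) ((k == i) && (l == j)).

Lemma flip_x sx sy i j P : curl (flip sx i j) sy P =
  curl sx sy P (+) ((P == (i, j)) (+) ((P.1 == i) && (P.2.+1 == j))).
Proof.
case: P => k l; rewrite /curl /flip /= xpair_eqE /=.
by case: (sx k l) (sx k l.+1) (sy k l) (sy k.+1 l) (k == i) (l == j) (l.+1 == j) => [] [] [] [] [] [] [].
Qed.

Lemma flip_y sx sy i j P : curl sx (flip sy i j) P =
  curl sx sy P (+) ((P == (i, j)) (+) ((P.1.+1 == i) && (P.2 == j))).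
Proof.
case: P => k l; rewrite /curl /flip /= xpair_eqE /=.
by case: (sx k l) (sx k l.+1) (sy k l) (sy k.+1 l) (k == i) (l == j) (k.+1 == i) => [] [] [] [] [] [] [].
Qed.

Lemma flip_id (s : nat -> nat -> bool) i j k l : (k == i) && (l == j) = false -> flip s i j k l = s k l.
Proof. by rewrite /flip => ->; rewrite addbF. Qed.

Lemma same_good_trans sx sy sx' sy' sx'' sy'' : same_good sx sy sx' sy' ->
  same_good sx' sy' sx'' sy'' -> same_good sx sy sx'' sy''.
Proof.
move=> h1 h2 Q hQ gQ; have [a1 a2 a3 a4] := h1 Q hQ gQ; have [b1 b2 b3 b4] := h2 Q hQ gQ.
by rewrite b1 b2 b3 b4.
Qed.

Lemma flip_x_good sx sy i j : (in_box m (i, j) -> bad (i, j)) ->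
  (forall l, j = l.+1 -> in_box m (i, l) -> bad (i, l)) -> same_good sx sy (flip sx i j) sy.
Proof.
move=> h1 h2 [k l] hQ gQ /=; split=> //; apply: flip_id; apply/negP => /andP[/eqP ki /eqP lj].
  by apply: gQ; rewrite ki lj; apply: h1; rewrite -ki -lj.
by apply: gQ; rewrite ki; apply: h2; rewrite -?ki.
Qed.

Lemma flip_y_good sx sy i j : (in_box m (i, j) -> bad (i, j)) ->
  (forall k, i = k.+1 -> in_box m (k, j) -> bad (k, j)) -> same_good sx sy sx (flip sy i j).
Proof.
move=> h1 h2 [k l] hQ gQ /=; split=> //; apply: flip_id; apply/negP => /andP[/eqP ki /eqP lj].
  by apply: gQ; rewrite ki lj; apply: h1; rewrite -ki -lj.
by apply: gQ; rewrite lj; apply: h2; rewrite -?lj.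
Qed.

(** Flipping an edge on the rim of the box changes the curl of one square only. *)
Lemma togglable_rim Q : in_box m Q -> bad Q -> on_rim m Q -> togglable Q.
Proof.
case: Q => i j hb bQ /or4P[] /= /eqP e sx sy; rewrite ?e in hb bQ *.
- exists sx, (flip sy 0 j); split; first by apply: flip_y_good.
  by move=> P hP; rewrite flip_y addbF.
- exists (flip sx i 0), sy; split; first by apply: flip_x_good.
  by move=> P hP; rewrite flip_x andbF addbF.
- exists sx, (flip sy m j); split.
    apply: flip_y_good; first by rewrite /in_box /= ltnn.
    by move=> k mk _; suff -> : k = i by []; apply: succn_inj; rewrite -mk e.
  move=> [k l] hP; rewrite flip_y /= !xpair_eqE -e eqSS.
  suff -> : (k == i.+1) = false by [].
  by apply/negP => /eqP ki; move: hP; rewrite /in_box /= ki e ltnn.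
- exists (flip sx i m), sy; split.
    apply: flip_x_good; first by rewrite /in_box /= ltnn andbF.
    by move=> k mk _; suff -> : k = j by []; apply: succn_inj; rewrite -mk e.
  move=> [k l] hP; rewrite flip_x /= !xpair_eqE -e eqSS.
  suff -> : (l == j.+1) = false by rewrite andbF.
  by apply/negP => /eqP ki; move: hP; rewrite /in_box /= ki e ltnn andbF.
Qed.

(** Flipping the common edge moves the curl from one bad square to the next. *)
Lemma togglable_adj Q Q' : in_box m Q -> in_box m Q' -> bad Q -> bad Q' -> adjacent Q Q' ->
  togglable Q' -> togglable Q.
Proof.
move=> hQ hQ' bQ bQ' adj tQ' sx sy; have [sx' [sy' [g1 c1]]] := tQ' sx sy.
suff [sx'' [sy'' [g2 c2]]] : exists sx'' sy'', same_good sx' sy' sx'' sy'' /\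
    forall P, curl sx'' sy'' P = curl sx' sy' P (+) ((P == Q) (+) (P == Q')).
  exists sx'', sy''; split; first exact: same_good_trans g1 g2.
  by move=> P hP; rewrite c2 c1//; case: (curl sx sy P) (P == Q) (P == Q') => [] [] [].
case: Q Q' hQ hQ' bQ bQ' adj {tQ' c1} => i j [i' j'] hQ hQ' bQ bQ'.
move=> /or4P[] /= /andP[/eqP e1 /eqP e2]; rewrite ?e1 ?e2 in hQ hQ' bQ bQ' *.
- exists sx', (flip sy' i.+1 j); split.
    by apply: flip_y_good => // k [<-].
  move=> [k l]; rewrite flip_y /= !xpair_eqE eqSS.
  by congr (_ (+) _); rewrite addbC.
- exists sx', (flip sy' i'.+1 j); split.
    by apply: flip_y_good => // k [<-].
  by move=> [k l]; rewrite flip_y /= !xpair_eqE eqSS.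
- exists (flip sx' i j.+1), sy'; split.
    by apply: flip_x_good => // k [<-].
  move=> [k l]; rewrite flip_x /= !xpair_eqE eqSS.
  by congr (_ (+) _); rewrite addbC.
- exists (flip sx' i j'.+1), sy'; split.
    by apply: flip_x_good => // k [<-].
  by move=> [k l]; rewrite flip_x /= !xpair_eqE eqSS.
Qed.

(** Integration along the first row and then along columns. *)
Lemma potential_of_curl0 sx sy : (forall Q, in_box m Q -> curl sx sy Q = false) ->
  exists tau : nat -> nat -> bool,
    (forall i j, i < m -> j <= m -> tau i.+1 j = tau i j (+) sx i j) /\
    (forall i j, tau i j.+1 = tau i j (+) sy i j).
Proof.
move=> h; pose row := fix row i := if i is k.+1 then row k (+) sx k 0 else false.
pose tau := fix tau i j := if j is l.+1 then tau i l (+) sy i l else row i.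
exists tau; split=> // i j im; elim: j => [//|j IH] jm /=.
rewrite IH; last exact: ltnW.
have : curl sx sy (i, j) = false by apply: h; rewrite /in_box im jm.
rewrite /curl /=.
by case: (tau i j) (sx i j) (sy i.+1 j) (sx i j.+1) (sy i j) => [] [] [] [] [].
Qed.

(** Bad squares that are not togglable would form a set closed under adjacency and
away from the rim; there are none if the bad squares do not enclose anything.
So all curl can be removed, and the labels integrate to a potential. *)
Lemma grid_potential sx sy : (forall Q, in_box m Q -> ~ bad Q -> curl sx sy Q = false) ->
  (forall T : nat * nat -> Prop,
     (forall Q, T Q -> in_box m Q /\ bad Q) -> (forall Q, T Q -> ~~ on_rim m Q) ->
     (forall Q Q', T Q -> in_box m Q' -> bad Q' -> adjacent Q Q' -> T Q') ->
     forall Q, ~ T Q) ->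
  exists tau : nat -> nat -> bool, forall Q, in_box m Q -> ~ bad Q ->
    [/\ tau Q.1.+1 Q.2 = tau Q.1 Q.2 (+) sx Q.1 Q.2,
        tau Q.1.+1 Q.2.+1 = tau Q.1 Q.2.+1 (+) sx Q.1 Q.2.+1,
        tau Q.1 Q.2.+1 = tau Q.1 Q.2 (+) sy Q.1 Q.2 &
        tau Q.1.+1 Q.2.+1 = tau Q.1.+1 Q.2 (+) sy Q.1.+1 Q.2].
Proof.
move=> hgood hT.
have tog Q : in_box m Q -> bad Q -> togglable Q.
  move=> hQ bQ; apply: contrapT => ntQ.
  apply: (hT (fun P => [/\ in_box m P, bad P & ~ togglable P]) _ _ _ Q) => //.
  - by move=> P [].
  - by move=> P [h1 h2 h3]; apply/negP => h; apply: h3; exact: togglable_rim.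
  - move=> P P' [h1 h2 h3] h4 h5 adj; split=> // h6; apply: h3.
    exact: togglable_adj adj h6.
have fix_list (l : seq (nat * nat)) : exists sx' sy', same_good sx sy sx' sy' /\
    forall Q, Q \in l -> in_box m Q -> curl sx' sy' Q = false.
  elim: l => [|Q l [sx' [sy' [g1 c1]]]]; first by exists sx, sy; split=> // Q hQ gQ; split.
  have [hQ|hQ] := boolP (in_box m Q); last first.
    exists sx', sy'; split=> // P; rewrite inE => /orP[/eqP ->|]; last exact: c1.
    by rewrite (negbTE hQ).
  have [cQ|cQ] := boolP (curl sx' sy' Q); last first.
    exists sx', sy'; split=> // P; rewrite inE => /orP[/eqP -> _|]; last exact: c1.
    by apply/negbTE.
  have bQ : bad Q.
    apply: contrapT => nbQ; have [a1 a2 a3 a4] := g1 Q hQ nbQ.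
    by move: cQ; rewrite /curl a1 a2 a3 a4; have := hgood Q hQ nbQ; rewrite /curl => ->.
  have [sx'' [sy'' [g2 c2]]] := tog Q hQ bQ sx' sy'.
  exists sx'', sy''; split; first exact: same_good_trans g1 g2.
  move=> P; have [-> _|PQ] := eqVneq P Q.
    by move=> _; rewrite c2// eqxx cQ.
  rewrite inE (negbTE PQ) /= => Pl hP.
  by rewrite c2// (negbTE PQ) addbF; exact: c1.
have [sx' [sy' [g c]]] := fix_list [seq (i, j) | i <- iota 0 m, j <- iota 0 m].
have c0 Q : in_box m Q -> curl sx' sy' Q = false.
  case: Q => i j hQ; apply: (c (i, j)) => //.
  by apply: allpairs_f; rewrite mem_iota add0n; case/andP: hQ.
have [tau [tx ty]] := potential_of_curl0 c0.
exists tau => -[i j] hQ gQ; have [a1 a2 a3 a4] := g _ hQ gQ; case/andP: hQ => /= im jm.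
by rewrite /= in a1 a2 a3 a4; rewrite -a1 -a2 -a3 -a4; split=> //; apply: tx => //; exact: ltnW.
Qed.

End Grid.

(** * Square roots on a grid *)
Section PrincipalRoot.
Context {R : realType}.
Notation C := (Cplx R).
Implicit Types (z w x y : C).

(** The principal root; its cut along the negative half-axis is the complement of
[slit]. *)
Definition ps z : C := if 0 < complex.Re (sqrtc z) then sqrtc z else - sqrtc z.

Definition slit : set C := [set z | complex.Im z != 0 \/ 0 < complex.Re z].

Lemma psK z : ps z ^+ 2 = z.
Proof. by rewrite /ps; case: ifP => _; rewrite ?sqrrN; exact: sqr_sqrtc. Qed.

Lemma ps_Re_ge0 z : 0 <= complex.Re (ps z).
Proof. by rewrite /ps; case: ltP => [/ltW//|h]; rewrite cReN oppr_ge0. Qed.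

Lemma ps_Re_gt0 z : slit z -> 0 < complex.Re (ps z).
Proof.
move=> hz; rewrite lt_neqAle ps_Re_ge0 andbT eq_sym; apply/negP => /eqP e.
have := psK z; case: (ps z) e => a b /= -> h; move: hz; rewrite -h expr2 /slit /=.
rewrite !mul0r mulr0 addr0 sub0r eqxx => -[//|].
by rewrite oppr_gt0 ltNge -expr2 sqr_ge0.
Qed.

Lemma sq_inj_Re x y : 0 < complex.Re x -> 0 <= complex.Re y -> x ^+ 2 = y ^+ 2 -> x = y.
Proof.
move=> hx hy /eqP; rewrite eqf_sqr => /orP[/eqP //|/eqP e].
by move: hx; rewrite e cReN oppr_gt0 ltNge hy.
Qed.

Lemma ps_uniq x : 0 < complex.Re x -> ps (x ^+ 2) = x.
Proof.
by move=> hx; apply/esym/sq_inj_Re => //; [exact: ps_Re_ge0|rewrite psK].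
Qed.

Lemma cts_ps z : slit z -> cts ps z.
Proof.
move=> hz; have p0 := ps_Re_gt0 hz; apply/ccontP => e e0; apply/nbhsCP.
have d0 : 0 < e * complex.Re (ps z) by rewrite mulr_gt0.
apply: filterS (nbhsC_disk z d0) => w hw.
have h1 : complex.Re (ps z) <= normc (ps w + ps z).
  apply: le_trans (Re_le _); rewrite cReD ger0_norm ?addr_ge0 ?ps_Re_ge0//.
  by rewrite lerDr ps_Re_ge0.
have h2 : normc (ps w - ps z) * normc (ps w + ps z) = normc (w - z).
  by rewrite -normcM -subr_sqr !psK.
have h3 : normc (ps w - ps z) * complex.Re (ps z) <= normc (w - z).
  by rewrite -h2 ler_wpM2l ?normc_ge0.
by rewrite -(ltr_pM2r p0); exact: le_lt_trans h3 hw.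
Qed.

Lemma ps_neq0 z : slit z -> ps z != 0.
Proof. by move=> /ps_Re_gt0 h; apply/eqP => e; move: h; rewrite e ltxx. Qed.

Lemma cder_ps z : slit z -> cder ps z (1 / (ps z *+ 2)).
Proof.
move=> hz; apply: (@cder_sqrt _ ps (fun w => w)); [exact: cts_ps| |exact: ps_neq0|exact: cder_id].
by apply: nearCW => w; exact: psK.
Qed.

Lemma ps_mul x y : 0 < complex.Re x -> 0 < complex.Re y -> ps (x * y) = ps x * ps y.
Proof.
move=> hx hy.
have cone z : 0 < complex.Re z -> `|complex.Im (ps z)| < complex.Re (ps z).
  move=> hz; have p0 : 0 < complex.Re (ps z) by apply: ps_Re_gt0; right.
  have := psK z; case: (ps z) p0 => a b /= a0 e; move: hz; rewrite -e expr2 /= => h.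
  have hb : `|b| * `|b| = b * b by rewrite -normrM ger0_norm// -expr2 sqr_ge0.
  rewrite ltNge; apply/negP => hab; have := ler_pM (ltW a0) (ltW a0) hab hab.
  by rewrite hb; lra.
have := cone x hx; have := cone y hy => h1 h2.
rewrite -[LHS](_ : ps ((ps x * ps y) ^+ 2) = _); last by rewrite exprMn !psK.
apply: ps_uniq; rewrite cReM subr_gt0.
apply: le_lt_trans (ler_norm _) _; rewrite normrM.
by apply: ltr_pM.
Qed.

End PrincipalRoot.

Section DiskConnected.
Context {R : realType}.
Notation C := (Cplx R).

(** Every point is joined to the centre by a segment. *)
Lemma disk_connected (a : C) (r : R) : connected (disk a r).
Proof.
have [r0|r0] := ltP 0 r; last first.
  have -> : disk a r = set0.
    apply/seteqP; split=> // z /=; rewrite /disk /= => h.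
    by have := normc_ge0 (z - a); lra.
  exact: connected0.
pose seg (w : C) := (fun t : R => a + t%:C%C * (w - a)) @` `[0, 1].
have -> : disk a r = \bigcup_(w in disk a r) seg w.
  apply/seteqP; split=> [w hw|z [w hw [t ht <-]]].
    by exists w => //; exists 1; [rewrite /= in_itv /= lexx ler01|rewrite rmorph1 mul1r addrC subrK].
  have ha : disk a r a by rewrite /disk /= subrr normc0.
  by apply: segment_disk => //; move: ht; rewrite /= in_itv.
apply: bigcup_connected.
  exists a => w hw; exists 0; first by rewrite /= in_itv /= lexx ler01.
  by rewrite rmorph0 mul0r addr0.
move=> w hw; apply: connected_continuous_connected; first exact: segment_connected.
apply: continuous_subspaceT => t.
by have [h] := rder_ccts (rder_affine a (w - a) t).
Qed.

End DiskConnected.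

Section GridRoots.
Context {R : realType}.
Notation C := (Cplx R).

(** For closed [A] this is connectedness of [A] with the point at infinity added,
expressed in the plane: a bounded relatively clopen part of [A] is empty. *)
Definition noisle (A : set C) := forall B B' : set C, closed B -> closed B' ->
  (exists M : R, forall z, B z -> normc z <= M) -> A `<=` B `|` B' ->
  (forall z, A z -> B z -> ~ B' z) -> forall z, A z -> ~ B z.

Variables (A : set C) (g : C -> C).
Hypotheses (nA : noisle A) (gc : forall z, ~ A z -> cts g z)
  (g0 : forall z, ~ A z -> g z != 0).
Variables (M : nat) (eta : R).
Hypotheses (eta0 : 0 < eta).

Let Aeta (z : C) := exists2 x : C, A x & normc (z - x) < eta.
Let G : set C := [set z | [/\ `|complex.Re z| <= M%:R, `|complex.Im z| <= M%:R & ~ Aeta z]].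

Lemma closed_comp_le (h : C -> R) (c : R) : continuous h -> closed [set z | h z <= c].
Proof. by move=> hc; apply: (@closed_comp _ _ h [set x | x <= c]) => //; exact: closed_le. Qed.

Lemma closed_comp_ge (h : C -> R) (c : R) : continuous h -> closed [set z | c <= h z].
Proof. by move=> hc; apply: (@closed_comp _ _ h [set x | c <= x]) => //; exact: closed_ge. Qed.

Let G_compact : compact G.
Proof.
apply: (subclosed_compact _ (@disk_compact R 0 (M%:R + M%:R))); last first.
  move=> z [h1 h2 _] /=; rewrite subr0; apply: le_trans (normc_le_ReIm _) _; exact: lerD.
have -> : G = [set z | normc (complex.Re z)%:C%C <= M%:R] `&` ([set z | normc (complex.Im z)%:C%C <= M%:R] `&`
     ~` [set z | Aeta z]).
  apply/seteqP; split=> z; rewrite /G /setI /=; first by rewrite !normc_real => -[].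
  by rewrite !normc_real => -[h1 [h2 h3]].
apply: closedI; [|apply: closedI].
- apply: closed_comp_le => z; apply: (@continuous_comp _ _ _ (fun z : C => complex.Re z) (fun x : R => normc (x%:C)%C)); first exact: continuous_Re.
  have -> : (fun x : R => normc (x%:C)%C) = (fun x : R => `|x|) by apply/funext => x; rewrite normc_real.
  exact: norm_continuous.
- apply: closed_comp_le => z; apply: (@continuous_comp _ _ _ (fun z : C => complex.Im z) (fun x : R => normc (x%:C)%C)); first exact: continuous_Im.
  have -> : (fun x : R => normc (x%:C)%C) = (fun x : R => `|x|) by apply/funext => x; rewrite normc_real.
  exact: norm_continuous.
- rewrite closedC; apply/openCP => z [x Ax hx]; exists (eta - normc (z - x)); first by rewrite subr_gt0.
  move=> w hw; exists x => //; have := normcD (w - z) (z - x); rewrite addrA subrK; lra.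
Qed.

Let G_A z : G z -> ~ A z.
Proof. by move=> [_ _ h] Az; apply: h; exists z; rewrite ?subrr ?normc0. Qed.

Lemma ratio_near : exists2 d : R, 0 < d & forall z w, G z -> normc (w - z) < d -> 0 < complex.Re (g w / g z).
Proof.
have [G0|/set0P G0] := eqVneq G set0.
  by exists 1 => // z w; rewrite G0.
have hcc : {within G, continuous (fun z => normc (g z))}.
  apply: continuous_in_subspaceT => z; rewrite inE => /G_A /gc[hz].
  exact: (cvg_comp _ _ hz (@continuous_normc R _)).
have [c hc hmin] := compact_EVT_min G0 G_compact hcc.
have m0 : 0 < normc (g c) by rewrite normc_gt0; apply: g0; apply: G_A; rewrite inE in hc.
have [d d0 hd] := compact_ucts G_compact (fun z hz => gc (G_A hz)) m0.
exists d => // z w Gz zw; have gz : g z != 0 := g0 (G_A Gz).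
have hlt : normc (g w / g z - 1) < 1.
  have -> : g w / g z - 1 = (g w - g z) / g z by field.
  rewrite normcf ltr_pdivrMr ?normc_gt0// mul1r.
  by apply: lt_le_trans (hd z w Gz zw) _; apply: hmin; rewrite inE.
have := Re_le (g w / g z - 1); rewrite cReD cReN /= => h.
have := le_lt_trans h hlt; rewrite ltr_norml; lra.
Qed.

Section Mesh.
Variables (d : R) (n : nat).
Hypotheses (hd : forall z w, G z -> normc (w - z) < d -> 0 < complex.Re (g w / g z))
  (n0 : (0 < n)%N) (nd : 2 / n%:R < d) (ne : 2 / n%:R < eta).

Let X (i : nat) : R := i%:R / n%:R - M%:R.
Let v (i j : nat) : C := (X i +i* X j)%C.
Let Sq (Q : nat * nat) (z : C) :=
  X Q.1 <= complex.Re z <= X Q.1.+1 /\ X Q.2 <= complex.Im z <= X Q.2.+1.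
Let bad (Q : nat * nat) := exists2 z, Sq Q z & Aeta z.
Let m := (2 * M * n)%N.

Let nR : 0 < n%:R :> R. Proof. by rewrite ltr0n. Qed.
Let nR0 : n%:R != 0 :> R. Proof. by rewrite gt_eqF. Qed.

Let XS i : X i.+1 = X i + 1 / n%:R.
Proof. by rewrite /X -natr1; field. Qed.

Let X_le i j : (i <= j)%N -> X i <= X j.
Proof. by move=> ij; rewrite lerD2r ler_pM2r ?invr_gt0// ler_nat. Qed.

Let X0 : X 0 = - M%:R. Proof. by rewrite /X mul0r sub0r. Qed.
Let Xm : X m = M%:R.
Proof. by rewrite /X /m !natrM; field. Qed.

Let Sq_dist Q z w : Sq Q z -> Sq Q w -> normc (z - w) <= 2 / n%:R.
Proof.
move=> [/andP[a1 a2] /andP[a3 a4]] [/andP[b1 b2] /andP[b3 b4]].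
apply: le_trans (normc_le_ReIm _) _; rewrite cReD cReN cImD cImN.
rewrite !XS in a2 a4 b2 b4.
have -> : 2 / n%:R = 1 / n%:R + 1 / n%:R :> R by field.
move: (1 / n%:R : R) (complex.Re z) (complex.Re w) (complex.Im z) (complex.Im w) a1 a2 a3 a4 b1 b2 b3 b4.
move=> h a b c e a1 a2 a3 a4 b1 b2 b3 b4.
by apply: lerD; rewrite ler_norml; apply/andP; split; lra.
Qed.

Let Sq_box Q z : in_box m Q -> Sq Q z -> `|complex.Re z| <= M%:R /\ `|complex.Im z| <= M%:R.
Proof.
move=> /andP[q1 q2] [/andP[a1 a2] /andP[a3 a4]].
have := X_le q1; have := X_le q2; have := X_le (leq0n Q.1); have := X_le (leq0n Q.2).
by rewrite X0 Xm => h1 h2 h3 h4; split; rewrite ler_norml; apply/andP; split; lra.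
Qed.

Let good_G Q z : in_box m Q -> ~ bad Q -> Sq Q z -> G z.
Proof.
move=> hQ gQ hz; have [h1 h2] := Sq_box hQ hz; split=> // h3.
by apply: gQ; exists z.
Qed.

Let vert Q (k l : bool) : Sq Q (v (Q.1 + k) (Q.2 + l)).
Proof.
have h i (b : bool) : X i <= X (i + b) <= X i.+1.
  by rewrite !X_le// ?leq_addr//; case: b; rewrite ?addn0 ?addn1.
by split; exact: h.
Qed.

Let rt i j := ps (g (v i j)).
Let lab i j i' j' : bool := rt i' j' != rt i j * ps (g (v i' j') / g (v i j)).
Let sx i j := lab i j i.+1 j.
Let sy i j := lab i j i j.+1.

Let labE i j i' j' : g (v i j) != 0 ->
  rt i' j' = (-1) ^+ lab i j i' j' * (rt i j * ps (g (v i' j') / g (v i j))).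
Proof.
move=> h0; rewrite /lab; case: eqVneq => [{1}->|h]; first by rewrite expr0 mul1r.
apply/eqP; rewrite expr1 mulN1r; move/negbTE: h => h.
have : rt i' j' ^+ 2 == (rt i j * ps (g (v i' j') / g (v i j))) ^+ 2.
  by rewrite exprMn !psK mulrC divfK.
by rewrite eqf_sqr h.
Qed.

Let rt_neq0 i j : g (v i j) != 0 -> rt i j != 0.
Proof. by move=> h; apply/eqP => e; move: h; rewrite -[g _]psK -/(rt i j) e expr0n eqxx. Qed.

Let good_ratio Q z w : in_box m Q -> ~ bad Q -> Sq Q z -> Sq Q w -> 0 < complex.Re (g w / g z).
Proof.
move=> hQ gQ hz hw; apply: hd; first exact: good_G hQ gQ hz.
by apply: le_lt_trans nd; exact: Sq_dist hw hz.
Qed.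

Let good_g0 Q z : in_box m Q -> ~ bad Q -> Sq Q z -> g z != 0.
Proof. by move=> hQ gQ hz; apply: g0; apply: G_A; exact: good_G hQ gQ hz. Qed.

Let chain Q x y z : in_box m Q -> ~ bad Q -> Sq Q x -> Sq Q y -> Sq Q z ->
  ps (g y / g x) * ps (g z / g y) = ps (g z / g x).
Proof.
move=> hQ gQ hx hy hz; rewrite -ps_mul; [|exact: good_ratio hx hy|exact: good_ratio hy hz].
congr ps; have := good_g0 hQ gQ hx; have := good_g0 hQ gQ hy => h1 h2.
by field; rewrite h1 h2.
Qed.

Let curl_good Q : in_box m Q -> ~ bad Q -> curl sx sy Q = false.
Proof.
move=> hQ gQ; rewrite /curl /sx /sy.
have ha := vert Q false false; have hb := vert Q true false; have hc := vert Q true true.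
have hdd := vert Q false true.
rewrite !addn0 !addn1 in ha hb hc hdd.
have e1 := labE Q.1.+1 Q.2 (good_g0 hQ gQ ha).
have e2 := labE Q.1.+1 Q.2.+1 (good_g0 hQ gQ hb).
have e3 := labE Q.1 Q.2.+1 (good_g0 hQ gQ ha).
have e4 := labE Q.1.+1 Q.2.+1 (good_g0 hQ gQ hdd).
have c1 := chain hQ gQ ha hb hc; have c2 := chain hQ gQ ha hdd hc.
have rc := rt_neq0 (good_g0 hQ gQ hc).
move: (lab Q.1 Q.2 Q.1.+1 Q.2) (lab Q.1.+1 Q.2 Q.1.+1 Q.2.+1) (lab Q.1 Q.2 Q.1 Q.2.+1)
  (lab Q.1 Q.2.+1 Q.1.+1 Q.2.+1) e1 e2 e3 e4 => l1 l2 l3 l4 e1 e2 e3 e4.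
set p := ps (g (v Q.1.+1 Q.2.+1) / g (v Q.1 Q.2)) in c1 c2.
have E1 : rt Q.1.+1 Q.2.+1 = (-1) ^+ (l1 (+) l2) * (rt Q.1 Q.2 * p).
  by rewrite signr_addb -c1 e2 e1; ring.
have E2 : rt Q.1.+1 Q.2.+1 = (-1) ^+ (l3 (+) l4) * (rt Q.1 Q.2 * p).
  by rewrite signr_addb -c2 e4 e3; ring.
have E3 : (l1 (+) l2) = (l3 (+) l4).
  move: E1 E2; case: (l1 (+) l2) (l3 (+) l4) => [] [] //; rewrite expr0 expr1 mul1r mulN1r => E1 E2.
    move: rc; have : rt Q.1.+1 Q.2.+1 + rt Q.1.+1 Q.2.+1 = 0 by rewrite {1}E1 E2 addNr.
    by rewrite -mulr2n => /eqP; rewrite mulrn_eq0 /= => /eqP ->; rewrite eqxx.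
  move: rc; have : rt Q.1.+1 Q.2.+1 + rt Q.1.+1 Q.2.+1 = 0 by rewrite {1}E2 E1 addNr.
  by rewrite -mulr2n => /eqP; rewrite mulrn_eq0 /= => /eqP ->; rewrite eqxx.
by rewrite E3; case: l3 l4 {E1 E2 E3 e3 e4} => [] [].
Qed.

Let closed_squares (l : seq (nat * nat)) (P : nat * nat -> Prop) :
  closed [set z : C | exists Q, [/\ Q \in l, P Q & Sq Q z]].
Proof.
have cS Q : closed [set z : C | Sq Q z].
  have -> : [set z : C | Sq Q z] = ([set z : C | X Q.1 <= complex.Re z] `&` [set z : C | complex.Re z <= X Q.1.+1]) `&`
     ([set z : C | X Q.2 <= complex.Im z] `&` [set z : C | complex.Im z <= X Q.2.+1]).
    apply/seteqP; split=> z; rewrite /setI /=; first by move=> [/andP[-> ->] /andP[-> ->]].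
    by move=> [[h1 h2] [h3 h4]]; split; apply/andP.
  apply: closedI; apply: closedI.
  - exact: closed_comp_ge (@continuous_Re R).
  - exact: closed_comp_le (@continuous_Re R).
  - exact: closed_comp_ge (@continuous_Im R).
  - exact: closed_comp_le (@continuous_Im R).
elim: l => [|Q l IH].
  have -> : [set z : C | exists Q, [/\ Q \in [::], P Q & Sq Q z]] = set0.
    by apply/seteqP; split=> // z [Q [hQ]]; rewrite in_nil in hQ.
  exact: closed0.
have [PQ|nPQ] := pselect (P Q); last first.
  have -> : [set z : C | exists Q', [/\ Q' \in Q :: l, P Q' & Sq Q' z]] = [set z : C | exists Q', [/\ Q' \in l, P Q' & Sq Q' z]].
    apply/seteqP; split=> z [Q' [h1 h2 h3]]; exists Q'; split=> //; last by rewrite inE h1 orbT.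
    by move: h1; rewrite inE => /orP[/eqP e|//]; rewrite e in h2.
  exact: IH.
have -> : [set z : C | exists Q', [/\ Q' \in Q :: l, P Q' & Sq Q' z]] = [set z : C | Sq Q z] `|` [set z : C | exists Q', [/\ Q' \in l, P Q' & Sq Q' z]].
  apply/seteqP; split=> z.
    move=> [Q' [h1 h2 h3]]; move: h1; rewrite inE => /orP[/eqP <-|h1]; [by left|right].
    by exists Q'.
  by move=> [h|[Q' [h1 h2 h3]]]; [exists Q|exists Q']; split=> //; rewrite inE ?eqxx// h1 orbT.
exact: closedU.
Qed.

Let allQ := [seq (i, j) | i <- iota 0 m, j <- iota 0 m].

Let mem_allQ Q : (Q \in allQ) = in_box m Q.
Proof.
apply/allpairsP/idP => [[[i j] [/=]]|].
  by rewrite !mem_iota !add0n => /andP[_ h1] /andP[_ h2] ->; apply/andP.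
by case: Q => i j /andP[h1 h2]; exists (i, j); split; rewrite ?mem_iota.
Qed.

Let idx (x : R) : nat := Num.truncn ((x + M%:R) * n%:R).

Let idxP x : - M%:R <= x -> x < M%:R -> (idx x < m)%N /\ X (idx x) <= x < X (idx x).+1.
Proof.
move=> h1 h2; have y0 : 0 <= (x + M%:R) * n%:R by rewrite mulr_ge0//; lra.
have := truncn_itv y0; rewrite -/(idx x) => /andP[t1 t2]; split.
  rewrite -(ltr_nat R); apply: le_lt_trans t1 _; rewrite /m !natrM ltr_pM2r//; lra.
rewrite /X lerBlDr ler_pdivrMr// t1 /=.
by rewrite ltrBrDr ltr_pdivlMr.
Qed.

Let cQ z := (idx (complex.Re z), idx (complex.Im z)).

Let cQP z : `|complex.Re z| < M%:R -> `|complex.Im z| < M%:R -> in_box m (cQ z) /\ Sq (cQ z) z.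
Proof.
rewrite !ltr_norml => /andP[/ltW h1 h2] /andP[/ltW h3 h4].
have [a1 /andP[a2 /ltW a3]] := idxP h1 h2; have [b1 /andP[b2 /ltW b3]] := idxP h3 h4.
by split; [rewrite /in_box a1 b1|rewrite /Sq /= a2 a3 b2 b3].
Qed.

Let X_close i i' x : X i <= x <= X i.+1 -> X i' <= x <= X i'.+1 ->
  [\/ i' = i, i' = i.+1 | i = i'.+1].
Proof.
have Xlt j j' : X j <= X j' -> (j <= j')%N.
  by rewrite lerD2r ler_pM2r ?invr_gt0// ler_nat.
move=> /andP[h1 h2] /andP[h3 h4].
have a1 := Xlt _ _ (le_trans h1 h4); have a2 := Xlt _ _ (le_trans h3 h2).
have [e|e|e] := ltngtP i i'.
- by apply: Or32; apply/eqP; rewrite eqn_leq a2 e.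
- by apply: Or33; apply/eqP; rewrite eqn_leq a1 e.
- by apply: Or31.
Qed.

Let adj_step Q Q' z (T : nat * nat -> Prop) :
  (forall Q Q', T Q -> in_box m Q' -> bad Q' -> adjacent Q Q' -> T Q') ->
  in_box m Q -> in_box m Q' -> Sq Q z -> Sq Q' z -> Aeta z -> T Q -> T Q'.
Proof.
move=> hT hQ hQ' sQ sQ' Az TQ.
case: Q Q' hQ hQ' sQ sQ' TQ => i j [i' j'] /andP[/= q1 q2] /andP[/= q3 q4] [/= s1 s2] [/= s3 s4] TQ.
have b1 : in_box m (i', j) by rewrite /in_box q3 q2.
have b2 : in_box m (i', j') by rewrite /in_box q3 q4.
have T1 : T (i', j).
  have bd : bad (i', j) by exists z.
  case: (X_close s1 s3) => [->//|e|e]; apply: hT TQ b1 bd _; rewrite /adjacent /= e !eqxx ?orbT//.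
have bd : bad (i', j') by exists z.
by case: (X_close s2 s4) => [->//|e|e]; apply: hT T1 b2 bd _; rewrite /adjacent /= e !eqxx ?orbT.
Qed.

(** The points of [A] whose squares belong to [T] would form a bounded part of [A]
separated from the rest. *)
Lemma no_trap (T : nat * nat -> Prop) :
  (forall Q, T Q -> in_box m Q /\ bad Q) -> (forall Q, T Q -> ~~ on_rim m Q) ->
  (forall Q Q', T Q -> in_box m Q' -> bad Q' -> adjacent Q Q' -> T Q') -> forall Q, ~ T Q.
Proof.
move=> hT1 hT2 hT3 Q0 TQ0.
pose B := [set z : C | exists Q, [/\ Q \in allQ, T Q & Sq Q z]].
pose B1 := [set z : C | exists Q, [/\ Q \in allQ, bad Q /\ ~ T Q & Sq Q z]].
pose B2 := ([set z : C | complex.Re z <= - M%:R] `|` [set z : C | M%:R <= complex.Re z]) `|`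
  ([set z : C | complex.Im z <= - M%:R] `|` [set z : C | M%:R <= complex.Im z]).
have cB : closed B by exact: closed_squares.
have cB' : closed (B1 `|` B2).
  apply: closedU; first exact: closed_squares.
  apply: closedU; apply: closedU.
  - exact: closed_comp_le (@continuous_Re R).
  - exact: closed_comp_ge (@continuous_Re R).
  - exact: closed_comp_le (@continuous_Im R).
  - exact: closed_comp_ge (@continuous_Im R).
have bB : exists K : R, forall z, B z -> normc z <= K.
  exists (M%:R + M%:R) => z [Q [h1 h2 h3]]; have [h4 h5] := Sq_box (hT1 Q h2).1 h3.
  by apply: le_trans (normc_le_ReIm _) _; exact: lerD.
have cover z : Aeta z -> B z \/ (B1 `|` B2) z.
  move=> Az; have [h1|h1] := ltP `|complex.Re z| M%:R; last first.
    right; right; left; move: h1; rewrite ler_normr => /orP[|]; [by right|].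
    by move=> h; left; rewrite /= lerNr.
  have [h2|h2] := ltP `|complex.Im z| M%:R; last first.
    right; right; right; move: h2; rewrite ler_normr => /orP[|]; [by right|].
    by move=> h; left; rewrite /= lerNr.
  have [q1 q2] := cQP h1 h2; have bq : bad (cQ z) by exists z.
  have [tq|tq] := pselect (T (cQ z)); [left|right; left]; exists (cQ z); split; rewrite ?mem_allQ//.
have disj z : Aeta z -> B z -> ~ (B1 `|` B2) z.
  move=> Az [Q [h1 h2 h3]]; rewrite mem_allQ in h1.
  case=> [[Q' [k1 [k2 k3] k4]]|].
    by apply: k3; rewrite mem_allQ in k1; exact: adj_step hT3 h1 k1 h3 k4 Az h2.
  have := hT2 Q h2; move=> /negP rim hz; apply: rim.
  have [/andP[p1 p2] /andP[p3 p4]] := h3; case/andP: h1 => r1 r2.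
  have lt0 i : X i <= - M%:R -> i = 0%N.
    rewrite -X0 lerD2r ler_pM2r ?invr_gt0// ler_nat leqn0.
    by move/eqP.
  have ltm i : (i < m)%N -> M%:R <= X i.+1 -> i.+1 = m.
    by rewrite -Xm lerD2r ler_pM2r ?invr_gt0// ler_nat => k1 k2; apply/eqP; rewrite eqn_leq k1.
  rewrite /on_rim; move: hz => [[|]|[|]] /= hz.
  - by rewrite (lt0 Q.1) ?eqxx// (le_trans p1).
  - by rewrite (ltm Q.1) ?eqxx ?orbT// (le_trans hz).
  - by rewrite (lt0 Q.2) ?eqxx ?orbT// (le_trans p3).
  - by rewrite (ltm Q.2) ?eqxx ?orbT// (le_trans hz).
have AAeta z : A z -> Aeta z by move=> Az; exists z; rewrite ?subrr ?normc0.
have AB := nA cB cB' bB (fun z Az => cover z (AAeta z Az)) (fun z Az => disj z (AAeta z Az)).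
have [h1 [z0 sz0 [x Ax zx]]] := hT1 Q0 TQ0.
have Bz0 : B z0 by exists Q0; rewrite mem_allQ.
have sub w : disk x eta w -> Aeta w by move=> hw; exists x.
have oB : open (~` B) by rewrite openC.
have oB' : open (~` (B1 `|` B2)) by rewrite openC.
apply: (AB x Ax).
apply: (connected_ind (P := B) (@disk_connected R x eta) (@open_disk R x eta)).
- move=> w hw Bw; have nw := disj w (sub w hw) Bw.
  move: oB'; rewrite openE => /(_ w nw) hnear.
  have hdk := disk_near hw.
  apply: (filterS2 _ _ hdk hnear) => y hy ny.
  by case: (cover y (sub y hy)).
- by move=> w hw nBw; move: oB; rewrite openE => /(_ w nBw).
- by exists z0.
- by rewrite /disk /= subrr normc0.
Qed.

(** On a mesh fine enough for [g] to vary by less than a right angle, principal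
roots at neighbouring vertices agree up to a sign. These signs have no curl on
the squares away from [A], so a choice of signs at the vertices makes the roots
agree, and the root at a vertex extends to its square. *)
Lemma grid_root : exists s : C -> C, forall z w,
  `|complex.Re z| < M%:R -> `|complex.Im z| < M%:R -> (forall x, A x -> eta + eta <= normc (z - x)) ->
  `|complex.Re w| < M%:R -> `|complex.Im w| < M%:R -> (forall x, A x -> eta + eta <= normc (w - x)) ->
  normc (w - z) < 1 / n%:R ->
  [/\ s z ^+ 2 = g z, 0 < complex.Re (g w / g z) & s w = s z * ps (g w / g z)].
Proof.
have [tau htau] := grid_potential curl_good no_trap.
pose val (i j : nat) z : C := (-1) ^+ tau i j * rt i j * ps (g z / g (v i j)).
have step Q i j i' j' z : in_box m Q -> ~ bad Q -> Sq Q z -> Sq Q (v i j) -> Sq Q (v i' j') ->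
    tau i' j' = tau i j (+) lab i j i' j' -> val i' j' z = val i j z.
  move=> hQ gQ hz hv hv' e; rewrite /val e signr_addb.
  have g1 := good_g0 hQ gQ hv; rewrite (labE i' j' g1) -(chain hQ gQ hv hv' hz).
  set S := (-1) ^+ lab i j i' j'; have SS : S * S = 1 :> C by rewrite -expr2 sqrr_sign.
  set T := (-1) ^+ tau i j; set p := ps _; set q := ps _.
  have -> : T * S * (S * (rt i j * p)) * q = S * S * (T * rt i j * (p * q)) by ring.
  by rewrite SS mul1r.
have val_eq Q (k l : bool) z : in_box m Q -> ~ bad Q -> Sq Q z -> val (Q.1 + k)%N (Q.2 + l)%N z = val Q.1 Q.2 z.
  move=> hQ gQ hz; have [t1 t2 t3 t4] := htau Q hQ gQ.
  have ha := vert Q false false; have hb := vert Q true false; have hc := vert Q true true.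
  have hdd := vert Q false true.
  rewrite !addn0 !addn1 in ha hb hc hdd.
  have e1 : val Q.1.+1 Q.2 z = val Q.1 Q.2 z by exact: step hQ gQ hz ha hb t1.
  have e2 : val Q.1.+1 Q.2.+1 z = val Q.1.+1 Q.2 z by exact: step hQ gQ hz hb hc t4.
  have e3 : val Q.1 Q.2.+1 z = val Q.1 Q.2 z by exact: step hQ gQ hz ha hdd t3.
  by case: k l => [] []; rewrite !(addn0, addn1) ?e2.
pose s z := val (idx (complex.Re z)) (idx (complex.Im z)) z.
have goodE z : `|complex.Re z| < M%:R -> `|complex.Im z| < M%:R -> (forall x, A x -> eta + eta <= normc (z - x)) ->
    [/\ in_box m (cQ z), Sq (cQ z) z & ~ bad (cQ z)].
  move=> h1 h2 h3; have [q1 q2] := cQP h1 h2; split=> // -[y sy' [x Ax yx]].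
  have := h3 x Ax; have := Sq_dist q2 sy'; have := normcD (z - y) (y - x); rewrite addrA subrK.
  move: ne; move: (2 / n%:R : R) => k; lra.
have idx_close x y : - M%:R < x -> x < M%:R -> - M%:R < y -> y < M%:R -> `|y - x| < 1 / n%:R ->
    exists k l : bool, (idx x + k = idx y + l)%N.
  move=> x1 x2 y1 y2 hxy.
  have [_ /andP[a1 a2]] := idxP (ltW x1) x2; have [_ /andP[b1 b2]] := idxP (ltW y1) y2.
  rewrite !XS in a2 b2; rewrite ltr_norml in hxy.
  have Xlt j j' : X j < X j' -> (j < j')%N.
    by rewrite ltrD2r ltr_pM2r ?invr_gt0// ltr_nat.
  have c1 : X (idx y) < X (idx x).+2 by rewrite !XS; move: (1 / n%:R : R) a1 a2 b1 b2 hxy => h a1 a2 b1 b2 hxy; lra.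
  have c2 : X (idx x) < X (idx y).+2 by rewrite !XS; move: (1 / n%:R : R) a1 a2 b1 b2 hxy => h a1 a2 b1 b2 hxy; lra.
  have := Xlt _ _ c1; have := Xlt _ _ c2; rewrite !ltnS => d1 d2.
  have [e|e|e] := ltngtP (idx x) (idx y).
  - by exists true, false; rewrite addn1 addn0; apply/eqP; rewrite eqn_leq e d2.
  - by exists false, true; rewrite addn1 addn0; apply/eqP; rewrite eqn_leq e d1.
  - by exists false, false; rewrite e.
have n12 : 1 / n%:R <= 2 / n%:R :> R by rewrite ler_pM2r ?invr_gt0//; lra.
exists s => z w z1 z2 z3 w1 w2 w3 zw.
have [bz qz gz] := goodE z z1 z2 z3; have [bw qw gw] := goodE w w1 w2 w3.
have gz0 : g z != 0 := good_g0 bz gz qz.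
have Gz : G z by exact: good_G bz gz qz.
have rzw : 0 < complex.Re (g w / g z) by apply: hd => //; apply: lt_trans zw _; apply: le_lt_trans n12 nd.
have vz : Sq (cQ z) (v (cQ z).1 (cQ z).2) by have := vert (cQ z) false false; rewrite !addn0.
split=> //.
  by rewrite /s /val !exprMn !psK sqrr_sign mul1r mulrC divfK// (good_g0 bz gz vz).
have [k [l kl]] : exists k l : bool, (idx (complex.Re z) + k = idx (complex.Re w) + l)%N.
  move: z1 w1; rewrite !ltr_norml => /andP[? ?] /andP[? ?]; apply: idx_close => //.
  by apply: le_lt_trans zw; rewrite -cReN -cReD Re_le.
have [k' [l' kl']] : exists k l : bool, (idx (complex.Im z) + k = idx (complex.Im w) + l)%N.
  move: z2 w2; rewrite !ltr_norml => /andP[? ?] /andP[? ?]; apply: idx_close => //.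
  by apply: le_lt_trans zw; rewrite -cImN -cImD Im_le.
have ez := val_eq (cQ z) k k' z bz gz qz; have ew := val_eq (cQ w) l l' w bw gw qw.
rewrite /= kl kl' in ez; rewrite /= in ew.
rewrite /s -ew -ez /val -[RHS]mulrA; congr (_ * _).
set u := v _ _.
have hu : Sq (cQ z) u by have := vert (cQ z) k k'; rewrite /= kl kl'.
have hu' : Sq (cQ w) u := vert (cQ w) l l'.
rewrite -ps_mul//; last exact: good_ratio bz gz hu qz.
by congr ps; have gu : g u != 0 := good_g0 bz gz hu; field; rewrite gu gz0.
Qed.

End Mesh.
End GridRoots.

(** * Holomorphic square roots off a set that reaches infinity *)
Section SquareRoots.
Context {R : realType}.
Notation C := (Cplx R).

Lemma sinv_lt (e : R) : 0 < e -> exists N : nat, forall n, (N <= n)%N -> n.+1%:R^-1 < e.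
Proof.
by move=> e0; have [N _ hN] := near_infty_natSinv_lt (PosNum e0); exists N.
Qed.

Lemma uniform_root (A : set C) (g : C -> C) (M : nat) (eta : R) : noisle A ->
  (forall z, ~ A z -> cts g z) -> (forall z, ~ A z -> g z != 0) -> 0 < eta ->
  exists s : C -> C, exists2 h : R, 0 < h & forall z w,
  `|complex.Re z| < M%:R -> `|complex.Im z| < M%:R -> (forall x, A x -> eta + eta <= normc (z - x)) ->
  `|complex.Re w| < M%:R -> `|complex.Im w| < M%:R -> (forall x, A x -> eta + eta <= normc (w - x)) ->
  normc (w - z) < h ->
  [/\ s z ^+ 2 = g z, 0 < complex.Re (g w / g z) & s w = s z * ps (g w / g z)].
Proof.
move=> nA gc g0 eta0; have [d d0 hd] := ratio_near gc g0 M eta0.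
have k0 : 0 < Num.min d eta / 2 by rewrite divr_gt0// lt_min d0.
have [n hn] := sinv_lt k0; have := hn n (leqnn n).
have n0 : 0 < n.+1%:R :> R by rewrite ltr0n.
rewrite ltr_pdivlMr// mulrC lt_min => /andP[h1 h2].
have [s hs] := grid_root nA g0 eta0 hd (isT : (0 < n.+1)%N) h1 h2.
by exists s, (1 / n.+1%:R); rewrite ?divr_gt0.
Qed.

(** The roots on larger and larger boxes and closer and closer to [A] converge
along an ultrafilter, since each takes one of two values at a given point. The
relation between values at close points survives the limit and gives
continuity. *)
Theorem sqrt_exists (A : set C) (g : C -> C) : closed A -> noisle A -> hol (~` A) g ->
  (forall z, ~ A z -> g z != 0) ->
  exists2 s : C -> C, hol (~` A) s & forall z, ~ A z -> s z ^+ 2 = g z.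
Proof.
move=> cA nA hg g0; have gc z : ~ A z -> cts g z by move=> nz; exact: hol_fc hg _ nz.
pose eta (N : nat) : R := N.+1%:R^-1.
have eta0 N : 0 < eta N by rewrite invr_gt0.
have /choice[sN] := fun N : nat => uniform_root N.+1 nA gc g0 (eta0 N).
move=> /(_ _)/cid2-/all_sig2[hN hN0 hsN].
pose S N z := if sN N z ^+ 2 == g z then sN N z else ps (g z).
have SS N z : S N z ^+ 2 = g z by rewrite /S; case: ifP => [/eqP//|_]; exact: psK.
have Sb N z : normc (S N z) <= normc (ps (g z)).
  by rewrite -(@ler_pXn2r _ 2) ?nnegrE ?normc_ge0// -!normcX SS psK.
have [F [uF hF]] := free_ultrafilter; have FF : ProperFilter F by exact: ultra_proper.
have /choice[s hs] : forall z, exists l : C, (fun N => S N z) @ F --> l.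
  by move=> z; have [l _ hl] := ultra_limit uF (fun N => Sb N z); exists l.
have ss z : s z ^+ 2 = g z.
  have h1 : (fun N => S N z * S N z) @ F --> s z * s z by apply: cvgM; exact: hs.
  have h2 : (fun N => S N z * S N z) @ F --> g z.
    have -> : (fun N => S N z * S N z) = (fun _ => g z) by apply/funext => N; rewrite -expr2 SS.
    exact: cvg_cst.
  by rewrite expr2; apply: (cvg_unique _ h1 h2); exact: norm_hausdorff.
exists s => // a Aa.
have oA : open (~` A) by rewrite openC.
have [r0 r00 sub0] := (openCP (~` A)).1 oA a Aa.
have ga0 : g a != 0 := g0 a Aa.
have ratc : cts (fun z => g z / g a) a by apply: contM; [exact: gc|exact: cont_cst].
have rat1 : g a / g a = 1 by rewrite divff.
have [r1 r10 hr1] : exists2 r : R, 0 < r & forall z, normc (z - a) < r -> 0 < complex.Re (g z / g a).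
  have [d d0 hd] := (ccontP _ _).1 ratc 1 ltr01; exists d => // z /hd; rewrite rat1 => h.
  have := Re_le (g z / g a - 1); rewrite cReD cReN /= => h'.
  have := le_lt_trans h' h; rewrite ltr_norml; lra.
pose rho := Num.min r1 (r0 / 2).
have rho0 : 0 < rho by rewrite lt_min r10 divr_gt0.
have r1E z : normc (z - a) < rho -> normc (z - a) < r1 by rewrite lt_min => /andP[].
have r0E z : normc (z - a) < rho -> normc (z - a) < r0 / 2 by rewrite lt_min => /andP[].
have r04 : 0 < r0 / 4 by rewrite divr_gt0.
have [N1 hN1] := sinv_lt r04.
have [N2 hN2] : exists N2 : nat, normc a + r0 < N2%:R.
  by exists (Num.truncn (normc a + r0)).+1; exact: truncnS_gt.
pose N0 := maxn N1 N2.
have key N z : (N0 <= N)%N -> normc (z - a) < rho -> S N z = S N a * ps (g z / g a).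
  move=> NN hz; have NN1 : (N1 <= N)%N := leq_trans (leq_maxl _ _) NN.
  have NN2 : (N2 <= N)%N := leq_trans (leq_maxr _ _) NN.
  have e4 : eta N < r0 / 4 := hN1 N NN1.
  have inE w : normc (w - a) < rho -> [/\ `|complex.Re w| < N.+1%:R, `|complex.Im w| < N.+1%:R &
      forall x, A x -> eta N + eta N <= normc (w - x)].
    move=> hw; have hw0 := r0E w hw.
    have hb : normc w < N.+1%:R.
      apply: lt_trans (_ : N2%:R < _); last by rewrite ltr_nat ltnS.
      by apply: lt_trans hN2; have := normcD (w - a) a; rewrite subrK; lra.
    split; [exact: le_lt_trans (Re_le _) hb|exact: le_lt_trans (Im_le _) hb|].
    move=> x Ax; have hx : r0 <= normc (x - a).
      by rewrite leNgt; apply/negP => /sub0; apply.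
    have := normcD (x - w) (w - a); rewrite addrA subrK normcBC; lra.
  have [k hk] : exists k : nat, normc (z - a) / hN N < k.+1%:R.
    by exists (Num.truncn (normc (z - a) / hN N)); exact: truncnS_gt.
  have k0 : (0 : R) < k.+1%:R by rewrite ltr0n.
  pose p (j : nat) : C := a + (j%:R / k.+1%:R)%:C%C * (z - a).
  have pin j : (j <= k.+1)%N -> normc (p j - a) < rho.
    move=> jk; rewrite /p addrC addKr normcM normc_real ger0_norm ?divr_ge0//.
    by apply: le_lt_trans hz; rewrite ler_piMl ?normc_ge0// ler_pdivrMr// mul1r ler_nat.
  have pS j : normc (p j.+1 - p j) < hN N.
    have -> : p j.+1 - p j = (1 / k.+1%:R)%:C%C * (z - a).
      rewrite /p opprD addrACA subrr add0r -mulrBl -rmorphB; congr (_%:C%C * _).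
      by rewrite -mulrBl -natr1 [_ + 1]addrC addrK.
    rewrite normcM normc_real ger0_norm ?divr_ge0// mul1r mulrC ltr_pdivrMr//.
    by move: hk; rewrite ltr_pdivrMr// mulrC.
  have SE w : normc (w - a) < rho -> S N w = sN N w.
    move=> hw; have [b1 b2 b3] := inE w hw.
    have [|e _ _] := hsN N w w b1 b2 b3 b1 b2 b3; first by rewrite subrr normc0.
    by rewrite /S e eqxx.
  have ind j : (j <= k.+1)%N -> S N (p j) = S N a * ps (g (p j) / g a).
    elim: j => [_|j IH jk].
      have -> : p 0%N = a by rewrite /p mul0r rmorph0 mul0r addr0.
      rewrite rat1; have := @ps_uniq R 1; rewrite expr1n => -> /=; rewrite ?mulr1//.
    have q1 := pin _ jk; have q0 := pin _ (ltnW jk).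
    have [a1 a2 a3] := inE _ q0; have [b1 b2 b3] := inE _ q1.
    have [_ pos e] := hsN N _ _ a1 a2 a3 b1 b2 b3 (pS j).
    rewrite SE// e -SE// IH; last exact: ltnW.
    rewrite -mulrA -ps_mul//; last by apply: hr1; exact: r1E.
    congr (_ * ps _); have gj : g (p j) != 0.
      by apply: g0; apply: sub0; have := r0E _ q0; lra.
    by field; rewrite ga0 gj.
  have := ind k.+1 (leqnn _).
  by have -> : p k.+1 = z by rewrite /p divff ?gt_eqF// rmorph1 mul1r addrC subrK.
have sloc z : normc (z - a) < rho -> s z = s a * ps (g z / g a).
  move=> hz; have h1 : (fun N => S N a * ps (g z / g a)) @ F --> s a * ps (g z / g a).
    by apply: cvgM; [exact: hs|exact: cvg_cst].
  apply: (cvg_unique _ (hs z) _); first exact: norm_hausdorff.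
  apply/cvgCP => e e0; have /cvgCP/(_ e e0) h2 := h1.
  apply: (filterS2 _ _ h2 (hF N0)) => N k1 k2; rewrite key//.
have sc : cts s a.
  apply: (@cont_near _ (fun z => s a * ps (g z / g a))).
    by apply/nbhsCP; exists rho => // w hw; rewrite [RHS]sloc.
  apply: contM; first exact: cont_cst.
  apply: (cont_comp ratc); apply: cts_ps; by right; rewrite rat1 /= ltr01.
have [l hl] := hg a Aa.
eexists; apply: (cder_sqrt sc _ _ hl); first by apply: nearCW => w; exact: ss.
by apply/eqP => e; move: ga0; rewrite -ss e expr0n eqxx.
Qed.

Lemma disk_sub_component (O : set C) z r : 0 < r -> disk z r `<=` O -> disk z r `<=` connected_component O z.
Proof.
move=> r0 sO; apply: connected_component_max => //; last exact: disk_connected.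
by rewrite /disk /= subrr normc0.
Qed.

Lemma component_open (O : set C) x : open O -> open (connected_component O x).
Proof.
move=> oO; apply/openCP => z hz.
have Oz : O z := @connected_component_sub _ _ _ _ hz.
have [d d0 hd] := (openCP O).1 oO z Oz; exists d => // w hw.
by rewrite (same_connected_component hz); exact: (disk_sub_component d0 hd).
Qed.

Lemma component_rel_closed (O : set C) x : open O -> open (O `\` connected_component O x).
Proof.
move=> oO; apply/openCP => z [Oz nz]; have [d d0 hd] := (openCP O).1 oO z Oz.
exists d => // w hw; split; first exact: hd.
move=> cw; apply: nz; have zw := disk_sub_component d0 hd hw.
rewrite (same_connected_component cw); exact: connected_component_sym.
Qed.

(** A zero-free function on one component extends by 1 to the whole complement. *)
Theorem component_square_roots (A : set C) x : closed A -> noisle A ->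
  has_square_roots (connected_component (~` A) x).
Proof.
move=> cA nA g hg g0; set U := connected_component _ _ in hg g0 *.
have oA : open (~` A) by rewrite openC.
have oU : open U by exact: component_open.
have oU' : open (~` A `\` U) by exact: component_rel_closed.
pose g' z : C := if pselect (U z) then g z else 1.
have g'U z : U z -> g' z = g z by rewrite /g'; case: pselect.
have g'n z : ~ U z -> g' z = 1 by rewrite /g'; case: pselect.
have hg' : hol (~` A) g'.
  move=> z Az; have [Uz|nUz] := pselect (U z).
    have [l hl] := hg z Uz; exists l; apply: cder_near hl.
    by move: oU; rewrite openE => /(_ z Uz); apply: filterS => w Uw; rewrite g'U.
  exists 0; apply: cder_near (cder_cst 1 z).
  have : (~` A `\` U) z by split.
  by move: oU'; rewrite openE => h /h; apply: filterS => w [_ nUw]; rewrite g'n.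
have g'0 z : ~ A z -> g' z != 0.
  move=> _; have [Uz|nUz] := pselect (U z); first by rewrite g'U//; exact: g0.
  by rewrite g'n//; exact: oner_neq0.
have [s hs ss] := sqrt_exists cA nA hg' g'0.
have UA z : U z -> ~ A z by move=> Uz; exact: (@connected_component_sub _ _ _ _ Uz).
exists s; first exact: hol_sub hs.
by move=> z Uz; rewrite ss ?g'U//; exact: UA.
Qed.

End SquareRoots.

(** * Ahlfors' lemma for pulled-back densities *)
Section Ahlfors.
Context {R : realType}.
Notation C := (Cplx R).

Lemma rint_sq_ge (u : R -> R) : rcon 0 1 u -> (rint 0 1 u) ^+ 2 <= rint 0 1 (fun t => u t ^+ 2).
Proof.
move=> hu; set m := rint 0 1 u.
have h2 : rcon 0 1 (fun t => u t ^+ 2) by move=> t /hu h; exact: (rctsM h h).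
have hm : rcon 0 1 (fun t => (2 * m) * u t) by exact: rconZ.
have hc : rcon 0 1 (fun _ : R => m ^+ 2) by move=> t _; exact: rcts_cst.
have h3 : rcon 0 1 (fun t => u t ^+ 2 - (2 * m) * u t) by move=> t ht; exact: (rctsB (h2 t ht) (hm t ht)).
have : rint 0 1 (fun _ => 0) <= rint 0 1 (fun t => u t ^+ 2 - (2 * m) * u t + m ^+ 2).
  apply: le_rint.
  - by move=> t _; exact: rcts_cst.
  - by move=> t ht; exact: (rctsD (h3 t ht) (hc t ht)).
  - by move=> t _; have := sqr_ge0 (u t - m); rewrite sqrrB; lra.
rewrite rintD// rintB// rintZ// !rint_cst// -/m; lra.
Qed.

(** The infinitesimal form of the Schwarz--Pick estimate: at a point where the
hyperbolic derivative of [G] is maximal it cannot exceed 1. The mean of [|G'|]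
on a small circle is at least [M], and that of [|G|^2] is at least
[r^2 M^2] by Cauchy--Schwarz, so integrating the hypothesis over the circle gives
[(1 - r^2) M <= M (1 - r^2 M^2)]. *)
Lemma schwarz_local (G : C -> C) (rho M : R) : 0 < rho -> rho <= 1 -> hol (disk 0 rho) G -> G 0 = 0 -> 0 < M ->
  (forall z, disk 0 rho z -> normc (dc G z) * (1 - normc z ^+ 2) <= M * (1 - normc (G z) ^+ 2)) ->
  normc (dc G 0) = M -> M <= 1.
Proof.
move=> rho0 rho1 hG G0 M0 hle hM.
pose r := rho / 2; have r0 : 0 < r by rewrite divr_gt0.
have rr : r < rho by rewrite /r; lra.
have r1 : r < 1 by lra.
have rle : 0 <= r < rho by rewrite ltW.
have hdG := hol_dc_hol (@open_disk R 0 rho) hG.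
pose u := dquot G 0 (dc G 0); have hu : hol (disk 0 rho) u := hol_dquot hG rho0.
have e1 : cm (dc G) 0 r = dc G 0 := cm_mean hdG rle.
have e2 : cm u 0 r = dc G 0 by rewrite (cm_mean hu rle) /u /dquot eqxx.
have cc f : hol (disk 0 rho) f -> ccon 0 1 (fun t => f (circ 0 r t)).
  move=> hf; apply: ccon_circ => z hz; apply: hol_fc hf _ _.
  by rewrite /disk /= hz ger0_norm// ltW.
have nz t : normc (circ 0 r t) = r.
  by have := normc_circ (0 : C) r t; rewrite subr0 ger0_norm// ltW.
have q0 : 0 < 1 - r ^+ 2 by rewrite subr_gt0 expr_lt1// ltW.
have c1 := rcon_normc (cc _ hdG); have c2 := rcon_normc (cc _ hu); have c3 := rcon_normc (cc _ hG).
have c3' : rcon 0 1 (fun t => normc (G (circ 0 r t)) ^+ 2) by move=> t ht; exact: (rctsM (c3 t ht) (c3 t ht)).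
have c2' : rcon 0 1 (fun t => normc (u (circ 0 r t)) ^+ 2) by move=> t ht; exact: (rctsM (c2 t ht) (c2 t ht)).
have a1 : M <= rint 0 1 (fun t => normc (dc G (circ 0 r t))).
  by rewrite -hM -{1}e1; apply: cint_norm => //; exact: cc.
have a2 : M ^+ 2 <= rint 0 1 (fun t => normc (u (circ 0 r t)) ^+ 2).
  have h1 : M <= rint 0 1 (fun t => normc (u (circ 0 r t))).
    by rewrite -hM -{1}e2; apply: cint_norm => //; exact: cc.
  apply: le_trans (rint_sq_ge c2); rewrite ler_pXn2r ?nnegrE//; first exact: ltW.
  by apply: le_trans h1; exact: ltW.
have a3 : rint 0 1 (fun t => normc (G (circ 0 r t)) ^+ 2) = r ^+ 2 * rint 0 1 (fun t => normc (u (circ 0 r t)) ^+ 2).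
  rewrite -rintZ//; apply: eq_rint => t _.
  have z0 : circ 0 r t != 0 by rewrite -normc_gt0 nz.
  have := dquotE G (dc G 0) z0; rewrite G0 !subr0 -/u => ->.
  by rewrite normcM nz exprMn mulrC.
have a4 : rint 0 1 (fun t => (1 - r ^+ 2) * normc (dc G (circ 0 r t))) <=
   rint 0 1 (fun t => M * (1 - normc (G (circ 0 r t)) ^+ 2)).
  apply: le_rint.
  - exact: rconZ.
  - by apply: rconZ => t ht; exact: (rctsB (rcts_cst 1 t) (c3' t ht)).
  - move=> t _; have hz : disk 0 rho (circ 0 r t) by rewrite /disk /= subr0 nz.
    by have := hle _ hz; rewrite nz mulrC.
have c4 : rcon 0 1 (fun _ : R => (1 : R)) by move=> t _; exact: rcts_cst.
have c5 : rcon 0 1 (fun t => 1 - normc (G (circ 0 r t)) ^+ 2) by move=> t ht; exact: (rctsB (rcts_cst 1 t) (c3' t ht)).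
have f1 := rintZ (1 - r ^+ 2) c1; have f2 := rintZ M c5; have f3 := rintB c4 c3'.
have {}a4 : (1 - r ^+ 2) * rint 0 1 (fun t => normc (dc G (circ 0 r t))) <= M * (1 - r ^+ 2 * rint 0 1 (fun t => normc (u (circ 0 r t)) ^+ 2)).
  by rewrite -f1 -a3; move: f3; rewrite rint_cst// !subr0 mulr1 => <-; rewrite -f2.
have b1 : (1 - r ^+ 2) * M <= M * (1 - r ^+ 2 * M ^+ 2).
  apply: le_trans (ler_wpM2l (ltW q0) a1) _; apply: le_trans a4 _.
  by rewrite ler_pM2l// lerB// ler_pM2l// exprn_gt0.
have b2 : r ^+ 2 * M ^+ 2 <= r ^+ 2.
  by move: b1; rewrite mulrC ler_pM2l//; lra.
have r20 : 0 < r ^+ 2 by rewrite exprn_gt0.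
by move: b2; rewrite ger_pMr// -[leRHS](expr1n _ 2) ler_pXn2r ?nnegrE// ltW.
Qed.

(** A density of curvature -4 near [z], given by a developing map [G] into the
disk. *)
Definition hyp_pullback (h : C -> R) (z : C) := exists r : R, exists2 G : C -> C, 0 < r &
  [/\ hol (disk z r) G, (forall w, disk z r w -> udisk (G w)) &
      forall w, disk z r w -> h w = normc (dc G w) / (1 - normc (G w) ^+ 2)].

Lemma rcts_of_cts (f : C -> C) z : cts f z -> (fun w => normc (f w)) @ z --> normc (f z).
Proof. by move=> [h]; exact: (cvg_comp _ _ h (@continuous_normc R _)). Qed.

Lemma hyp_pullback_cont h z : hyp_pullback h z -> {for z, continuous h}.
Proof.
move=> [r [G r0 [hG Gb hE]]].
have hz : disk z r z by rewrite /disk /= subrr normc0.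
have h1 := rcts_of_cts (hol_fc (hol_dc_hol (@open_disk R z r) hG) hz).
have h2 := rcts_of_cts (hol_fc hG hz).
have Gz := sq_lt1 (Gb z hz).
rewrite /prop_for /continuous_at hE//.
have h3 : (fun w => normc (dc G w) / (1 - normc (G w) ^+ 2)) @ z --> normc (dc G z) / (1 - normc (G z) ^+ 2).
  apply: (cvgM h1); apply: cvgV; first by rewrite gt_eqF.
  apply: cvgB; first exact: cvg_cst.
  by rewrite expr2; under eq_fun do rewrite expr2; exact: (cvgM h2 h2).
move=> A hA; have h4 := h3 A hA.
have h5 := disk_near hz.
have h6 w : disk z r w -> A (normc (dc G w) / (1 - normc (G w) ^+ 2)) -> (h @^-1` A) w.
  by move=> /hE /= ->.
exact: (filterS2 _ h6 h5 h4).
Qed.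

Lemma cts_scaled (h : C -> R) (r : R) (w : C) : {for w, continuous h} ->
  {for w, continuous (fun w => h w * (r ^+ 2 - normc w ^+ 2))}.
Proof.
move=> k1; have k2 : {for w, continuous (@normc R : C -> R)} := @continuous_normc R w.
have k3 : {for w, continuous (fun x : C => r ^+ 2 - normc x ^+ 2)}.
  apply: (@continuousB _ _ _ (fun=> r ^+ 2) (fun x : C => normc x ^+ 2)); first exact: cst_continuous.
  exact: (@continuousM _ _ (fun x : C => normc x) (fun x : C => normc x) w k2 k2).
exact: (continuousM k1 k3).
Qed.

(** On a disk of radius [r < 1] the ratio of [h] to the density of that disk tends
to 0 at the boundary, so it has a maximum. Moebius maps move the maximum and the
value of the developing map to 0, where [schwarz_local] applies. *)
Theorem ahlfors (h : C -> R) : (forall z, udisk z -> hyp_pullback h z) ->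
  forall z, udisk z -> h z * (1 - normc z ^+ 2) <= 1.
Proof.
move=> hh z hz.
have [hz0|hz0] := leP (h z) 0.
  by apply: le_trans (_ : 0 <= 1)=> //; rewrite mulr_le0_ge0// ltW// sq_lt1.
suff key r : normc z < r -> r < 1 -> h z * (r ^+ 2 - normc z ^+ 2) <= r.
  apply/ler_addgt0Pr => e e0.
  have z1 : normc z < 1 := hz.
  pose d := Num.min ((1 - normc z) / 2) (Num.min (1 / 2) (e / (2 * h z))).
  have d0 : 0 < d by rewrite !lt_min !divr_gt0 ?mulr_gt0// subr_gt0 z1.
  have d1 : d <= (1 - normc z) / 2 by rewrite ge_min lexx.
  have d2 : d <= 1 / 2 by rewrite !ge_min lexx orbT.
  have d3 : d * (2 * h z) <= e by rewrite -ler_pdivlMr ?mulr_gt0// !ge_min lexx !orbT.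
  have := key (1 - d); have -> : (1 - d) ^+ 2 = 1 - (2 * d - d ^+ 2) by ring.
  have dd : 0 <= d ^+ 2 by exact: sqr_ge0.
  move=> k; have k1 : normc z < 1 - d by lra.
  have k2 : 1 - d < 1 by lra.
  have {k k1 k2} k := k k1 k2.
  have hd2 : 0 <= h z * d ^+ 2 by rewrite mulr_ge0// ltW.
  move: (normc z ^+ 2) k d3 hd2 => N; move: (d ^+ 2) => D; lra.
move=> zr r1; have r0 : 0 < r := le_lt_trans (normc_ge0 _) zr.
pose phi w := h w * (r ^+ 2 - normc w ^+ 2).
pose K := [set w : C | normc (w - 0) <= r].
have Kd w : K w -> udisk w by rewrite /K /udisk /= subr0; lra.
have phic : {within K, continuous phi}.
  apply: continuous_in_subspaceT => w; rewrite inE => /Kd hw.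
  exact: cts_scaled (hyp_pullback_cont (hh w hw)).
have zK : K z by rewrite /K /= subr0 ltW.
have [w0 + hmax] := compact_EVT_max (ex_intro _ z zK) (@disk_compact R 0 r) phic.
rewrite inE => Kw0.
have hmaxz : phi z <= phi w0 by apply: hmax; rewrite inE.
apply: le_trans hmaxz _; rewrite leNgt; apply/negP => hgt.
have hw0 := Kd _ Kw0.
have w0r : normc w0 < r.
  rewrite lt_neqAle; move: (Kw0); rewrite /K /= subr0 => ->; rewrite andbT; apply/eqP => e.
  by move: hgt; rewrite /phi e subrr mulr0; lra.
pose M := phi w0 / r; have M1 : 1 < M by rewrite ltr_pdivlMr// mul1r.
have M0 : 0 < M := lt_trans ltr01 M1.
have hle w : K w -> h w * (r ^+ 2 - normc w ^+ 2) <= M * r.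
  by move=> Kw; rewrite divfK ?gt_eqF//; apply: hmax; rewrite inE.
have [r' [G r'0 [hG Gb hE]]] := hh w0 hw0.
have rC : (r%:C%C : C) != 0 by rewrite -normc_gt0 normc_real normr_gt0 gt_eqF.
pose a : C := w0 / r%:C%C.
have na : normc a = normc w0 / r by rewrite normcf normc_real ger0_norm// ltW.
have ha : udisk (- a) by rewrite /udisk /= normcN na ltr_pdivrMr// mul1r.
pose T (x : C) := r%:C%C * moeb (- a) x.
have T0 : T 0 = w0 by rewrite /T /moeb mulr0 subr0 divr1 sub0r opprK mulrC divfK.
have dT x : udisk x -> cder T x (r%:C%C * ((1 - (- a)^*%C * (- a)) / (1 - ((- a)^*%C : C) * x) ^+ 2)).
  move=> hx; have := cder_lin (r%:C%C) 0 (cder_moeb ha hx).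
  by apply: cder_ext => y; rewrite addr0.
have nT x : udisk x -> normc (T x) = r * normc (moeb (- a) x).
  by move=> hx; rewrite normcM normc_real ger0_norm// ltW.
have isoT x : udisk x -> normc (dc T x) * r * (1 - normc x ^+ 2) = r ^+ 2 - normc (T x) ^+ 2.
  move=> hx; rewrite (dcE (dT x hx)) nT// exprMn -[X in _ = X - _]mulr1 -mulrBr moeb_norm//.
  have h0 := moeb_den ha hx.
  rewrite normcM normcf normcX normc_real ger0_norm ?(ltW r0)// [_^*%C * _]mulrC mulJc.
  have -> : normc (1 - ((normc (- a) ^+ 2)%:C%C : C)) = 1 - normc (- a) ^+ 2.
    have -> : (1 - ((normc (- a) ^+ 2)%:C%C) : C) = ((1 - normc (- a) ^+ 2)%:C)%C by rewrite rmorphB rmorph1.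
    by rewrite normc_real ger0_norm// ltW// sq_lt1.
  by field; rewrite normc_eq0.
have T_K x : udisk x -> K (T x).
  move=> hx; rewrite /K /= subr0 nT//; have := moeb_disk ha hx; rewrite /udisk /= => h1.
  by rewrite ler_piMr// ltW.
have u0 : udisk (0 : C) by rewrite /udisk /= normc0.
have Tc : cts T 0 := cder_cont (dT 0 u0).
have hT0 : disk w0 r' (T 0) by rewrite T0 /disk /= subrr normc0.
have [rho1 rho10 hrho1] := nbhsCE (cts_nbhs Tc (disk_near hT0)).
pose rho := Num.min rho1 1; have rho0 : 0 < rho by rewrite lt_min rho10 ltr01.
have rhou x : disk 0 rho x -> udisk x by rewrite /disk /udisk /= subr0 lt_min => /andP[].
have rhoT x : disk 0 rho x -> disk w0 r' (T x) by rewrite /disk /= lt_min => /andP[/hrho1].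
pose b := G w0; have w00 : disk w0 r' w0 by rewrite /disk /= subrr normc0.
have hb : udisk b by exact: Gb.
pose G1 x := moeb b (G (T x)).
have dG1 x : disk 0 rho x -> cder G1 x ((1 - b^*%C * b) / (1 - (b^*%C : C) * G (T x)) ^+ 2 * (dc G (T x) * dc T x)).
  move=> hx; have e1 := dT x (rhou x hx); have e2 := hol_dc hG (rhoT x hx).
  have := cder_comp (cder_comp e1 e2) (cder_moeb hb (Gb _ (rhoT x hx))).
  by rewrite (dcE e1).
have hG1 : hol (disk 0 rho) G1 by move=> x hx; eexists; exact: dG1.
have isoG x : disk 0 rho x -> normc (dc G1 x) / (1 - normc (G1 x) ^+ 2) = h (T x) * normc (dc T x).
  move=> hx; rewrite (dcE (dG1 x hx)) moeb_norm//; last exact: Gb (rhoT x hx).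
  have h0 := moeb_den hb (Gb _ (rhoT x hx)); have s1 := sq_lt1 (Gb _ (rhoT x hx)).
  have s2 := sq_lt1 hb.
  rewrite hE; last exact: rhoT.
  rewrite !normcM normcV normcX [_^*%C * _]mulrC mulJc.
  have -> : normc (1 - ((normc b ^+ 2)%:C%C : C)) = 1 - normc b ^+ 2.
    have -> : (1 - ((normc b ^+ 2)%:C%C) : C) = ((1 - normc b ^+ 2)%:C)%C by rewrite rmorphB rmorph1.
    by rewrite normc_real ger0_norm// ltW.
  field; rewrite normc_eq0 h0 /= !gt_eqF//.
have G1b x : disk 0 rho x -> udisk (G1 x) by move=> hx; apply: moeb_disk => //; exact: Gb (rhoT x hx).
have G10 : G1 0 = 0 by rewrite /G1 T0 moeb0.
have d0 : disk 0 rho 0 by rewrite /disk /= subrr normc0.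
have hfin x : disk 0 rho x -> normc (dc G1 x) * (1 - normc x ^+ 2) <= M * (1 - normc (G1 x) ^+ 2).
  move=> hx; have s0 := sq_lt1 (G1b x hx).
  have -> : normc (dc G1 x) = h (T x) * normc (dc T x) * (1 - normc (G1 x) ^+ 2).
    by rewrite -isoG// divfK// gt_eqF.
  rewrite mulrAC ler_pM2r// -(ler_pM2r r0); apply: le_trans (hle _ (T_K x (rhou x hx))).
  by rewrite -isoT; [rewrite -!mulrA [X in _ * (_ * X)]mulrC|exact: rhou].
have hM : normc (dc G1 0) = M.
  have := isoG 0 d0; rewrite G10 normc0 expr0n /= subr0 divr1 => ->.
  have := isoT 0 u0; rewrite normc0 expr0n /= subr0 mulr1 T0 => e.
  rewrite /M /phi -e; field; rewrite gt_eqF//.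
have := schwarz_local rho0 _ hG1 G10 M0 hfin hM; rewrite ge_min lexx orbT => /(_ isT).
by rewrite leNgt M1.
Qed.

End Ahlfors.

(** * The sphere punctured at a finite point *)
Section Punctured.
Context {R : realType}.
Notation C := (Cplx R).
Variable p : C.
Implicit Types (u z : C) (w : sphere R).

(** Together with [to_plane], the coordinate on the sphere punctured at [p] in which the
puncture is at infinity. *)
Definition of_plane u : sphere R := if u == 0 then infty else fin (p + u^-1).
Definition to_plane w : C := if w is Some z then (z - p)^-1 else 0.

Lemma of_planeK u : to_plane (of_plane u) = u.
Proof. by rewrite /of_plane; have [->|u0] := eqVneq u 0 => //=; rewrite addrC addKr invrK. Qed.

Lemma to_planeK w : w <> fin p -> of_plane (to_plane w) = w.
Proof.
case: w => [z|] hz; rewrite /of_plane /to_plane ?eqxx//.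
have zp : z - p != 0 by rewrite subr_eq0; apply/eqP => e; apply: hz; rewrite e.
by rewrite invr_eq0 (negPf zp) invrK addrC subrK.
Qed.

Lemma of_plane_neq u : of_plane u <> fin p.
Proof.
rewrite /of_plane; have [//|u0] := eqVneq u 0; case => /eqP.
by rewrite -subr_eq0 addrC addKr invr_eq0 (negPf u0).
Qed.

Lemma compact_bounded (K : set C) : compact K -> exists2 M : R, 0 <= M & forall z, K z -> normc z <= M.
Proof.
move=> cK; have [[z0 Kz0]|] := pselect (K !=set0); last first.
  by move=> h; exists 0 => // z Kz; case: h; exists z.
have h : {within K, continuous (fun z : C => normc z)} by apply: continuous_subspaceT; exact: continuous_normc.
have [z1 _ hz1] := compact_EVT_max (ex_intro _ z0 Kz0) cK h.
by exists (normc z1); [exact: normc_ge0|move=> z Kz; apply: hz1; rewrite inE].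
Qed.

Lemma nbhs_infty (B : set (sphere R)) :
  nbhs (infty : sphere R) B <-> B infty /\ exists M : R, forall z, M < normc z -> B (fin z).
Proof.
split.
  move=> [D [cD _] hB]; split; first by apply: hB; right.
  have [M _ hM] := compact_bounded cD; exists M => z hz; apply: hB; left; exists z => // Dz.
  by have := hM _ Dz; rewrite leNgt hz.
move=> [B0 [M hM]]; exists [set z : C | normc (z - 0) <= M].
  split; first exact: disk_compact.
  have h : closed [set z : C | normc z <= M] by apply: closed_comp_le; exact: continuous_normc.
  by rewrite (_ : [set z : C | _] = [set z : C | normc z <= M])//; apply/seteqP; split => z /=; rewrite subr0.
move=> [z|] [|//]; last by move=> _; exact: B0.
  by move=> [y hy [<-]]; apply: hM; rewrite ltNge; apply/negP; move: hy => /=; rewrite subr0.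
Qed.

Lemma of_plane_cont u : {for u, continuous of_plane}.
Proof.
have [->|u0] := eqVneq u 0.
  move=> B; rewrite {1}/of_plane eqxx => /nbhs_infty[B0 [M hM]].
  apply/nbhsCP; pose N := `|M| + normc p + 1.
  have N0 : 0 < N by rewrite ltr_wpDl// addr_ge0// normc_ge0.
  exists N^-1; first by rewrite invr_gt0.
  move=> v; rewrite subr0 /= /of_plane; have [->//|v0] := eqVneq v 0 => hv; apply: hM.
  have nv : 0 < normc v by rewrite normc_gt0.
  have h1 : N < normc v^-1 by rewrite normcV -(invrK N) ltf_pV2// posrE// invr_gt0.
  have h2 := normcB_ge v^-1 (- p); rewrite normcN opprK addrC in h2.
  have h3 := ler_norm M; rewrite [p + _]addrC.
  by apply: lt_le_trans h2; move: h1 h3; rewrite /N; move: (normc v^-1) (normc p) (`|M|) => x y m; lra.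
have h : cts (fun v => p + v^-1) u by apply: contD; [exact: cont_cst|apply: contV => //; exact: cont_id].
move=> B; rewrite {1}/of_plane (negPf u0) => hB.
have h1 : \forall v \near u, B (fin (p + v^-1)) := cts_nbhs h hB.
have h2 := near_neq u0.
by apply: (filterS2 _ _ h1 h2) => v Bv v0; rewrite /= /of_plane (negPf v0).
Qed.

Lemma to_plane_cont w : w <> fin p -> {for w, continuous to_plane}.
Proof.
case: w => [z|] hz.
  have zp : z - p != 0 by rewrite subr_eq0; apply/eqP => e; apply: hz; rewrite e.
  have h : cts (fun v => (v - p)^-1) z by apply: contV => //; apply: contB; [exact: cont_id|exact: cont_cst].
  move=> B hB; exact: (cts_nbhs h hB).
move=> B /nbhsCE[e e0 he]; apply/nbhs_infty; split; first by apply: he; rewrite subr0 normc0.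
exists (normc p + e^-1) => z lz; apply: he; rewrite /= subr0 normcV.
have h := normcB_ge z p; have e10 : 0 < e^-1 by rewrite invr_gt0.
have h1 : e^-1 < normc (z - p) by lra.
by rewrite -(invrK e) ltf_pV2// posrE// (lt_trans e10).
Qed.

Lemma neq_p_near w : w <> fin p -> \forall w' \near w, w' <> fin p.
Proof.
case: w => [z|] hz.
  have zp : z != p by apply/eqP => e; apply: hz; rewrite e.
  have h : \forall x \near z, fin x <> fin p.
    by apply: filterS (near_neq zp) => x /eqP xp [].
  exact: h.
apply/nbhs_infty; split=> //; exists (normc p) => z h [e]; by rewrite e ltxx in h.
Qed.


(** [to_plane] in terms of the standard coordinate at [w]; [smap] is its inverse. *)
Definition tmap w (v : C) : C := if w is Some _ then (v - p)^-1 else v / (1 - p * v).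
Definition smap w (u : C) : C := if w is Some _ then p + u^-1 else u / (1 + p * u).

End Punctured.

Section Component.
Context {R : realType}.
Notation C := (Cplx R).
Variables (Omega K : set (sphere R)) (p : C).
Hypotheses (hOmega : hyperbolic_domain Omega) (hK : is_component (~` Omega) K)
  (hKiso : isolated_component Omega K) (hKnd : nondegenerate_set K) (Kp : K (fin p)).

Let oO : open Omega. Proof. by case: hOmega. Qed.

Lemma component_sub : K `<=` ~` Omega.
Proof. by case: hK => x _ ->; exact: connected_component_sub. Qed.

Lemma component_closed_sphere : closed K.
Proof. by case: hK => x _ ->; apply: component_closed; exact: open_closedC. Qed.

Lemma component_connected_sphere : connected K.
Proof. by case: hK => x _ ->; exact: component_connected. Qed.

Lemma domain_neq_p w : Omega w -> w <> fin p.
Proof. by move=> Ow e; apply: (component_sub Kp); rewrite -e. Qed.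

Definition plane_hull : set C := [set u | K (of_plane p u)].
Definition plane_dom : set C := [set u | Omega (of_plane p u)].
Definition plane_rest : set C := [set u | ~ Omega (of_plane p u) /\ ~ K (of_plane p u)].
Local Notation A := plane_hull.
Local Notation W := plane_dom.

Lemma plane_hull_closed : closed A.
Proof. by apply: closed_comp component_closed_sphere => u _; exact: of_plane_cont. Qed.

Lemma plane_dom_connected : connected W.
Proof.
have -> : W = to_plane p @` Omega.
  apply/seteqP; split => u /=; first by exists (of_plane p u) => //; rewrite of_planeK.
  by move=> [w Ow <-]; rewrite /plane_dom /= to_planeK//; exact: domain_neq_p.
apply: connected_continuous_connected; first by case: hOmega.
apply: continuous_in_subspaceT => w; rewrite inE => Ow; apply: to_plane_cont; exact: domain_neq_p.
Qed.

(** A bounded separated part of the hull would be a part of [K] separated from the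
rest: it stays away from [p], and [K] is connected. *)
Lemma plane_hull_noisle : noisle A.
Proof.
move=> B B' cB cB' [M hM] AB disj z0 Az0 Bz0.
pose E b : set (sphere R) := if b then [set w | K w /\ (w = fin p \/ B' (to_plane p w))]
  else [set w | [/\ K w, w <> fin p & B (to_plane p w)]].
have KA w : K w -> w <> fin p -> A (to_plane p w) by move=> Kw wp; rewrite /plane_hull /= to_planeK.
have KC := component_connected_sphere.
have hE := (@connectedP (sphere R) K).1 KC; apply: (hE E); split.
- move=> [|]; first by exists (fin p); split => //; left.
  by exists (of_plane p z0); split => //; [exact: of_plane_neq|rewrite of_planeK].
- apply/seteqP; split => w.
    move=> Kw; have [->|wp] := pselect (w = fin p); first by right; split => //; left.
    by have [h|h] := AB _ (KA _ Kw wp); [left|right; split => //; right].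
  by move=> [[]|[]].
have pull w (D : set C) : w <> fin p -> closed D -> ~ D (to_plane p w) -> \forall x \near w, ~ D (to_plane p x).
  move=> wp cD nD; have h : nbhs (to_plane p w) (~` D) by apply: open_nbhs_nbhs; split => //; exact: closed_openC.
  exact: (to_plane_cont wp h).
split; apply/seteqP; split=> w //.
- move=> [hcl [Kw hw]].
  have hB : \forall x \near w, ~ (x <> fin p /\ B (to_plane p x)).
    have [e|wp] := pselect (w = fin p).
      rewrite e; have M0 : 0 < (`|M| + 1)^-1 by rewrite invr_gt0 ltr_wpDl.
      have h : \forall x \near p, ~ (fin x <> fin p /\ B (x - p)^-1).
        apply: filterS (nbhsC_disk p M0) => x hx [xp Bx].
        have := hM _ Bx; rewrite normcV => hle.
        have xp0 : 0 < normc (x - p).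
          by rewrite normc_gt0 subr_eq0; apply/eqP => e'; apply: xp; rewrite e'.
        have : `|M| + 1 < (normc (x - p))^-1 by rewrite -(invrK (_ + 1)) ltf_pV2// posrE.
        by have := ler_norm M; lra.
      exact: h.
    have hB' : B' (to_plane p w) by case: hw.
    have nB : ~ B (to_plane p w) by move=> Bw; exact: (disj _ (KA _ Kw wp) Bw hB').
    by apply: filterS (pull _ _ wp cB nB) => x h [_].
  by have [x [[Kx xp Bx] hx]] := hcl _ hB; exact: hx.
- move=> [[Kw wp Bw] hcl].
  have nB : ~ B' (to_plane p w) by exact: (disj _ (KA _ Kw wp) Bw).
  have h1 := pull _ _ wp cB' nB; have h2 := neq_p_near wp.
  have [x [[Kx hx] [hx1 hx2]]] := hcl _ (filterI h1 h2).
  by case: hx.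
Qed.

(** Since [K] is isolated, no point of [K], in particular not [p], is a limit of
the other complementary points; avoiding [p] means being bounded in the plane. *)
Lemma rest_compact : exists Y : set C, [/\ compact Y, plane_rest `<=` Y & forall u, Y u -> ~ A u].
Proof.
have nK w : K w -> exists2 B, nbhs w B & forall x, B x -> Omega x \/ K x.
  move=> Kw; apply: contrapT => hno.
  have : (K `&` closure (~` (Omega `|` K))) w.
    split => // B hB; apply: contrapT => hE; apply: hno; exists B => // x Bx.
    by apply: contrapT => nx; apply: hE; exists x.
  by rewrite hKiso.
have [B hB hBO] := nK _ Kp.
have [e e0 he] := nbhsCE (hB : nbhs p (fun x => B (fin x))).
have restB u : plane_rest u -> normc u <= e^-1.
  move=> [nO nKu]; rewrite leNgt; apply/negP => hu.
  have u0 : u != 0 by rewrite -normc_gt0 (lt_trans _ hu)// invr_gt0.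
  have : B (of_plane p u).
    rewrite /of_plane (negPf u0); apply: he; rewrite addrC addKr normcV -(invrK e) ltf_pV2//.
      by rewrite posrE normc_gt0.
    by rewrite posrE invr_gt0.
  by move=> /hBO[].
have hA u : A u -> \forall x \near u, ~ plane_rest x.
  move=> Au; have [D hD hDO] := nK _ Au.
  have h : \forall x \near u, D (of_plane p x) := of_plane_cont hD.
  by apply: filterS h => x /hDO hx [h1 h2]; case: hx.
exists (closure plane_rest); split.
- apply: (subclosed_compact _ (@disk_compact R 0 e^-1)); first exact: closed_closure.
  have -> : [set z : C | normc (z - 0) <= e^-1] = [set z : C | normc z <= e^-1].
    by apply/seteqP; split => z /=; rewrite subr0.
  have hc : closed [set z : C | normc z <= e^-1] by apply: closed_comp_le; exact: continuous_normc.
  by move=> u hu; apply: hc; apply: (closure_subset restB).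
- exact: subset_closure.
- move=> u hu Au; have [x [h1 h2]] := hu _ (hA _ Au); exact: h2.
Qed.

(** The complementary points inside [U] form a compact set, which [psi] maps into a
smaller disk. Points of [U] that tend to infinity leave the images under [chi]
of all smaller disks. *)
Lemma plane_riemann : exists (U : set C) (psi chi : C -> C),
  [/\ open U, W `<=` U, hol U psi & hol (@udisk R) chi] /\
  [/\ (forall u, U u -> udisk (psi u) /\ chi (psi u) = u),
      (forall w, udisk w -> U (chi w) /\ psi (chi w) = w),
      (exists2 r, r < 1 & forall w, udisk w -> r < normc w -> W (chi w)) &
      (forall r, r < 1 -> exists M : R, forall u, U u -> M < normc u -> r < normc (psi u))].
Proof.
have [w0 Ow0] : Omega !=set0 by case: hOmega.
pose u0 := to_plane p w0; have Wu0 : W u0 by rewrite /plane_dom /= to_planeK//; exact: domain_neq_p.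
have WA : W `<=` ~` A by move=> u Wu Au; exact: (component_sub Au).
pose U := connected_component (~` A) u0.
have oA : open (~` A) by apply: closed_openC; exact: plane_hull_closed.
have oU : open U by exact: component_open.
have cU : connected U by exact: component_connected.
have UA : U `<=` ~` A by exact: connected_component_sub.
have WU : W `<=` U by apply: connected_component_max => //; exact: plane_dom_connected.
have [a Aa] : exists a, A a.
  apply: contrapT => hno; apply: (@hKnd (fin p)); apply/seteqP; split => [w Kw|w -> //].
  apply: contrapT => wp; apply: hno; exists (to_plane p w); rewrite /plane_hull /= to_planeK//.
have [e e0 he] := (openCP U).1 oU _ (WU _ Wu0).
pose u1 := u0 + (e / 2)%:C%C.
have n01 : normc (u1 - u0) = e / 2.
  by rewrite /u1 addrC addKr normc_real ger0_norm// divr_ge0// ltW.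
have Uu1 : U u1 by apply: he; rewrite n01 ltr_pdivrMr// ltr_pMr// ltr1n.
have u10 : u1 != u0 by rewrite -subr_eq0 -normc_gt0 n01 divr_gt0.
have nUa : ~ U a by move=> /UA.
have [psi [hpsi ipsi opsi]] := riemann_mapping oU cU (component_square_roots plane_hull_closed plane_hull_noisle) (WU _ Wu0) Uu1 u10 nUa.
have [_ [chi [hchi chi1 chi2]]] := hol_inverse oU hpsi ipsi.
rewrite opsi in hchi chi2.
have psiD u : U u -> udisk (psi u) by move=> Uu; rewrite -opsi; exists u.
exists U, psi, chi; split; first by [].
have [Y [cY hY YA]] := rest_compact.
split => //.
- by move=> u Uu; split; [exact: psiD|exact: chi1].
- pose Z := [set w : C | udisk w /\ ~ W (chi w)].
  (* the part of [Y] in [U] is compact since the other components are open *)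
  pose YU := Y `&` U.
  have cYU : compact YU.
    have -> : YU = Y `&` ~` (~` A `\` U).
      apply/seteqP; split => u [Yu h]; split=> //; first by move=> [].
      by apply: contrapT => nU; apply: h; split => //; exact: YA.
    apply: compact_closedI => //; apply: open_closedC; exact: component_rel_closed.
  have [[y0 y0h]|nY] := pselect (YU !=set0); last first.
    exists 0 => // w hw _; apply: contrapT => nW; apply: nY; exists (chi w).
    have [Uc _] := chi2 _ hw; split => //; apply: hY; split => // Ac; exact: (UA _ Uc).
  have hc : {within YU, continuous (fun u => normc (psi u))}.
    apply: continuous_in_subspaceT => u; rewrite inE => -[_ Uu].
    have [h] := hol_cont hpsi Uu; exact: (cvg_comp _ _ h (@continuous_normc R _)).
  have [y1 + hy1] := compact_EVT_max (ex_intro _ y0 y0h) cYU hc.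
  rewrite inE => -[_ Uy1].
  exists (normc (psi y1)); first exact: psiD.
  move=> w hw lt; apply: contrapT => nW; have [Uc e1] := chi2 _ hw.
  have : normc (psi (chi w)) <= normc (psi y1).
    apply: hy1; rewrite inE; split => //; apply: hY; split => // Ac; exact: (UA _ Uc).
  by rewrite e1 leNgt lt.
- move=> r r1.
  have hc : {within [set z : C | normc (z - 0) <= r], continuous (fun u => normc (chi u))}.
    apply: continuous_in_subspaceT => u; rewrite inE /= subr0 => hu.
    have Du : udisk u by exact: le_lt_trans hu r1.
    have [h] := hol_cont hchi Du; exact: (cvg_comp _ _ h (@continuous_normc R _)).
  have [[y0 y0h]|nY] := pselect ([set z : C | normc (z - 0) <= r] !=set0); last first.
    exists 0 => u Uu _; rewrite ltNge; apply/negP => hle; apply: nY; exists (psi u).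
    by rewrite /= subr0.
  have [y1 _ hy1] := compact_EVT_max (ex_intro _ y0 y0h) (@disk_compact R 0 r) hc.
  exists (normc (chi y1)) => u Uu hM; rewrite ltNge; apply/negP => hle.
  have : normc (chi (psi u)) <= normc (chi y1) by apply: hy1; rewrite inE /= subr0.
  by rewrite chi1// leNgt hM.
Qed.

End Component.

(** * Continuously differentiable curves *)
Section Curves.
Context {R : realType}.
Notation C := (Cplx R).
Implicit Types (g : R -> C) (f : C -> C) (t s : R).

Definition vel g t : C := (derive1 (re_part g) t +i* derive1 (im_part g) t)%C.

Lemma rder_near g h t v : (\forall s \near t, g s = h s) -> rder g t v -> rder h t v.
Proof.
move=> e hg eps eps0; have [d d0 hd] := hg eps eps0.
have [d' /= d'0 hd'] := (nbhs_ballP _ _).1 e.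
exists (Num.min d d'); first by rewrite lt_min d0.
move=> s; rewrite lt_min => /andP[h1 h2].
have -> : h s = g s by rewrite hd'//= /ball /= distrC.
have -> : h t = g t by rewrite hd'//=; exact: ballxx.
exact: hd.
Qed.

Lemma C1_of_rder g v t : (\forall s \near t, rder g s (v s)) -> ccts v t -> C1_at g t /\ vel g t = v t.
Proof.
move=> h cv.
have hs s : rder g s (v s) -> is_derive s 1 (re_part g) (complex.Re (v s)) /\ is_derive s 1 (im_part g) (complex.Im (v s)).
  by move=> /rder_is_derive.
have e1 s : rder g s (v s) -> complex.Re (v s) = derive1 (re_part g) s.
  by move=> /hs[h1 _]; rewrite derive1E derive_val.
have e2 s : rder g s (v s) -> complex.Im (v s) = derive1 (im_part g) s.
  by move=> /hs[_ h1]; rewrite derive1E derive_val.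
have ht := nbhs_singleton h.
have [c1] := ccts_Re cv; have [c2] := ccts_Im cv.
split; last by rewrite /vel -e1// -e2//; case: (v t).
split.
- by apply: filterS h => s /hs[h1 h2]; split; exact: ex_derive.
- rewrite /prop_for /continuous_at -e1//.
  by apply: cvg_trans c1; apply: near_eq_cvg; apply: filterS h => s /e1.
- rewrite /prop_for /continuous_at -e2//.
  by apply: cvg_trans c2; apply: near_eq_cvg; apply: filterS h => s /e2.
Qed.

Lemma C1_vel g t : C1_at g t -> (\forall s \near t, rder g s (vel g s)) /\ ccts (vel g) t.
Proof.
move=> [h c1 c2]; split; last by apply: ccts_pair; split.
apply: filterS h => s [h1 h2]; apply/rder_is_derive; split.
  by rewrite /= derive1E; exact: derivableP.
by rewrite /= derive1E; exact: derivableP.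
Qed.

Lemma C1_rder g t : C1_at g t -> rder g t (vel g t).
Proof. by move=> /C1_vel[/nbhs_singleton]. Qed.

Lemma C1_near g h t : (\forall s \near t, g s = h s) -> C1_at g t -> C1_at h t /\ vel h t = vel g t.
Proof.
move=> e /C1_vel[h1 h2]; apply: C1_of_rder h2.
apply: filterS2 (nbhs_interior e) h1 => s es; exact: rder_near.
Qed.

Lemma C1_comp g f t : (\forall z \near g t, exists l, cder f z l) -> C1_at g t ->
  C1_at (fun s => f (g s)) t /\ vel (fun s => f (g s)) t = dc f (g t) * vel g t.
Proof.
move=> /nbhsCE[r r0 hf] /[dup] /C1_rder /rder_ccts cg /C1_vel[h1 h2].
have hh : hol (disk (g t) r) f by [].
have hg : disk (g t) r (g t) by rewrite /disk /= subrr normc0.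
have hcd := hol_fc (hol_dc_hol (@open_disk R (g t) r) hh) hg.
apply: (@C1_of_rder _ (fun s => dc f (g s) * vel g s)).
  have [cg'] := cg; have h3 : \forall s \near t, disk (g t) r (g s) := cg' _ (disk_near hg).
  apply: filterS2 h3 h1 => s ds; apply: rder_cder; exact: (hol_dc hh).
apply: cctsM => //; exact: ccts_comp cg hcd.
Qed.

Lemma C1_affine (a b : C) t : C1_at (fun s => a + s%:C%C * b) t /\ vel (fun s => a + s%:C%C * b) t = b.
Proof.
apply: (@C1_of_rder _ (fun _ => b)); last exact: ccts_cst.
by have h := @nearW _ (nbhs t) _ _ (fun s => rder_affine a b s); exact: h.
Qed.

Lemma ftc (f F : R -> R) : rcon 0 1 f -> (forall t, 0 <= t <= 1 -> is_derive t 1 F (f t)) ->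
  rint 0 1 f = F 1 - F 0.
Proof.
move=> cf dF.
have hc t : 0 <= t <= 1 -> {for t, continuous F}.
  by move=> /dF h; apply: differentiable_continuous; apply/derivable1_diffP; exact: ex_derive.
rewrite /rint /Rintegral (@continuous_FTC2 _ f F 0 1)//.
- by apply: continuous_in_subspaceT => t; rewrite inE /= in_itv /= => /cf[].
- split.
  + by move=> t; rewrite in_itv /= => /andP[h1 h2]; have h := dF t; apply: ex_derive; apply: h; rewrite !ltW.
  + by apply: cvg_at_right_filter; apply: hc; rewrite lexx ler01.
  + by apply: cvg_at_left_filter; apply: hc; rewrite lexx ler01.
- move=> t; rewrite in_itv /= => /andP[h1 h2]; rewrite derive1E.
  have h : is_derive t 1 F (f t) by apply: dF; rewrite !ltW.
  exact: derive_val.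
Qed.

End Curves.

(** * Holomorphic maps into and out of the punctured sphere *)
Section Charts.
Context {R : realType}.
Notation C := (Cplx R).
Variable p : C.
Implicit Types (u v z : C) (w : sphere R).

Definition dtmap w v : C := if w is Some _ then - 1 / (v - p) ^+ 2 else 1 / (1 - p * v) ^+ 2.
(** The factor between the standard coordinate at [w] and the plane coordinate, for
densities and for speeds of curves. *)
Definition coord_factor w : R := normc (dtmap w (sph_coord w w)).

Lemma to_plane_coord w0 : w0 <> fin p -> \forall w \near w0, to_plane p w = tmap p w0 (sph_coord w0 w).
Proof.
case: w0 => [a|] hw.
  have h : \forall x \near a, to_plane p (fin x) = tmap p (fin a) (sph_coord (fin a) (fin x)) by apply: nearCW.
  exact: h.
apply/nbhs_infty; split; first by rewrite /= mul0r.
exists (normc p) => z hz /=.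
have z0 : z != 0 by rewrite -normc_gt0; apply: le_lt_trans hz; exact: normc_ge0.
have -> : 1 - p / z = (z - p) / z by rewrite mulrBl divff.
by rewrite invf_div mulKf.
Qed.

Lemma to_plane_chart w v : to_plane p (sph_chart w v) = tmap p w v.
Proof.
case: w => [a|]//=; have [->|v0] := eqVneq v 0; first by rewrite /= mul0r.
by rewrite /= -[v / _]invf_div mulrBl mul1r mulfK.
Qed.

Lemma tmap_coord w : tmap p w (sph_coord w w) = to_plane p w.
Proof. by case: w => [a|]//=; rewrite mul0r. Qed.

Lemma cder_tmap w : w <> fin p -> \forall v \near sph_coord w w, cder (tmap p w) v (dtmap w v).
Proof.
case: w => [a|] hw /=.
  have c : cts (fun v => v - p) a by apply: contB; [exact: cont_id|exact: cont_cst].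
  have ap : a - p != 0 by rewrite subr_eq0; apply/eqP => e; apply: hw; rewrite e.
  apply: filterS (cont_neq0 c ap) => v vp.
  have := cderV (cderB (cder_id v) (cder_cst p v)) vp.
  by rewrite subr0.
have c : cts (fun v => 1 - p * v) 0.
  by apply: contB; [exact: cont_cst|apply: contM; [exact: cont_cst|exact: cont_id]].
have c0 : 1 - p * 0 != 0 by rewrite mulr0 subr0 oner_neq0.
apply: filterS (cont_neq0 c c0) => v vp.
have := cder_div (cder_id v) (cderB (cder_cst 1 v) (cderM (cder_cst p v) (cder_id v))) vp.
by have -> : 1 * (1 - p * v) - v * (0 - (0 * v + p * 1)) = 1 by ring.
Qed.

Lemma coord_factor_gt0 w : w <> fin p -> 0 < coord_factor w.
Proof.
case: w => [a|] hw; rewrite /coord_factor normc_gt0 /=.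
  have ap : a - p != 0 by rewrite subr_eq0; apply/eqP => e; apply: hw; rewrite e.
  by rewrite mulf_neq0// ?oppr_eq0 ?oner_neq0// invr_eq0 expf_neq0.
by rewrite mulr0 subr0 expr1n divr1 oner_neq0.
Qed.

Lemma coord_of_plane w : w <> fin p -> \forall u \near to_plane p w, sph_coord w (of_plane p u) = smap p w u.
Proof.
case: w => [a|] hw /=.
  have ap : (a - p)^-1 != 0 by rewrite invr_eq0 subr_eq0; apply/eqP => e; apply: hw; rewrite e.
  by apply: filterS (near_neq ap) => u u0; rewrite /of_plane (negPf u0).
apply: nearCW => u; rewrite /of_plane; have [->|u0] := eqVneq u 0; rewrite /= ?mul0r//.
by rewrite -[u / _]invf_div mulrDl mul1r mulfK// addrC.
Qed.

Lemma cder_smap w : w <> fin p -> \forall u \near to_plane p w, exists l, cder (smap p w) u l.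
Proof.
case: w => [a|] hw /=.
  have ap : (a - p)^-1 != 0 by rewrite invr_eq0 subr_eq0; apply/eqP => e; apply: hw; rewrite e.
  apply: filterS (near_neq ap) => u u0; eexists.
  by apply: cderD; [exact: cder_cst|apply: cderV => //; exact: cder_id].
have c : cts (fun u => 1 + p * u) 0.
  by apply: contD; [exact: cont_cst|apply: contM; [exact: cont_cst|exact: cont_id]].
have c0 : 1 + p * 0 != 0 by rewrite mulr0 addr0 oner_neq0.
apply: filterS (cont_neq0 c c0) => u u0; eexists; apply: cder_div => //; first exact: cder_id.
by apply: cderD; [exact: cder_cst|apply: cderM; [exact: cder_cst|exact: cder_id]].
Qed.

Lemma arc_to_plane (G : R -> sphere R) t : G t <> fin p -> {for t, continuous G} ->
  C1_at (sph_coord (G t) \o G) t ->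
  C1_at (fun s => to_plane p (G s)) t /\ normc (vel (fun s => to_plane p (G s)) t) = coord_factor (G t) * normc (curve_deriv G t).
Proof.
move=> hG cG hC.
have h1 : \forall s \near t, tmap p (G t) (sph_coord (G t) (G s)) = to_plane p (G s).
  by have h : \forall s \near t, _ := cG _ (to_plane_coord hG); apply: filterS h => s ->.
have h2 := cder_tmap hG.
have h2' : \forall v \near sph_coord (G t) (G t), exists l, cder (tmap p (G t)) v l.
  by apply: filterS h2 => v hv; eexists; exact: hv.
have [h3 e3] := C1_comp (g := sph_coord (G t) \o G) h2' hC.
have [h4 e4] := C1_near h1 h3.
split => //; rewrite e4 e3 normcM /coord_factor; congr (_ * _); congr normc.
exact: dcE (nbhs_singleton h2).
Qed.

Lemma arc_of_plane (g : R -> C) t : C1_at g t ->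
  [/\ {for t, continuous (fun s => of_plane p (g s))}, C1_at (sph_coord (of_plane p (g t)) \o (fun s => of_plane p (g s))) t &
      normc (vel g t) = coord_factor (of_plane p (g t)) * normc (curve_deriv (fun s => of_plane p (g s)) t)].
Proof.
move=> hC; set w := of_plane p (g t); have hw : w <> fin p by exact: of_plane_neq.
have ew : to_plane p w = g t by rewrite /w of_planeK.
have [cg] := rder_ccts (C1_rder hC).
have cG : {for t, continuous (fun s => of_plane p (g s))}.
  by move=> B /(@of_plane_cont _ p _) /cg.
have hn : \forall u \near g t, exists l, cder (smap p w) u l by rewrite -ew; exact: cder_smap.
have [h3 e3] := C1_comp hn hC.
have h1 : \forall s \near t, smap p w (g s) = (sph_coord w \o (fun s => of_plane p (g s))) s.
  have h : \forall u \near g t, sph_coord w (of_plane p u) = smap p w u by rewrite -ew; exact: coord_of_plane.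
  by have h' : \forall s \near t, _ := cg _ h; apply: filterS h' => s /= ->.
have [h4 e4] := C1_near h1 h3.
split => //.
have [h5 <-] := @arc_to_plane (fun s => of_plane p (g s)) t hw cG h4.
by have -> : (fun s => to_plane p (of_plane p (g s))) = g by apply/funext => s; rewrite of_planeK.
Qed.

Lemma holomorphic_of_plane (Omega : set (sphere R)) (F : C -> C) w :
  Omega w -> w <> fin p -> (exists l, cder F (to_plane p w) l) ->
  derivable ((F \o to_plane p) \o sph_chart w) (sph_coord w w) 1 /\
  normc (cderiv (F \o to_plane p) w) = normc (dc F (to_plane p w)) * coord_factor w.
Proof.
move=> Ow wp [l hl].
have h2 := nbhs_singleton (cder_tmap wp).
have h3 : cder F (tmap p w (sph_coord w w)) l by rewrite tmap_coord.
have h4 : cder ((F \o to_plane p) \o sph_chart w) (sph_coord w w) (l * dtmap w (sph_coord w w)).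
  by apply: cder_ext (cder_comp h2 h3) => v; rewrite /= to_plane_chart.
have h5 := (cder_is_derive _ _ _).1 h4.
split; first exact: ex_derive.
by rewrite /cderiv derive_val normcM (dcE hl).
Qed.

Lemma plane_of_holomorphic (pi : C -> sphere R) z : pi z <> fin p -> {for z, continuous pi} ->
  derivable (sph_coord (pi z) \o pi) z 1 ->
  exists2 l, cder (to_plane p \o pi) z l & normc l = coord_factor (pi z) * normc (sphere_cderiv pi z).
Proof.
move=> hp cp /derivableP /cder_is_derive h1.
have h2 := nbhs_singleton (cder_tmap hp).
exists (dtmap (pi z) (sph_coord (pi z) (pi z)) * sphere_cderiv pi z); last by rewrite normcM.
apply: cder_near (cder_comp h1 h2).
by have h : \forall x \near z, _ := cp _ (to_plane_coord hp); apply: filterS h => x /= ->.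
Qed.

End Charts.

(** * The hyperbolic density in the plane *)
Section PlaneDensity.
Context {R : realType}.
Notation C := (Cplx R).

(** The hyperbolic density in the plane coordinate together with the covering [q]
that defines it. Of the covering property only the local inverses are kept. *)
Record plane_density (W : set C) (lam : C -> R) (q : C -> C) : Prop := PlaneDensity {
  pd_hol : hol (@udisk R) q;
  pd_in : forall v, udisk v -> W (q v);
  pd_onto : forall u, W u -> exists2 v, udisk v & q v = u;
  pd_eq : forall v, udisk v -> lam (q v) * normc (dc q v) = disk_density v;
  pd_inv : forall u, W u -> exists r : R, exists2 G : C -> C, 0 < r &
     [/\ hol (disk u r) G, (forall x, disk u r x -> udisk (G x)) & (forall x, disk u r x -> q (G x) = x)] }.

Variables (W : set C) (lam : C -> R) (q : C -> C).
Hypothesis H : plane_density W lam q.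

Lemma udisk_near (x : C) : udisk x -> \forall y \near x, udisk y.
Proof.
move=> hx; have h : disk 0 1 x by rewrite /disk /= subr0.
by apply: filterS (disk_near h) => y; rewrite /disk /udisk /= subr0.
Qed.

Lemma rcts_disk_density (y : R -> C) t : ccts y t -> udisk (y t) -> rcts (fun s => disk_density (y s)) t.
Proof.
move=> cy hy; have n := sq_lt1 hy.
have [c] := rctsB (rcts_cst 1 t) (rctsM (ccts_normc cy) (ccts_normc cy)).
have e s : disk_density (y s) = (1 - normc (y s) * normc (y s))^-1 by rewrite /disk_density expr2.
have n0 : 1 - normc (y t) * normc (y t) != 0 by rewrite -expr2 gt_eqF.
by split; rewrite e; under eq_fun do rewrite e; exact: (cvgV n0 c).
Qed.

Lemma disk_density_gt0 (v : C) : udisk v -> 0 < disk_density v.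
Proof. by move=> hv; rewrite /disk_density invr_gt0 sq_lt1. Qed.

Lemma dq_neq0 v : udisk v -> 0 < normc (dc q v).
Proof.
move=> hv; rewrite lt_neqAle normc_ge0 andbT eq_sym; apply/eqP => e.
by have := disk_density_gt0 hv; rewrite -(pd_eq H hv) e mulr0 ltxx.
Qed.

Lemma lam_gt0 u : W u -> 0 < lam u.
Proof.
move=> /(pd_onto H)[v hv <-]; have := disk_density_gt0 hv.
by rewrite -(pd_eq H hv) pmulr_lgt0// dq_neq0.
Qed.

Lemma lam_pullback u : W u -> hyp_pullback lam u.
Proof.
move=> /(pd_inv H)[r [G r0 [hG GD qG]]]; exists r, G => //; split => // w hw.
have Gw := GD _ hw.
have e : dc q (G w) * dc G w = 1.
  have h := cder_comp (hol_dc hG hw) (hol_dc (pd_hol H) Gw).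
  have h2 : cder (fun x => q (G x)) w 1.
    by apply: cder_near (cder_id w); apply: filterS (disk_near hw) => x /qG ->.
  exact: cder_uniq h h2.
have := pd_eq H Gw; rewrite qG// /disk_density => e1.
rewrite mulrC -e1 -mulrA -normcM e normc1 mulr1//.
Qed.

Lemma lam_cont u : W u -> {for u, continuous lam}.
Proof. by move=> /lam_pullback /hyp_pullback_cont. Qed.

(** Schwarz--Pick for maps from the disk into [W]: local inverses of the covering
turn the pulled-back density into the kind to which [ahlfors] applies. *)
Lemma lam_upper (k : C -> C) z : hol (@udisk R) k -> (forall z, udisk z -> W (k z)) -> udisk z ->
  lam (k z) * normc (dc k z) <= disk_density z.
Proof.
move=> hk kW hz.
have hh x : udisk x -> hyp_pullback (fun z => lam (k z) * normc (dc k z)) x.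
  move=> hx; have [r [G r0 [hG GD hE]]] := lam_pullback (kW _ hx).
  have kx : disk (k x) r (k x) by rewrite /disk /= subrr normc0.
  have h1 := cts_nbhs (hol_fc hk hx) (disk_near kx).
  have h2 : \forall y \near x, udisk y by exact: udisk_near.
  have [d d0 hd] := nbhsCE (filterI h1 h2).
  have hc y : disk x d y -> cder (fun y => G (k y)) y (dc G (k y) * dc k y).
    by move=> /hd[Gy Dy]; apply: cder_comp; [exact: hol_dc hk Dy|exact: hol_dc hG Gy].
  exists d, (fun y => G (k y)) => //; split.
  - by move=> y hy; eexists; exact: hc.
  - by move=> y /hd[Gy Dy]; exact: GD.
  - by move=> y hy; rewrite (dcE (hc y hy)) normcM; have [Gy Dy] := hd _ hy; rewrite hE// mulrAC.
have := ahlfors hh hz.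
by rewrite /disk_density -[_^-1]mul1r ler_pdivlMr// sq_lt1.
Qed.

(** Schwarz--Pick for maps from [W] into the disk: composed with the covering they
become self-maps of the disk. *)
Lemma lam_lower (f : C -> C) u : hol W f -> (forall u, W u -> udisk (f u)) -> W u ->
  disk_density (f u) * normc (dc f u) <= lam u.
Proof.
move=> hf fD Wu; have [v hv e] := pd_onto H Wu; rewrite -e in Wu *.
have hc z : udisk z -> cder (fun y => f (q y)) z (dc f (q z) * dc q z).
  by move=> hz; apply: cder_comp; [exact: hol_dc (pd_hol H) hz|exact: hol_dc hf (pd_in H hz)].
have hh x : udisk x -> hyp_pullback (fun z => normc (dc f (q z) * dc q z) / (1 - normc (f (q z)) ^+ 2)) x.
  move=> hx; have h2 : \forall y \near x, udisk y by exact: udisk_near.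
  have [d d0 hd] := nbhsCE h2.
  exists d, (fun y => f (q y)) => //; split.
  - by move=> y /hd hy; eexists; exact: hc.
  - by move=> y /hd hy; apply: fD; exact: pd_in H _ hy.
  - by move=> y /hd hy; rewrite (dcE (hc y hy)).
have := ahlfors hh hv.
rewrite -ler_pdivlMr ?sq_lt1// div1r -[leRHS](pd_eq H hv) normcM mulrAC ler_pM2r ?dq_neq0//.
by rewrite mulrC.
Qed.

End PlaneDensity.

(** * Arcs and distances on the sphere *)
Section SphereDistance.
Context {R : realType}.
Notation C := (Cplx R).
Variables (Omega : set (sphere R)) (p : C).
Hypotheses (oO : open Omega) (hp : forall w, Omega w -> w <> fin p).
Local Notation lam := (hyperbolic_density Omega).

Definition plane_lam (l : sphere R -> R) (u : C) : R := l (of_plane p u) / coord_factor p (of_plane p u).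
Local Notation W := (plane_dom Omega p).

(** On a sheet the covering is injective, so it has a holomorphic inverse there. *)
Lemma covering_density (pi : C -> sphere R) (l : sphere R -> R) :
  holomorphic_universal_covering Omega pi ->
  (forall z, unit_disk z -> l (pi z) * normc (sphere_cderiv pi z) = disk_density z) ->
  plane_density W (plane_lam l) (to_plane p \o pi).
Proof.
move=> [hpi [cpi ipi cov]] hl.
have piO v : udisk v -> Omega (pi v) by move=> hv; rewrite -ipi; exists v.
have hq v : udisk v -> exists2 m, cder (to_plane p \o pi) v m & normc m = coord_factor p (pi v) * normc (sphere_cderiv pi v).
  by move=> hv; have [h1 h2] := hpi _ hv; apply: plane_of_holomorphic => //; exact: hp (piO _ hv).
have hhol : hol (@udisk R) (to_plane p \o pi) by move=> v /hq[m hm _]; exists m.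
split => //.
- by move=> v hv; rewrite /plane_dom /= to_planeK; [exact: piO|exact: hp (piO _ hv)].
- move=> u Wu; have : Omega (of_plane p u) by [].
  by rewrite -ipi => -[v hv e]; exists v => //=; rewrite e of_planeK.
- move=> v hv; have [m hm em] := hq _ hv; rewrite (dcE hm) em /plane_lam /= to_planeK; last exact: hp (piO _ hv).
  by rewrite -hl// mulrA divfK// gt_eqF// coord_factor_gt0//; exact: hp (piO _ hv).
- move=> u Wu; have [U [oU Uu UO [sheets [hs _ hV]]]] := cov _ (Wu : Omega (of_plane p u)).
  have : Omega (of_plane p u) by []; rewrite -ipi => -[v hv ev].
  have : (unit_disk `&` pi @^-1` U) v by split => //; rewrite /= ev.
  rewrite hs => -[V sV Vv].
  have [oV [g [h1 h2 h3 h4 _]]] := hV _ sV.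
  have VD x : V x -> udisk x.
    move=> Vx; have : (\bigcup_(V in sheets) V) x by exists V.
    by rewrite -hs => -[].
  have hVq : hol V (to_plane p \o pi) := hol_sub VD hhol.
  have iVq z w : V z -> V w -> (to_plane p \o pi) z = (to_plane p \o pi) w -> z = w.
    move=> Vz Vw /= e; rewrite -(h3 z)// -(h3 w)//.
    by rewrite -(to_planeK (hp (piO _ (VD _ Vz)))) e to_planeK//; exact: hp (piO _ (VD _ Vw)).
  have [oq [G [hG G1 G2]]] := hol_inverse oV hVq iVq.
  have Vu : ((to_plane p \o pi) @` V) u by exists v => //=; rewrite ev of_planeK.
  have [r r0 hr] := (openCP _).1 oq _ Vu.
  exists r, G => //; split.
  + by move=> x /hr hx; exact: hG.
  + by move=> x /hr /G2[/VD].
  + by move=> x /hr /G2[].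
Qed.

Lemma arc_plane (G : R -> sphere R) : smooth_arc_in Omega G ->
  let g := fun s => to_plane p (G s) in
  [/\ forall t, 0 <= t <= 1 -> W (g t) /\ C1_at g t, of_plane p (g 0) = G 0, of_plane p (g 1) = G 1 &
    arc_length Omega G = rint 0 1 (fun t => plane_lam lam (g t) * normc (vel g t))].
Proof.
move=> hG g.
have gG t : 0 <= t <= 1 -> of_plane p (g t) = G t by move=> /hG[Ot _ _]; rewrite /g to_planeK//; exact: hp.
split.
- move=> t ht; have [Ot ct C1t] := hG t ht; split; first by rewrite /plane_dom /= gG.
  by have [] := arc_to_plane (hp Ot) ct C1t.
- by rewrite gG// lexx ler01.
- by rewrite gG// lexx ler01.
- apply: eq_rint => t ht; have [Ot ct C1t] := hG t ht.
  have [_ ->] := arc_to_plane (hp Ot) ct C1t.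
  by rewrite /plane_lam gG// mulrA divfK// gt_eqF// coord_factor_gt0//; exact: hp.
Qed.

Lemma plane_arc (g : R -> C) : (forall t, 0 <= t <= 1 -> W (g t) /\ C1_at g t) ->
  smooth_arc_in Omega (fun s => of_plane p (g s)) /\
  arc_length Omega (fun s => of_plane p (g s)) = rint 0 1 (fun t => plane_lam lam (g t) * normc (vel g t)).
Proof.
move=> hg; split.
  by move=> t ht; have [Wt C1t] := hg t ht; have [h1 h2 _] := @arc_of_plane _ p g t C1t; split.
apply: eq_rint => t ht; have [Wt C1t] := hg t ht.
have [_ _ ->] := @arc_of_plane _ p g t C1t.
by rewrite /plane_lam mulrA divfK// gt_eqF// coord_factor_gt0//; exact: of_plane_neq.
Qed.

Variable q : C -> C.
Hypothesis H : plane_density W (plane_lam lam) q.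

Lemma plane_speed_rcon (g : R -> C) : (forall t, 0 <= t <= 1 -> W (g t) /\ C1_at g t) ->
  rcon 0 1 (fun t => plane_lam lam (g t) * normc (vel g t)).
Proof.
move=> hg t ht; have [Wt C1t] := hg t ht; have [_ cv] := C1_vel C1t.
have [cg] := rder_ccts (C1_rder C1t).
apply: rctsM; last exact: ccts_normc.
by split; exact: (cvg_comp _ _ cg (lam_cont H Wt)).
Qed.

Lemma arc_length_ge0 G : smooth_arc_in Omega G -> 0 <= arc_length Omega G.
Proof.
move=> /arc_plane[hg _ _ ->].
have := @le_rint R 0 1 (fun _ => 0) _ (fun t _ => rcts_cst 0 t) (plane_speed_rcon hg).
rewrite rint_cst// mul0r; apply => t /hg[Wt _].
by rewrite mulr_ge0 ?normc_ge0// ltW// (lam_gt0 H).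
Qed.

Lemma length_ge0 s z w : piecewise_smooth_curve Omega z s w -> 0 <= hyperbolic_length Omega s.
Proof.
rewrite /hyperbolic_length; elim: s z => [|G s IH] z /=; first by rewrite big_nil.
by move=> [hG _ /IH h]; rewrite big_cons addr_ge0// arc_length_ge0.
Qed.

Lemma curve_cat z s w s' w' : piecewise_smooth_curve Omega z s w -> piecewise_smooth_curve Omega w s' w' ->
  piecewise_smooth_curve Omega z (s ++ s') w'.
Proof. by elim: s z => [|G s IH] z /= => [->//|[h1 h2 /IH h] /h]. Qed.

Local Notation lengths z w := [set hyperbolic_length Omega s | s in [set s | piecewise_smooth_curve Omega z s w]].

Lemma dist_le s z w : piecewise_smooth_curve Omega z s w -> hyperbolic_distance Omega z w <= hyperbolic_length Omega s.
Proof.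
move=> hs; apply: ge_inf; last by exists s.
by exists 0 => _ [s' hs' <-]; exact: length_ge0 hs'.
Qed.

Lemma dist_ge z w (m : R) : (exists s, piecewise_smooth_curve Omega z s w) ->
  (forall s, piecewise_smooth_curve Omega z s w -> m <= hyperbolic_length Omega s) ->
  m <= hyperbolic_distance Omega z w.
Proof.
move=> [s hs] h; apply: lb_le_inf; first by exists (hyperbolic_length Omega s), s.
by move=> _ [s' hs' <-]; exact: h.
Qed.

Lemma dist_extend z w w' s : (exists s0, piecewise_smooth_curve Omega z s0 w) ->
  piecewise_smooth_curve Omega w s w' ->
  hyperbolic_distance Omega z w' <= hyperbolic_distance Omega z w + hyperbolic_length Omega s.
Proof.
move=> hex hs; rewrite -lerBlDr; apply: dist_ge => // s0 hs0.
rewrite lerBlDr; apply: le_trans (dist_le (curve_cat hs0 hs)) _.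
by rewrite /hyperbolic_length big_cat.
Qed.

Definition seg_arc (k : C -> C) (a b : C) : R -> sphere R := fun t => of_plane p (k (a + t%:C%C * (b - a))).

Lemma seg_disk (a b : C) t : udisk a -> udisk b -> 0 <= t <= 1 -> udisk (a + t%:C%C * (b - a)).
Proof.
move=> ha hb ht; have := @segment_disk R 0 1 a b t; rewrite /disk /udisk /= !subr0; apply=> //.
Qed.

(** Images of segments are the only curves that upper bounds for distances require. *)
Lemma seg_arcP k a b : hol (@udisk R) k -> (forall z, udisk z -> W (k z)) -> udisk a -> udisk b ->
  [/\ piecewise_smooth_curve Omega (of_plane p (k a)) [:: seg_arc k a b] (of_plane p (k b)) &
      hyperbolic_length Omega [:: seg_arc k a b] <=
        rint 0 1 (fun t => disk_density (a + t%:C%C * (b - a)) * normc (b - a))].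
Proof.
move=> hk kW ha hb.
pose g t := k (a + t%:C%C * (b - a)).
have kC t : 0 <= t <= 1 -> C1_at g t /\ vel g t = dc k (a + t%:C%C * (b - a)) * (b - a).
  move=> ht; have [h1 e1] := @C1_affine R a (b - a) t.
  have hd := seg_disk ha hb ht.
  have hn : \forall z \near a + t%:C%C * (b - a), exists l, cder k z l.
    have h2 := @disk_near R 0 1 (a + t%:C%C * (b - a)).
    have h3 : disk 0 1 (a + t%:C%C * (b - a)) by rewrite /disk /= subr0.
    apply: filterS (h2 h3) => z hz; apply: hk; by move: hz; rewrite /disk /= subr0.
  by have [h4 e4] := C1_comp hn h1; rewrite e4 e1.
have hg t : 0 <= t <= 1 -> W (g t) /\ C1_at g t.
  by move=> ht; split; [apply: kW; exact: seg_disk|have [] := kC t ht].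
have [h1 h2] := plane_arc hg.
split.
  by split; rewrite ?/seg_arc ?mul0r ?addr0 ?mul1r ?[a + (b - a)]addrC ?subrK.
rewrite /hyperbolic_length big_seq1 -/g h2; apply: le_rint.
- exact: plane_speed_rcon.
- move=> t ht; apply: rctsM; last exact: rcts_cst.
  have hd := seg_disk ha hb ht.
  exact: (rcts_disk_density (rder_ccts (rder_affine a (b - a) t)) hd).
- move=> t ht; have [_ ->] := kC t ht.
  have h3 := lam_upper H hk kW (seg_disk ha hb ht).
  by rewrite normcM mulrA; exact: (ler_wpM2r (normc_ge0 (b - a)) h3).
Qed.

(** Up to an additive bounded term this is minus the hyperbolic distance of
[psi u] to the centre of the disk. *)
Definition log_height (psi : C -> C) (u : C) : R := ln (1 - normc (psi u) ^+ 2) / 2.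

(** The logarithmic derivative of [1 - |psi|^2] along the arc is bounded by twice
the hyperbolic speed of the image in the disk, hence by twice the speed of the
arc, by [lam_lower]. *)
Lemma arc_lower (psi : C -> C) (g : R -> C) : hol W psi -> (forall u, W u -> udisk (psi u)) ->
  (forall t, 0 <= t <= 1 -> W (g t) /\ C1_at g t) ->
  log_height psi (g 1) - log_height psi (g 0) <= rint 0 1 (fun t => plane_lam lam (g t) * normc (vel g t)).
Proof.
move=> hpsi psiD hg.
have oW : open W by apply: open_comp oO => u _; exact: of_plane_cont.
pose y s := psi (g s).
have hy t : 0 <= t <= 1 -> C1_at y t /\ vel y t = dc psi (g t) * vel g t.
  move=> /hg[Wt C1t]; apply: C1_comp => //.
  have [e e0 he] := (openCP W).1 oW _ Wt; have h1 := nbhsC_disk (g t) e0.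
  by apply: filterS h1 => z /he; exact: hpsi.
pose dh t : R := - (complex.Re (y t) * complex.Re (vel y t) + complex.Im (y t) * complex.Im (vel y t)) / (1 - normc (y t) ^+ 2).
have yD t : 0 <= t <= 1 -> 0 < 1 - normc (y t) ^+ 2 by move=> /hg[Wt _]; apply: sq_lt1; exact: psiD.
have hd (t : R) : 0 <= t <= 1 -> is_derive t 1 (fun s : R => log_height psi (g s)) (dh t).
  move=> ht; have [/C1_rder /rder_is_derive /= [d1 d2] _] := hy t ht.
  have e : (fun s => log_height psi (g s)) =
      (fun s => 2^-1 * ln (1 - (complex.Re (y s) ^+ 2 + complex.Im (y s) ^+ 2))).
    by apply/funext => s; rewrite /log_height normc_sq mulrC.
  rewrite e.
  have p0 := yD t ht; rewrite normc_sq in p0.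
  have h1 : is_derive t 1 (fun s => 1 - (complex.Re (y s) ^+ 2 + complex.Im (y s) ^+ 2))
      (- ((complex.Re (y t) *+ 2) * complex.Re (vel y t) + (complex.Im (y t) *+ 2) * complex.Im (vel y t))).
    apply: is_derive_eq.
    by rewrite /GRing.scale /=; ring.
  have h2 := is_derive1_ln p0.
  pose gg (s : R) : R := 1 - (complex.Re (y s) ^+ 2 + complex.Im (y s) ^+ 2).
  have h3 := @is_derive1_comp R (@ln R) gg t _ _ h2 h1.
  have h4 : is_derive t 1 (2^-1 \*: (@ln R \o gg)) _ := is_deriveZ _ h3.
  apply: (is_derive_eq h4); rewrite /dh normc_sq /GRing.scale /=.
  by field; rewrite gt_eqF.
have cdh : rcon 0 1 dh.
  move=> t ht; have [C1y _] := hy t ht; have [_ cv] := C1_vel C1y; have cy := rder_ccts (C1_rder C1y).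
  have [Wt _] := hg t ht; have c3 := rcts_disk_density cy (psiD _ Wt).
  have c2 := rctsB (rcts_cst 0 t) (rctsD (rctsM (ccts_Re cy) (ccts_Re cv)) (rctsM (ccts_Im cy) (ccts_Im cv))).
  have [c4] := rctsM c2 c3; split.
  have e s : dh s = (0 - (complex.Re (y s) * complex.Re (vel y s) + complex.Im (y s) * complex.Im (vel y s))) * disk_density (y s).
    by rewrite /dh sub0r.
  by rewrite (funext e).
rewrite -(ftc cdh hd); apply: le_rint => //; first exact: plane_speed_rcon.
move=> t ht; have [Wt C1t] := hg t ht; have p0 := yD t ht; have [_ ev] := hy t ht.
have h1 := lam_lower H hpsi psiD Wt.
apply: le_trans (_ : normc (vel y t) / (1 - normc (y t) ^+ 2) <= _); last first.
  rewrite ev normcM mulrAC -/(y t) ler_wpM2r ?normc_ge0//.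
  by apply: le_trans h1; rewrite /disk_density mulrC.
rewrite ler_pM2r ?invr_gt0//.
apply: le_trans (ler_norm _) _; rewrite normrN.
rewrite -(@ler_pXn2r _ 2)// ?nnegrE ?normc_ge0// real_normK ?num_real//.
have y1 : normc (y t) ^+ 2 <= 1 by lra.
apply: le_trans (_ : normc (y t) ^+ 2 * normc (vel y t) ^+ 2 <= _); last first.
  by rewrite ler_piMl// sqr_ge0.
rewrite !normc_sq; set a := complex.Re _; set b := complex.Re _; set c := complex.Im _; set d := complex.Im _.
have := sqr_ge0 (a * d - b * c); rewrite -subr_ge0.
by have -> : (a ^+ 2 + c ^+ 2) * (b ^+ 2 + d ^+ 2) - (a * b + c * d) ^+ 2 = (a * d - b * c) ^+ 2 by ring.
Qed.

Lemma curve_lower (psi : C -> C) s z w : hol W psi -> (forall u, W u -> udisk (psi u)) ->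
  piecewise_smooth_curve Omega z s w ->
  log_height psi (to_plane p w) - log_height psi (to_plane p z) <= hyperbolic_length Omega s.
Proof.
move=> hpsi psiD; rewrite /hyperbolic_length; elim: s z => [|G s IH] z /=; first by move=> ->; rewrite big_nil subrr.
move=> [hG <- /IH h]; rewrite big_cons.
have [hg e0 e1 ->] := arc_plane hG.
have := arc_lower hpsi psiD hg; rewrite -[X in X - _](subrK (log_height psi (to_plane p (G 1)))) /= in h *.
by move: h; lra.
Qed.

End SphereDistance.

(** * The extremal map and the comparison map of the disk *)
Section Models.
Context {R : realType}.
Notation C := (Cplx R).
Implicit Types (w y z s : C).

(** The Cayley map onto the upper half-plane; the boundary point 1 goes to 0. *)
Definition cayley w : C := 'i%C * (1 - w) / (1 + w).
Definition cayley_inv y : C := ('i%C - y) / ('i%C + y).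
Definition upper : set C := [set y | 0 < complex.Im y].

Lemma divJ x y : y != 0 -> x / y = ((normc y ^+ 2)^-1)%:C%C * (x * y^*%C) :> C.
Proof.
move=> y0; have n0 : normc y ^+ 2 != 0 by rewrite expf_neq0// normc_eq0.
have e : ((normc y ^+ 2)%:C%C : C) != 0 by rewrite -normc_gt0 normc_real normr_gt0.
apply: (mulIf e); rewrite -{1}mulJc mulrA divfK// [RHS]mulrAC -rmorphM /= mulVf// mul1r//.
Qed.

Lemma Re_div x y : y != 0 -> complex.Re (x / y : C) =
  (complex.Re x * complex.Re y + complex.Im x * complex.Im y) / normc y ^+ 2.
Proof.
by move=> y0; rewrite divJ// cReM /= cReM mul0r subr0; case: x y {y0} => a b [c d] /=; ring.
Qed.

Lemma Im_div x y : y != 0 -> complex.Im (x / y : C) =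
  (complex.Im x * complex.Re y - complex.Re x * complex.Im y) / normc y ^+ 2.
Proof.
by move=> y0; rewrite divJ// cImM /= cImM mul0r addr0; case: x y {y0} => a b [c d] /=; ring.
Qed.

Lemma one_add_neq0 w : udisk w -> 1 + w != 0.
Proof.
move=> hw; apply/eqP => e; have e1 : w = - 1 by rewrite -[w](addKr 1) e addr0.
by move: hw; rewrite e1 /udisk /= normcN normc1 ltxx.
Qed.

Lemma cayley_Im w : udisk w -> complex.Im (cayley w) = (1 - normc w ^+ 2) / normc (1 + w) ^+ 2.
Proof.
by move=> hw; rewrite Im_div ?one_add_neq0//; congr (_ / _); rewrite normc_sq; case: w {hw} => a b /=; ring.
Qed.

Lemma cayley_upper w : udisk w -> upper (cayley w).
Proof.
by move=> hw; rewrite /upper /= cayley_Im// divr_gt0 ?sq_lt1// exprn_gt0// normc_gt0 one_add_neq0.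
Qed.

Lemma cayley_inv_den y : upper y -> 'i%C + y != 0.
Proof.
rewrite /upper /= => hy; apply/eqP => e; have : complex.Im ('i%C + y) = 1 + complex.Im y by case: y {hy e} => a b.
by rewrite e /=; lra.
Qed.

Lemma cayley_inv_norm y : upper y -> 1 - normc (cayley_inv y) ^+ 2 = 4 * complex.Im y / normc ('i%C + y) ^+ 2.
Proof.
move=> hy; have n0 : normc ('i%C + y) ^+ 2 != 0 by rewrite expf_neq0// normc_eq0 cayley_inv_den.
rewrite normcf expr_div_n -[X in X - _](divff n0) -mulrBl; congr (_ / _).
by rewrite !normc_sq; case: y {hy n0} => a b /=; ring.
Qed.

Lemma cayley_inv_disk y : upper y -> udisk (cayley_inv y).
Proof.
move=> hy; apply: sq_lt1E; rewrite cayley_inv_norm// divr_gt0//; first by rewrite mulr_gt0.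
by rewrite exprn_gt0// normc_gt0 cayley_inv_den.
Qed.

Lemma i_neq0 : 'i%C != 0 :> C. Proof. by rewrite -normc_gt0 normc_i. Qed.

Lemma cayley_invK w : udisk w -> cayley_inv (cayley w) = w.
Proof.
move=> hw; have h1 := one_add_neq0 hw; have h2 := cayley_inv_den (cayley_upper hw).
apply: (mulIf h2); rewrite divfK// /cayley; field; exact: h1.
Qed.

Lemma cayleyK y : upper y -> cayley (cayley_inv y) = y.
Proof.
move=> hy; have h1 := cayley_inv_den hy; have h2 := one_add_neq0 (cayley_inv_disk hy).
have h3 : 2 * 'i%C != 0 :> C by rewrite mulf_neq0// ?i_neq0// pnatr_eq0.
apply: (mulIf h2); rewrite divfK// /cayley_inv; field; exact: h1.
Qed.

Lemma cder_cayley w : udisk w -> cder cayley w (- (2 * 'i%C) / (1 + w) ^+ 2).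
Proof.
move=> hw; have h1 := one_add_neq0 hw.
have := cder_div (cderM (cder_cst 'i%C w) (cderB (cder_cst 1 w) (cder_id w))) (cderD (cder_cst 1 w) (cder_id w)) h1.
congr cder; congr (_ / _); ring.
Qed.

Lemma cder_cayley_inv y : upper y -> cder cayley_inv y (- (2 * 'i%C) / ('i%C + y) ^+ 2).
Proof.
move=> hy; have h1 := cayley_inv_den hy.
have := cder_div (cderB (cder_cst 'i%C y) (cder_id y)) (cderD (cder_cst 'i%C y) (cder_id y)) h1.
congr cder; congr (_ / _); ring.
Qed.

(** The Cayley map is an isometry between the disk and the half-plane with density
[1 / (2 Im y)], so the hyperbolic derivative may be computed in the half-plane. *)
Lemma transport (M : C -> C) (w m : C) (k : R) : udisk w -> upper (M (cayley w)) -> cder M (cayley w) m ->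
  normc m * complex.Im (cayley w) = k * complex.Im (M (cayley w)) ->
  exists2 l, cder (fun w => cayley_inv (M (cayley w))) w l &
    disk_density (cayley_inv (M (cayley w))) * normc l = k * disk_density w.
Proof.
move=> hw hM hm e; have h1 := cder_comp (cder_comp (cder_cayley hw) hm) (cder_cayley_inv hM).
eexists; first exact: h1.
rewrite /disk_density cayley_inv_norm//; rewrite cayley_Im// in e.
rewrite !normcM !normcV !normcX normcN normcM normc_i mulr1.
have -> : normc (2 : C) = 2.
  have -> : (2 : C) = (2 : R)%:C%C by rewrite rmorphD rmorph1.
  by rewrite normc_real ger0_norm.
have a0 : normc ('i%C + M (cayley w)) != 0 by rewrite normc_eq0 cayley_inv_den.
have b0 : normc (1 + w) != 0 by rewrite normc_eq0 one_add_neq0.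
have c0 : 1 - normc w ^+ 2 != 0 by rewrite gt_eqF// sq_lt1.
have d0 : complex.Im (M (cayley w)) != 0 by rewrite gt_eqF.
move: e a0 b0 c0 d0; move: (normc ('i%C + _)) (normc (1 + w)) (1 - _) (complex.Im _) (normc m) => A B D I m' e a0 b0 c0 d0.
have -> : k = m' * (D / B ^+ 2) / I by rewrite e mulfK.
by field; rewrite a0 b0 c0 d0.
Qed.

Lemma ps_quadrant x : upper x -> [/\ 0 < complex.Re (ps x), 0 < complex.Im (ps x) &
  complex.Im x = 2 * complex.Re (ps x) * complex.Im (ps x)].
Proof.
rewrite /upper /= => hx.
have e : complex.Im x = 2 * complex.Re (ps x) * complex.Im (ps x).
  by rewrite -{1}(psK x) expr2 cImM; ring.
have hr : 0 < complex.Re (ps x) by apply: ps_Re_gt0; left; rewrite gt_eqF.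
by split => //; move: hx; rewrite e pmulr_rgt0// mulr_gt0.
Qed.

(** The cosine of half the argument of [x]. *)
Definition cosarg x : R := complex.Re (ps x) / normc (ps x).

Lemma one_add_upper y : upper y -> upper (1 + y).
Proof. by rewrite /upper /=; case: y => a b /=; rewrite add0r. Qed.

(** The square root with base point -1 of the half-plane. Its image is a proper part
of the half-plane, so it contracts; near the boundary point 1 of the disk the
contraction factor differs from 1 by the order of [exp (- 4 d)], where [d] is the
distance to the centre. *)
Definition root_map w : C := cayley_inv (ps (1 + cayley w)).

(** With [x = s^2] one has [Im x = 2 (Re s) (Im s)] and [|ds / dx| = 1 / (2 |s|)]. *)
Lemma ps_hyp x : upper x -> normc (1 / (ps x *+ 2)) * complex.Im x = cosarg x * complex.Im (ps x).
Proof.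
move=> hx; have [h1 h2 e] := ps_quadrant hx.
have s0 : ps x != 0 by apply/eqP => e0; move: h1; rewrite e0 ltxx.
have n0 : normc (ps x) != 0 by rewrite normc_eq0.
have -> : ps x *+ 2 = (2 : R)%:C%C * ps x by rewrite rmorphD rmorph1 mulrDl mul1r mulr2n.
rewrite normcf normc1 normcM normc_real ger0_norm// e /cosarg.
by field.
Qed.

Lemma cder_ps1 y : upper y -> cder (fun y => ps (1 + y)) y (1 / (ps (1 + y) *+ 2)).
Proof.
move=> hy; have hx := one_add_upper hy.
have := cder_comp (cderD (cder_cst 1 y) (cder_id y)) (cder_ps (z := 1 + y) _).
by rewrite add0r mulr1; apply; left; rewrite gt_eqF.
Qed.

Lemma ps_upper y : upper y -> upper (ps (1 + y)).
Proof. by move=> /one_add_upper /ps_quadrant[]. Qed.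

Lemma root_mapP w : udisk w -> udisk (root_map w) /\ exists2 l, cder root_map w l &
  disk_density (root_map w) * normc l = cosarg (1 + cayley w) * disk_density w.
Proof.
move=> hw; have hy := cayley_upper hw; split; first by apply: cayley_inv_disk; exact: ps_upper.
apply: (@transport (fun y => ps (1 + y)) w _ _ hw (ps_upper hy) (cder_ps1 hy)).
rewrite -ps_hyp//; last exact: one_add_upper.
by congr (_ * _); case: (cayley w) => a b /=; rewrite add0r.
Qed.

Lemma root_map_inj z w : udisk z -> udisk w -> root_map z = root_map w -> z = w.
Proof.
move=> hz hw /(congr1 cayley); rewrite !cayleyK; try exact/ps_upper/cayley_upper.
by move=> /(congr1 (fun x => x ^+ 2)); rewrite !psK => /addrI /(congr1 cayley_inv); rewrite !cayley_invK.
Qed.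

Variable eps : R.
Hypotheses (e0 : 0 < eps) (e1 : eps <= 1 / 2).

(** Maps the first quadrant onto the upper half of the disk of radius [eps]. *)
Definition half (s : C) : C := eps%:C%C * ((s - 1) / (s + 1)).
(** The conformal map of the disk onto a half-disk at the boundary point 1, read in
the half-plane coordinate. *)
Definition half_disk_map w : C := cayley_inv (half (ps (1 + cayley w))).

Lemma half_den s : 0 < complex.Re s -> s + 1 != 0.
Proof.
move=> hs; apply/eqP => e; have : complex.Re (s + 1) = complex.Re s + 1 by rewrite cReD.
by rewrite e /=; lra.
Qed.

Lemma half_Im s : 0 < complex.Re s -> complex.Im (half s) = eps * (2 * complex.Im s / normc (s + 1) ^+ 2).
Proof.
move=> hs; rewrite cImM Im_div ?half_den//= mul0r addr0; congr (_ * (_ / _)).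
by case: s {hs} => a b /=; ring.
Qed.

Lemma half_upper s : 0 < complex.Re s -> 0 < complex.Im s -> upper (half s).
Proof.
move=> h1 h2; have h3 : 0 < normc (s + 1) ^+ 2 by rewrite exprn_gt0// normc_gt0 half_den.
by rewrite /upper /= half_Im//; apply: mulr_gt0 => //; apply: divr_gt0 => //; apply: mulr_gt0.
Qed.

Lemma half_norm s : 0 < complex.Re s -> normc (half s) <= eps.
Proof.
move=> hs; rewrite normcM normc_real (ger0_norm (ltW e0)) normcf.
have h3 : 0 < normc (s + 1) by rewrite normc_gt0 half_den.
have h4 : normc (s - 1) <= normc (s + 1).
  rewrite -(@ler_pXn2r _ 2)// ?nnegrE ?normc_ge0// !normc_sq.
  by case: s hs {h3} => a b /= h; nra.
have h5 : normc (s - 1) / normc (s + 1) <= 1 by rewrite ler_pdivrMr// mul1r.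
by have := ler_wpM2l (ltW e0) h5; rewrite mulr1.
Qed.

Lemma cder_half s : 0 < complex.Re s -> cder half s (eps%:C%C * (2 / (s + 1) ^+ 2)).
Proof.
move=> hs; have h := cder_div (cderB (cder_id s) (cder_cst 1 s)) (cderD (cder_id s) (cder_cst 1 s)) (half_den hs).
have := cder_lin eps%:C%C 0 h.
have -> : (1 - 0) * (s + 1) - (s - 1) * (1 + 0) = 2 :> C by ring.
by apply: cder_ext => x; rewrite addr0.
Qed.

(** The quadrant and its image under [half] have the same ratio of hyperbolic
density to the density of the half-plane, so the hyperbolic derivative is that
of the square root, as for [root_map]. *)
Lemma half_disk_mapP w : udisk w -> udisk (half_disk_map w) /\ exists2 l, cder half_disk_map w l &
  disk_density (half_disk_map w) * normc l = cosarg (1 + cayley w) * disk_density w.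
Proof.
move=> hw; have hy := cayley_upper hw; have [h1 h2 e] := ps_quadrant (one_add_upper hy).
have hu := half_upper h1 h2.
split; first exact: cayley_inv_disk.
have hd := cder_comp (cder_ps1 hy) (cder_half h1).
apply: (@transport (fun y => half (ps (1 + y))) w _ _ hw hu hd).
have := ps_hyp (one_add_upper hy).
have -> : complex.Im (1 + cayley w) = complex.Im (cayley w) by case: (cayley w) => a b /=; rewrite add0r.
have n0 : normc (ps (1 + cayley w) + 1) != 0 by rewrite normc_eq0 half_den.
have n2 : normc (2 : C) = 2.
  have -> : (2 : C) = (2 : R)%:C%C by rewrite rmorphD rmorph1.
  by rewrite normc_real ger0_norm.
move=> h3; rewrite half_Im// normcM -mulrA h3 !normcM normcV normcX normc_real (ger0_norm (ltW e0)) n2.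
by field.
Qed.

Lemma half_disk_map_far w : udisk w -> 1 - normc (half_disk_map w) ^+ 2 <= 16 * eps.
Proof.
move=> hw; have hy := cayley_upper hw; have [h1 h2 e] := ps_quadrant (one_add_upper hy).
have hu := half_upper h1 h2; rewrite cayley_inv_norm//.
have n1 := half_norm h1; have n2 := Im_le (half (ps (1 + cayley w))).
have n3 := ler_norm (complex.Im (half (ps (1 + cayley w)))).
have n4 := normcB_ge 'i%C (- half (ps (1 + cayley w))); rewrite opprK normcN normc_i in n4.
have n5 := e1; move: n1 n2 n3 n4 n5; set a := normc (half _); set b := normc ('i%C + _); set c := complex.Im _.
move: (`|c|) => d n1 n2 n3 n4 n5.
have n6 : 1 / 2 <= b by lra.
have n7 : 1 / 4 <= b ^+ 2 by rewrite expr2; nra.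
rewrite ler_pdivrMr; last by lra.
have n8 : 4 * c <= 16 * eps * (1 / 4) by lra.
have n9 : 0 <= 16 * eps by apply: mulr_ge0 => //; exact: ltW.
exact: (le_trans n8 (ler_wpM2l n9 n7)).
Qed.

(** Inverts [half] and the square root; near 0 the preimage under [half] lies in
the open first quadrant. *)
Lemma half_disk_map_onto w : udisk w -> normc (cayley w) < eps ->
  let s := (eps%:C%C + cayley w) / (eps%:C%C - cayley w) : C in
  [/\ 0 < complex.Re s, 0 < complex.Im s, udisk (cayley_inv (s ^+ 2 - 1)),
     ps (1 + cayley (cayley_inv (s ^+ 2 - 1))) = s & half_disk_map (cayley_inv (s ^+ 2 - 1)) = w].
Proof.
move=> hw; have hy := cayley_upper hw; set y := cayley w in hy * => ly s.
have d0 : eps%:C%C - y != 0 :> C.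
  rewrite subr_eq0; apply/eqP => e'; move: ly.
  by rewrite -e' normc_real (ger0_norm (ltW e0)) ltxx.
have p0 : 0 < normc (eps%:C%C - y) ^+ 2 by rewrite exprn_gt0// normc_gt0.
have hr : 0 < complex.Re s.
  rewrite Re_div//; apply: divr_gt0 => //.
  have : normc y ^+ 2 < eps ^+ 2 by rewrite ltr_pXn2r ?nnegrE ?normc_ge0// ltW.
  rewrite normc_sq; case: (y) => a b /=; move: (eps) => e; rewrite !expr2; lra.
have hi : 0 < complex.Im s.
  rewrite Im_div//; apply: divr_gt0 => //.
  move: hy e0; rewrite /upper /=; case: (y) => a b /=; move: (eps) => e; nra.
have hu : upper (s ^+ 2 - 1).
  have : 0 < 2 * complex.Re s * complex.Im s by rewrite !mulr_gt0.
  rewrite /upper /= expr2; case: (s) => a b /=; lra.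
have hz := cayley_inv_disk hu.
have e2 : ps (1 + cayley (cayley_inv (s ^+ 2 - 1))) = s by rewrite cayleyK// addrC subrK ps_uniq.
split => //; rewrite /half_disk_map e2.
have -> : half s = y.
  have s1 := half_den hr.
  have e : eps%:C%C != 0 :> C by rewrite -normc_gt0 normc_real normr_gt0 gt_eqF.
  rewrite /half; apply: (mulIf s1); rewrite -mulrA divfK//.
  apply: (mulIf d0).
  have es : s * (eps%:C%C - y) = eps%:C%C + y by rewrite divfK.
  have -> : eps%:C%C * (s - 1) * (eps%:C%C - y) = eps%:C%C * (s * (eps%:C%C - y) - (eps%:C%C - y)) by ring.
  have -> : y * (s + 1) * (eps%:C%C - y) = y * (s * (eps%:C%C - y) + (eps%:C%C - y)) by ring.
  by rewrite es; ring.
exact: cayley_invK.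
Qed.

(** [1 - Re s / |s| = (Im s)^2 / (|s| (|s| + Re s))]. *)
Lemma cosarg_def s x : 0 < complex.Re s -> ps x = s ->
  (complex.Im s ^+ 2) / (2 * normc s ^+ 2) <= 1 - cosarg x <= complex.Im s ^+ 2 / normc s ^+ 2.
Proof.
move=> hr e; rewrite /cosarg e.
have n0 : 0 < normc s by rewrite normc_gt0; apply/eqP => e0'; move: hr; rewrite e0' ltxx.
have nR : complex.Re s <= normc s := le_trans (ler_norm _) (Re_le s).
have := normc_sq s; move: (normc s) (complex.Re s) (complex.Im s) hr n0 nR => n r i r0 n0 nr e2.
have -> : 1 - r / n = i ^+ 2 / (n * (n + r)).
  have -> : i ^+ 2 = (n - r) * (n + r) by rewrite -[i ^+ 2](addKr (r ^+ 2)) -e2; ring.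
  by field; rewrite !gt_eqF// addr_gt0.
have q0 := sqr_ge0 i.
have a0 : 0 < n * (n + r) by rewrite mulr_gt0// addr_gt0.
have n2 : 0 < n ^+ 2 by rewrite exprn_gt0.
have nn2 : 0 < 2 * n ^+ 2 by rewrite mulr_gt0.
have le1 : n * (n + r) <= 2 * n ^+ 2 by rewrite expr2; nra.
have le2 : n ^+ 2 <= n * (n + r) by rewrite expr2; nra.
by apply/andP; split; apply: ler_wpM2l => //; rewrite lef_pV2// posrE.
Qed.

End Models.

(** The square roots [s1] (at [w]) and [s2] (at its preimage under the half-disk
map) stay in a compact part of the right half-plane and have imaginary parts
comparable to [Y], while [1 - |z|] is comparable to the imaginary part of
[s2]. *)
Lemma local_model (R : realType) (eps : R) : 0 < eps -> eps <= 1 / 2 -> exists c A : R, [/\ 0 < c, 0 < A & forall w, udisk w -> normc (cayley w) <= eps / 4 ->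
  let Y := complex.Im (cayley w) in
  [/\ Y ^+ 2 / 32 <= 1 - cosarg (1 + cayley w), 1 - normc w ^+ 2 <= 4 * Y & exists2 z, udisk z &
    [/\ half_disk_map eps z = w, (1 - cosarg (1 + cayley w)) + (1 - cosarg (1 + cayley z)) <= A * Y ^+ 2 &
       c * Y <= 1 - normc z]]].
Proof.
move=> e0 e1.
(* the defect is at most [Y^2] for [s1] and [64 / eps^2 * Y^2] for [s2] *)
exists (1 / (16 * eps)), (1 + 64 / eps ^+ 2).
have e2 : 0 < eps ^+ 2 by rewrite exprn_gt0.
split; [by rewrite divr_gt0// mulr_gt0|by rewrite addr_gt0// divr_gt0|].
move=> w hw hyw Y; have Y0 : 0 < Y := cayley_upper hw.
have hlt : normc (cayley w) < eps by apply: le_lt_trans hyw _; move: e0; clear; lra.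
have [r2 i2 hz e3 e4] := half_disk_map_onto e0 hw hlt.
have [r1 i1 eI] := ps_quadrant (one_add_upper (cayley_upper hw)).
have {}eI : Y = 2 * complex.Re (ps (1 + cayley w)) * complex.Im (ps (1 + cayley w)).
  by rewrite -eI /Y; case: (cayley w) => a b /=; rewrite add0r.
set s1 := ps (1 + cayley w) in r1 i1 eI; set s2 := (_ / _ : Cplx R) in r2 i2 e3 e4 hz.
have [/andP[k1 k2] /andP[_ k4]] := (cosarg_def r1 (erefl : ps (1 + cayley w) = s1), cosarg_def r2 e3).
(* [s1] stays away from 0 and from the imaginary axis *)
have y4 : normc (cayley w) <= 1 / 4 by apply: le_trans hyw _; move: e1; clear; lra.
have n1 : normc s1 ^+ 2 = normc (1 + cayley w) by rewrite -normcX psK.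
have n1a : normc s1 ^+ 2 <= 2.
  by rewrite n1; apply: le_trans (normcD _ _) _; rewrite normc1; move: y4; clear; lra.
have n1b : 3 / 4 <= normc s1 ^+ 2.
  by rewrite n1; have := normcB_ge 1 (- cayley w); rewrite opprK normcN normc1; move: y4; clear; lra.
have R1 : 3 / 4 <= complex.Re s1 ^+ 2.
  have h : complex.Re (s1 ^+ 2) = 1 + complex.Re (cayley w) by rewrite psK cReD.
  have h' : complex.Re (s1 ^+ 2) = complex.Re s1 ^+ 2 - complex.Im s1 ^+ 2 by rewrite expr2 cReM !expr2.
  have h2 := Re_le (cayley w); have h3 := ler_norm (- complex.Re (cayley w)); rewrite normrN in h3.
  have h4 := sqr_ge0 (complex.Im s1).
  rewrite h' in h; move: h h2 h3 h4 y4; clear; lra.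
have nR : complex.Re s1 ^+ 2 <= normc s1 ^+ 2 by rewrite normc_sq lerDl sqr_ge0.
have YI : Y ^+ 2 = 4 * complex.Re s1 ^+ 2 * complex.Im s1 ^+ 2 by rewrite eI; ring.
have q1 : complex.Im s1 ^+ 2 / normc s1 ^+ 2 <= Y ^+ 2.
  rewrite ler_pdivrMr; last by move: n1b; clear; lra.
  rewrite YI; have := sqr_ge0 (complex.Im s1).
  move: (complex.Im s1 ^+ 2) (complex.Re s1 ^+ 2) (normc s1 ^+ 2) R1 n1b => I r n h1 h2 h3.
  have : 1 * I <= (4 * r * n) * I by apply: ler_wpM2r => //; move: h1 h2; clear; nra.
  by rewrite mul1r mulrAC.
have q0 : Y ^+ 2 / 32 <= complex.Im s1 ^+ 2 / (2 * normc s1 ^+ 2).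
  rewrite ler_pdivlMr; last by move: n1b; clear; lra.
  rewrite YI; have := sqr_ge0 (complex.Im s1).
  move: (complex.Im s1 ^+ 2) (complex.Re s1 ^+ 2) (normc s1 ^+ 2) R1 n1a nR => I r n h1 h2 h3 h4.
  have : (r * n / 4) * I <= 1 * I by apply: ler_wpM2r => //; move: h1 h2 h3; clear; nra.
  by rewrite mul1r; apply: le_trans; move: h4; clear; lra.
(* the same for [s2] *)
pose D := normc (eps%:C%C - cayley w).
have D0 : 3 / 4 * eps <= D.
  by have := normcB_ge eps%:C%C (cayley w); rewrite normc_real (ger0_norm (ltW e0)) /D; move: hyw; clear; lra.
have D1 : D <= 5 / 4 * eps.
  by have := normcB eps%:C%C (cayley w); rewrite normc_real (ger0_norm (ltW e0)) /D; move: hyw; clear; lra.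
have N0 : normc (eps%:C%C + cayley w) <= 5 / 4 * eps.
  by have := normcD eps%:C%C (cayley w); rewrite normc_real (ger0_norm (ltW e0)); move: hyw; clear; lra.
have N1 : 3 / 4 * eps <= normc (eps%:C%C + cayley w).
  by have := normcB_ge eps%:C%C (- cayley w); rewrite opprK normcN normc_real (ger0_norm (ltW e0)); move: hyw; clear; lra.
have ep := e0.
have Dp : 0 < D by move: D0 ep; clear; lra.
have d0 : eps%:C%C - cayley w != 0  by rewrite -normc_gt0.
have ns2 : normc s2 = normc (eps%:C%C + cayley w) / D by rewrite normcf.
have s2a : normc s2 <= 5 / 3 by rewrite ns2 ler_pdivrMr//; move: N0 D0; clear; lra.
have s2b : 3 / 5 <= normc s2 by rewrite ns2 ler_pdivlMr//; move: N1 D1; clear; lra.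
have Is2 : complex.Im s2 = 2 * eps * Y / D ^+ 2.
  by rewrite Im_div// /Y; congr (_ / _); case: (cayley w) => a b /=; ring.
have Rs2 : complex.Re s2 = (eps ^+ 2 - normc (cayley w) ^+ 2) / D ^+ 2.
  by rewrite Re_div//; congr (_ / _); rewrite normc_sq; case: (cayley w) => a b /=; ring.
have DD0 : 9 / 16 * eps ^+ 2 <= D ^+ 2 by rewrite !expr2; move: D0 ep; clear; nra.
have DD1 : D ^+ 2 <= 25 / 16 * eps ^+ 2 by rewrite !expr2; move: D1 Dp ep; clear; nra.
have Dp2 : 0 < D ^+ 2 by rewrite exprn_gt0.
have yy : normc (cayley w) ^+ 2 <= eps ^+ 2 / 16 by have := normc_ge0 (cayley w); rewrite !expr2; move: hyw ep; clear; nra.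
have R2 : 3 / 5 <= complex.Re s2 by rewrite Rs2 ler_pdivlMr//; move: yy DD1; clear; lra.
have I2a : complex.Im s2 * eps <= 4 * Y.
  rewrite Is2 mulrAC ler_pdivrMr//; have : Y * (9 / 16 * eps ^+ 2) <= Y * D ^+ 2 by rewrite ler_pM2l.
  by rewrite !expr2; move: ep Y0; clear; nra.
have I2b : Y <= complex.Im s2 * eps.
  rewrite Is2 mulrAC ler_pdivlMr//; have : Y * D ^+ 2 <= Y * (25 / 16 * eps ^+ 2) by rewrite ler_pM2l.
  by rewrite !expr2; move: ep Y0; clear; nra.
split.
- exact: le_trans q0 k1.
- have := cayley_Im hw; rewrite -/Y => ->.
  have b0 : normc (1 + w) != 0 by rewrite normc_eq0 one_add_neq0.
  have b1 : normc (1 + w) ^+ 2 <= 4.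
    have := normcD 1 w; rewrite normc1; have : normc w < 1 := hw.
    by have := normc_ge0 (1 + w); rewrite expr2; clear; nra.
  have b2 : 0 < normc (1 + w) ^+ 2 by rewrite exprn_gt0// lt_neqAle normc_ge0 eq_sym b0.
  have s0 := sq_lt1 hw.
  by rewrite mulrA ler_pdivlMr// [4 * _]mulrC ler_pM2l.
- exists (cayley_inv (s2 ^+ 2 - 1)) => //; split => //.
  + have q2 : complex.Im s2 ^+ 2 / normc s2 ^+ 2 <= 64 / eps ^+ 2 * Y ^+ 2.
      have n9 : 9 / 25 <= normc s2 ^+ 2 by rewrite expr2; move: s2b; clear; nra.
      rewrite ler_pdivrMr; last by move: n9; clear; lra.
      have -> : 64 / eps ^+ 2 * Y ^+ 2 * normc s2 ^+ 2 = (64 * Y ^+ 2 * normc s2 ^+ 2) / eps ^+ 2 by ring.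
      rewrite ler_pdivlMr// -exprMn.
      apply: le_trans (_ : (4 * Y) ^+ 2 <= _).
        by rewrite ler_pXn2r ?nnegrE// ltW// mulr_gt0.
      have : Y ^+ 2 * (9 / 25) <= Y ^+ 2 * normc s2 ^+ 2 by rewrite ler_wpM2l// sqr_ge0.
      by rewrite exprMn; have := sqr_ge0 Y; move: (Y ^+ 2) (normc s2 ^+ 2) => a b; clear; lra.
    by move: q1 k2 k4 q2; clear; lra.
  + have [_ _ hu] : [/\ True, True & upper (s2 ^+ 2 - 1)].
      split => //; have : 0 < 2 * complex.Re s2 * complex.Im s2 by rewrite !mulr_gt0.
      by rewrite /upper /= expr2; case: (s2) => a b /=; clear; lra.
    have bn := cayley_inv_norm hu; have bz := hz; rewrite /udisk /= in bz.
    set n := normc (cayley_inv _) in bn bz *.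
    have nn : 0 <= n := normc_ge0 _.
    have h5 : 1 - n ^+ 2 <= 2 * (1 - n) by rewrite expr2; move: nn bz; clear; nra.
    have Iu : complex.Im (s2 ^+ 2 - 1) = 2 * complex.Re s2 * complex.Im s2.
      by rewrite expr2; case: (s2) => a b /=; ring.
    pose N := normc ('i%C + (s2 ^+ 2 - 1)).
    have N5 : N ^+ 2 <= 25.
      have : N <= 1 + (normc s2 ^+ 2 + 1).
        apply: le_trans (normcD _ _) _; rewrite normc_i lerD2l; apply: le_trans (normcB _ _) _.
        by rewrite normcX normc1.
      have s22 : normc s2 ^+ 2 <= 25 / 9 by rewrite expr2; have := normc_ge0 s2; move: s2a; clear; nra.
      have N0' : 0 <= N := normc_ge0 _.
      by move: s22 N0'; rewrite [N ^+ 2]expr2; move: (normc s2 ^+ 2) N => x y; clear; nra.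
    have Np : 0 < N ^+ 2 by rewrite exprn_gt0// normc_gt0 cayley_inv_den.
    have h6 : 4 * (2 * complex.Re s2 * complex.Im s2) <= 50 * (1 - n).
      have e6 : 4 * (2 * complex.Re s2 * complex.Im s2) = (1 - n ^+ 2) * N ^+ 2.
        by rewrite bn Iu divfK// gt_eqF.
      rewrite e6; apply: le_trans (_ : (1 - n ^+ 2) * 25 <= _); last by move: h5; clear; lra.
      by apply: ler_wpM2l => //; rewrite expr2; move: nn bz; clear; nra.
    have h7 : 3 / 5 * complex.Im s2 <= complex.Re s2 * complex.Im s2 by rewrite ler_pM2r.
    have h8 : Y / eps <= complex.Im s2 by rewrite ler_pdivrMr.
    have -> : 1 / (16 * eps) * Y = Y / eps / 16 by field; rewrite gt_eqF.
    have u0 : 0 <= Y / eps by rewrite divr_ge0// ltW.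
    rewrite -mulrA in h6; move: h6 h7 h8 u0.
    by move: (Y / eps) (complex.Re s2 * complex.Im s2) (complex.Im s2) => u v I; clear; lra.
Qed.

(** * Subsequences along an ultrafilter *)
Section Diagonal.
Context {R : realType}.
Notation C := (Cplx R).

Definition ucvg (F : set_system nat) (u : nat -> R) (l : R) :=
  forall e, 0 < e -> F [set n | `|u n - l| < e].

Lemma ultra_real (F : set_system nat) (uF : UltraFilter F) (G : set nat) (u : nat -> R) (M : R) :
  F G -> (forall n, G n -> `|u n| <= M) -> exists l, ucvg F u l.
Proof.
move=> FG hu; pose v n : C := (if `[< G n >] then u n else 0)%:C%C.
have hv n : normc (v n) <= `|M|.
  rewrite /v normc_real; case: asboolP => [/hu h|_]; last by rewrite normr0.
  exact: le_trans h (ler_norm _).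
have [l _ hl] := ultra_limit uF hv.
have FF : ProperFilter F by exact: ultra_proper.
exists (complex.Re l) => e ep; have h1 : F [set n | normc (v n - l) < e] by exact: ((cvgCP v l).1 hl e ep).
have h2 n : G n -> normc (v n - l) < e -> `|u n - complex.Re l| < e.
  move=> Gn; apply: le_lt_trans.
  have -> : u n - complex.Re l = complex.Re (v n - l) by rewrite cReD cReN /v asboolT.
  exact: Re_le.
exact: (filterS2 _ h2 FG h1).
Qed.

Lemma ucvg_ge (F : set_system nat) (FF : ProperFilter F) (u : nat -> R) l (G : set nat) a :
  ucvg F u l -> F G -> (forall n, G n -> a <= u n) -> a <= l.
Proof.
move=> h FG hG; rewrite leNgt; apply/negP => la.
have al : 0 < a - l by rewrite subr_gt0.
have [n [h1 h2]] := filter_ex (filterI (h _ al) FG).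
by move: h1 (hG n h2) => /=; have := ler_norm (u n - l); lra.
Qed.

Lemma ucvg_near (F : set_system nat) (FF : ProperFilter F) (u v : nat -> R) l m (G : set nat) a :
  ucvg F u l -> ucvg F v m -> F G -> (forall n, G n -> `|u n - v n| <= a) -> `|l - m| <= a.
Proof.
move=> hu hv FG hG; apply/ler_addgt0Pr => e ep; have e2 : 0 < e / 2 by rewrite divr_gt0.
have [n [h1 [h2 h3]]] := filter_ex (filterI (hu _ e2) (filterI (hv _ e2) FG)).
have -> : l - m = - (u n - l) + (v n - m) + (u n - v n) by ring.
have := hG n h3; move: h1 h2 => /= h1 h2 h4.
have := ler_normD (- (u n - l) + (v n - m)) (u n - v n); have := ler_normD (- (u n - l)) (v n - m).
by rewrite normrN; lra.
Qed.

(** Finitely many conditions that hold along the ultrafilter hold together at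
arbitrarily large indices. *)
Lemma diagonal (F : set_system nat) (FF : ProperFilter F) (G : set nat) (x : nat -> nat -> R) (l : nat -> R) :
  (forall N, F [set n | (N <= n)%N]) -> F G -> (forall j, ucvg F (x j) (l j)) ->
  exists nk : nat -> nat, forall k, [/\ (k <= nk k)%N, G (nk k) &
    forall j, (j <= k)%N -> `|x j (nk k) - l j| < k.+1%:R^-1].
Proof.
move=> tl FG hx.
have sel k : exists n, [/\ (k <= n)%N, G n & forall j, (j <= k)%N -> `|x j n - l j| < k.+1%:R^-1].
  have h m : F [set n | forall j, (j < m)%N -> `|x j n - l j| < k.+1%:R^-1].
    elim: m => [|m IH]; first by apply: filterS FG => n _ j.
    have k0 : 0 < k.+1%:R^-1 :> R by rewrite invr_gt0.
    apply: filterS2 IH (hx m _ k0) => n h1 h2 j; rewrite ltnS leq_eqVlt => /orP[/eqP->//|]; exact: h1.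
  have [n [h1 [h2 h3]]] := filter_ex (filterI (tl k) (filterI FG (h k.+1))).
  by exists n; split => // j hj; apply: h3.
by have [nk hnk] := choice sel; exists nk.
Qed.

(** Enumerates the points of the disk with rational coordinates. *)
Definition dense_pt (j : nat) : C :=
  if @unpickle (rat * rat)%type j is Some ab then
    let z := (ratr ab.1 +i* ratr ab.2)%C : C in if normc z < 1 then z else 0
  else 0.

Lemma dense_pt_disk j : udisk (dense_pt j).
Proof.
rewrite /dense_pt; case: unpickle => [ab|] /=; last by rewrite /udisk /= normc0.
by case: ifP => // _; rewrite /udisk /= normc0.
Qed.

Lemma dense_ptP (v : C) e : udisk v -> 0 < e -> exists j, normc (dense_pt j - v) < e.
Proof.
move=> hv e0'; have hv' : 0 < 1 - normc v by rewrite subr_gt0.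
have [d [d0 d1 d2]] : exists d : R, [/\ 0 < d, d <= e & d <= 1 - normc v].
  exists (Num.min e (1 - normc v)); split; first by rewrite lt_min e0'.
    by rewrite ge_min lexx.
  by rewrite ge_min lexx orbT.
have hrat (x : R) : exists r : rat, `|ratr r - x| < d / 2.
  have lt : x < x + d / 2 by rewrite ltrDl divr_gt0.
  have [r] := rat_in_itvoo lt; rewrite in_itv /= => /andP[h1 h2].
  by exists r; rewrite ger0_norm; lra.
have [a ha] := hrat (complex.Re v); have [b hb] := hrat (complex.Im v).
pose z : C := (ratr a +i* ratr b)%C.
have hz : normc (z - v) < d.
  apply: le_lt_trans (normc_le_ReIm _) _; rewrite cReD cImD cReN cImN /z /=; lra.
have z1 : normc z < 1.
  by have := normcD (z - v) v; rewrite subrK; lra.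
exists (pickle (a, b)); rewrite /dense_pt pickleK /= -/z z1; lra.
Qed.

End Diagonal.

Section Radial.
Context {R : realType}.
Notation C := (Cplx R).

(** The integrand is the derivative of half the logarithm of
[(1 - |z| + |z| t) / (1 + |z| - |z| t)]. *)
Lemma radial_length (z : C) : udisk z ->
  rint 0 1 (fun t => disk_density (z + t%:C%C * (0 - z)) * normc (0 - z)) <= ln (2 / (1 - normc z)) / 2.
Proof.
move=> hz; set n := normc z; have n0 : 0 <= n := normc_ge0 z; have n1 : n < 1 := hz.
have u0 : udisk (0 : C) by rewrite /udisk /= normc0.
pose F (t : R) : R := 2^-1 * (ln (1 - n + n * t) - ln (1 + n - n * t)).
have nt t : 0 <= t <= 1 -> normc (z + t%:C%C * (0 - z)) = (1 - t) * n.
  move=> /andP[t0 t1]; have -> : z + t%:C%C * (0 - z) = (1 - t)%:C%C * z by rewrite rmorphB rmorph1; ring.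
  by rewrite normcM normc_real ger0_norm// subr_ge0.
have -> : rint 0 1 (fun t => disk_density (z + t%:C%C * (0 - z)) * normc (0 - z)) = F 1 - F 0.
  apply: ftc.
  - move=> t ht; apply: rctsM; last exact: rcts_cst.
    exact: (rcts_disk_density (rder_ccts (rder_affine z (0 - z) t)) (seg_disk hz u0 ht)).
  - move=> t ht; have /andP[t0 t1] := ht.
    have p1 : 0 < 1 - n + n * t by have := mulr_ge0 n0 t0; lra.
    have p2 : 0 < 1 + n - n * t by have := ler_piMr n0 t1; lra.
    have d1 : is_derive t 1 (fun t : R => 1 - n + n * t) n.
      by apply: is_derive_eq; rewrite /GRing.scale /=; ring.
    have d2 : is_derive t 1 (fun t : R => 1 + n - n * t) (- n).
      by apply: is_derive_eq; rewrite /GRing.scale /=; ring.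
    have e1 := @is_derive1_comp R (@ln R) (fun t : R => 1 - n + n * t) t _ _ (is_derive1_ln p1) d1.
    have e2 := @is_derive1_comp R (@ln R) (fun t : R => 1 + n - n * t) t _ _ (is_derive1_ln p2) d2.
    have e3 : is_derive t 1 (2^-1 \*: ((@ln R \o (fun t : R => 1 - n + n * t)) - (@ln R \o (fun t : R => 1 + n - n * t)))) _ := is_deriveZ _ (is_deriveB e1 e2).
    apply: (is_derive_eq e3).
    rewrite /disk_density nt// sub0r normcN -/n /GRing.scale /=.
    have -> : 1 - ((1 - t) * n) ^+ 2 = (1 - n + n * t) * (1 + n - n * t) by ring.
    by field; rewrite !gt_eqF.
have -> : F 1 - F 0 = (ln (1 + n) - ln (1 - n)) / 2.
  rewrite /F !mulr1 !mulr0 subrK subr0 addr0 addrK ln1; ring.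
rewrite ler_pM2r ?invr_gt0// ln_div ?posrE ?subr_gt0// lerD2r ler_ln ?posrE//; lra.
Qed.

End Radial.

(** * The extremal map near the boundary point *)
Section Local.
Context {R : realType}.
Notation C := (Cplx R).
Variables (U W : set C) (lam : C -> R) (q psi chi : C -> C) (eps r : R).
Hypotheses (H : plane_density W lam q) (oU : open U) (WU : W `<=` U) (hpsi : hol U psi) (hchi : hol (@udisk R) chi)
  (psiK : forall u, U u -> udisk (psi u) /\ chi (psi u) = u)
  (chiK : forall w, udisk w -> U (chi w) /\ psi (chi w) = w)
  (hW : forall w, udisk w -> r < normc w -> W (chi w))
  (e0 : 0 < eps) (e1 : eps <= 1 / 2) (er : 0 <= r) (er1 : 16 * eps < 1 - r ^+ 2).

(** It lands in [W], since the half-disk map only reaches points close to the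
circle. *)
Definition comparison z := chi (half_disk_map eps z).

Lemma comparison_hol : hol (@udisk R) comparison.
Proof.
move=> z hz; have [hg [l hl _]] := half_disk_mapP e0 hz.
by eexists; apply: cder_comp; [exact: hl|exact: hol_dc hchi hg].
Qed.

Lemma comparison_in z : udisk z -> W (comparison z).
Proof.
move=> hz; have [hg _] := half_disk_mapP e0 hz; apply: hW => //.
rewrite ltNge; apply/negP => hle.
have h : normc (half_disk_map eps z) ^+ 2 <= r ^+ 2 by rewrite ler_pXn2r ?nnegrE ?normc_ge0.
move: h er1 (half_disk_map_far e0 e1 hz); move: (_ ^+ 2) (_ ^+ 2) => a b; lra.
Qed.

Lemma cosarg_01 (x : C) : 0 <= cosarg x <= 1.
Proof.
rewrite /cosarg divr_ge0 ?normc_ge0 ?ps_Re_ge0//=.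
have [->|n0] := eqVneq (normc (ps x)) 0; first by rewrite invr0 mulr0.
rewrite ler_pdivrMr ?mul1r; last by rewrite lt_neqAle eq_sym n0 normc_ge0.
exact: le_trans (ler_norm _) (Re_le _).
Qed.

Definition extremal u := root_map (psi u).

Lemma extremalP u : U u -> udisk (extremal u) /\ exists2 l, cder extremal u l &
  disk_density (extremal u) * normc l = cosarg (1 + cayley (psi u)) * (disk_density (psi u) * normc (dc psi u)).
Proof.
move=> Uu; have [hw _] := psiK Uu; have [hP [l hl el]] := root_mapP hw; split => //.
eexists; first exact: (cder_comp (hol_dc hpsi Uu) hl).
by rewrite /extremal normcM [LHS]mulrA el mulrA.
Qed.

(** The quotient of the statement in the plane coordinate; see [ratio_sphere]. *)
Definition ratio u : R := disk_density (extremal u) * normc (dc extremal u) / lam u.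

Lemma ratio_upper u : W u -> 0 <= ratio u <= cosarg (1 + cayley (psi u)).
Proof.
move=> Wu; have Uu := WU Wu; have l0 := lam_gt0 H Wu.
have [_ [l hl el]] := extremalP Uu; rewrite /ratio (dcE hl) el.
have /andP[k0 k1] := cosarg_01 (1 + cayley (psi u)).
have hl2 := lam_lower H (hol_sub WU hpsi) (fun u Wu => (psiK (WU Wu)).1) Wu.
have d0 : 0 <= disk_density (psi u) * normc (dc psi u).
  by rewrite mulr_ge0 ?normc_ge0// ltW// disk_density_gt0//; exact: (psiK Uu).1.
apply/andP; split; first exact: divr_ge0 (mulr_ge0 k0 d0) (ltW l0).
by rewrite ler_pdivrMr// ler_wpM2l.
Qed.

(** [lam_upper] for the comparison map: the density of [W] is at most that of its
subdomain, which is the image of a half-disk. *)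
Lemma ratio_lower z : udisk z ->
  cosarg (1 + cayley (half_disk_map eps z)) * cosarg (1 + cayley z) <= ratio (comparison z).
Proof.
move=> hz; have Wu := comparison_in hz; have Uu := WU Wu; have l0 := lam_gt0 H Wu.
have [hg [g' hg' eg]] := half_disk_mapP e0 hz; have [_ ew] := chiK hg.
have [_ [l hl el]] := extremalP Uu; rewrite /ratio (dcE hl) el [psi (comparison z)]ew.
rewrite -mulrA; have /andP[k0 k1] := cosarg_01 (1 + cayley (half_disk_map eps z)); apply: ler_wpM2l => //.
rewrite ler_pdivlMr//.
have hk := cder_comp hg' (hol_dc hchi hg).
have h1 := lam_upper H comparison_hol comparison_in hz; rewrite (dcE hk) normcM in h1.
have h2 : dc psi (comparison z) * dc chi (half_disk_map eps z) = 1.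
  have h := cder_comp (hol_dc hchi hg) (hol_dc hpsi Uu).
  have h3 : cder (fun w => psi (chi w)) (half_disk_map eps z) 1.
    by apply: cder_near (cder_id _); apply: filterS (udisk_near hg) => w /chiK[_ ->].
  exact: cder_uniq h h3.
have {}h2 : normc (dc psi (comparison z)) * normc (dc chi (half_disk_map eps z)) = 1 by rewrite -normcM h2 normc1.
have dz := disk_density_gt0 hz; have dw := disk_density_gt0 hg.
move: h1 h2 eg; move: (normc (dc psi _)) (normc (dc chi _)) (normc g') (lam _) (cosarg (1 + cayley z)) (disk_density z) (disk_density (half_disk_map eps z)) (normc_ge0 (dc psi (comparison z))) dz dw.
move=> P X g L k2 a b P0 a0 b0 h1 h2 eg.
rewrite -(ler_pM2r a0).
have -> : k2 * L * a = b * P * (L * (X * g)).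
  have -> : b * P * (L * (X * g)) = (b * g) * L * (P * X) by ring.
  by rewrite h2 eg; ring.
by apply: ler_wpM2l => //; rewrite mulr_ge0// ltW.
Qed.

Lemma extremal_local : exists c A : R, [/\ 0 < c, 0 < A & forall u, W u -> normc (cayley (psi u)) <= eps / 4 ->
  exists2 Y, 0 < Y &
  [/\ Y ^+ 2 / 32 <= 1 - ratio u, 1 - ratio u <= A * Y ^+ 2, 1 - normc (psi u) ^+ 2 <= 4 * Y &
      exists z, [/\ udisk z, comparison z = u & c * Y <= 1 - normc z]]].
Proof.
have [c [A [c0 A0 hloc]]] := local_model e0 e1; exists c, A; split => // u Wu hy.
have [hw eu] := psiK (WU Wu); have [h1 h2 [z hz [gz h3 h4]]] := hloc _ hw hy.
exists (complex.Im (cayley (psi u))); first exact: cayley_upper.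
have kz : comparison z = u by rewrite /comparison gz.
have /andP[_ r1] := ratio_upper Wu; have r2 := ratio_lower hz; rewrite kz gz in r2.
have /andP[a0 a1] := cosarg_01 (1 + cayley (psi u)); have /andP[b0 b1] := cosarg_01 (1 + cayley z).
split => //; last by exists z.
- by move: h1 r1; lra.
- apply: le_trans h3; move: r2 a0 a1 b0 b1.
  by move: (cosarg _) (cosarg _) (ratio u) => a b x; nra.
Qed.

End Local.

Section Final.
Context {R : realType}.
Notation C := (Cplx R).
Variables (Omega K : set (sphere R)) (p : C).
Hypotheses (hOmega : hyperbolic_domain Omega) (hK : is_component (~` Omega) K)
  (hKiso : isolated_component Omega K) (hKnd : nondegenerate_set K) (Kp : K (fin p))
  (clp : closure Omega (fin p)).
Local Notation W := (plane_dom Omega p).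

Lemma approach_seq : exists z : nat -> C, forall n, Omega (fin (z n)) /\ normc (z n - p) < n.+1%:R^-1.
Proof.
suff sel n : exists z : C, Omega (fin z) /\ normc (z - p) < n.+1%:R^-1.
  by have [z hz] := choice sel; exists z.
have n0 : 0 < n.+1%:R^-1 :> R by rewrite invr_gt0.
have h : nbhs (fin p : sphere R) [set w | exists2 z : C, w = fin z & normc (z - p) < n.+1%:R^-1].
  have h' : \forall z \near p, exists2 z' : C, fin z = fin z' & normc (z' - p) < n.+1%:R^-1.
    by apply: filterS (nbhsC_disk p n0) => z hz; exists z.
  exact: h'.
by have [w [Ow [z e hz]]] := clp h; exists z; rewrite -e.
Qed.

(** The images [psi (u n)] have a limit of modulus 1 along a free ultrafilter, since
[u n] tends to infinity; a rotation moves this limit to 1. *)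
Lemma boundary_images : exists (F : set_system nat) (U : set C) (psi chi : C -> C) (z : nat -> C) (r : R),
 [/\ UltraFilter F, (forall N, F [set n | (N <= n)%N]), (forall n, Omega (fin (z n))) &
     (forall n, normc (z n - p) < n.+1%:R^-1)] /\
 ([/\ open U, W `<=` U, hol U psi & hol (@udisk R) chi] /\
 [/\ (forall u, U u -> udisk (psi u) /\ chi (psi u) = u), (forall w, udisk w -> U (chi w) /\ psi (chi w) = w),
     0 <= r < 1, (forall w, udisk w -> r < normc w -> W (chi w)) &
     forall e, 0 < e -> F [set n | normc (psi (to_plane p (fin (z n))) - 1) < e]]).
Proof.
have [F [uF tl]] := free_ultrafilter.
have [z hz] := approach_seq.
have [U [psi [chi [[oU WU hpsi hchi] [h1 h2 [r r1 h3] h4]]]]] := plane_riemann hOmega hK hKiso hKnd Kp.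
pose u n := to_plane p (fin (z n)).
have np n : fin (z n) <> fin p := domain_neq_p hK Kp (hz n).1.
have Wu n : W (u n) by rewrite /plane_dom /= to_planeK//; exact: (hz n).1.
have Uu n := WU _ (Wu n).
have bw n : normc (psi (u n)) <= 1 by apply: ltW; exact: (h1 _ (Uu n)).1.
have FF : ProperFilter F by exact: ultra_proper.
have [zeta zeta1 hzeta] := ultra_limit uF bw.
have hz' (e : R) : 0 < e -> F [set n | normc (psi (u n) - zeta) < e] by move=> e0; exact: ((cvgCP _ zeta).1 hzeta e e0).
have nz : normc zeta = 1.
  apply/eqP; rewrite eq_le zeta1 /= leNgt; apply/negP => lt.
  have m1 : (normc zeta + 1) / 2 < 1 by lra.
  have [M hM] := h4 _ m1.
  have e0 : 0 < (1 - normc zeta) / 2 by lra.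
  have M0 : 0 < (`|M| + 1)^-1 by rewrite invr_gt0 ltr_wpDl.
  have [N hN] := sinv_lt M0.
  have [n [k1 k2]] := filter_ex (filterI (hz' _ e0) (tl N)).
  have : M < normc (u n).
    have zp : 0 < normc (z n - p) by rewrite normc_gt0 subr_eq0; apply/eqP => e; apply: (np n); rewrite e.
    rewrite /u /= normcV; have := lt_trans (hz n).2 (hN n k2).
    move=> hlt.
    have : `|M| + 1 < (normc (z n - p))^-1 by rewrite -(invrK (_ + 1)) ltf_pV2// posrE// invr_gt0 ltr_wpDl.
    by have := ler_norm M; lra.
  move=> /(hM _ (Uu n)) hlt; move: k1 => /= k1.
  by have := normcD (psi (u n) - zeta) zeta; rewrite subrK; lra.
have z0 : zeta != 0 by rewrite -normc_gt0 nz.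
have nzV : normc zeta^-1 = 1 by rewrite normcV nz invr1.
exists F, U, (fun x => zeta^-1 * psi x), (fun w => chi (zeta * w)), z, (Num.max r 0).
have rot w : udisk w -> udisk (zeta * w) by rewrite /udisk /= normcM nz mul1r.
split; first by split => // n; have [] := hz n.
split; split => //.
- by move=> x Ux; have := cder_lin zeta^-1 0 (hol_dc hpsi Ux) => h; eexists; apply: cder_ext h => y; rewrite addr0.
- move=> w hw; have h := cder_lin zeta 0 (cder_id w).
  have h' : cder (fun w => zeta * w) w (zeta * 1) by apply: cder_ext h => y; rewrite addr0.
  by eexists; apply: (cder_comp h' (hol_dc hchi (rot _ hw))).
- by move=> x Ux; rewrite /udisk /= normcM nzV mul1r mulVKf//; exact: h1.
- by move=> w hw; have [a b] := h2 _ (rot _ hw); rewrite b mulKf.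
- by rewrite le_max lexx orbT gt_max r1 ltr01.
- move=> w hw lt; apply: h3; first exact: rot.
  by rewrite normcM nz mul1r; apply: le_lt_trans lt; rewrite le_max lexx.
- move=> e e0; have k w : normc (psi w - zeta) < e -> normc (zeta^-1 * psi w - 1) < e.
    by rewrite -[1](mulVf z0) -mulrBr normcM nzV mul1r.
  by apply: filterS (hz' _ e0) => n /k.
Qed.

End Final.

(** * Distances to base points and the conclusion *)
Section Distances.
Context {R : realType}.
Notation C := (Cplx R).
Variables (Omega : set (sphere R)) (p : C) (q : C -> C).
Hypotheses (oO : open Omega) (hp : forall w, Omega w -> w <> fin p).
Local Notation W := (plane_dom Omega p).
Local Notation lam := (hyperbolic_density Omega).
Hypothesis H : plane_density W (plane_lam p lam) q.
Local Notation d := (hyperbolic_distance Omega).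

Definition base v := of_plane p (q v).
Definition seg_len (v v' : C) : R := rint 0 1 (fun t => disk_density (v + t%:C%C * (v' - v)) * normc (v' - v)).

Lemma base_curve v v' : udisk v -> udisk v' ->
  piecewise_smooth_curve Omega (base v) [:: seg_arc p q v v'] (base v') /\
  hyperbolic_length Omega [:: seg_arc p q v v'] <= seg_len v v'.
Proof. by move=> hv hv'; have [] := seg_arcP H (pd_hol H) (pd_in H) hv hv'. Qed.

Lemma base_onto z : Omega z -> exists2 v, udisk v & z = base v.
Proof.
move=> Oz; have Wz : W (to_plane p z) by rewrite /plane_dom /= to_planeK//; exact: hp.
by have [v hv e] := pd_onto H Wz; exists v => //; rewrite /base e to_planeK//; exact: hp.
Qed.

Lemma dist_base z v v' : Omega z -> udisk v -> udisk v' -> d z (base v') <= d z (base v) + seg_len v v'.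
Proof.
move=> /base_onto[v0 hv0 ->] hv hv'; have [h1 h2] := base_curve hv hv'.
apply: le_trans (dist_extend hp H _ h1) _; last by rewrite lerD2l.
by exists [:: seg_arc p q v0 v]; exact: (base_curve hv0 hv).1.
Qed.

Lemma seg_len_local v : udisk v -> exists M r : R, [/\ 0 < r, 0 < M & forall v', normc (v' - v) < r ->
  seg_len v v' <= M * normc (v' - v) /\ seg_len v' v <= M * normc (v' - v)].
Proof.
move=> hv; have v1 : normc v < 1 := hv; have v0 := normc_ge0 v.
pose r : R := (1 - normc v) / 2; have r0 : 0 < r by rewrite divr_gt0// subr_gt0.
pose s : R := (1 + normc v) / 2; have s1 : s < 1 by rewrite /s; lra.
have s0 : 0 < s by rewrite /s; lra.
have ss : 0 < 1 - s ^+ 2 by rewrite subr_gt0 expr_lt1// ltW.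
exists (1 - s ^+ 2)^-1, r; split; rewrite ?invr_gt0//.
have xs x : disk v r x -> normc x <= s.
  by rewrite /disk /= => hx; have := normcD (x - v) v; rewrite subrK; move: hx; rewrite /r /s; lra.
have dx x : disk v r x -> udisk x by move=> /xs; rewrite /udisk /=; lra.
have bnd a b : disk v r a -> disk v r b -> seg_len a b <= (1 - s ^+ 2)^-1 * normc (b - a).
  move=> ha hb.
  have c1 : rcon 0 1 (fun t => disk_density (a + t%:C%C * (b - a)) * normc (b - a)).
    move=> t ht; apply: rctsM; last exact: rcts_cst.
    exact: (rcts_disk_density (rder_ccts (rder_affine a (b - a) t)) (seg_disk (dx _ ha) (dx _ hb) ht)).
  have c2 : rcon 0 1 (fun _ : R => (1 - s ^+ 2)^-1 * normc (b - a)) by move=> t _; exact: rcts_cst.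
  apply: le_trans (le_rint c1 c2 _) _; last by rewrite rint_cst// subr0 mulr1.
  move=> t ht; apply: ler_wpM2r; first exact: normc_ge0.
  have hx := segment_disk ha hb ht; rewrite /disk_density lef_pV2 ?posrE//; last exact: sq_lt1 (dx _ hx).
  rewrite lerD2l lerN2; move: (xs _ hx) (normc_ge0 (a + t%:C%C * (b - a))).
  by move: (normc _) => x xs0 x0; rewrite ler_pXn2r// nnegrE ltW.
have vv : disk v r v by rewrite /disk /= subrr normc0.
by move=> v' hv'; split; [|rewrite normcBC]; exact: bnd.
Qed.

Lemma udisk0 : udisk (0 : C). Proof. by rewrite /udisk /= normc0. Qed.

(** Follow the image under [k] of the radius from [z] to 0, then a fixed path. *)
Lemma dist_upper (k : C -> C) : hol (@udisk R) k -> (forall z, udisk z -> W (k z)) ->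
  exists C0 : R, forall z, udisk z -> d (of_plane p (k z)) (base 0) <= ln (2 / (1 - normc z)) / 2 + C0.
Proof.
move=> hk kW; have [v0 hv0 e] := pd_onto H (kW _ udisk0).
exists (seg_len v0 0) => z hz.
have [h1 h2] := seg_arcP H hk kW hz udisk0.
have [h3 h4] := base_curve hv0 udisk0; rewrite /base e in h3.
have h5 := curve_cat h1 h3.
apply: le_trans (dist_le hp H h5) _.
rewrite /hyperbolic_length big_cat; apply: lerD => //.
exact: le_trans h2 (radial_length hz).
Qed.

Lemma dist_lower (psi : C -> C) u : hol W psi -> (forall u, W u -> udisk (psi u)) -> W u ->
  log_height psi (q 0) - log_height psi u <= d (of_plane p u) (base 0).
Proof.
move=> hpsi psiD Wu; have [v hv e] := pd_onto H Wu.
apply: dist_ge.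
  exists [:: seg_arc p q v 0]; have [h _] := base_curve hv udisk0.
  by rewrite -e.
move=> s hs; have := curve_lower oO hp H hpsi psiD hs.
by rewrite /base !of_planeK.
Qed.

(** By [extremal_local] the defect is comparable to [Y^2], and the two bounds for
the distance make [exp (4 d)] comparable to [Y^-2]. *)
Lemma defect_bounds (U : set C) (psi chi : C -> C) (eps r : R) :
  W `<=` U -> hol U psi -> hol (@udisk R) chi ->
  (forall u, U u -> udisk (psi u) /\ chi (psi u) = u) ->
  (forall w, udisk w -> U (chi w) /\ psi (chi w) = w) ->
  (forall w, udisk w -> r < normc w -> W (chi w)) ->
  0 < eps -> eps <= 1 / 2 -> 0 <= r -> 16 * eps < 1 - r ^+ 2 ->
  exists a b : R, 0 < a /\ forall u, W u -> normc (cayley (psi u)) <= eps / 4 ->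
    a <= (1 - ratio (plane_lam p lam) psi u) * expR (4 * d (of_plane p u) (base 0)) <= b.
Proof.
move=> WU hpsi hchi psiK chiK hW e0 e1 r0 er.
have [c [A [c0 A0 hloc]]] := extremal_local H WU hpsi hchi psiK chiK hW e0 e1 r0 er.
have psiD u : W u -> udisk (psi u) by move=> Wu; exact: (psiK _ (WU _ Wu)).1.
have [C0 hC0] := dist_upper (comparison_hol hchi e0) (comparison_in hW e0 e1 r0 er).
have lX (x : R) : 0 < x -> expR (2 * ln x) = x ^+ 2.
  by move=> x0; rewrite mulr2n mulrDl mul1r expRD lnK.
(* [512 = 32 * 16], from [Y^2 / 32] and from [(1 - |psi u|^2)^2 <= (4 Y)^2] *)
exists (expR (4 * log_height psi (q 0)) / 512), (A * (4 / c ^+ 2 * expR (4 * C0))).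
have p512 : 0 < (512 : R) by rewrite ltr0n.
have a0 := divr_gt0 (expR_gt0 (4 * log_height psi (q 0))) p512.
split; first exact: a0.
move=> u Wu hu; have [Y Y0 [h1 h2 h3 [z [hz kz h4]]]] := hloc _ Wu hu.
set x := 1 - ratio _ _ _ in h1 h2 *; have Y2 : 0 < Y ^+ 2 by rewrite exprn_gt0.
have x0 : 0 <= x by apply: le_trans h1; rewrite divr_ge0// ltW.
apply/andP; split.
  have hd := dist_lower (hol_sub WU hpsi) psiD Wu.
  pose del := 1 - normc (psi u) ^+ 2; have del0 : 0 < del := sq_lt1 (psiD _ Wu).
  have he : expR (4 * log_height psi (q 0)) / del ^+ 2 <= expR (4 * d (of_plane p u) (base 0)).
    rewrite -(lX _ del0) -expRN -expRD ler_expR.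
    by move: hd; rewrite [log_height psi u]/log_height -/del; lra.
  apply: le_trans (ler_wpM2l x0 he).
  set E := expR _ in he *; have E0 : 0 < E by exact: expR_gt0.
  have hdel : del ^+ 2 <= 16 * Y ^+ 2.
    have -> : 16 * Y ^+ 2 = (4 * Y) ^+ 2 by ring.
    by rewrite ler_pXn2r ?nnegrE// ltW// mulr_gt0.
  have del2 : 0 < del ^+ 2 by rewrite exprn_gt0.
  rewrite mulrA ler_pdivlMr//.
  have -> : E / 512 * del ^+ 2 = E * (del ^+ 2 / 512) by ring.
  rewrite [x * E]mulrC ler_pM2l//; apply: le_trans h1.
  by move: hdel; move: (del ^+ 2) (Y ^+ 2) => a b; lra.
have hd := hC0 z hz; rewrite kz in hd.
pose m := 1 - normc z; have m0 : 0 < m by rewrite subr_gt0.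
have he : expR (4 * d (of_plane p u) (base 0)) <= (2 / m) ^+ 2 * expR (4 * C0).
  have m2 : 0 < 2 / m by rewrite divr_gt0.
  by rewrite -lX// -expRD ler_expR; move: hd; rewrite -/m; lra.
apply: le_trans (ler_pM x0 (expR_ge0 _) h2 he) _.
rewrite -[X in X <= _]mulrA; apply: ler_wpM2l; first exact: ltW.
rewrite [X in X <= _]mulrA; apply: ler_wpM2r; first exact: expR_ge0.
have cY : 0 < c * Y by rewrite mulr_gt0.
rewrite expr_div_n mulrA ler_pdivrMr; last by rewrite exprn_gt0.
have : (c * Y) ^+ 2 <= m ^+ 2 by rewrite ler_pXn2r ?nnegrE// ltW.
have cc : 0 < c ^+ 2 by rewrite exprn_gt0.
rewrite exprMn => hm.
have -> : 4 / c ^+ 2 * m ^+ 2 = 4 * m ^+ 2 / c ^+ 2 by ring.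
rewrite ler_pdivlMr//; move: hm; move: (c ^+ 2) (Y ^+ 2) (m ^+ 2) => a b f; lra.
Qed.

End Distances.

Section Conclusion.
Context {R : realType}.
Notation C := (Cplx R).

Lemma cvg_of_eps (u : nat -> R) l : (forall e, 0 < e -> exists N, forall k, (N <= k)%N -> `|u k - l| < e) ->
  u @ \oo --> l.
Proof.
move=> h; apply/cvgrPdist_lt => e e0; have [N hN] := h e e0.
by exists N => // k /= hk; rewrite distrC; exact: hN.
Qed.

Variables (Omega : set (sphere R)) (p : C).
Hypotheses (oO : open Omega) (hp : forall w, Omega w -> w <> fin p).
Local Notation W := (plane_dom Omega p).
Local Notation lam := (hyperbolic_density Omega).
Local Notation d := (hyperbolic_distance Omega).

Lemma cvg_to_p (z : nat -> C) (nk : nat -> nat) : (forall n, normc (z n - p) < n.+1%:R^-1) ->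
  (forall k, (k <= nk k)%N) -> (fun k => fin (z (nk k)) : sphere R) @ \oo --> (fin p : sphere R).
Proof.
move=> hz hn B hB; have [e e0 he] := nbhsCE (hB : nbhs p (fun x => B (fin x))).
have [N hN] := sinv_lt e0; exists N => // k /= hk.
apply: he; apply: lt_trans (hz _) (hN _ _); exact: leq_trans hk (hn k).
Qed.

Variables (U : set C) (psi chi : C -> C).
Hypotheses (WU : W `<=` U) (hpsi : hol U psi)
  (psiK : forall u, U u -> udisk (psi u) /\ chi (psi u) = u).

Lemma extremal_admissible : [/\ holomorphic_on Omega (extremal psi \o to_plane p), set_inj Omega (extremal psi \o to_plane p) &
  set_fun Omega (@unit_disk R) (extremal psi \o to_plane p)].
Proof.
have Uw w : Omega w -> U (to_plane p w) by move=> Ow; apply: WU; rewrite /plane_dom /= to_planeK//; exact: hp.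
split.
- move=> w Ow; have [_ [l hl _]] := extremalP hpsi psiK (Uw w Ow).
  have hl' : exists l, cder (extremal psi) (to_plane p w) l by exists l.
  by have [h _] := holomorphic_of_plane Ow (hp Ow) hl'.
- move=> x y; rewrite !inE => Ox Oy /= e.
  have [dx ex] := psiK (Uw _ Ox); have [dy ey] := psiK (Uw _ Oy).
  have := root_map_inj dx dy e; move=> /(congr1 chi); rewrite ex ey => /(congr1 (of_plane p)).
  by rewrite !to_planeK; [|exact: hp|exact: hp].
- by move=> w Ow; have [h _] := extremalP hpsi psiK (Uw w Ow).
Qed.

Lemma ratio_sphere w : Omega w ->
  disk_density ((extremal psi \o to_plane p) w) * normc (cderiv (extremal psi \o to_plane p) w) / lam w =
  ratio (plane_lam p lam) psi (to_plane p w).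
Proof.
move=> Ow; have wp := hp Ow.
have Uw : U (to_plane p w) by apply: WU; rewrite /plane_dom /= to_planeK//; exact: hp.
have [_ [l hl _]] := extremalP hpsi psiK Uw.
have hl' : exists l, cder (extremal psi) (to_plane p w) l by exists l.
have [_ ->] := holomorphic_of_plane Ow wp hl'.
by rewrite /ratio /plane_lam to_planeK// invf_div mulrA [in RHS]mulrA mulrAC.
Qed.

Lemma no_density : ~ (exists l, is_hyperbolic_density Omega l) -> lam = (fun _ => 0).
Proof.
move=> h; rewrite /hyperbolic_density; apply: getPN => l hl; apply: h; by exists l.
Qed.

(** All curves have length 0, and the infimum is 0 even if there is no curve. *)
Lemma no_density_dist z w : lam = (fun _ => 0) -> d z w = 0.
Proof.
move=> e; rewrite /hyperbolic_distance.
set S := [set _ | _ in _].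
have hS x : S x -> x = 0.
  move=> [s _ <-]; rewrite /hyperbolic_length big1// => G _.
  rewrite /arc_length e (_ : (fun _ => _) = cst 0) ?Rintegral_cst ?mul0r//.
  by apply/funext => t; rewrite mul0r.
have [[x Sx]|nS] := pselect (S !=set0); last first.
  rewrite (_ : S = set0) ?inf0//; apply/seteqP; split => // x Sx; apply: nS; by exists x.
have -> : S = [set 0].
  by apply/seteqP; split => [y /hS ->//|y ->]; rewrite -(hS _ Sx).
exact: inf1.
Qed.

End Conclusion.

Section Main.
Context {R : realType}.
Notation C := (Cplx R).
Variables (Omega : set (sphere R)) (p : C).
Hypotheses (oO : open Omega) (hp : forall w, Omega w -> w <> fin p).
Local Notation W := (plane_dom Omega p).
Local Notation lam := (hyperbolic_density Omega).
Local Notation d := (hyperbolic_distance Omega).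
Variables (F : set_system nat) (U : set C) (psi chi : C -> C) (z : nat -> C) (r : R) (q : C -> C).
Hypotheses (uF : UltraFilter F) (tl : forall N, F [set n | (N <= n)%N]) (Oz : forall n, Omega (fin (z n)))
  (WU : W `<=` U) (hpsi : hol U psi) (hchi : hol (@udisk R) chi)
  (psiK : forall u, U u -> udisk (psi u) /\ chi (psi u) = u)
  (chiK : forall w, udisk w -> U (chi w) /\ psi (chi w) = w)
  (r01 : 0 <= r < 1) (hW : forall w, udisk w -> r < normc w -> W (chi w))
  (psi1 : forall e, 0 < e -> F [set n | normc (psi (to_plane p (fin (z n))) - 1) < e])
  (H : plane_density W (plane_lam p lam) q).

(** Index 0 of the diagonal argument carries the normalized defects, the others the
differences of distances at the points of the dense set. *)
Lemma convergent_subsequence : exists nk : nat -> nat, (forall k, (k <= nk k)%N) /\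
  forall w, Omega w -> exists2 L : R, L < 0 &
    (fun k => (ratio (plane_lam p lam) psi (to_plane p (fin (z (nk k)))) - 1) *
       expR (4 * d (fin (z (nk k))) w)) @ \oo --> L.
Proof.
have FF : ProperFilter F by exact: ultra_proper.
have /andP[r0 r1] := r01.
have r2 : 0 < 1 - r ^+ 2 by rewrite subr_gt0 expr_lt1.
(* so small that the half-disk lies in the part of the disk that [W] fills *)
have [eps [e0 e1 er]] : exists eps : R, [/\ 0 < eps, eps <= 1 / 2 & 16 * eps < 1 - r ^+ 2].
  exists (Num.min (1 / 2) ((1 - r ^+ 2) / 32)); split; first by rewrite lt_min !divr_gt0.
    by rewrite ge_min lexx.
  have : Num.min (1 / 2) ((1 - r ^+ 2) / 32) <= (1 - r ^+ 2) / 32 by rewrite ge_min lexx orbT.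
  by move=> hm; lra.
have [a [b [a0 hab]]] := defect_bounds oO hp H WU hpsi hchi psiK chiK hW e0 e1 r0 er.
pose u n := to_plane p (fin (z n)).
have cuu n : of_plane p (u n) = fin (z n) by rewrite to_planeK//; exact: hp (Oz n).
have Wu n : W (u n) by rewrite /plane_dom /= cuu.
pose D n v := d (fin (z n)) (base p q v).
pose e n := (1 - ratio (plane_lam p lam) psi (u n)) * expR (4 * D n 0).
pose G := [set n | normc (psi (u n) - 1) < Num.min (1 / 2) (eps / 4)].
have m0 : 0 < Num.min (1 / 2) (eps / 4) by rewrite lt_min !divr_gt0.
have FG : F G := psi1 m0.
have hG n : G n -> a <= e n <= b.
  rewrite /G /= lt_min => /andP[g1 g2].
  have hh : normc (cayley (psi (u n))) <= eps / 4.
    rewrite /cayley normcf normcM normc_i mul1r normcBC.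
    have n1 : 1 <= normc (1 + psi (u n)).
      have := normcB_ge (2 : C) (1 - psi (u n)).
      have -> : (2 : C) - (1 - psi (u n)) = 1 + psi (u n) by ring.
      have -> : normc (2 : C) = 2.
        have -> : (2 : C) = (2 : R)%:C%C by rewrite rmorphD rmorph1.
        by rewrite normc_real ger0_norm.
      rewrite [normc (1 - _)]normcBC; lra.
    rewrite ler_pdivrMr; last by lra.
    apply: le_trans (ltW g2) _; rewrite ler_peMr//; apply: divr_ge0 => //; exact: ltW.
  by have := hab (u n) (Wu n) hh; rewrite cuu.
have he n : G n -> `|e n| <= b.
  by move=> /hG /andP[h1 h2]; rewrite ger0_norm// (le_trans _ h1)// ltW.
have [Y hY] := ultra_real uF FG he.
have Y0 : 0 < Y by apply: lt_le_trans a0 _; apply: (ucvg_ge FF hY FG) => n /hG/andP[].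
have dD n v v' : udisk v -> udisk v' -> `|D n v' - D n v| <= Num.max (seg_len v v') (seg_len v' v).
  move=> hv hv'; have h1 := dist_base hp H (Oz n) hv hv'; have h2 := dist_base hp H (Oz n) hv' hv.
  rewrite ler_norml; apply/andP; split.
    rewrite lerNl opprB lerBlDl; apply: le_trans h2 _; rewrite lerD2l le_max lexx orbT//.
  by rewrite lerBlDl; apply: le_trans h1 _; rewrite lerD2l le_max lexx.
have u0 : udisk (0 : C) by exact: udisk0.
have FT : F setT by exact: filterT.
have exE v : udisk v -> exists E, ucvg F (fun n => D n v - D n 0) E.
  by move=> hv; apply: (ultra_real uF FT) => n _; exact: dD.
have [E hE] : exists E : C -> R, forall v, udisk v -> ucvg F (fun n => D n v - D n 0) (E v).
  have sel v : exists E, udisk v -> ucvg F (fun n => D n v - D n 0) E.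
    have [/exE[E hE]|nv] := pselect (udisk v); first by exists E.
    by exists 0.
  by have [E hE] := choice sel; exists E.
pose x j n := if j is j'.+1 then D n (dense_pt j') - D n 0 else e n.
pose l j := if j is j'.+1 then E (dense_pt j') else Y.
have hx j : ucvg F (x j) (l j) by case: j => [|j] //; exact: hE (dense_pt_disk j).
have [nk hnk] := diagonal FF tl FG hx.
exists nk; split; first by move=> k; have [] := hnk k.
move=> w Ow; have [v hv ->] := base_onto hp H Ow.
exists (- (Y * expR (4 * E v))); first by rewrite oppr_lt0 mulr_gt0// expR_gt0.
have ce : (fun k => e (nk k)) @ \oo --> Y.
  apply: cvg_of_eps => ep ep0; have [N hN] := sinv_lt ep0; exists N => k hk.
  by have [_ _ h] := hnk k; exact: lt_trans (h 0%N (leq0n k)) (hN k hk).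
have cD : (fun k => D (nk k) v - D (nk k) 0) @ \oo --> E v.
  apply: cvg_of_eps => ep ep0; have [M [r' [r'0 M0 hM]]] := seg_len_local hv.
  have ep3 : 0 < ep / 3 by rewrite divr_gt0.
  have mm : 0 < Num.min r' (ep / 3 / M) by rewrite lt_min r'0 divr_gt0.
  have [j hj] := dense_ptP hv mm.
  move: hj; rewrite lt_min => /andP[j1 j2].
  have hvj : udisk (dense_pt j : C) := dense_pt_disk j.
  have near n : `|(D n (dense_pt j) - D n 0) - (D n v - D n 0)| <= ep / 3.
    have -> : (D n (dense_pt j) - D n 0) - (D n v - D n 0) = D n (dense_pt j) - D n v by ring.
    apply: le_trans (dD n _ _ hv hvj) _; have [h1 h2] := hM _ j1.
    have h3 : M * normc (dense_pt j - v) <= ep / 3 by rewrite mulrC -ler_pdivlMr// ltW.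
    by rewrite ge_max; apply/andP; split; apply: le_trans h3.
  have nE : `|E (dense_pt j) - E v| <= ep / 3.
    by apply: (ucvg_near FF (hE _ hvj) (hE _ hv) FT) => n _; exact: near.
  have [N hN] := sinv_lt ep3; exists (maxn N j.+1) => k; rewrite geq_max => /andP[k1 k2].
  have [_ _ h] := hnk k; have h1 := lt_trans (h j.+1 k2) (hN k k1).
  have h2 := near (nk k); rewrite /x /l in h1.
  rewrite distrC in h2; move: h1 h2 nE.
  move: (D (nk k) v - _) (D (nk k) (dense_pt j) - _) (E (dense_pt j)) (E v) => A B A' B' h1 h2 h3.
  have -> : A - B' = (A - B) + (B - A') + (A' - B') by ring.
  have := ler_normD (A - B + (B - A')) (A' - B'); have := ler_normD (A - B) (B - A').
  by lra.
have eqf : (fun k => (ratio (plane_lam p lam) psi (u (nk k)) - 1) * expR (4 * D (nk k) v)) =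
   (fun k => - (e (nk k) * expR (4 * (D (nk k) v - D (nk k) 0)))).
  apply/funext => k; rewrite /e -mulrA -expRD -mulNr opprB; congr (_ * expR _); ring.
rewrite eqf; apply: cvgN; apply: cvgM => //.
have c4 : (fun k => 4 * (D (nk k) v - D (nk k) 0)) @ \oo --> 4 * E v by apply: cvgMr.
exact: (cvg_comp _ _ c4 (@continuous_expR R _)).
Qed.

End Main.

Unset Implicit Arguments.

Theorem theorem2p2 (R : realType) (Omega K : set (sphere R)) (p : Cplx R)
    (hOmega : hyperbolic_domain Omega)
    (hK : is_component (~` Omega) K)
    (hKiso : isolated_component Omega K)
    (hKnd : nondegenerate_set K)
    (hp : (K `&` boundary Omega) (fin p))
    (hacc : accessible Omega p) :
  exists (z : nat -> sphere R) (f : sphere R -> Cplx R),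
    [/\ (forall n, Omega (z n)),
        z @ \oo --> fin p,
        holomorphic_on Omega f,
        set_inj Omega f &
        set_fun Omega unit_disk f] /\
    (forall q : sphere R, Omega q ->
       exists2 L : R, L < 0 &
         (disk_density (f (z n)) * normc (cderiv f (z n))
            / hyperbolic_density Omega (z n) - 1)
           * expR (4 * hyperbolic_distance Omega (z n) q)
         @[n --> \oo] --> L).
Proof.
have [Kp [clp _]] := hp; have oO : open Omega by case: hOmega.
have np := domain_neq_p hK Kp.
have [F [U [psi [chi [z [r [[uF tl Oz hz] [[oU WU hpsi hchi] [psiK chiK r01 hW psi1]]]]]]]]] :=
  boundary_images hOmega hK hKiso hKnd Kp clp.
have [f1 f2 f3] := extremal_admissible np WU hpsi psiK.
(* without a covering by the disk the chosen density is 0 *)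
have [[l0 hl0]|nl] := pselect (exists l, is_hyperbolic_density Omega l); last first.
  have e := no_density nl.
  exists (fun n => fin (z n)), (extremal psi \o to_plane p); split.
    by split => //; exact: (@cvg_to_p _ p z id hz (fun k => leqnn k)).
  move=> q Oq; exists (-1); first by rewrite oppr_lt0.
  have -> : (fun n => (disk_density ((extremal psi \o to_plane p) (fin (z n))) * normc (cderiv (extremal psi \o to_plane p) (fin (z n))) /
      hyperbolic_density Omega (fin (z n)) - 1) * expR (4 * hyperbolic_distance Omega (fin (z n)) q)) = (fun _ => -1).
    by apply/funext => n; rewrite e invr0 mulr0 sub0r no_density_dist// mulr0 expR0 mulr1.
  exact: cvg_cst.
have [pi hpi hd] : is_hyperbolic_density Omega (hyperbolic_density Omega) := @getI _ _ l0 hl0.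
have H := covering_density np hpi hd.
have [nk [hnk hlim]] := convergent_subsequence oO np uF tl Oz WU hpsi hchi psiK chiK r01 hW psi1 H.
exists (fun k => fin (z (nk k))), (extremal psi \o to_plane p); split.
  by split => //; exact: cvg_to_p.
move=> q Oq; have [L L0 hL] := hlim q Oq; exists L => //.
apply: cvg_trans hL; apply: near_eq_cvg; near=> k.
by rewrite (ratio_sphere np WU hpsi psiK (Oz (nk k))).
Unshelve. all: by end_near. Qed.
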